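(* Consider the integrator with parameter $\alpha$ described in the context. If $\alpha\ge1/4$, assume that the step size is restricted by $h\omega_j\le\mathrm{const}$ for $j=1,\dots,\ell$; if $\alpha<1/4$, assume that $h\omega_j\le 2\theta/\sqrt{1-4\alpha}$ for $j=1,\dots,\ell$ with $\theta<1$. Fix an arbitrary integer $N\ge1$ and $0<\delta\le1/4$. Then there exists $h_0>0$ such that, under the assumptions (1)–(4) of the context, the numerical solution satisfies, for $h\le h_0$ under the step size restriction $h\omega_j\le\mathrm{const}$ for $j=1,\dots,\ell$ (if $\alpha\ge1/4$), respectively $h\omega_j\le 2\theta/\sqrt{1-4\alpha}$ for $j=1,\dots,\ell$ with $\theta<1$ (if $\alpha<1/4$), $$H_{\rm slow}(\mathbf p_n,\mathbf q_n)=H_{\rm slow}(\mathbf p_0,\mathbf q_0)+\mathcal O(h^{1-\delta})\qquad\text{for }0\le nh\le h^{-N},$$ as long as $H(\mathbf p_n,\mathbf q_n)\le\mathrm{Const}$. If, in addition, the step size $h$ and the numerical frequencies $\widetilde\omega_j$ satisfy $$|h(\mathbf k\cdot\widetilde{\boldsymbol\omega})-2\pi r|\ge\sqrt h\qquad\text{for all }r\in\mathbb Z,\ r\ne0,\ \text{and all }\mathbf k\in\mathbb Z^\ell\text{ with }\|\mathbf k\|\le N+1,$$ then one further has $$H^*_{\widetilde{\boldsymbol\omega}}(\mathbf p_n,\mathbf q_n)=H^*_{\widetilde{\boldsymbol\omega}}(\mathbf p_0,\mathbf q_0)+\mathcal O(h^{1-\delta}/\kappa)\qquad\text{for }0\le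 nh\le h^{-N},$$ where $\kappa=\kappa(h)\ge\sqrt h$ is such that $|\sin(h\widetilde\omega_j)|\ge\kappa$ for $j=1,\dots,\ell$. The constants symbolized by $\mathcal O$ are independent of $n$, $h$, $\varepsilon$ and $\omega_j$, but depend on $\ell$, $N$, $\delta$, $\theta$ and the constants in the assumptions (1)–(4). The threshold $h_0$ is independent of the frequencies $\omega_j$.
   Context: **Problem.** Let $\mathbf q=(q_0,\dots,q_\ell)$, $\mathbf p=(p_0,\dots,p_\ell)$ with $q_j,p_j\in\mathbb R^{d_j}$. Consider $\ddot q_j+\omega_j^2q_j=-\nabla_jU(\mathbf q)$, $j=0,\dots,\ell$, where $\omega_0=0$ and $\omega_j\ge1/\varepsilon$ for $j=1,\dots,\ell$, with a small parameter $0<\varepsilon\ll1$. The real-valued potential $U$ is smooth with derivatives bounded independently of $\varepsilon$. Write $\mathbf g=-\nabla U$ and let $\boldsymbol\Omega$ be the diagonal matrix acting as multiplication by $\omega_j$ on the $j$th component. The energies are $$H=H_{\boldsymbol\omega}+H_{\rm slow},\quad H_{\boldsymbol\omega}(\mathbf p,\mathbf q)=\sum_{j=1}^\ell\tfrac12\bigl(|p_j|^2+\omega_j^2|q_j|^2\bigr),\quad H_{\rm slow}(\mathbf p,\mathbf q)=\tfrac12|p_0|^2+U(\mathbf q).$$ For $\mathbf k\in\mathbb Z^\ell$: $\mathbf k\cdot\widetilde{\boldsymbol\omega}=\sum_{j=1}^\ell k_j\widetilde\omega_j$ and $\|\mathbf k\|=\sum_{j=1}^\ell|k_j|$. **Integrator**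 with real parameter $\alpha$ and step size $h$: $$\mathbf q_{n+1}-2\mathbf q_n+\mathbf q_{n-1}+h^2\boldsymbol\Omega^2\mathbf q_n+\alpha h^2\boldsymbol\Omega^2(\mathbf q_{n+1}-2\mathbf q_n+\mathbf q_{n-1})=h^2\mathbf g(\mathbf q_n),$$ $$2h\,\mathbf p_n=(I+\alpha h^2\boldsymbol\Omega^2)(\mathbf q_{n+1}-\mathbf q_{n-1}).$$ It is started with $\mathbf q_0=\mathbf q(0)$, $\mathbf p_0=\mathbf p(0)$, and $\mathbf q_1$ is obtained by putting $n=0$ in both equations and eliminating $\mathbf q_{-1}$. (The Störmer–Verlet method is $\alpha=0$; the IMEX method is $\alpha=1/4$.) **Numerical frequencies.** $\widetilde\omega_0=0$, and for $j=1,\dots,\ell$, $h\widetilde\omega_j\in[0,\pi]$ is defined by $\sin\bigl(\tfrac12h\widetilde\omega_j\bigr)=\tfrac12h\omega_j/\sqrt{1+\alpha h^2\omega_j^2}$. **Modified oscillatory energy.** With $\mathrm{sinc}(\xi)=\sin(\xi)/\xi$, $\chi(\xi)=1-4\alpha\sin^2(\tfrac12\xi)$ and $\sigma(\xi)=\mathrm{sinc}(\xi)/\chi(\xi)$, $$H^*_{\widetilde{\boldsymbol\omega}}(\mathbf p,\mathbf q)=\sum_{j=1}^\ell\sigma(h\widetilde\omega_j)\,\tfrac12\Bigl(\Bigl(\frac{\chi(h\widetilde\omega_j)}{\mathrm{sinc}(h\widetilde\omega_j)}\Bigr)^2|p_j|^2+\widetilde\omega_j^2|q_j|^2\Bigr).$$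 **Assumptions.** (1) $H(\mathbf p(0),\mathbf q(0))\le E$ with $E$ independent of $\varepsilon$. (2) There are $\rho>0$ and a set $K\subset\mathbb R^{d_0}$ such that $U$ is bounded and has bounded derivatives of all orders in the $\rho$-neighbourhood $K_\rho$ of $K\times0\times\cdots\times0$. (3) The numerical solution values $\mathbf q_n$ stay in $K_{\rho/2}$ (the $\rho/2$-neighbourhood of the same set). (4) $h/\varepsilon\ge c_0>0$. *)

(* Defs.v *)
From HB Require Import structures.
From mathcomp Require Import all_boot all_order all_algebra.
From mathcomp Require Import all_classical all_reals all_analysis.
Set Implicit Arguments.
Unset Strict Implicit.
Unset Printing Implicit Defensive.
Import Order.TTheory GRing.Theory Num.Theory.
Import numFieldNormedType.Exports.
Local Open Scope classical_set_scope.
Local Open Scope ring_scope.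

(* Block vectors (x_0, ..., x_ell) with x_j in R^(d_j); the block x_j is
   [submxrow x j].  The fast indices 1, ..., ell are [lift ord0 j] with
   [j : 'I_ell]. *)
Notation state R d := 'rV[R]_(\sum_i d i).

(* The library norm on row vectors is the sup norm; the energies and
   neighbourhoods below use the Euclidean one. *)
Definition sqnorm (R : realType) (n : nat) (x : 'rV[R]_n) : R :=
  \sum_i x 0 i ^+ 2.

Definition enorm (R : realType) (n : nat) (x : 'rV[R]_n) : R :=
  Num.sqrt (sqnorm x).

Definition gradient (R : realType) (n : nat) (U : 'rV[R]_n -> R)
    (x : 'rV[R]_n) : 'rV[R]_n :=
  \row_i 'D_(delta_mx 0 i) U x.

(* [iter_derive U [:: v_1; ...; v_m] x] is the m-th derivative of U at x
   applied to the directions v_1, ..., v_m. *)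
Definition iter_derive (R : realType) (n : nat) (U : 'rV[R]_n -> R)
    (vs : seq 'rV[R]_n) : 'rV[R]_n -> R :=
  foldr (fun (v : 'rV[R]_n) (f : 'rV[R]_n -> R) => 'D_v f) U vs.

Definition smooth (R : realType) (n : nat) (U : 'rV[R]_n -> R) : Prop :=
  forall (vs : seq 'rV[R]_n) (x : 'rV[R]_n), differentiable (iter_derive U vs) x.

(* On A, the operator norm of the m-th derivative of U (of U itself, if m = 0)
   is at most M m. *)
Definition derivatives_bounded_on (R : realType) (n : nat) (M : nat -> R)
    (A : set 'rV[R]_n) (U : 'rV[R]_n -> R) : Prop :=
  forall (vs : seq 'rV[R]_n) (x : 'rV[R]_n), A x ->
    `|iter_derive U vs x| <= M (size vs) * \prod_(v <- vs) enorm v.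

(* The rho-neighbourhood of K x 0 x ... x 0. *)
Definition neighbourhood (R : realType) (ell : nat) (d : 'I_ell.+1 -> nat)
    (K : set 'rV[R]_(d ord0)) (rho : R) : set (state R d) :=
  [set x | exists y : state R d,
     [/\ K (submxrow y ord0),
         forall j : 'I_ell, submxrow y (lift ord0 j) = 0
       & enorm (x - y) < rho]].

Definition Hosc (R : realType) (ell : nat) (d : 'I_ell.+1 -> nat)
    (omega : 'I_ell.+1 -> R) (p q : state R d) : R :=
  \sum_(j < ell) 2^-1 * (sqnorm (submxrow p (lift ord0 j))
    + omega (lift ord0 j) ^+ 2 * sqnorm (submxrow q (lift ord0 j))).

Definition Hslow (R : realType) (ell : nat) (d : 'I_ell.+1 -> nat)
    (U : state R d -> R) (p q : state R d) : R :=
  2^-1 * sqnorm (submxrow p ord0) + U q.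

Definition Htotal (R : realType) (ell : nat) (d : 'I_ell.+1 -> nat)
    (omega : 'I_ell.+1 -> R) (U : state R d -> R) (p q : state R d) : R :=
  Hosc omega p q + Hslow U p q.

Definition Omega_mx (R : realType) (ell : nat) (d : 'I_ell.+1 -> nat)
    (omega : 'I_ell.+1 -> R) : 'M[R]_(\sum_i d i) :=
  \mxdiag_(j < ell.+1) ((omega j)%:M : 'M[R]_(d j)).
Arguments Omega_mx {R ell} d omega.

(* The two equations defining the integrator at step n, for
   x = q_(n-1), y = q_n, z = q_(n+1). *)
Definition position_eq (R : realType) (ell : nat) (d : 'I_ell.+1 -> nat)
    (alpha h : R) (omega : 'I_ell.+1 -> R) (U : state R d -> R)
    (x y z : state R d) : Prop :=
  z - 2 *: y + x + h ^+ 2 *: (y *m Omega_mx d omega ^+ 2)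
    + (alpha * h ^+ 2) *: ((z - 2 *: y + x) *m Omega_mx d omega ^+ 2)
  = h ^+ 2 *: (- gradient U y).

Definition momentum_eq (R : realType) (ell : nat) (d : 'I_ell.+1 -> nat)
    (alpha h : R) (omega : 'I_ell.+1 -> R) (x z p : state R d) : Prop :=
  (2 * h) *: p = (z - x) *m (1%:M + (alpha * h ^+ 2) *: Omega_mx d omega ^+ 2).

(* The existentially quantified vector is q_(-1), to be eliminated between the
   two equations for n = 0. *)
Definition numerical_solution (R : realType) (ell : nat) (d : 'I_ell.+1 -> nat)
    (alpha h : R) (omega : 'I_ell.+1 -> R) (U : state R d -> R)
    (p q : nat -> state R d) : Prop :=
  (exists qm1 : state R d,
     position_eq alpha h omega U qm1 (q 0%N) (q 1%N) /\
     momentum_eq alpha h omega qm1 (q 1%N) (p 0%N)) /\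
  (forall n : nat,
     position_eq alpha h omega U (q n) (q n.+1) (q n.+2) /\
     momentum_eq alpha h omega (q n) (q n.+2) (p n.+1)).

Definition numerical_frequencies (R : realType) (ell : nat) (alpha h : R)
    (omega omegat : 'I_ell.+1 -> R) : Prop :=
  omegat ord0 = 0 /\
  forall j : 'I_ell,
    0 <= h * omegat (lift ord0 j) <= pi /\
    sin (2^-1 * h * omegat (lift ord0 j))
    = 2^-1 * h * omega (lift ord0 j)
      / Num.sqrt (1 + alpha * h ^+ 2 * omega (lift ord0 j) ^+ 2).

Definition step_restriction (R : realType) (ell : nat) (alpha c1 theta h : R)
    (omega : 'I_ell.+1 -> R) : Prop :=
  (4^-1 <= alpha -> forall j : 'I_ell, h * omega (lift ord0 j) <= c1) /\
  (alpha < 4^-1 -> forall j : 'I_ell,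
     h * omega (lift ord0 j) <= 2 * theta / Num.sqrt (1 - 4 * alpha)).

(* Only evaluated at nonzero arguments below. *)
Definition sinc (R : realType) (xi : R) : R := sin xi / xi.

Definition chi (R : realType) (alpha xi : R) : R :=
  1 - 4 * alpha * sin (2^-1 * xi) ^+ 2.

Definition sigma (R : realType) (alpha xi : R) : R := sinc xi / chi alpha xi.

Definition Hmod (R : realType) (ell : nat) (d : 'I_ell.+1 -> nat) (alpha h : R)
    (omegat : 'I_ell.+1 -> R) (p q : state R d) : R :=
  \sum_(j < ell) sigma alpha (h * omegat (lift ord0 j)) * (2^-1 *
    ((chi alpha (h * omegat (lift ord0 j)) / sinc (h * omegat (lift ord0 j)))
       ^+ 2 * sqnorm (submxrow p (lift ord0 j))
     + omegat (lift ord0 j) ^+ 2 * sqnorm (submxrow q (lift ord0 j)))).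

Definition nonresonant (R : realType) (ell : nat) (N : nat) (h : R)
    (omegat : 'I_ell.+1 -> R) : Prop :=
  forall (r : int) (k : 'I_ell -> int), r != 0 ->
    (\sum_(j < ell) absz (k j) <= N.+1)%N ->
    Num.sqrt h <= `|h * (\sum_(j < ell) (k j)%:~R * omegat (lift ord0 j))
                    - 2 * pi * r%:~R|.

(* Main.v *)
Require Import Defs.
From HB Require Import structures.
From mathcomp Require Import all_boot all_order all_algebra.
From mathcomp Require Import all_classical all_reals all_analysis.
From mathcomp.real_closed Require Import complex.
From mathcomp Require Import ring lra zify.
Set Implicit Arguments.
Unset Strict Implicit.
Unset Printing Implicit Defensive.
Import Order.TTheory GRing.Theory Num.Theory.
Import numFieldNormedType.Exports.
Local Open Scope ring_scope.

(* From a pair (q_(n-1), q_n) the next positions are approximated by a modulated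
   Fourier expansion: a finite sum of terms c e^(i k.theta m) X^l in the step
   number m (fast phase) and the slow time X, obtained by Picard iteration. The
   frequencies h omega~ are first moved to nearby rational multiples theta of
   2 pi for which every combination k.theta of low order is either exactly
   resonant or bounded away from resonance; all phase averages are then finite
   means over a common period. The averaged equations inherit two symmetries of
   the mechanical system. Invariance under translation of X gives an almost
   invariant close to H_slow, and, when the only relations of order at most
   N + 1 are k.theta = 0, invariance under rotation of the phases gives one
   close to H*. Expansions started at consecutive pairs agree up to a high power
   of h, so both quantities drift by O(h^(N+2)) per step, hence stay within
   O(h^(1-delta)) over h^(-N-1) steps. *)

(** * Modulated exponential polynomials *)

(** Small divisors shape the proof: solving a modulated equation costs a factor [tau], the inverse
    gap. Exact resonances are harmless: they only add a power of X, which is also weighted by [tau].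
    Near resonances are the danger, and with several frequencies they cannot be excluded. The move
    of h omega~ is much smaller than the gap it opens, so it can be put back as a perturbation. All
    smallness is counted in powers of one parameter g = h^(1/q) with q large. Since [tau] h <= g^2,
    a Picard step that pays [tau] still gains g, and since a harmonic of order k is damped by (h /
    g)^k, orders beyond N + 1 contribute only (h / g)^(N + 2). The total loss is a fixed number of
    powers of g, at most h^(-delta). An expansion serves for a single step, so slow time only runs
    over [0, 1]; in return every constant must be uniform over parameters and starting pairs, which
    is why bounds are stated for indexed families. For H* no energy bound at later times is assumed:
    it is recovered along the trajectory from the two nearly conserved quantities. *)

Lemma absz_addr (a b : int) : (absz (a + b)%R <= absz a + absz b)%N.
Proof. lia. Qed.

Section Modulated.
Variables (R : realType) (ell : nat).
Local Notation C := R[i].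

(** The norm of [R[i]] takes its values in [R[i]]; this modulus is real, so that estimates can be
    summed and compared in [R]. *)
Definition cabs (z : C) : R := Normc.normc z.

Lemma cabs_ge0 z : 0 <= cabs z.
Proof. by case: z => a b; rewrite /cabs /= sqrtr_ge0. Qed.
Lemma cabsM y z : cabs (y * z) = cabs y * cabs z.
Proof. exact: Normc.normcM. Qed.
Lemma cabsD y z : cabs (y + z) <= cabs y + cabs z.
Proof. exact: le_normcD. Qed.
Lemma cabs0 : cabs 0 = 0. Proof. exact: Normc.normc0. Qed.
Lemma cabs1 : cabs 1 = 1. Proof. exact: Normc.normc1. Qed.
Lemma cabsN z : cabs (- z) = cabs z.
Proof. exact: normcN. Qed.
Lemma cabsV z : cabs z^-1 = (cabs z)^-1.
Proof. exact: Normc.normcV. Qed.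
Lemma cabs_real (x : R) : cabs x%:C%C = `|x|.
Proof. by rewrite /cabs /= expr0n /= addr0 sqrtr_sqr. Qed.
Lemma cabs_nat n : cabs n%:R = n%:R.
Proof.
have -> : (n%:R : C) = (n%:R : R)%:C%C by rewrite rmorph_nat.
by rewrite cabs_real ger0_norm.
Qed.
Lemma cabs_eq0 z : (cabs z == 0) = (z == 0).
Proof.
apply/eqP/eqP => [/Normc.eq0_normc //|->]; exact: cabs0.
Qed.
Lemma cabs_sum (T : Type) (s : seq T) (P : pred T) (F : T -> C) :
  cabs (\sum_(t <- s | P t) F t) <= \sum_(t <- s | P t) cabs (F t).
Proof.
elim/big_ind2: _ => [|x1 x2 y1 y2 h1 h2|//]; first by rewrite cabs0.
by apply: le_trans (cabsD _ _) _; exact: lerD.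
Qed.

Definition expi (x : R) : C := (cos x +i* sin x)%C.

Lemma expi0 : expi 0 = 1.
Proof. by rewrite /expi cos0 sin0. Qed.
Lemma expiD x y : expi (x + y) = expi x * expi y.
Proof.
by rewrite /expi cosD sinD; apply/eqP; rewrite eq_complex /= !eqxx /= addrC eqxx.
Qed.
Lemma cabs_expi x : cabs (expi x) = 1.
Proof. by rewrite /cabs /= cos2Dsin2 sqrtr1. Qed.
Lemma expi_neq0 x : expi x != 0.
Proof. by rewrite -cabs_eq0 cabs_expi oner_eq0. Qed.
Lemma expiN x : expi (- x) = (expi x)^-1.
Proof.
apply: (mulfI (expi_neq0 x)).
by rewrite -expiD subrr expi0 divff ?expi_neq0.
Qed.

Definition lab := {ffun 'I_ell -> int}.
Definition lnorm (k : lab) : nat := (\sum_j absz (k j))%N.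
Definition phase (th : 'I_ell -> R) (k : lab) : R := \sum_j (k j)%:~R * th j.
Definition chr th k (m : int) : C := expi (phase th k * m%:~R).

Lemma lnormD k k' : (lnorm (k + k')%R <= lnorm k + lnorm k')%N.
Proof.
rewrite /lnorm -big_split /=; apply: leq_sum => j _.
by rewrite ffunE; exact: absz_addr.
Qed.
Lemma lnorm0 : lnorm 0 = 0%N.
Proof. by rewrite /lnorm big1 // => j _; rewrite ffunE. Qed.
Lemma lnormN k : lnorm (- k) = lnorm k.
Proof. by apply: eq_bigr => j _; rewrite ffunE abszN. Qed.
Lemma lnorm_eq0 k : lnorm k = 0%N -> k = 0.
Proof.
move=> /eqP; rewrite sum_nat_eq0 => /forallP h.
by apply/ffunP => j; rewrite ffunE; apply/eqP; rewrite -absz_eq0; exact: h.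
Qed.

Lemma phaseD th k k' : phase th (k + k') = phase th k + phase th k'.
Proof.
rewrite /phase -big_split /=; apply: eq_bigr => j _.
by rewrite ffunE intrD mulrDl.
Qed.
Lemma phase0 th : phase th 0 = 0.
Proof. by rewrite /phase big1 // => j _; rewrite ffunE mul0r. Qed.
Lemma phaseN th k : phase th (- k) = - phase th k.
Proof. by apply/eqP; rewrite -subr_eq0 opprK -phaseD addNr phase0. Qed.

Lemma chrD th k k' m : chr th (k + k') m = chr th k m * chr th k' m.
Proof. by rewrite /chr phaseD mulrDl expiD. Qed.
Lemma chr0 th m : chr th 0 m = 1.
Proof. by rewrite /chr phase0 mul0r expi0. Qed.
Lemma chrN th k m : chr th (- k) m = (chr th k m)^-1.
Proof. by rewrite /chr phaseN mulNr expiN. Qed.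
Lemma chr_add th k m m' : chr th k (m + m') = chr th k m * chr th k m'.
Proof. by rewrite /chr intrD mulrDr expiD. Qed.
Lemma chr_0 th k : chr th k 0 = 1.
Proof. by rewrite /chr mulr0 expi0. Qed.
Lemma cabs_chr th k m : cabs (chr th k m) = 1.
Proof. exact: cabs_expi. Qed.
Lemma chr_neq0 th k m : chr th k m != 0.
Proof. exact: expi_neq0. Qed.

(* [F m] is the polynomial in the slow time X attached to the phase index m;
   the modelled sequence is F m evaluated at X = m. *)
Definition modf := int -> {poly C}.
Definition mterm := (C * nat * lab)%type.
(** Powers of X and harmonic order are counted together, so that one bound d controls the losses
    under shift and derivative as well as the labels for which gaps are required. *)
Definition tdeg (t : mterm) := (t.1.2 + lnorm t.2)%N.
Definition twt (tau sig : R) w (t : mterm) : R :=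
  cabs t.1.1 * tau ^+ t.1.2 * sig ^+ maxn (lnorm t.2) w.
Definition tfun th (t : mterm) : modf :=
  fun m => (t.1.1 * chr th t.2 m) *: 'X^(t.1.2).

(* A norm: a power of X costs tau, a harmonic of order |k| costs sig^|k|, and
   components of weight w = 1 (the fast ones) cost at least sig. *)
Definition rep th (tau sig : R) w d (B : R) (F : modf) : Prop :=
  exists T : seq mterm,
    [/\ all (fun t => tdeg t <= d)%N T,
        \sum_(t <- T) twt tau sig w t <= B
      & forall m, F m = \sum_(t <- T) tfun th t m].

(** Step number and slow time advance together: iterating [shf] and evaluating at m = 0, X = 0 reads
    off the modelled sequence. *)
Definition shf (F : modf) : modf := fun m => F (m + 1) \Po ('X + 1).

Section Calculus.
Variables (th : 'I_ell -> R) (tau sig : R).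
Hypotheses (tau1 : 1 <= tau) (sig1 : 1 <= sig).
Local Notation rep := (rep th tau sig).
Local Notation chr := (chr th).

Let tau0 : 0 <= tau. Proof. exact: le_trans ler01 tau1. Qed.
Let sig0 : 0 <= sig. Proof. exact: le_trans ler01 sig1. Qed.

Lemma twt_ge0 w t : 0 <= twt tau sig w t.
Proof. by rewrite /twt !mulr_ge0 ?exprn_ge0 ?cabs_ge0. Qed.

Lemma rep_ge0 w d B F : rep w d B F -> 0 <= B.
Proof.
by case=> T [_ h _]; apply: le_trans h; apply: sumr_ge0 => t _; exact: twt_ge0.
Qed.

Lemma rep_ext w d B F G : (forall m, F m = G m) -> rep w d B F -> rep w d B G.
Proof. by move=> e [T [h1 h2 h3]]; exists T; split=> // m; rewrite -e. Qed.

Lemma rep_le w d d' B B' F : (d <= d')%N -> B <= B' -> rep w d B F -> rep w d' B' F.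
Proof.
move=> dd BB [T [h1 h2 h3]]; exists T; split=> //; last exact: le_trans h2 BB.
by apply: sub_all h1 => t /= /leq_trans; exact.
Qed.

Lemma rep_term w d c l k : (l + lnorm k <= d)%N ->
  rep w d (cabs c * tau ^+ l * sig ^+ maxn (lnorm k) w)
    (fun m => (c * chr k m) *: 'X^l).
Proof.
move=> h; exists [:: (c, l, k)]; split => [|| m].
- by rewrite /= andbT.
- by rewrite big_seq1.
- by rewrite big_seq1.
Qed.

Lemma rep0 w d B : 0 <= B -> rep w d B (fun=> 0).
Proof. by move=> B0; exists [::]; split=> [|| m]; rewrite ?big_nil. Qed.

Lemma repD w d B B' F G : rep w d B F -> rep w d B' G ->
  rep w d (B + B') (fun m => F m + G m).
Proof.
move=> [T [h1 h2 h3]] [T' [h1' h2' h3']]; exists (T ++ T'); split=> [||m].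
- by rewrite all_cat h1.
- by rewrite big_cat lerD.
- by rewrite big_cat h3 h3'.
Qed.

Lemma repZ w d B a F : rep w d B F -> rep w d (cabs a * B) (fun m => a *: F m).
Proof.
move=> [T [h1 h2 h3]]; exists [seq (a * t.1.1, t.1.2, t.2) | t <- T]; split=> [||m].
- by rewrite all_map; apply: sub_all h1.
- rewrite big_map; apply: le_trans (ler_wpM2l (cabs_ge0 a) h2).
  rewrite mulr_sumr; apply: ler_sum => t _.
  by rewrite /twt /= cabsM !mulrA.
- rewrite big_map h3 scaler_sumr; apply: eq_bigr => t _.
  by rewrite /tfun /= scalerA mulrA.
Qed.

Lemma repN w d B F : rep w d B F -> rep w d B (fun m => - F m).
Proof.
move=> /(repZ (-1)); rewrite cabsN cabs1 mul1r.
by apply: rep_ext => m; rewrite scaleN1r.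
Qed.

Lemma repB w d B B' F G : rep w d B F -> rep w d B' G ->
  rep w d (B + B') (fun m => F m - G m).
Proof. by move=> h /repN; exact: repD. Qed.

Lemma rep_sum w d (I : Type) (s : seq I) (P : pred I) (B : I -> R) (F : I -> modf) :
  (forall i, P i -> rep w d (B i) (F i)) ->
  rep w d (\sum_(i <- s | P i) B i) (fun m => \sum_(i <- s | P i) F i m).
Proof.
move=> h; elim: s => [|i s IH].
  by rewrite big_nil; apply: rep_ext (rep0 w d (lexx 0)) => m; rewrite big_nil.
rewrite big_cons; case: ifPn => Pi.
  by apply: rep_ext (repD (h i Pi) IH) => m; rewrite big_cons Pi.
by apply: rep_ext IH => m; rewrite big_cons (negbTE Pi).
Qed.

Lemma repM d d' B B' F G : rep 0 d B F -> rep 0 d' B' G ->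
  rep 0 (d + d') (B * B') (fun m => F m * G m).
Proof.
move=> rF rG; have B0 := rep_ge0 rF.
case: rF rG => [T [h1 h2 h3]] [T' [h1' h2' h3']].
exists [seq (t.1.1 * t'.1.1, (t.1.2 + t'.1.2)%N, t.2 + t'.2) | t <- T, t' <- T'].
split=> [||m].
- apply/allP => _ /allpairsP [[t t'] /= [tT tT' ->]].
  rewrite /tdeg /=; have := allP h1 _ tT; have := allP h1' _ tT'; rewrite /tdeg.
  move=> b a; apply: leq_trans (leq_add a b).
  by rewrite addnACA leq_add2l; exact: lnormD.
- have s1 : 0 <= \sum_(t <- T') twt tau sig 0 t.
    by apply: sumr_ge0 => t _; exact: twt_ge0.
  rewrite big_allpairs_dep; apply: (@le_trans _ _
    ((\sum_(t <- T) twt tau sig 0 t) * (\sum_(t <- T') twt tau sig 0 t))); last first.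
    by apply: ler_pM => //; apply: sumr_ge0 => t _; exact: twt_ge0.
  rewrite mulr_suml; apply: ler_sum => t _.
  rewrite mulr_sumr; apply: ler_sum => t' _.
  rewrite /twt /= !maxn0 cabsM exprD.
  set u := cabs t.1.1; set u' := cabs t'.1.1.
  have -> : u * tau ^+ t.1.2 * sig ^+ lnorm t.2 *
    (u' * tau ^+ t'.1.2 * sig ^+ lnorm t'.2) =
    u * u' * (tau ^+ t.1.2 * tau ^+ t'.1.2) * sig ^+ (lnorm t.2 + lnorm t'.2).
    by rewrite exprD; ring.
  apply: ler_wpM2l; first by rewrite !mulr_ge0 ?exprn_ge0 ?cabs_ge0.
  by apply: ler_weXn2l => //; exact: lnormD.
- rewrite big_allpairs_dep h3 h3' mulr_suml; apply: eq_bigr => t _.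
  rewrite mulr_sumr; apply: eq_bigr => t' _.
  rewrite /tfun /= chrD -scalerAl -scalerAr scalerA exprD; congr (_ *: _).
  by ring.
Qed.

Lemma rep_w01 d B F : rep 1 d B F -> rep 0 d B F.
Proof.
move=> [T [h1 h2 h3]]; exists T; split=> //; apply: le_trans h2.
apply: ler_sum => t _; apply: ler_wpM2l; first by rewrite mulr_ge0 ?exprn_ge0 ?cabs_ge0.
by apply: ler_weXn2l => //; rewrite maxn0 leq_maxl.
Qed.

Lemma rep_w10 w d B F : rep 0 d B F -> rep w d (sig ^+ w * B) F.
Proof.
move=> [T [h1 h2 h3]]; exists T; split=> //.
apply: le_trans (ler_wpM2l (exprn_ge0 w sig0) h2).
rewrite mulr_sumr; apply: ler_sum => t _; rewrite /twt maxn0.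
rewrite [leRHS]mulrCA; apply: ler_wpM2l; first by rewrite mulr_ge0 ?exprn_ge0 ?cabs_ge0.
rewrite -exprD; apply: ler_weXn2l => //; lia.
Qed.

Lemma shf_term c l k m :
  shf (fun m => (c * chr k m) *: 'X^l) m =
  \sum_(i < l.+1) (c * chr k 1 * 'C(l, i)%:R * chr k m) *: 'X^i.
Proof.
rewrite /shf linearZ /= rmorphXn /= comp_polyX (addrC 'X 1) exprDn scaler_sumr.
apply: eq_bigr => i _; rewrite expr1n mul1r chr_add.
rewrite -scaler_nat scalerA; congr (_ *: _).
by rewrite mulrCA; ring.
Qed.

Lemma shfD F G m : shf (fun m => F m + G m) m = shf F m + shf G m.
Proof. by rewrite /shf raddfD. Qed.
Lemma shfB F G m : shf (fun m => F m - G m) m = shf F m - shf G m.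
Proof. by rewrite /shf raddfB. Qed.
Lemma shfZ a F m : shf (fun m => a *: F m) m = a *: shf F m.
Proof. by rewrite /shf linearZ. Qed.
Lemma shfM F G m : shf (fun m => F m * G m) m = shf F m * shf G m.
Proof. by rewrite /shf rmorphM. Qed.
Lemma shf_sum (I : Type) (s : seq I) (P : pred I) (F : I -> modf) m :
  shf (fun m => \sum_(i <- s | P i) F i m) m = \sum_(i <- s | P i) shf (F i) m.
Proof. by rewrite /shf raddf_sum. Qed.

(** The binomial coefficients of (X + 1)^l sum to 2^l, and lower powers of X are no heavier since
    tau >= 1. *)
Lemma rep_shf w d B F : rep w d B F -> rep w d (2 ^+ d * B) (shf F).
Proof.
move=> rF; have B0 := rep_ge0 rF; case: rF => [T [h1 h2 h3]].
have e m : shf F m = \sum_(t <- T) shf (tfun th t) m.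
  by rewrite -shf_sum /shf h3.
apply: (@rep_ext _ _ _ (fun m => \sum_(t <- T) shf (tfun th t) m)) => [m|].
  by rewrite e.
apply: (rep_le (leqnn d) (ler_wpM2l (exprn_ge0 d _) h2)); first by rewrite ler0n.
rewrite mulr_sumr.
elim: T h1 {h2 h3 e} => [|t T IH] /=.
  by move=> _; apply: rep_ext (rep0 w d _) => [m|]; rewrite big_nil.
move=> /andP [ht /IH rT]; rewrite big_cons.
apply: (@rep_ext _ _ _ (fun m => shf (tfun th t) m + \sum_(t <- T) shf (tfun th t) m)).
  by move=> m; rewrite big_cons.
apply: repD rT; case: t ht => [[c l] k] ht; rewrite /tdeg /= in ht.
pose f (i : 'I_l.+1) m := (c * chr k 1 * 'C(l, i)%:R * chr k m) *: 'X^i : {poly C}.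
apply: (@rep_ext _ _ _ (fun m => \sum_(i < l.+1) f i m)).
  by move=> m; rewrite [RHS]shf_term.
apply: (@rep_le _ d _ (\sum_(i < l.+1)
   (cabs (c * chr k 1 * 'C(l, i)%:R) * tau ^+ i * sig ^+ maxn (lnorm k) w))) => //.
  rewrite /twt /=; apply: (@le_trans _ _ (\sum_(i < l.+1)
    ('C(l, i)%:R * (cabs c * tau ^+ l * sig ^+ maxn (lnorm k) w)))).
    apply: ler_sum => i _; rewrite !cabsM cabs_chr cabs_nat mulr1.
    rewrite [cabs c * _]mulrC -!mulrA; do 2!(apply: ler_wpM2l; rewrite ?cabs_ge0 //).
    apply: ler_wpM2r; first exact: exprn_ge0.
    by apply: ler_weXn2l => //; rewrite -ltnS.
  rewrite -mulr_suml -natr_sum; apply: ler_wpM2r.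
    by rewrite !mulr_ge0 ?exprn_ge0 ?cabs_ge0.
  rewrite -natrX ler_nat.
  have -> : (\sum_(i < l.+1) 'C(l, i) = 2 ^ l)%N.
    by rewrite -[2%N]/(1 + 1)%N expnDn; apply: eq_bigr => i _; rewrite !exp1n !muln1.
  by apply: leq_pexp2l => //; lia.
apply: rep_sum => i _; apply: rep_term; have := ltn_ord i; lia.
Qed.

(** Differentiation trades one power of X, of weight tau, for a factor at most d. Thus tau is the
    time scale on which the coefficients vary. *)
Lemma rep_deriv w d B F : rep w d B F ->
  rep w d (d%:R / tau * B) (fun m => (F m)^`()).
Proof.
move=> rF; have B0 := rep_ge0 rF; case: rF => [T [h1 h2 h3]].
have tp : 0 < tau by exact: lt_le_trans ltr01 tau1.
exists [seq (t.1.1 * t.1.2%:R, t.1.2.-1, t.2) | t <- T]; split=> [||m].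
- rewrite all_map; apply: sub_all h1 => -[[c l] k]; rewrite /tdeg /=; lia.
- rewrite big_map; apply: (le_trans _ (ler_wpM2l _ h2)); last by rewrite mulr_ge0 ?invr_ge0.
  rewrite mulr_sumr big_seq [leRHS]big_seq; apply: ler_sum => t tT.
  have := allP h1 _ tT; case: t tT => [[c l] k] _; rewrite /twt /tdeg /= => ht.
  rewrite cabsM cabs_nat -!mulrA; case: l ht => [|l] ht.
    by rewrite mul0r mulr0 !mulr_ge0 ?invr_ge0 ?exprn_ge0 ?cabs_ge0.
  set W := sig ^+ _.
  have -> : d%:R * (tau^-1 * (cabs c * (tau ^+ l.+1 * W))) =
    cabs c * (d%:R * (tau ^+ l * W)).
    by rewrite exprS; field; rewrite gt_eqF.
  apply: ler_wpM2l; first exact: cabs_ge0.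
  apply: ler_wpM2r; first by rewrite mulr_ge0 ?exprn_ge0.
  rewrite ler_nat; lia.
- rewrite big_map h3 raddf_sum; apply: eq_bigr => t _.
  rewrite /tfun /= derivZ derivXn -scaler_nat scalerA; congr (_ *: _).
  by ring.
Qed.

Lemma rep_val_wt w d B F m t : rep w d B F -> `|t| <= tau ->
  cabs (F m).[t%:C%C] * sig ^+ w <= B.
Proof.
move=> [T [h1 h2 h3]] tt; apply: le_trans h2; rewrite h3 horner_sum.
apply: (le_trans (ler_wpM2r (exprn_ge0 w sig0) (cabs_sum _ _ _))).
rewrite mulr_suml; apply: ler_sum => -[[c l] k] _.
rewrite /tfun /twt /= hornerZ hornerXn !cabsM cabs_chr mulr1 -!mulrA.
apply: ler_wpM2l; first exact: cabs_ge0.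
rewrite -rmorphXn cabs_real normrX; apply: ler_pM => //; rewrite ?exprn_ge0 //.
- by apply: lerXn2r => //; rewrite nnegrE.
- by apply: ler_weXn2l => //; exact: leq_maxr.
Qed.

(** The dichotomy behind solving shf F - mu F = G at cost tau: a resonant term gains one power of X,
    of weight tau, and any other term is divided by something at least 1 / tau. *)
Definition gapped (d : nat) (mu : C) : Prop :=
  forall k, (lnorm k <= d)%N -> chr k 1 = mu \/ 1 <= tau * cabs (chr k 1 - mu).

End Calculus.

(** Stated with its own divisor gam, which may be much larger than 1 / tau: [solve_rest] applies it
    with both sizes. *)
Definition nonres_bound (l : nat) (A : R) :=
  forall (th : 'I_ell -> R) (tau sig gam : R) w d (k : lab) (mu : C) (i : nat),
  1 <= tau -> 1 <= sig -> (i <= l)%N -> (i + lnorm k <= d)%N ->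
  1 <= tau * gam -> 0 < gam -> gam <= cabs (chr th k 1 - mu) ->
  exists2 F, rep th tau sig w d (A / gam * tau ^+ i * sig ^+ maxn (lnorm k) w) F
    & forall m, shf F m - mu *: F m = chr th k m *: 'X^i.

(** Dividing the leading term by chr k 1 - mu leaves lower powers of X, solved by induction. Each
    correction meets a second divisor, but 1 / gam <= tau and a power of X has been lost, so a
    single factor 1 / gam remains in the bound. *)
Lemma solve_term_nonres (l : nat) : exists2 A : R, 0 <= A & nonres_bound l A.
Proof.
elim: l => [|l [A A0 IH]].
  exists 1 => // th tau sig gam w d k mu i t1 s1; rewrite leqn0 => /eqP -> hd tg g0 gm.
  have nz : chr th k 1 - mu != 0.
    by rewrite -cabs_eq0 gt_eqF //; exact: lt_le_trans gm.
  exists (fun m => ((chr th k 1 - mu)^-1 * chr th k m) *: 'X^0).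
    apply: (rep_le (leqnn d)) (rep_term _ _ _ _ _ hd).
    rewrite cabsV !expr0 !mulr1 mul1r; apply: ler_wpM2r.
      by rewrite exprn_ge0 // (le_trans ler01).
    by rewrite lef_pV2 // posrE //; exact: lt_le_trans gm.
  move=> m; rewrite shf_term big_ord1 /= bin0 mulr1 scalerA -scalerBl; congr (_ *: _).
  by field.
pose S : R := \sum_(i < l.+1) 'C(l.+1, i)%:R.
have S0 : 0 <= S by apply: sumr_ge0 => i _; exact: ler0n.
exists (A + (1 + S * A)) => [|th tau sig gam w d k mu i t1 s1].
  by rewrite !addr_ge0 // mulr_ge0.
move=> il hd tg g0 gm.
have ge0 j : 0 <= tau ^+ j * sig ^+ maxn (lnorm k) w.
  by rewrite mulr_ge0 ?exprn_ge0 ?(le_trans ler01).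
have gi0 : 0 <= gam^-1 by rewrite invr_ge0 ltW.
move: il; rewrite leq_eqVlt => /orP [/eqP ei|]; last first.
  rewrite ltnS => il; have [F rF eF] := IH th tau sig gam w d k mu i t1 s1 il hd tg g0 gm.
  exists F => //; apply: rep_le rF => //; rewrite -!mulrA; apply: ler_wpM2r.
    by rewrite mulr_ge0 // ge0.
  by rewrite lerDl addr_ge0 // mulr_ge0.
subst i.
have nz : chr th k 1 - mu != 0.
  by rewrite -cabs_eq0 gt_eqF //; exact: lt_le_trans gm.
have /choice [f hf] : forall j : 'I_l.+1, exists F, rep th tau sig w d
    (A / gam * tau ^+ j * sig ^+ maxn (lnorm k) w) F
    /\ forall m, shf F m - mu *: F m = chr th k m *: 'X^j.
  move=> j; have jl : (j <= l)%N by rewrite -ltnS.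
  have hd' : (j + lnorm k <= d)%N by apply: leq_trans hd; rewrite leq_add2r ltnW.
  by have [F h1 h2] := IH th tau sig gam w d k mu j t1 s1 jl hd' tg g0 gm; exists F.
pose z := (chr th k 1 - mu)^-1.
have cz : cabs z <= gam^-1.
  by rewrite cabsV lef_pV2 // posrE //; exact: lt_le_trans gm.
pose G (j : 'I_l.+1) m := (z * chr th k 1 * 'C(l.+1, j)%:R) *: f j m.
exists (fun m => (z * chr th k m) *: 'X^(l.+1) - \sum_(j < l.+1) G j m).
  apply: (rep_le (leqnn d)); last first.
    apply: repB; first exact: (rep_term _ _ _ _ _ hd).
    by apply: rep_sum => j _; apply: repZ; exact: (proj1 (hf j)).
  set W := sig ^+ _; rewrite -!mulrA.
  have W0 : 0 <= W by rewrite exprn_ge0 // (le_trans ler01).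
  apply: (@le_trans _ _ (gam^-1 * (tau ^+ l.+1 * W) +
     S * A * (gam^-1 * (tau ^+ l.+1 * W)))); last first.
    rewrite !mulrDl mul1r lerDr mulr_ge0 // mulr_ge0 ?ge0 //.
  apply: lerD; first by apply: ler_wpM2r => //; exact: ge0.
  rewrite /S -mulrA mulr_suml; apply: ler_sum => j _.
  rewrite !cabsM cabs_chr cabs_nat mulr1 [cabs z * _]mulrC -!mulrA.
  apply: ler_wpM2l; first exact: ler0n.
  rewrite mulrCA; apply: ler_wpM2l => //.
  rewrite mulrCA; apply: ler_wpM2l => //.
  rewrite mulrA; apply: ler_wpM2r => //.
  apply: (@le_trans _ _ (tau * tau ^+ j)).
    apply: ler_wpM2r; first by rewrite exprn_ge0 // (le_trans ler01).
    by apply: le_trans cz _; rewrite -[leLHS]mul1r ler_pdivrMr.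
  by rewrite -exprS; apply: ler_weXn2l => //; rewrite ltnS -ltnS.
move=> m; rewrite shfB shf_term big_ord_recr /= shf_sum scalerBr scaler_sumr.
rewrite binn mulr1.
have -> : \sum_(j < l.+1) shf (G j) m = \sum_(j < l.+1) (mu *: G j m) +
   \sum_(j < l.+1) (z * chr th k 1 * 'C(l.+1, j)%:R * chr th k m) *: 'X^j.
  rewrite -big_split /=; apply: eq_bigr => j _.
  rewrite /G shfZ -(subrK (mu *: f j m) (shf (f j) m)) (proj2 (hf j)).
  by rewrite scalerDr !scalerA addrC (mulrC mu).
set a := \sum_(i < _) _ *: 'X^i; set b := \sum_(i < _) mu *: _.
have aux (V : comNzRingType) (u v x y : V) : x + u - (y + x) - (v - y) = u - v.
  by ring.
rewrite aux !scalerA -scalerBl; congr (_ *: _); rewrite /z; by field.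
Qed.

(** Discrete antidifferentiation: (X + 1)^(i + 1) - X^(i + 1) has leading term (i + 1) X^i, and the
    lower powers are removed by induction. *)
Lemma solve_term_res (l : nat) : exists2 A : R, 0 <= A &
  forall (th : 'I_ell -> R) (tau sig : R) w d (k : lab) (i : nat),
  1 <= tau -> 1 <= sig -> (i <= l)%N -> (i + lnorm k <= d)%N ->
  exists2 F, rep th tau sig w d.+1 (A * tau ^+ i.+1 * sig ^+ maxn (lnorm k) w) F
    & forall m, shf F m - chr th k 1 *: F m = chr th k m *: 'X^i.
Proof.
elim: l => [|l [A A0 IH]].
  exists 1 => // th tau sig w d k i t1 s1; rewrite leqn0 => /eqP -> hd.
  exists (fun m => ((chr th k 1)^-1 * chr th k m) *: 'X^1).
    have hd' : (1 + lnorm k <= d.+1)%N by rewrite add1n ltnS.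
    apply: (rep_le (leqnn _)) (rep_term _ _ _ _ _ hd').
    by rewrite cabsV cabs_chr invr1.
  move=> m; rewrite shf_term !big_ord_recl big_ord0 /= bin0 bin1 /bump /=.
  rewrite addr0 scalerA mulr1 !mulrA mulVf ?chr_neq0 // mulfV ?chr_neq0 // !mul1r.
  by rewrite addrK.
pose S : R := \sum_(i < l.+1) 'C(l.+2, i)%:R.
have S0 : 0 <= S by apply: sumr_ge0 => i _; exact: ler0n.
exists (A + (1 + S * A)) => [|th tau sig w d k i t1 s1].
  by rewrite !addr_ge0 // mulr_ge0.
move=> il hd.
have ge0 j : 0 <= tau ^+ j * sig ^+ maxn (lnorm k) w.
  by rewrite mulr_ge0 ?exprn_ge0 ?(le_trans ler01).
move: il; rewrite leq_eqVlt => /orP [/eqP ei|]; last first.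
  rewrite ltnS => il; have [F rF eF] := IH th tau sig w d k i t1 s1 il hd.
  exists F => //; apply: rep_le rF => //; rewrite -!mulrA; apply: ler_wpM2r.
    exact: ge0.
  by rewrite lerDl addr_ge0 // mulr_ge0.
subst i.
have /choice [f hf] : forall j : 'I_l.+1, exists F, rep th tau sig w d.+1
    (A * tau ^+ j.+1 * sig ^+ maxn (lnorm k) w) F
    /\ forall m, shf F m - chr th k 1 *: F m = chr th k m *: 'X^j.
  move=> j; have jl : (j <= l)%N by rewrite -ltnS.
  have hd' : (j + lnorm k <= d)%N by apply: leq_trans hd; rewrite leq_add2r ltnW.
  by have [F h1 h2] := IH th tau sig w d k j t1 s1 jl hd'; exists F.
pose z : C := l.+2%:R^-1.
have l0 : (l.+2%:R : C) != 0 by rewrite pnatr_eq0.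
have cz : cabs z <= 1.
  by rewrite cabsV cabs_nat invf_le1 ?ler1n ?ltr0n.
pose mu := chr th k 1.
have mu0 : mu != 0 by exact: chr_neq0.
pose G (j : 'I_l.+1) m := (z * 'C(l.+2, j)%:R) *: f j m.
have hd' : (l.+2 + lnorm k <= d.+1)%N by rewrite addSn ltnS.
exists (fun m => (z / mu * chr th k m) *: 'X^(l.+2) - \sum_(j < l.+1) G j m).
  apply: (rep_le (leqnn _)); last first.
    apply: repB; first exact: (rep_term _ _ _ _ _ hd').
    by apply: rep_sum => j _; apply: repZ; exact: (proj1 (hf j)).
  set W := sig ^+ _; have W0 : 0 <= W by rewrite exprn_ge0 // (le_trans ler01).
  have cz' : cabs (z / mu) <= 1 by rewrite cabsM cabsV cabs_chr invr1 mulr1.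
  have ge1 (j : 'I_l.+1) : tau ^+ j.+1 <= tau ^+ l.+2.
    by apply: ler_weXn2l => //; rewrite !ltnS ltnW // ltnS -ltnS.
  have ge2 : 0 <= tau ^+ l.+2 * W by exact: ge0.
  apply: (@le_trans _ _ ((A + (1 + S * A)) * (tau ^+ l.+2 * W))); last by rewrite mulrA.
  rewrite -[X in X + _ <= _]mulrA; move: (tau ^+ l.+2) ge1 ge2 => T ge1 ge2.
  apply: (@le_trans _ _ (T * W + S * A * (T * W))); last first.
    by rewrite !mulrDl mul1r lerDr mulr_ge0.
  apply: lerD; first by rewrite -[leRHS]mul1r; apply: ler_wpM2r.
  rewrite /S -mulrA mulr_suml; apply: ler_sum => j _.
  rewrite !cabsM cabs_nat [cabs z * _]mulrC -!mulrA.
  apply: ler_wpM2l; first exact: ler0n.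
  rewrite mulrCA; apply: ler_wpM2l => //.
  rewrite -[leRHS]mul1r; apply: ler_pM => //; first exact: cabs_ge0.
  by apply: ler_wpM2r => //; apply: ge1.
move=> m; rewrite shfB shf_term big_ord_recr /= big_ord_recr /= shf_sum scalerBr scaler_sumr.
rewrite binn mulr1.
have -> : \sum_(j < l.+1) shf (G j) m = \sum_(j < l.+1) (mu *: G j m) +
   \sum_(j < l.+1) (z / mu * mu * 'C(l.+2, j)%:R * chr th k m) *: 'X^j.
  rewrite -big_split /=; apply: eq_bigr => j _.
  rewrite /G shfZ -(subrK (mu *: f j m) (shf (f j) m)) (proj2 (hf j)).
  by rewrite scalerDr !scalerA addrC (mulrC mu) divfK.
set a := \sum_(i < _) _ *: 'X^i; set b := \sum_(i < _) _ *: G _ _.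
have -> : (z / mu * chr th k 1 * 'C(l.+2, l.+1)%:R * chr th k m) = chr th k m.
  by rewrite divfK // -bin_sub // subSnn bin1 mulVf // mul1r.
have -> : z / mu * chr th k 1 = z by rewrite divfK.
have -> : chr th k 1 *: ((z / mu * chr th k m) *: 'X^(l.+2)) = (z * chr th k m) *: 'X^(l.+2).
  by rewrite scalerA; congr (_ *: _); rewrite mulrA (mulrC _ (z / mu)) divfK.
have aux (V : comNzRingType) (u v x y : V) : x + v + u - (y + x) - (u - y) = v.
  by ring.
exact: aux.
Qed.

Lemma big_rep_solve (P : mterm -> Prop) (bd : mterm -> R) th tau sig w d mu :
  (forall t, P t -> exists2 F, rep th tau sig w d (bd t) F
     & forall m, shf F m - mu *: F m = tfun th t m) ->
  forall T, (forall t, t \in T -> P t) ->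
  exists2 F, rep th tau sig w d (\sum_(t <- T) bd t) F
     & forall m, shf F m - mu *: F m = \sum_(t <- T) tfun th t m.
Proof.
move=> h; elim=> [|t T IH] hT.
  exists (fun=> 0) => [|m]; first by apply: rep0; rewrite big_nil.
  by rewrite big_nil scaler0 subr0 /shf raddf0.
have [F1 r1 e1] := h t (hT t (mem_head _ _)).
have [|F2 r2 e2] := IH; first by move=> u uT; apply: hT; rewrite inE uT orbT.
exists (fun m => F1 m + F2 m) => [|m]; first by rewrite big_cons; exact: repD.
by rewrite big_cons -e1 -e2 shfD scalerDr; ring.
Qed.

Lemma solve_one d : exists2 A : R, 0 <= A &
  forall (th : 'I_ell -> R) (tau sig : R) w mu t, 1 <= tau -> 1 <= sig ->
  (tdeg t <= d)%N ->
  chr th t.2 1 = mu \/ 1 <= tau * cabs (chr th t.2 1 - mu) ->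
  exists2 F, rep th tau sig w d.+1 (A * tau * twt tau sig w t) F
    & forall m, shf F m - mu *: F m = tfun th t m.
Proof.
have [A1 A10 h1] := solve_term_res d; have [A2 A20 h2] := solve_term_nonres d.
exists (A1 + A2) => [|th tau sig w mu [[c l] k] t1 s1]; first exact: addr_ge0.
rewrite /tdeg /twt /= => hd hg.
have tp : 0 < tau by exact: lt_le_trans ltr01 t1.
have ld : (l <= d)%N by apply: leq_trans hd; exact: leq_addr.
have X0 : 0 <= cabs c * tau ^+ l * sig ^+ maxn (lnorm k) w * tau.
  by rewrite !mulr_ge0 ?cabs_ge0 ?exprn_ge0 ?(le_trans ler01) // ltW.
have [F rF eF] : exists2 F, rep th tau sig w d.+1
    ((A1 + A2) * tau * (tau ^+ l * sig ^+ maxn (lnorm k) w)) F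
    & forall m, shf F m - mu *: F m = chr th k m *: 'X^l.
  have W0 : 0 <= tau * (tau ^+ l * sig ^+ maxn (lnorm k) w).
    by rewrite !mulr_ge0 ?exprn_ge0 ?(le_trans ler01) // ltW.
  case: hg => [<-|hg].
    have [F r e] := h1 th tau sig w d k l t1 s1 ld hd; exists F => //.
    apply: rep_le r => //; rewrite exprS -!mulrA.
    by apply: ler_wpM2r => //; rewrite lerDl.
  have g0 : 0 < cabs (chr th k 1 - mu).
    by rewrite -(pmulr_rgt0 _ tp); exact: lt_le_trans hg.
  have [F r e] := h2 th tau sig _ w d k mu l t1 s1 ld hd hg g0 (lexx _); exists F => //.
  apply: rep_le r => //; rewrite -!mulrA; apply: (@le_trans _ _
    (A2 * (tau * (tau ^+ l * sig ^+ maxn (lnorm k) w)))).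
    apply: ler_wpM2l => //; apply: ler_wpM2r.
      by rewrite !mulr_ge0 ?exprn_ge0 ?(le_trans ler01).
    by rewrite -[leLHS]mul1r ler_pdivrMr.
  by apply: ler_wpM2r => //; rewrite lerDr.
exists (fun m => c *: F m) => [|m].
  apply: (rep_le (leqnn _)) (repZ c rF).
  by rewrite [leLHS]mulrCA; rewrite !mulrA.
by rewrite shfZ scalerA mulrC -scalerA -scalerBr eF /tfun /= scalerA.
Qed.

(** The character of kap solves the homogeneous equation, so a multiple of it normalises the
    solution at m = 0, X = 0. This at most doubles the norm: as lnorm kap <= w, the subtracted term
    has weight sig^w, which [rep_val_wt] already controls. *)
Lemma rep_solve d : exists2 A : R, 0 <= A &
  forall (th : 'I_ell -> R) (tau sig : R) w kap B G, 1 <= tau -> 1 <= sig ->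
  gapped th tau d (chr th kap 1) -> (lnorm kap <= w)%N -> (lnorm kap <= d.+1)%N ->
  rep th tau sig w d B G ->
  exists F, [/\ rep th tau sig w d.+1 (A * tau * B) F,
    forall m, shf F m - chr th kap 1 *: F m = G m & (F 0).[0] = 0].
Proof.
have [A A0 h] := solve_one d; exists (2 * A) => [|th tau sig w kap B G t1 s1 hg kw kd].
  by rewrite mulr_ge0.
move=> [T [hT1 hT2 hT3]].
have [|t tT|F rF eF] := @big_rep_solve (fun t => (tdeg t <= d)%N)
   (fun t => A * tau * twt tau sig w t) th tau sig w d.+1 (chr th kap 1) _ T.
- move=> t td; apply: h => //; apply: hg.
  by apply: leq_trans td; exact: leq_addl.
- exact: (allP hT1).
have rF' : rep th tau sig w d.+1 (A * tau * B) F.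
  apply: rep_le rF => //; rewrite -mulr_sumr; apply: ler_wpM2l => //.
  by rewrite mulr_ge0 // (le_trans ler01).
exists (fun m => F m - ((F 0).[0] * chr th kap m) *: 'X^0); split => [|m|].
- have hd : (0 + lnorm kap <= d.+1)%N by [].
  apply: (rep_le (leqnn _)) (repB rF' (rep_term _ _ _ _ _ hd)).
  rewrite (_ : 2 * A * tau * B = A * tau * B + A * tau * B); last by ring.
  rewrite lerD2l expr0 mulr1 (maxn_idPr kw).
  have := rep_val_wt t1 s1 0 rF' (t := 0); rewrite normr0; apply.
  exact: le_trans ler01 t1.
- rewrite shfB hT3 -eF shf_term big_ord1 bin0 mulr1 /= scalerBr scalerA.
  rewrite (mulrC (chr th kap 1)) -!mulrA (mulrC (chr th kap m)).
  have aux (V : comNzRingType) (u v x : V) : u - x - (v - x) = u - v by ring.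
  exact: aux.
- by rewrite chr_0 mulr1 expr0 hornerD hornerN hornerZ hornerC mulr1 subrr.
Qed.

(** * Averages over a common period, resonance classes and uniqueness *)

Section Averages.
Variables (th : 'I_ell -> R) (Q : nat).
Hypotheses (Q0 : (0 < Q)%N) (chrQ : forall k, chr th k Q = 1).
Local Notation chr := (chr th).

Definition mean (F : modf) : {poly C} := Q%:R^-1 *: \sum_(m < Q) F m.
(** Different labels may have the same character, so this projects onto the whole resonance class of
    kap and not onto a single label. *)
Definition lproj kap (F : modf) : modf :=
  fun m => chr kap m *: mean (fun m => chr (- kap) m *: F m).

Let QC : (Q%:R : C) != 0. Proof. by rewrite pnatr_eq0 -lt0n. Qed.

Lemma chr_nat k (m : nat) : chr k m = chr k 1 ^+ m.
Proof.
elim: m => [|m IH]; first by rewrite chr_0 expr0.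
by rewrite -addn1 PoszD chr_add IH addn1 exprSr.
Qed.

Lemma chr_mod k (m : int) : chr k (m + Q) = chr k m.
Proof. by rewrite chr_add chrQ mulr1. Qed.

Lemma chr_eq k k' m : chr k 1 = chr k' 1 -> chr k m = chr k' m.
Proof.
move=> e; case: m => n; first by rewrite (chr_nat k) (chr_nat k') e.
rewrite NegzE; have h k0 : chr k0 (- n.+1%:Z) = (chr k0 1 ^+ n.+1)^-1.
  apply: (mulfI (chr_neq0 th k0 n.+1)).
  by rewrite -chr_add subrr chr_0 chr_nat divff // expf_neq0 // chr_neq0.
by rewrite !h e.
Qed.

Lemma sum_pow_root (z : C) : z ^+ Q = 1 -> z != 1 -> \sum_(m < Q) z ^+ m = 0.
Proof.
move=> zQ z1; apply/eqP; have := subrX1 z Q; rewrite zQ subrr => /esym /eqP.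
by rewrite mulf_eq0 subr_eq0 (negbTE z1).
Qed.

Lemma mean_ext F G : (forall m, F m = G m) -> mean F = mean G.
Proof. by move=> e; rewrite /mean; congr (_ *: _); apply: eq_bigr => i _; exact: e. Qed.
Lemma meanD F G : mean (fun m => F m + G m) = mean F + mean G.
Proof. by rewrite /mean big_split scalerDr. Qed.
Lemma meanZ a F : mean (fun m => a *: F m) = a *: mean F.
Proof. by rewrite /mean -scaler_sumr scalerA mulrC -scalerA. Qed.
Lemma meanN F : mean (fun m => - F m) = - mean F.
Proof.
rewrite -scaleN1r -meanZ; apply: mean_ext => m; by rewrite scaleN1r.
Qed.
Lemma meanB F G : mean (fun m => F m - G m) = mean F - mean G.
Proof. by rewrite meanD meanN. Qed.
Lemma mean_cst p : mean (fun=> p) = p.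
Proof. by rewrite /mean sumr_const card_ord -(scaler_nat Q p) scalerA mulVf ?scale1r. Qed.
Lemma mean_sum (I : Type) (s : seq I) (P : pred I) (F : I -> modf) :
  mean (fun m => \sum_(i <- s | P i) F i m) = \sum_(i <- s | P i) mean (F i).
Proof. by rewrite /mean exchange_big /= scaler_sumr. Qed.
Lemma mean_deriv F : mean (fun m => (F m)^`()) = (mean F)^`().
Proof. by rewrite /mean derivZ; congr (_ *: _); rewrite raddf_sum. Qed.

Lemma mean_tfun (t : mterm) :
  mean (tfun th t) = if chr t.2 1 == 1 then t.1.1 *: 'X^(t.1.2) else 0.
Proof.
case: t => [[c l] k] /=; rewrite /mean /tfun /=.
rewrite -scaler_suml -mulr_sumr scalerA mulrCA.
case: eqP => e.
  rewrite (eq_bigr (fun=> 1)) => [|m _]; last by rewrite (chr_nat _ m) e expr1n.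
  by rewrite sumr_const card_ord mulVf // mulr1.
rewrite (eq_bigr (fun m : 'I_Q => chr k 1 ^+ m)) => [|m _]; last by rewrite (chr_nat _ m).
by rewrite sum_pow_root ?mulr0 ?scale0r -?(chr_nat _ Q) ?chrQ //; exact/eqP.
Qed.

Lemma proj_tfun kap (t : mterm) m :
  lproj kap (tfun th t) m = if chr t.2 1 == chr kap 1 then tfun th t m else 0.
Proof.
rewrite /lproj (@mean_ext _ (tfun th (t.1.1, t.1.2, t.2 - kap))); last first.
  move=> m'; rewrite /tfun /= scalerA chrD; congr (_ *: _); ring.
rewrite mean_tfun /= chrD chrN -subr_eq0.
have -> : (chr t.2 1 / chr kap 1 - 1 == 0) = (chr t.2 1 == chr kap 1).
  rewrite subr_eq0; apply/eqP/eqP => [h|->]; last by rewrite divff // chr_neq0.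
  by rewrite -[LHS](divfK (chr_neq0 th kap 1)) h mul1r.
case: eqP => e; last by rewrite scaler0.
by rewrite scalerA /tfun mulrC (chr_eq m e).
Qed.

Lemma proj_ext kap F G : (forall m, F m = G m) -> forall m, lproj kap F m = lproj kap G m.
Proof.
by move=> e m; rewrite /lproj; congr (_ *: _); apply: mean_ext => m'; rewrite e.
Qed.

Lemma proj_list kap T F : (forall m, F m = \sum_(t <- T) tfun th t m) ->
  forall m, lproj kap F m = \sum_(t <- [seq t <- T | chr t.2 1 == chr kap 1]) tfun th t m.
Proof.
move=> e m; rewrite big_filter (proj_ext kap e).
transitivity (\sum_(t <- T) lproj kap (tfun th t) m).
  rewrite /lproj -scaler_sumr -mean_sum; congr (_ *: _); apply: mean_ext => m'.
  by rewrite scaler_sumr.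
by rewrite [RHS]big_mkcond; apply: eq_bigr => t _; rewrite proj_tfun.
Qed.

Lemma rest_list kap T F : (forall m, F m = \sum_(t <- T) tfun th t m) ->
  forall m, F m - lproj kap F m =
    \sum_(t <- [seq t <- T | chr t.2 1 != chr kap 1]) tfun th t m.
Proof.
move=> e m; rewrite (proj_list kap e) e !big_filter.
by rewrite (bigID (fun t => chr t.2 1 == chr kap 1)) /= addrC addrK.
Qed.

Lemma proj0_mean F m : lproj 0 F m = mean F.
Proof.
rewrite /lproj chr0 scale1r; apply: mean_ext => m'.
by rewrite oppr0 chr0 scale1r.
Qed.

Definition mperiodic (F : modf) := forall m : int, F (m + Q%:Z) = F m.

Lemma rep_periodic tau sig w d B F : rep th tau sig w d B F -> mperiodic F.
Proof.
move=> [T [_ _ e]] m; rewrite !e; apply: eq_bigr => t _.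
by rewrite /tfun chr_mod.
Qed.

Lemma mean_shf F : mperiodic F -> mean (shf F) = mean F \Po ('X + 1).
Proof.
rewrite /mperiodic => pF; rewrite /mean comp_polyZ; congr (_ *: _); rewrite raddf_sum /=.
rewrite -(big_mkord predT (fun m => shf F m)) -(big_mkord predT (fun m : nat => F m \Po ('X + 1))).
case: Q Q0 pF => // n _ pF.
rewrite big_nat_recr //= [RHS]big_nat_recl //= addrC; congr (_ + _).
  have -> : F 0%Z = F (n%:Z + 1) by rewrite -(pF 0) add0r -PoszD addn1.
  by [].
by apply: eq_bigr => i _; rewrite /shf -PoszD addn1.
Qed.

Section RepAverages.
Variables (tau sig : R).
Hypotheses (tau1 : 1 <= tau) (sig1 : 1 <= sig).
Let sig0 : 0 <= sig. Proof. exact: le_trans ler01 sig1. Qed.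
Let tau0 : 0 <= tau. Proof. exact: le_trans ler01 tau1. Qed.

Lemma sum_filter_le w (P : pred mterm) T :
  \sum_(t <- [seq t <- T | P t]) twt tau sig w t <= \sum_(t <- T) twt tau sig w t.
Proof.
rewrite big_filter [leRHS](bigID P) /= lerDl; apply: sumr_ge0 => t _.
exact: twt_ge0.
Qed.

Lemma rep_proj kap w d B F : rep th tau sig w d B F -> rep th tau sig w d B (lproj kap F).
Proof.
move=> [T [h1 h2 h3]]; exists [seq t <- T | chr t.2 1 == chr kap 1]; split.
- by apply/allP => t; rewrite mem_filter => /andP [_ /(allP h1)].
- exact: le_trans (sum_filter_le _ _ _) h2.
- exact: proj_list.
Qed.

Lemma rep_mean w d B F : rep th tau sig w d B F -> rep th tau sig w d B (fun=> mean F).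
Proof. by move=> /(rep_proj 0); apply: rep_ext => m; exact: proj0_mean. Qed.

(** Only nonzero labels survive the removal of the mean, and each of them carries at least one
    factor sig. *)
Lemma rep_rest1 d B F : rep th tau sig 0 d B F ->
  rep th tau 1 0 d (B / sig) (fun m => F m - mean F).
Proof.
move=> [T [h1 h2 h3]]; exists [seq t <- T | chr t.2 1 != chr 0 1]; split.
- by apply/allP => t; rewrite mem_filter => /andP [_ /(allP h1)].
- rewrite ler_pdivlMr; last exact: lt_le_trans ltr01 sig1.
  rewrite big_filter mulr_suml; apply: le_trans h2.
  rewrite [leRHS](bigID (fun t => chr t.2 1 != chr 0 1)) /= -[leLHS]addr0.
  apply: lerD; last by apply: sumr_ge0 => t _; exact: twt_ge0.
  apply: ler_sum => -[[c l] k] /= ht; rewrite /twt /= expr1n mulr1.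
  apply: ler_wpM2l; first by rewrite mulr_ge0 ?cabs_ge0 ?exprn_ge0.
  rewrite -[leLHS]expr1; apply: ler_weXn2l => //; rewrite maxn0 lt0n.
  by apply: contraNneq ht => /lnorm_eq0 ->.
- by move=> m; rewrite -(rest_list 0 h3) proj0_mean.
Qed.

Lemma rep_fast1 d B F : rep th tau sig 1 d B F -> rep th tau 1 0 d (B / sig) F.
Proof.
move=> [T [h1 h2 h3]]; exists T; split=> //.
rewrite ler_pdivlMr; last exact: lt_le_trans ltr01 sig1.
apply: le_trans h2; rewrite mulr_suml; apply: ler_sum => t _.
rewrite /twt expr1n mulr1; apply: ler_wpM2l.
  by rewrite mulr_ge0 ?cabs_ge0 ?exprn_ge0.
by rewrite -[leLHS]expr1; apply: ler_weXn2l => //; rewrite leq_maxr.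
Qed.

End RepAverages.

Lemma comp_shiftS (p : {poly C}) (a : C) :
  (p \Po ('X + a%:P)) \Po ('X + 1) = p \Po ('X + (a + 1)%:P).
Proof.
have e : ('X + a%:P) \Po ('X + 1) = 'X + (a + 1)%:P :> {poly C}.
  by rewrite comp_polyD comp_polyX comp_polyC polyCD (addrC a%:P) addrA.
by rewrite -(comp_polyA p ('X + a%:P) ('X + 1)) e.
Qed.

Lemma comp_polyXaddn (p : {poly C}) n : iter n (fun p => p \Po ('X + 1)) p = p \Po ('X + n%:R%:P).
Proof.
elim: n => [|n IH]; first by rewrite addr0 comp_polyXr.
by rewrite iterS IH comp_shiftS natr1.
Qed.

Lemma comp_shift_const (p : {poly C}) n : (0 < n)%N ->
  p \Po ('X + n%:R%:P) = p -> p = (p.[0])%:P.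
Proof.
move=> n0 e; apply/eqP; rewrite -subr_eq0; apply/negPn/negP => h.
have e2 j : p.[(n * j)%:R] = p.[0].
  elim: j => [|j IH]; first by rewrite muln0.
  have := congr1 (fun q => q.[(n * j)%:R]) e.
  by rewrite horner_comp !hornerE -natrD -mulnSr IH.
pose s := [seq (n * j)%:R : C | j <- iota 0 (size (p - (p.[0])%:P))].
have us : uniq s.
  rewrite map_inj_in_uniq ?iota_uniq // => i j _ _ /eqP.
  by rewrite eqr_nat eqn_pmul2l // => /eqP.
have rs : all (root (p - (p.[0])%:P)) s.
  by apply/allP => _ /mapP [j _ ->]; rewrite rootE !hornerE e2 subrr.
by have := max_poly_roots h rs us; rewrite size_map size_iota ltnn.
Qed.

Lemma comp_X1_eq0 (p : {poly C}) : p \Po ('X + 1) = 0 -> p = 0.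
Proof.
move=> e; apply/eqP; rewrite -(@comp_poly_eq0 _ p ('X + 1)) ?e //.
by rewrite -(opprK 1) -polyCN size_XsubC.
Qed.

Lemma shf_iter (F : modf) mu n m : (forall m, shf F m = mu *: F m) ->
  F (m + n%:Z) \Po ('X + n%:R%:P) = mu ^+ n *: F m.
Proof.
move=> e; rewrite -comp_polyXaddn; elim: n m => [|n IH] m.
  by rewrite addr0 expr0 scale1r.
rewrite iterSr -addn1 PoszD addrA -/(shf F (m + n)) e.
have lin q : iter n (fun p : {poly C} => p \Po ('X + 1)) (mu *: q) =
   mu *: iter n (fun p => p \Po ('X + 1)) q.
  by elim: n {IH} => [//|n IHn]; rewrite !iterS IHn linearZ.
by rewrite lin IH scalerA addn1 exprS.
Qed.

(** After Q steps the equation says that each polynomial is invariant under X -> X + Q, hence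
    constant. *)
Lemma hom_const F mu : mperiodic F -> (forall m, shf F m = mu *: F m) -> mu ^+ Q = 1 ->
  forall m, F m = ((F m).[0])%:P.
Proof.
move=> pF e muQ m; apply: (@comp_shift_const _ Q) => //.
by have := shf_iter Q m e; rewrite pF muQ scale1r.
Qed.

(** After Q steps F m composed with X + Q equals mu^Q times F m; comparing leading coefficients
    forces mu^Q = 1 unless F m = 0. *)
Lemma hom_periodic F mu : mperiodic F -> (forall m, shf F m = mu *: F m) ->
  mu ^+ Q != 1 -> forall m, F m = 0.
Proof.
move=> pF e muQ m; have := shf_iter Q m e; rewrite pF => h.
apply/eqP; apply/negPn/negP => Fm; have := congr1 (fun q : {poly C} => lead_coef q) h.
rewrite lead_coefZ lead_coef_comp ?size_XaddC //.
rewrite lead_coefXaddC expr1n mulr1 => /eqP; rewrite -subr_eq0 -[X in X - _]mul1r -mulrBl.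
rewrite mulf_eq0 lead_coef_eq0 (negbTE Fm) orbF subr_eq0 eq_sym.
by rewrite (negbTE muQ).
Qed.

(** The coefficients are constant by [hom_const], vanish at m = 0, and zero propagates forward
    because composition with X + 1 is injective; negative indices are reached by periodicity. *)
Lemma solve_unique F kap : mperiodic F -> (forall m, shf F m = chr kap 1 *: F m) ->
  (F 0).[0] = 0 -> forall m, F m = 0.
Proof.
move=> pF e F0 m.
have cF := hom_const pF e (_ : chr kap 1 ^+ Q = 1); move: cF.
rewrite -chr_nat chrQ => /(_ erefl) cF.
have nat0 (n : nat) : F n = 0.
  elim: n => [|n IH]; first by rewrite cF F0.
  by apply: comp_X1_eq0; have := e n; rewrite IH scaler0 /shf -PoszD addn1.
have per (n : int) (j : nat) : F (n + (j * Q)%N) = F n.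
  elim: j => [|j IH]; first by rewrite mul0n addr0.
  by rewrite mulSnr PoszD addrA pF.
case: m => n //; rewrite NegzE -(per _ n.+1).
have -> : - n.+1%:Z + (n.+1 * Q)%N = (n.+1 * Q - n.+1)%N.
  have := leq_pmulr n.+1 Q0; move: (n.+1 * Q)%N => P; lia.
exact: nat0.
Qed.

Lemma proj_sub F G kap m : lproj kap (fun m => F m - G m) m = lproj kap F m - lproj kap G m.
Proof.
rewrite /lproj -scalerBr -meanB; congr (_ *: _); apply: mean_ext => m'.
by rewrite scalerBr.
Qed.

Lemma proj_scale F a kap m : lproj kap (fun m => a *: F m) m = a *: lproj kap F m.
Proof.
rewrite /lproj [RHS]scalerA [a * _]mulrC -[RHS]scalerA; congr (_ *: _).
by rewrite -meanZ; apply: mean_ext => m'; rewrite !scalerA mulrC.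
Qed.

Lemma proj_shf F kap m : mperiodic F -> lproj kap (shf F) m = shf (lproj kap F) m.
Proof.
move=> pF; have pG : mperiodic (fun m => chr (- kap) m *: F m).
  by move=> m'; rewrite chr_mod pF.
rewrite /shf /lproj comp_polyZ chr_add -mean_shf // -scalerA; congr (_ *: _).
rewrite -meanZ; apply: mean_ext => m'; rewrite /shf comp_polyZ scalerA.
by rewrite chr_add mulrCA -chrD subrr chr0 mulr1.
Qed.

(* Uniqueness for nonresonant labels: the average against mu^-m isolates the
   constant mu^m, which no listed character matches. *)
Lemma solve_unique_nonres F T mu : (forall m, F m = \sum_(t <- T) tfun th t m) ->
  (forall t, t \in T -> chr t.2 1 != mu) -> (forall m, shf F m = mu *: F m) ->
  mu != 0 -> forall m, F m = 0.
Proof.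
move=> eF hT e mu0.
have pF : mperiodic F by apply: (@rep_periodic 1 1 0 (\max_(t <- T) tdeg t) _ F); 
  exists T; split; [apply/allP => t tT; exact: leq_bigmax_seq | exact: lexx | exact: eF].
have [muQ|muQ] := eqVneq (mu ^+ Q) 1; last exact: hom_periodic muQ.
have cF := hom_const pF e muQ.
have it (n : nat) : F n = mu ^+ n *: F 0.
  have := shf_iter n 0 e; rewrite add0r => <-.
  by rewrite cF comp_polyC.
have F00 : F 0 = 0.
  have : mean (fun m : int => mu^-1 ^ m *: F m) = F 0.
    rewrite /mean (eq_bigr (fun=> F 0)) => [|i _].
      by rewrite sumr_const card_ord -(scaler_nat Q (F 0)) scalerA mulVf ?scale1r.
    by rewrite it scalerA -exprnP -exprMn mulVf // expr1n scale1r.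
  move=> <-.
  transitivity (\sum_(t <- T) mean (fun m : int => mu^-1 ^ m *: tfun th t m)).
    rewrite -mean_sum; apply: mean_ext => m; by rewrite eF scaler_sumr.
  rewrite big_seq big1 // => t tT.
  rewrite /mean (eq_bigr (fun i : 'I_Q => (chr t.2 1 / mu) ^+ i *: (t.1.1 *: 'X^(t.1.2)))).
    rewrite -scaler_suml sum_pow_root ?scale0r ?scaler0 //.
      by rewrite expr_div_n muQ divr1 -(chr_nat _ Q).
    by apply: contraNneq (hT _ tT) => /(congr1 ( *%R^~ mu)); rewrite mul1r divfK // => ->.
  move=> i _; rewrite /tfun !scalerA; congr (_ *: _).
  by rewrite (chr_nat _ i) expr_div_n -exprnP exprVn; ring.
have nat0 (n : nat) : F n = 0 by rewrite it F00 scaler0.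
have per (n : int) (j : nat) : F (n + (j * Q)%N) = F n.
  elim: j => [|j IH]; first by rewrite mul0n addr0.
  by rewrite mulSnr PoszD addrA pF.
case=> n //; rewrite NegzE -(per _ n.+1).
have -> : - n.+1%:Z + (n.+1 * Q)%N = (n.+1 * Q - n.+1)%N.
  have := leq_pmulr n.+1 Q0; move: (n.+1 * Q)%N => P; lia.
exact: nat0.
Qed.

(** Here mu is a true multiplier, only close to the character of kap. Outside the class of kap the
    source reduces to the mean of R1, divided by 1 - mu of size at least gam, and to the rest of R2,
    divided by at least 1 / tau: the large mean thus does not pay the factor tau. F agrees there
    with the solution so built because no character outside the class equals mu. *)
Lemma solve_rest d A1 (tau sig gam : R) w kap mu F d0 B0 (R1 R2 : modf) B1 B2 :
  0 <= A1 -> nonres_bound d A1 -> 1 <= tau -> 1 <= sig -> 0 < gam -> 1 <= tau * gam -> mu != 0 ->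
  gam <= cabs (1 - mu) -> chr kap 1 != 1 ->
  (forall k, (lnorm k <= maxn d d0)%N ->
     chr k 1 = chr kap 1 \/ 1 <= tau * cabs (chr k 1 - mu)) ->
  rep th tau sig w d0 B0 F ->
  (forall m, shf F m - mu *: F m = R1 m + R2 m) ->
  rep th tau sig w d B1 (fun=> mean R1) -> 
  rep th tau sig w d B2 R2 ->
  (forall m, lproj kap R1 m = R1 m - mean R1) ->
  rep th tau sig w d (A1 * (B1 / gam + tau * B2)) (fun m => F m - lproj kap F m).
Proof.
move=> A10 h1 t1 s1 g0 tg mu0 gmu kap1 gap.
move=> rF eF r1 r2 pR1.
have tp : 0 < tau by exact: lt_le_trans ltr01 t1.
pose rst (G : modf) m := G m - lproj kap G m.
have sol (gm : R) (T : seq mterm) : 0 < gm -> 1 <= tau * gm ->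
   all (fun t => tdeg t <= d)%N T ->
   (forall t, t \in T -> gm <= cabs (chr t.2 1 - mu)) ->
   exists2 G, rep th tau sig w d (A1 / gm * \sum_(t <- T) twt tau sig w t) G
     & forall m, shf G m - mu *: G m = \sum_(t <- T) tfun th t m.
  move=> gm0 tgm dT gT; rewrite mulr_sumr.
  apply: (@big_rep_solve (fun t => (tdeg t <= d)%N /\ gm <= cabs (chr t.2 1 - mu))).
    move=> [[c l] k] [/= hd hg]; rewrite /tdeg /= in hd.
    have ld : (l <= d)%N by apply: leq_trans hd; exact: leq_addr.
    have [G rG eG] := h1 th tau sig gm w d k mu l t1 s1 ld hd tgm gm0 hg.
    exists (fun m => c *: G m) => [|m].
      apply: (rep_le (leqnn _)) (repZ c rG); rewrite /twt /= le_eqVlt; apply/orP; left.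
      by apply/eqP; ring.
    by rewrite shfZ scalerA mulrC -scalerA -scalerBr eG /tfun /= scalerA.
  by move=> t tT; split; [exact: (allP dT) | exact: gT].
have [T1 [dT1 bT1 eT1]] := r1; have [T2 [dT2 bT2 eT2]] := r2.
pose S1 := [seq t <- T1 | chr t.2 1 == chr 0 1].
pose S2 := [seq t <- T2 | chr t.2 1 != chr kap 1].
have [|t|G1 rG1 eG1] := sol gam S1 g0 tg.
- by apply/allP => t; rewrite mem_filter => /andP [_ /(allP dT1)].
- by rewrite mem_filter => /andP [/eqP ->] _; rewrite chr0.
have ti0 : 0 < tau^-1 by rewrite invr_gt0.
have [||t|G2 rG2 eG2] := sol tau^-1 S2 ti0.
- by rewrite mulfV // gt_eqF.
- by apply/allP => t; rewrite mem_filter => /andP [_ /(allP dT2)].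
- rewrite mem_filter => /andP [tk] /(allP dT2) td.
  have ld : (lnorm t.2 <= maxn d d0)%N.
    by apply: leq_trans (leq_maxl _ _); apply: leq_trans td; exact: leq_addl.
  case: (gap _ ld) => [e|h]; first by rewrite e eqxx in tk.
  by rewrite -[leLHS]mul1r ler_pdivrMr // mulrC.
pose G m := G1 m + G2 m.
have rG : rep th tau sig w d (A1 * (B1 / gam + tau * B2)) G.
  apply: (rep_le (leqnn _)) (repD rG1 rG2).
  rewrite mulrDr; apply: lerD; rewrite -!mulrA; apply: ler_wpM2l => //.
    rewrite [leRHS]mulrC; apply: ler_wpM2l; first by rewrite invr_ge0 ltW.
    by apply: le_trans bT1; exact: sum_filter_le.
  rewrite invrK; apply: ler_wpM2l; first exact: ltW.
  by apply: le_trans bT2; exact: sum_filter_le.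
have rGr := rep_le (leqnn d) (lexx _) rG.
have R1e m : mean R1 = \sum_(t <- S1) tfun th t m.
  by rewrite -(proj_list 0 eT1) proj0_mean mean_cst.
(* Taking the part outside the class commutes with the shift, so the difference of the two parts
   solves the homogeneous equation. *)
have eqH m : shf (fun m => F m - lproj kap F m - (G m - lproj kap G m)) m =
   mu *: (F m - lproj kap F m - (G m - lproj kap G m)).
  have pF := rep_periodic rF; have pG := rep_periodic rG.
  have eG m' : shf G m' - mu *: G m' = mean R1 + (R2 m' - lproj kap R2 m').
    by rewrite (R1e m') (rest_list kap eT2) /G shfD scalerDr -eG1 -eG2; ring.
  have lin (K : modf) : mperiodic K -> shf (fun m => K m - lproj kap K m) m
      - mu *: (K m - lproj kap K m) =
    (shf K m - mu *: K m) - lproj kap (fun m => shf K m - mu *: K m) m.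
    by move=> pK; rewrite shfB proj_sub proj_scale proj_shf // scalerBr; ring.
  apply/eqP; rewrite -subr_eq0 shfB scalerBr; apply/eqP.
  have aux (V : comNzRingType) (a b c e : V) : a - b = c - e -> a - c - (b - e) = 0.
    by move=> h; have -> : a = c - e + b; [rewrite -h; ring | ring].
  apply: aux; apply/eqP; rewrite -subr_eq0; apply/eqP.
  rewrite (lin F) // (lin G) // eF eG.
  rewrite (proj_ext kap eF) (proj_ext kap eG).
  have pjD (K L : modf) : lproj kap (fun m => K m + L m) m = lproj kap K m + lproj kap L m.
    by rewrite /lproj -scalerDr -meanD; congr (_ *: _); apply: mean_ext => m'; rewrite scalerDr.
  rewrite (pjD R1 R2) (pjD (fun=> mean R1)) proj_sub pR1.
  have kap0 : lproj kap (fun=> mean R1) m = 0.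
    rewrite (proj_list kap R1e) big_seq big1 // => t; rewrite !mem_filter.
    move=> /and3P [/eqP e1 /eqP e2 _]; case/eqP: kap1.
    by rewrite -e1 e2 chr0.
  have idem : lproj kap (lproj kap R2) m = lproj kap R2 m.
    rewrite (proj_list kap (proj_list kap eT2)) (proj_list kap eT2).
    by rewrite -filter_predI; apply: congr_big => //; apply: eq_filter => t /=; rewrite andbb.
  by rewrite kap0 idem; ring.
have [TF [dTF _ eTF]] := rF; have [TG [dTG bTG eTG]] := rG.
have eH m : F m - lproj kap F m - (G m - lproj kap G m) =
  \sum_(t <- [seq t <- TF | chr t.2 1 != chr kap 1] ++
     [seq (- t.1.1, t.1.2, t.2) | t <- TG & chr t.2 1 != chr kap 1]) tfun th t m.
  rewrite big_cat big_map /= (rest_list kap eTF) (rest_list kap eTG) -sumrN.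
  by congr (_ + _); apply: eq_bigr => t _; rewrite /tfun /= mulNr scaleNr.
have H0 : forall m, F m - lproj kap F m - (G m - lproj kap G m) = 0.
  apply: (solve_unique_nonres eH) eqH mu0 => t.
  have nz k : (lnorm k <= maxn d d0)%N -> chr k 1 != chr kap 1 -> chr k 1 != mu.
    move=> kd kk; case: (gap k kd) => [e|h]; first by rewrite e eqxx in kk.
    apply: contraTneq h => ->; rewrite subrr cabs0 mulr0 -ltNge; exact: ltr01.
  rewrite mem_cat => /orP [|/mapP [u]]; rewrite mem_filter => /andP [tk].
    move=> /(allP dTF) td; apply: nz tk; apply: leq_trans (leq_maxr _ _).
    by apply: leq_trans td; exact: leq_addl.
  move=> /(allP dTG) td -> /=; apply: nz tk; apply: leq_trans (leq_maxl _ _).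
  by apply: leq_trans td; exact: leq_addl.
apply: (@rep_ext _ _ _ _ _ _ (fun m => G m - lproj kap G m)).
  by move=> m; apply/eqP; rewrite -subr_eq0 -oppr_eq0 opprB H0.
exists [seq t <- TG | chr t.2 1 != chr kap 1]; split.
- by apply/allP => t; rewrite mem_filter => /andP [_ /(allP dTG)].
- by apply: le_trans bTG; exact: sum_filter_le.
- exact: rest_list.
Qed.

End Averages.
End Modulated.

(** * Jets of the potential *)

Section Jets.
Local Open Scope classical_set_scope.
Local Open Scope ring_scope.
Variables (R : realType) (ell n : nat).
Local Notation C := R[i].

(** The j-linear form with coefficient array A on the diagonal (z, ..., z). Arrays indexed by
    sequences allow a slot to be fixed by a cons, which gives gradients and makes recursion on j
    possible. *)
Fixpoint jet (j : nat) (A : seq 'I_n -> R) (z : 'I_n -> {poly C}) : {poly C} :=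
  if j is j'.+1 then \sum_i z i * jet j' (fun J => A (i :: J)) z
  else (A [::])%:C%C%:P.

Arguments jet : simpl never.
Lemma jetS j A z : jet j.+1 A z = \sum_i z i * jet j (fun J => A (i :: J)) z.
Proof. by []. Qed.
Lemma jetE0 A z : jet 0 A z = (A [::])%:C%C%:P.
Proof. by []. Qed.

Definition jsym (A : seq 'I_n -> R) := forall J J', perm_eq J J' -> A J = A J'.
Definition jdir (b : 'I_n -> R) (A : seq 'I_n -> R) (J : seq 'I_n) : R :=
  \sum_c b c * A (c :: J).

Lemma jet_ext j A B z : (forall J, size J = j -> A J = B J) -> jet j A z = jet j B z.
Proof.
elim: j A B => [|j IH] A B e; first by rewrite !jetE0 e.
by apply: eq_bigr => i _; congr (_ * _); apply: IH => J sJ; apply: e; rewrite /= sJ.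
Qed.

Lemma jetD j A B z : jet j (fun J => A J + B J) z = jet j A z + jet j B z.
Proof.
elim: j A B => [|j IH] A B; first by rewrite !jetE0 rmorphD polyCD.
by rewrite !jetS -big_split; apply: eq_bigr => i _; rewrite IH mulrDr.
Qed.

Lemma jetZ j a A z : jet j (fun J => a * A J) z = a%:C%C *: jet j A z.
Proof.
elim: j A => [|j IH] A; first by rewrite !jetE0 rmorphM polyCM mul_polyC.
by rewrite !jetS scaler_sumr; apply: eq_bigr => i _; rewrite IH scalerAr.
Qed.

Lemma jet0 j z : jet j (fun=> 0) z = 0.
Proof.
elim: j => [|j IH]; first by rewrite jetE0 rmorph0.
by rewrite jetS big1 // => i _; rewrite IH mulr0.
Qed.

Lemma jet_sum (I : Type) (s : seq I) (P : pred I) (A : I -> seq 'I_n -> R) j z :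
  jet j (fun J => \sum_(i <- s | P i) A i J) z = \sum_(i <- s | P i) jet j (A i) z.
Proof.
elim: s => [|i s IH].
  by rewrite big_nil -(jet0 j z); apply: jet_ext => J _; rewrite big_nil.
rewrite big_cons -IH; case: ifP => Pi.
  by rewrite -jetD; apply: jet_ext => J _; rewrite big_cons Pi.
by apply: jet_ext => J _; rewrite big_cons Pi.
Qed.

Lemma jsym_cons A i : jsym A -> jsym (fun J => A (i :: J)).
Proof. by move=> s J J' p; apply: s; rewrite perm_cons. Qed.

Lemma jsym_dir b A : jsym A -> jsym (jdir b A).
Proof.
move=> s J J' p; apply: eq_bigr => c _; congr (_ * _).
by apply: s; rewrite perm_cons.
Qed.

Lemma jsym_swap A i k J : jsym A -> A (i :: k :: J) = A (k :: i :: J).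
Proof.
by move=> s; apply: s; rewrite (perm_catCA [:: i] [:: k] J).
Qed.

(** Variation of [jet] in a free direction w: it serves both for the derivative in X and for the
    rotation of the phases. *)
Fixpoint djet j A (z w : 'I_n -> {poly C}) : {poly C} :=
  if j is j'.+1 then \sum_i (w i * jet j' (fun J => A (i :: J)) z +
    z i * djet j' (fun J => A (i :: J)) z w) else 0.

Lemma djetE j A z w : jsym A ->
  djet j.+1 A z w = j.+1%:R *: \sum_c w c * jet j (fun J => A (c :: J)) z.
Proof.
elim: j A => [|j IH] A sA.
  by rewrite scale1r; apply: eq_bigr => i _; rewrite /= mulr0 addr0.
rewrite [LHS]/= big_split /= -/(djet j.+1) -(natr1 j.+1) scalerDl scale1r addrC; congr (_ + _).
transitivity (\sum_i j.+1%:R *: \sum_c z i * (w c * jet j (fun J => A (i :: c :: J)) z)).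
  apply: eq_bigr => i _; rewrite -mulr_sumr scalerAr; congr (_ * _).
  exact: IH (jsym_cons i sA).
rewrite -scaler_sumr; congr (_ *: _); rewrite exchange_big; apply: eq_bigr => c _ /=.
rewrite mulr_sumr; apply: eq_bigr => i _; rewrite mulrCA; congr (_ * (_ * _)).
by apply: jet_ext => J _; exact: jsym_swap.
Qed.

Lemma deriv_jet j A z : (jet j A z)^`() = djet j A z (fun c => (z c)^`()).
Proof.
elim: j A => [|j IH] A; first by rewrite jetE0 derivC.
by rewrite jetS raddf_sum /=; apply: eq_bigr => i _; rewrite derivM IH.
Qed.

Lemma jdir_iter_cons b i A c J : jsym A ->
  iter i (jdir b) (fun J => A (c :: J)) J = iter i (jdir b) A (c :: J).
Proof.
move=> sA; elim: i J => [//|i IH] J; rewrite !iterS; apply: eq_bigr => k _.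
rewrite IH; congr (_ * _); apply: jsym_swap.
by elim: i {IH} => [//|i IHi]; rewrite iterS; exact: jsym_dir.
Qed.

(** Binomial formula for a symmetric form: i of the m slots receive the constant vector b, which
    contracts the array i times by [jdir]. *)
Lemma jet_shift m A z (b : 'I_n -> R) : jsym A ->
  jet m A (fun i => z i + (b i)%:C%C%:P) =
  \sum_(i < m.+1) 'C(m, i)%:R *: jet (m - i) (iter i (jdir b) A) z.
Proof.
elim: m A => [|m IH] A sA; first by rewrite big_ord1 /= scale1r !jetE0.
rewrite jetS.
transitivity (\sum_(i < m.+1) ('C(m, i)%:R *: jet (m - i).+1 (iter i (jdir b) A) z
   + 'C(m, i)%:R *: jet (m - i) (iter i.+1 (jdir b) A) z)).
  under eq_bigr => c _ do rewrite (IH _ (jsym_cons c sA)) mulrDl.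
  rewrite big_split big_split /=; congr (_ + _).
    under eq_bigr => c _ do rewrite mulr_sumr.
    rewrite exchange_big; apply: eq_bigr => i _ /=.
    rewrite jetS scaler_sumr; apply: eq_bigr => c _.
    rewrite -scalerAr; congr (_ *: (_ * _)); apply: jet_ext => J _.
    exact: jdir_iter_cons.
  under eq_bigr => c _ do rewrite mulr_sumr.
  rewrite exchange_big; apply: eq_bigr => i _ /=.
  transitivity (\sum_c 'C(m, i)%:R *: jet (m - i)
      (fun J => b c * iter i (jdir b) A (c :: J)) z).
    apply: eq_bigr => c _; rewrite -scalerAr mul_polyC -jetZ; congr (_ *: _).
    by apply: jet_ext => J _; rewrite jdir_iter_cons.
  by rewrite -scaler_sumr -jet_sum.
rewrite big_split /=.
rewrite [in RHS]big_ord_recl /= bin0 subn0.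
rewrite [X in X + _ = _]big_ord_recl /= bin0 subn0 -addrA; congr (_ + _).
rewrite [X in _ + X = _]big_ord_recr /= binn subnn.
rewrite [in RHS]big_ord_recr /= /bump /= add1n binn subnn addrA; congr (_ + _).
rewrite -big_split /=; apply: eq_bigr => i _.
rewrite /bump /= add1n subSS subnSK // -scalerDl binS natrD addrC; congr (_ *: _).
Qed.

Lemma rep_jet th tau sig j A (z : 'I_n -> modf R) d B M : 1 <= sig ->
  (forall i, rep (ell := ell) th tau sig 0 d B (z i)) -> 1 <= tau ->
  (forall J, size J = j -> `|A J| <= M) ->
  rep th tau sig 0 (j * d) ((n%:R * B) ^+ j * M) (fun m => jet j A (z^~ m)).
Proof.
move=> s1 rz t0; elim: j A => [|j IH] A hA.
  have hd : (0 + lnorm (0%R : lab ell) <= 0 * d)%N by rewrite lnorm0.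
  apply: (rep_ext _ (rep_le (leqnn _) _ (rep_term th tau sig 0 (A [::])%:C%C hd))) => [m|].
    by rewrite jetE0 chr0 mulr1 expr0 alg_polyC.
  by rewrite !expr0 lnorm0 maxn0 expr0 !mulr1 mul1r cabs_real; exact: hA.
rewrite mulSn; apply: (rep_le (leqnn _) (lexx _)).
have := @rep_sum R ell th tau sig 0 (d + j * d) _ (index_enum 'I_n) predT
  (fun=> B * ((n%:R * B) ^+ j * M)) (fun i m => z i m * jet j (fun J => A (i :: J)) (z^~ m)).
rewrite sumr_const card_ord => H.
apply: (rep_ext _ (rep_le (leqnn _) _ (H _))) => [m||i _] //.
  by rewrite -[leLHS]mulr_natl le_eqVlt exprS -!mulrA eqxx.
apply: repM => //; apply: IH => J sJ; apply: hA; by rewrite /= sJ.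
Qed.

Lemma rep_jetB th tau sig j A (z z' : 'I_n -> modf R) d B M D : 1 <= tau -> 1 <= sig ->
  (forall i, rep (ell := ell) th tau sig 0 d B (z i)) ->
  (forall i, rep (ell := ell) th tau sig 0 d B (z' i)) ->
  (forall i, rep (ell := ell) th tau sig 0 d D (fun m => z i m - z' i m)) ->
  (forall J, size J = j -> `|A J| <= M) -> 0 <= M -> 0 <= D ->
  rep th tau sig 0 (j * d) (j%:R * (n%:R ^+ j * B ^+ j.-1 * M) * D)
    (fun m => jet j A (z^~ m) - jet j A (z'^~ m)).
Proof.
move=> t1 s1 rz rz' rd + M0 D0; have t0 : 0 <= tau by exact: le_trans ler01 t1.
elim: j A => [|j IH] A hA.
  rewrite !mul0r; apply: rep_ext (rep0 _ _ _ _ _ (lexx 0)) => m.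
  by rewrite !jetE0 subrr.
rewrite mulSn; have := @rep_sum R ell th tau sig 0 (d + j * d) _ (index_enum 'I_n) predT
  (fun=> D * ((n%:R * B) ^+ j * M) + B * (j%:R * (n%:R ^+ j * B ^+ j.-1 * M) * D))
  (fun i m => (z i m - z' i m) * jet j (fun J => A (i :: J)) (z^~ m) +
     z' i m * (jet j (fun J => A (i :: J)) (z^~ m) - jet j (fun J => A (i :: J)) (z'^~ m))).
rewrite sumr_const card_ord => H.
apply: (rep_ext _ (rep_le (leqnn _) _ (H _))) => [m||i _].
- rewrite !jetS -sumrB; apply: eq_bigr => i _; ring.
- rewrite le_eqVlt; apply/orP; left; apply/eqP; rewrite /= -[LHS]mulr_natl -natr1 exprMn exprS.
  by case: j {IH hA H} => [|j]; rewrite /= ?expr0 ?exprS; ring.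
- have hA' J : size J = j -> `|A (i :: J)| <= M by move=> sJ; apply: hA; rewrite /= sJ.
  apply: repD; apply: repM => //; last exact: IH.
  exact: rep_jet.
Qed.
End Jets.

(** * Symmetry of iterated derivatives and Taylor expansion along a segment *)

Section Calculus.
Local Open Scope classical_set_scope.
Local Open Scope ring_scope.
Variables (R : realType) (n : nat).
Local Notation V := 'rV[R]_n.
Implicit Types (f U : V -> R) (x v w : V).

Lemma iter_derive_cat U vs ws : iter_derive U (vs ++ ws) = iter_derive (iter_derive U ws) vs.
Proof. by rewrite /iter_derive foldr_cat. Qed.

Lemma smooth_iter U ws : smooth U -> smooth (iter_derive U ws).
Proof. by move=> sU vs x; rewrite -iter_derive_cat; exact: sU. Qed.

Lemma line_quotient f x v s :
  (fun h : R => h^-1 *: (((fun t : R => f (x + t *: v)) \o shift s) (h *: 1) - f (x + s *: v))) =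
  (fun h : R => h^-1 *: ((f \o shift (x + s *: v)) (h *: v) - f (x + s *: v))).
Proof.
apply/funext => h /=; congr (_ *: (f _ - _)).
by rewrite /shift /= scalerDl [h *: 1]mulr1 addrCA.
Qed.

Lemma translate_quotient f c y u :
  (fun h : R => h^-1 *: (((fun y => f (y + c)) \o shift y) (h *: u) - f (y + c))) =
  (fun h : R => h^-1 *: ((f \o shift (y + c)) (h *: u) - f (y + c))).
Proof. by apply/funext => h /=; rewrite /shift /= addrA. Qed.

Lemma is_derive_line f x v s : differentiable f (x + s *: v) ->
  is_derive s 1 (fun t : R => f (x + t *: v)) ('D_v f (x + s *: v)).
Proof.
move=> df; have dv : derivable f (x + s *: v) v by exact: diff_derivable.
split.
  by rewrite /derivable line_quotient.
by rewrite /derive line_quotient.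
Qed.

Lemma line_continuous f x v : (forall y, differentiable f y) ->
  continuous (fun t : R => f (x + t *: v)).
Proof.
move=> df s; apply/differentiable_continuous/derivable1_diffP.
by have [] := is_derive_line (df (x + s *: v)).
Qed.

Lemma mvt_line f x v t : (forall y, differentiable f y) -> 0 <= t ->
  exists2 c, 0 <= c <= t & f (x + t *: v) - f x = 'D_v f (x + c *: v) * t.
Proof.
move=> df t0; have [||c ct e] := @MVT_segment R (fun t => f (x + t *: v))
  (fun s => 'D_v f (x + s *: v)) 0 t t0.
- by move=> s _; exact: is_derive_line.
- by apply: continuous_subspaceT; exact: line_continuous.
exists c; first by move: ct; rewrite in_itv.
by move: e; rewrite scale0r addr0 subr0.
Qed.

(** The second difference over a small parallelogram, computed by the mean value theorem in either
    order, is t^2 times each mixed derivative at some nearby point. Continuity of both at x gives an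
    inequality up to e, and exchanging the directions gives the other one. *)
Lemma schwarz f v w x : smooth f -> 'D_v ('D_w f) x = 'D_w ('D_v f) x.
Proof.
move=> sf.
have d0 y : differentiable f y by exact: (sf [::]).
have dv y : differentiable ('D_v f) y by exact: (sf [:: v]).
have dw y : differentiable ('D_w f) y by exact: (sf [:: w]).
have cvw : {for x, continuous ('D_v ('D_w f))}.
  exact/differentiable_continuous/(sf [:: v; w]).
have cwv : {for x, continuous ('D_w ('D_v f))}.
  exact/differentiable_continuous/(sf [:: w; v]).
have dT (c : V) y : differentiable (fun y => f (y + c)) y.
  apply: (@differentiable_comp _ _ _ _ (fun y : V => y + c) f) => //.
have dB a (b : R) y : differentiable (fun y => f (y + b *: a) - f y) y.
  by apply: (@differentiableB _ _ _ (fun y => f (y + b *: a)) f).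
have DB a (b : R) u y : 'D_u (fun y => f (y + b *: a) - f y) y = 'D_u f (y + b *: a) - 'D_u f y.
  rewrite (@deriveB _ _ _ (fun y => f (y + b *: a)) f); last exact: diff_derivable.
    by rewrite /derive translate_quotient.
  exact: diff_derivable.
apply/eqP; rewrite eq_le; apply/andP.
suff key a b : {for x, continuous ('D_a ('D_b f))} -> {for x, continuous ('D_b ('D_a f))} ->
   (forall y, differentiable ('D_a f) y) -> (forall y, differentiable ('D_b f) y) ->
  'D_a ('D_b f) x <= 'D_b ('D_a f) x by split; exact: key.
move=> {dv dw cvw cwv} ca cb da db; apply/ler_addgt0Pr => e e0.
have e2 : 0 < e / 2 by exact: divr_gt0.
have /cvgrPdist_le /(_ _ e2) /nbhs_normP [r1 /= r10 h1] := ca.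
have /cvgrPdist_le /(_ _ e2) /nbhs_normP [r2 /= r20 h2] := cb.
pose r := Num.min r1 r2.
have r0 : 0 < r by rewrite lt_min r10 r20.
pose m := `|a| + `|b| + 1.
have m0 : 0 < m by rewrite ltr_wpDl // addr_ge0.
pose t := r / (2 * m).
have t0 : 0 < t by rewrite divr_gt0 // mulr_gt0.
have near c c' : 0 <= c <= t -> 0 <= c' <= t -> `|x - (x + c *: a + c' *: b)| < r.
  move=> /andP [c0 ct] /andP [c0' ct'].
  rewrite -addrA opprD addrA subrr add0r normrN.
  apply: le_lt_trans (ler_normD _ _) _; rewrite !normrZ !ger0_norm //.
  apply: (@le_lt_trans _ _ (t * (`|a| + `|b|))).
    by rewrite mulrDr; apply: lerD; apply: ler_wpM2r.
  rewrite /t mulrAC ltr_pdivrMr ?mulr_gt0 // ltr_pM2l //.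
  by rewrite /m; have := normr_ge0 a; have := normr_ge0 b; lra.
have [c1 hc1 e1] := mvt_line x a (dB b t) (ltW t0).
have [c2 hc2 e2'] := mvt_line (x + c1 *: a) b da (ltW t0).
have [c3 hc3 e3] := mvt_line x b (dB a t) (ltW t0).
have [c4 hc4 e4] := mvt_line (x + c3 *: b) a db (ltW t0).
have E : 'D_b ('D_a f) (x + c1 *: a + c2 *: b) = 'D_a ('D_b f) (x + c3 *: b + c4 *: a).
  rewrite DB e2' in e1; rewrite DB e4 in e3.
  have t00 : t != 0 by rewrite gt_eqF.
  move: e1 e3; rewrite (addrAC x (t *: a)).
  move: (f (x + t *: b + t *: a)) (f (x + t *: a)) (f (x + t *: b)) (f x).
  move: ('D_b ('D_a f) _) ('D_a ('D_b f) _) => D1 D2 f1 f2 f3 f4 h1' h3'.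
  apply: (mulIf t00); apply: (mulIf t00); rewrite -h1' -h3'; ring.
have n1 : `|'D_a ('D_b f) x - 'D_a ('D_b f) (x + c3 *: b + c4 *: a)| <= e / 2.
  apply: h1; rewrite /ball_ /= addrAC; apply: lt_le_trans (near _ _ hc4 hc3) _.
  by rewrite ge_min lexx.
have n2 : `|'D_b ('D_a f) x - 'D_b ('D_a f) (x + c1 *: a + c2 *: b)| <= e / 2.
  apply: h2; apply: lt_le_trans (near _ _ hc1 hc2) _.
  by rewrite ge_min lexx orbT.
move: n1 n2; rewrite E.
move: ('D_a ('D_b f) x) ('D_b ('D_a f) x) ('D_a ('D_b f) _) => p q u.
by rewrite !ler_norml => /andP [_ h] /andP [h' _]; move: h h'; clear; move=> h h'; lra.
Qed.

Lemma iter_derive_perm U vs ws x : smooth U -> perm_eq vs ws ->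
  iter_derive U vs x = iter_derive U ws x.
Proof.
move=> sU; suff: perm_eq vs ws -> iter_derive U vs = iter_derive U ws by move=> h /h ->.
elim: vs ws => [|v vs IH] ws; first by rewrite perm_sym => /perm_nilP ->.
move=> p; have : v \in ws by rewrite -(perm_mem p) mem_head.
move=> vin; case/path.splitPr: vin p => w1 w2 p.
have p' : perm_eq vs (w1 ++ w2).
  by rewrite -(perm_cons v); apply: perm_trans p _; rewrite perm_catC /= perm_cons perm_catC.
rewrite [LHS]/= (IH _ p'); elim: w1 {p IH p'} => [//|u w1 IH1] /=.
rewrite -IH1; apply/funext => y; apply: (schwarz (f := iter_derive U (w1 ++ w2))).
exact: smooth_iter.
Qed.

Definition darr U x (J : seq 'I_n) : R := iter_derive U [seq delta_mx 0 i | i <- J] x.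

Lemma darr_sym U x : smooth U -> jsym (darr U x).
Proof. by move=> sU J J' p; apply: iter_derive_perm => //; exact: perm_map. Qed.

Lemma derive_sum_coord f (b : V) x : differentiable f x ->
  'D_b f x = \sum_c b 0 c * 'D_(delta_mx 0 c) f x.
Proof.
move=> df; rewrite deriveE // {1}(row_sum_delta b) linear_sum; apply: eq_bigr => c _.
by rewrite linearZ deriveE.
Qed.

Lemma darr_dir U x (b : V) i J : smooth U ->
  iter i (jdir (fun c => b 0 c)) (darr U x) J =
  iter_derive U (nseq i b ++ [seq delta_mx 0 i | i <- J]) x.
Proof.
move=> sU; elim: i J => [//|i IH] J; rewrite iterS /jdir.
rewrite [RHS]/= derive_sum_coord; last exact: sU.
apply: eq_bigr => c _; rewrite IH; congr (_ * _).
rewrite -[in RHS]/(iter_derive U (delta_mx 0 c :: _)) -/(iter_derive U (_ :: _) x).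
apply: (iter_derive_perm (ws := delta_mx 0 c :: _)) => //.
by rewrite map_cons -cat1s perm_catCA.
Qed.

(** Induction on the order: the derivative in s of the remainder is the remainder of lower order of
    ['D_b U], and the mean value theorem carries its bound back. The factorial of the sharp
    remainder is given up, as the order is fixed. *)
Lemma taylor_line U x (b : V) r B : smooth U -> 0 <= B ->
  (forall s, 0 <= s <= 1 -> `|iter_derive U (nseq r.+1 b) (x + s *: b)| <= B) ->
  forall s, 0 <= s <= 1 ->
  `|U (x + s *: b) - \sum_(i < r.+1) s ^+ i / i`!%:R * iter_derive U (nseq i b) x| <= B.
Proof.
elim: r U => [|r IH] U sU B0 hB s /andP [s0 s1].
  rewrite big_ord1 /= expr0 divr1 mul1r.
  have [c /andP [c0 cs] ->] := mvt_line x b (fun y => sU [::] y) s0.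
  rewrite normrM (ger0_norm s0) -[leRHS]mulr1; apply: ler_pM => //.
  by apply: hB; rewrite c0 (le_trans cs).
have sdU : smooth ('D_b U) by exact: (@smooth_iter U [:: b]).
have shift_nseq i y : iter_derive ('D_b U) (nseq i b) y = iter_derive U (nseq i.+1 b) y.
  have -> : nseq i.+1 b = nseq i b ++ [:: b] by elim: i => //= i ->.
  by rewrite iter_derive_cat.
have hB' t : 0 <= t <= 1 -> `|iter_derive ('D_b U) (nseq r.+1 b) (x + t *: b)| <= B.
  by move=> ht; rewrite shift_nseq; exact: hB.
have {}IH := IH _ sdU B0 hB'.
pose p : {poly R} := \sum_(i < r.+2) (iter_derive U (nseq i b) x / i`!%:R) *: 'X^i.
pose p' : {poly R} := \sum_(i < r.+1) (iter_derive U (nseq i.+1 b) x / i`!%:R) *: 'X^i.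
have dp : p^`() = p'.
  rewrite /p raddf_sum big_ord_recl /= derivZ derivXn /= scaler0 add0r.
  apply: eq_bigr => i _; rewrite derivZ derivXn /bump /= -scalerMnr scalerMnl.
  congr (_ *: _); rewrite add0n add1n factS natrM invfM -mulr_natr -!mulrA.
  by congr (_ * _); rewrite mulrCA mulVf ?mulr1 // pnatr_eq0.
have ep t : \sum_(i < r.+2) t ^+ i / i`!%:R * iter_derive U (nseq i b) x = p.[t].
  rewrite horner_sum; apply: eq_bigr => i _; rewrite hornerZ hornerXn; ring.
have ep' t : \sum_(i < r.+1) t ^+ i / i`!%:R * iter_derive ('D_b U) (nseq i b) x = p'.[t].
  rewrite horner_sum; apply: eq_bigr => i _; rewrite hornerZ hornerXn shift_nseq; ring.
pose F t := U (x + t *: b) - p.[t].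
have dF (t : R) : is_derive t 1 F ('D_b U (x + t *: b) - p'.[t]).
  apply: is_deriveB; first exact: is_derive_line (sU [::] _).
  split; first exact: derivable_horner.
  by rewrite -dp derivE derive1E.
have F0 : F 0 = 0.
  rewrite /F scale0r addr0 -ep big_ord_recl /= expr0 divr1 mul1r big1 ?addr0 ?subrr //.
  by move=> i _; rewrite expr0n /= !mul0r.
have [|c cs eF] := @MVT_segment R F _ 0 s s0 (fun t _ => dF t).
  apply: continuous_subspaceT => t; apply/differentiable_continuous/derivable1_diffP.
  by have [] := dF t.
move: cs; rewrite in_itv /= => /andP [c0 cs].
rewrite ep -/(F s) -[F s]subr0 -F0 eF subr0 normrM (ger0_norm s0) -[leRHS]mulr1.
apply: ler_pM => //; rewrite -ep'; apply: IH; by rewrite c0 (le_trans cs).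
Qed.

End Calculus.

(** * Picard iteration, uniformly in all parameters *)

Section Families.
Variables (R : realType) (ell : nat) (I : Type).
Local Notation C := R[i].
Variables (th : I -> 'I_ell -> R) (tau sig : I -> R) (Q : I -> nat).
Hypotheses (tau1 : forall i, 1 <= tau i) (sig1 : forall i, 1 <= sig i).
Hypotheses (Q0 : forall i, (0 < Q i)%N) (chrQ : forall i k, chr (th i) k (Q i) = 1).

(* The index i ranges over all admissible parameters and starting points; the
   constant A must not depend on it. *)
Definition repO w d (B : I -> R) (F : I -> modf R) :=
  exists2 A : R, 0 <= A & forall i, rep (th i) (tau i) (sig i) w d (A * B i) (F i).
Definition bO (B f : I -> R) := exists2 A : R, 0 <= A & forall i, f i <= A * B i.

Let tau0 i : 0 < tau i. Proof. exact: lt_le_trans ltr01 (tau1 i). Qed.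

Lemma repO_ext w d B F G : (forall i m, F i m = G i m) -> repO w d B F -> repO w d B G.
Proof. by move=> e [A A0 h]; exists A => // i; apply: rep_ext (h i); exact: e. Qed.

Lemma repO_le w d d' B B' F : (d <= d')%N -> bO B' B -> repO w d B F -> repO w d' B' F.
Proof.
move=> dd [A' A'0 hB] [A A0 h]; exists (A * A'); first exact: mulr_ge0.
move=> i; apply: (rep_le dd) (h i); rewrite -mulrA; apply: ler_wpM2l => //.
Qed.

Lemma repO_deg w d d' B F : (d <= d')%N -> repO w d B F -> repO w d' B F.
Proof. by move=> dd; apply: repO_le => //; exists 1 => // i; rewrite mul1r. Qed.

Lemma bO_le B f : (forall i, f i <= B i) -> bO B f.
Proof. by move=> h; exists 1 => // i; rewrite mul1r. Qed.

Lemma repO_leB w d B B' F : (forall i, B i <= B' i) -> repO w d B F -> repO w d B' F.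
Proof. by move=> h; apply: repO_le => //; exact: bO_le. Qed.

Lemma repO0 w d B : (forall i, 0 <= B i) -> repO w d B (fun _ _ => 0).
Proof. by move=> B0; exists 0 => // i; apply: rep0; rewrite mul0r. Qed.

Lemma repOD w d B F G : repO w d B F -> repO w d B G -> repO w d B (fun i m => F i m + G i m).
Proof.
move=> [A A0 h] [A' A'0 h']; exists (A + A'); first exact: addr_ge0.
by move=> i; rewrite mulrDl; exact: repD.
Qed.

Lemma repON w d B F : repO w d B F -> repO w d B (fun i m => - F i m).
Proof. by move=> [A A0 h]; exists A => // i; exact: repN. Qed.

Lemma repOB w d B F G : repO w d B F -> repO w d B G -> repO w d B (fun i m => F i m - G i m).
Proof. by move=> h /repON; exact: repOD. Qed.

Lemma repO_sum (S : Type) (s : seq S) (P : pred S) w d B (F : S -> I -> modf R) :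
  (forall i, 0 <= B i) ->
  (forall k, P k -> repO w d B (F k)) ->
  repO w d B (fun i m => \sum_(k <- s | P k) F k i m).
Proof.
move=> B0 h; elim: s => [|k s IH].
  by apply: repO_ext (repO0 w d B0) => i m; rewrite big_nil.
case Pk: (P k); last by apply: repO_ext IH => i m; rewrite big_cons Pk.
by apply: repO_ext (repOD (h _ Pk) IH) => i m; rewrite big_cons Pk.
Qed.

Lemma repOZ w d (b B : I -> R) (a : I -> C) F : bO b (fun i => cabs (a i)) ->
  (forall i, 0 <= B i) -> repO w d B F -> repO w d (fun i => b i * B i) (fun i m => a i *: F i m).
Proof.
move=> [A' A'0 hb] B0 [A A0 h]; exists (A' * A); first exact: mulr_ge0.
move=> i; apply: (rep_le (leqnn _)) (repZ (a i) (h i)).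
rewrite mulrACA; apply: ler_wpM2r => //; exact: mulr_ge0.
Qed.

Lemma repOM d d' B B' F G : repO 0 d B F -> repO 0 d' B' G ->
  repO 0 (d + d') (fun i => B i * B' i) (fun i m => F i m * G i m).
Proof.
move=> [A A0 h] [A' A'0 h']; exists (A * A'); first exact: mulr_ge0.
by move=> i; rewrite mulrACA; exact: repM.
Qed.

Lemma repO_shf w d B F : repO w d B F -> repO w d B (fun i => shf (F i)).
Proof.
move=> [A A0 h]; exists (2 ^+ d * A); first by rewrite mulr_ge0 // exprn_ge0.
by move=> i; rewrite -mulrA; exact: rep_shf.
Qed.

Lemma repO_deriv w d B F : repO w d B F ->
  repO w d (fun i => B i / tau i) (fun i m => (F i m)^`()).
Proof.
move=> [A A0 h]; exists (d%:R * A); first exact: mulr_ge0.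
move=> i; apply: (rep_le (leqnn _)) (rep_deriv (tau1 i) (sig1 i) (h i)).
by rewrite le_eqVlt; apply/orP; left; apply/eqP; ring.
Qed.

Lemma repO_w0 w d B F : (w <= 1)%N -> repO w d B F -> repO 0 d B F.
Proof.
case: w => [//|[|//]] _ [A A0 h]; exists A => // i; exact: rep_w01.
Qed.

Lemma repO_per w d B F i : repO w d B F -> mperiodic (Q i) (F i).
Proof. by move=> [A A0 h]; apply: (rep_periodic _ (h i)) => k; exact: chrQ. Qed.

Lemma repO_chr w d (b : I -> R) (c : I -> C) kap : (lnorm kap <= d)%N -> (lnorm kap <= w)%N ->
  bO b (fun i => cabs (c i) * sig i ^+ w) ->
  repO w d b (fun i m => (c i * chr (th i) kap m) *: 'X^0).
Proof.
move=> kd kw [A A0 hb]; exists A => // i.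
have hd : (0 + lnorm kap <= d)%N by [].
apply: (rep_le (leqnn _)) (rep_term _ _ _ _ _ hd).
by rewrite expr0 mulr1 (maxn_idPr kw).
Qed.

Section Solve.
Variables (K : nat) (kap : lab ell) (w : nat).
Hypotheses (kw : (lnorm kap <= w)%N) (w1 : (w <= 1)%N).
Hypothesis gap : forall i, gapped (th i) (tau i) K (chr (th i) kap 1).

Let gapd d i : (d <= K)%N -> gapped (th i) (tau i) d (chr (th i) kap 1).
Proof. by move=> dK k kd; apply: gap; exact: leq_trans kd dK. Qed.

Let kd d : (lnorm kap <= d.+1)%N.
Proof. by apply: leq_trans (leq_trans kw w1) _. Qed.

Lemma solveO_ex d B G : (d <= K)%N -> repO w d B G ->
  exists F : I -> modf R, repO w d.+1 (fun i => tau i * B i) F /\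
  forall i, (forall m, shf (F i) m - chr (th i) kap 1 *: F i m = G i m) /\ (F i 0).[0] = 0.
Proof.
move=> dK [A A0 h]; have [A' A'0 hs] := rep_solve R ell d.
have /choice [F hF] : forall i, exists F, [/\ rep (th i) (tau i) (sig i) w d.+1
    (A' * tau i * (A * B i)) F, forall m, shf F m - chr (th i) kap 1 *: F m = G i m
    & (F 0).[0] = 0].
  move=> i; exact: hs (tau1 i) (sig1 i) (gapd i dK) kw (kd d) (h i).
exists F; split; last by move=> i; have [] := hF i.
exists (A' * A); first exact: mulr_ge0.
by move=> i; have [+ _ _] := hF i; apply: rep_le => //; rewrite mulrACA.
Qed.

(** A priori estimate: by uniqueness, any periodic solution is the normalised one plus its initial
    value times the character of kap. *)
Lemma solveO d B B0 F G : (d <= K)%N -> repO w d B G -> 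
  (forall i, mperiodic (Q i) (F i)) ->
  (forall i m, shf (F i) m - chr (th i) kap 1 *: F i m = G i m) ->
  bO B0 (fun i => cabs (F i 0).[0] * sig i ^+ w) ->
  (forall i, 0 <= B i) -> (forall i, 0 <= B0 i) ->
  repO w d.+1 (fun i => tau i * B i + B0 i) F.
Proof.
move=> dK rG pF eF b0 Bp B0p; have [F' [rF' hF']] := solveO_ex dK rG.
apply: (repO_ext (F := fun i m => F' i m + ((F i 0).[0] * chr (th i) kap m) *: 'X^0)).
  move=> i m; pose H m := F i m - (F' i m + ((F i 0).[0] * chr (th i) kap m) *: 'X^0).
  suff H0 : forall m, H m = 0 by apply/esym/eqP; rewrite -subr_eq0; apply/eqP; exact: H0.
  have [eF' F'0] := hF' i.
  apply: (solve_unique (Q0 i) (chrQ i) (kap := kap)).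
  - move=> m'; rewrite /H pF (repO_per i rF') chr_mod //; exact: chrQ.
  - move=> m'; apply/eqP; rewrite -subr_eq0 /H shfB shfD scalerBr scalerDr; apply/eqP.
    have := eF i m'; rewrite -(eF' m').
    rewrite shf_term big_ord1 bin0 mulr1 [X in _ -> X]/= scalerA.
    rewrite (mulrC (F i 0).[0] (chr _ _ 1)) -mulrA.
    have aux (V : comNzRingType) (a b c e x : V) : a - b = c - e -> a - (c + x) - (b - (e + x)) = 0.
      by move=> h; have -> : a = c - e + b; [rewrite -h; ring | ring].
    exact: aux.
  - rewrite /H chr_0 mulr1 expr0 !hornerE F'0; ring.
apply: repOD.
  apply: repO_leB rF' => i; by rewrite lerDl.
apply: repO_leB (repO_chr _ kw b0) => [i|]; last exact: kd.
by rewrite lerDr mulr_ge0 // ltW.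
Qed.
End Solve.

(** * An abstract system of modulated equations with polynomial force *)

Section System.
Variables (n L : nat) (T : finType).
Variables (kap : T -> lab ell) (wt : T -> nat) (cc : T -> 'I_n).
Variables (Mx : T -> T -> I -> C) (w0 : T -> I -> C) (rho : 'I_n -> T -> I -> C).
Variables (g : I -> R) (K : nat).
Hypotheses (kw : forall s, (lnorm (kap s) <= wt s)%N) (w1 : forall s, (wt s <= 1)%N).
Hypotheses (g0 : forall i, 0 <= g i) (g1 : forall i, g i <= 1) (L1 : (1 <= L)%N).
Hypothesis gap : forall s i, gapped (th i) (tau i) K (chr (th i) (kap s) 1).
Hypothesis hM : forall s s', bO (fun i => g i / tau i) (fun i => cabs (Mx s s' i)).
Hypothesis hMw : forall s s', wt s = wt s' \/ forall i, Mx s s' i = 0.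
Hypothesis hw : forall s, bO (fun i => g i ^+ 2 / tau i) (fun i => cabs (w0 s i) * sig i ^+ wt s).
Hypothesis hrho : forall c s, bO (fun=> 1) (fun i => cabs (rho c s i)).

Implicit Types (Y : T -> I -> modf R) (A : I -> seq 'I_n -> R) (e : 'I_n -> I -> C).

(** The unknowns are amplitudes; [rho] recombines them into coordinates and e is the base point of
    the Taylor expansion of the potential. *)
Definition deviation e Y c i m : {poly C} := \sum_s rho c s i *: Y s i m - (e c i)%:P.
Definition jet_grad (A : seq 'I_n -> R) (z : 'I_n -> {poly C}) c : {poly C} :=
  \sum_(j < L) (j`!%:R^-1 : C) *: jet j (fun J => A (c :: J)) z.
(** A linear coupling of size g / tau plus a force of size g^2 / tau in the weighted norm. After the
    factor tau lost in solving, unknowns of size g are reproduced with a spare factor g. *)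
Definition rhs A e Y s i m : {poly C} :=
  \sum_s' Mx s s' i *: Y s' i m + w0 s i *: jet_grad (A i) (fun c => deviation e Y c i m) (cc s).
Definition defect A e Y s i m : {poly C} :=
  shf (Y s i) m - chr (th i) (kap s) 1 *: Y s i m - rhs A e Y s i m.

Definition bounded_arr A := exists2 M : R, 0 <= M &
  forall i J, (size J <= L)%N -> `|A i J| <= M.

Let ti0 i : 0 <= (tau i)^-1. Proof. by rewrite invr_ge0 ltW. Qed.

Lemma repO_deviation d e Y : (forall s, repO (wt s) d g (Y s)) -> (forall c, bO g (fun i => cabs (e c i))) ->
  forall c, repO 0 d g (fun i m => deviation e Y c i m).
Proof.
move=> rY he c; apply: repOB.
  apply: repO_sum => // s _; apply: repO_leB; last first.
    apply: (repOZ (hrho c s)) => //; exact: (repO_w0 (w1 s) (rY s)).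
  by move=> i /=; rewrite mul1r.
apply: (repO_ext (F := fun i m => (e c i * chr (th i) 0 m) *: 'X^0)) => [i m|].
  by rewrite chr0 mulr1 expr0 alg_polyC.
have [M M0 h] := he c; apply: repO_chr; rewrite ?lnorm0 //.
by exists M => // i; rewrite expr0 mulr1.
Qed.

Lemma repO_deviationB d D e Y Y' : (forall i, 0 <= D i) ->
  (forall s, repO (wt s) d D (fun i m => Y s i m - Y' s i m)) ->
  forall c, repO 0 d D (fun i m => deviation e Y c i m - deviation e Y' c i m).
Proof.
move=> D0 rY c.
apply: (repO_ext (F := fun i m => \sum_s rho c s i *: (Y s i m - Y' s i m))) => [i m|].
  rewrite /deviation opprB addrA subrK -sumrB.
  by apply: eq_bigr => s _; rewrite scalerBr.
apply: repO_sum => // s _; apply: repO_leB; last first.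
  apply: (repOZ (F := fun i m => Y s i m - Y' s i m) (hrho c s) D0).
  exact: (repO_w0 (w1 s) (rY s)).
by move=> i /=; rewrite mul1r.
Qed.

Lemma fact_inv_le1 j : cabs (j`!%:R^-1 : C) <= 1.
Proof. by rewrite cabsV cabs_nat invf_le1 ?ler1n ?ltr0n fact_gt0. Qed.

Lemma repO_jet d A (z : 'I_n -> I -> modf R) j : (forall c, repO 0 d g (z c)) ->
  (exists2 M : R, 0 <= M & forall i J, size J = j -> `|A i J| <= M) ->
  repO 0 (j * d) (fun=> 1) (fun i m => jet j (A i) (fun c => z c i m)).
Proof.
move=> rz [M M0 hM']; have /choice [B hB] : forall c, exists B, 0 <= B /\
  forall i, rep (th i) (tau i) (sig i) 0 d (B * g i) (z c i).
  by move=> c; have [B B0 h] := rz c; exists B.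
pose B1 := \sum_c B c.
have B10 : 0 <= B1 by apply: sumr_ge0 => c _; have [] := hB c.
have BB c : B c <= B1.
  by rewrite /B1 (bigD1 c) //= lerDl; apply: sumr_ge0 => c' _; have [] := hB c'.
exists ((n%:R * B1) ^+ j * M); first by rewrite mulr_ge0 ?exprn_ge0 ?mulr_ge0.
move=> i; rewrite mulr1; apply: rep_jet => // [c|J sJ]; last exact: hM'.
have [B0 h] := hB c; apply: (rep_le (leqnn _)) (h i).
by rewrite -[leRHS]mulr1; apply: ler_pM.
Qed.

Lemma repO_jetB d A (z z' : 'I_n -> I -> modf R) D j : (forall c, repO 0 d g (z c)) ->
  (forall c, repO 0 d g (z' c)) -> (forall i, 0 <= D i) ->
  (forall c, repO 0 d D (fun i m => z c i m - z' c i m)) ->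
  (exists2 M : R, 0 <= M & forall i J, size J = j -> `|A i J| <= M) ->
  repO 0 (j * d) D (fun i m => jet j (A i) (fun c => z c i m) - jet j (A i) (fun c => z' c i m)).
Proof.
move=> rz rz' D0 rd [M M0 hM'].
have /choice [B hB] : forall c, exists B, 0 <= B /\ forall i,
  [/\ rep (th i) (tau i) (sig i) 0 d B (z c i), rep (th i) (tau i) (sig i) 0 d B (z' c i)
   & rep (th i) (tau i) (sig i) 0 d (B * D i) (fun m => z c i m - z' c i m)].
  move=> c; have [B0 B00 h0] := rz c; have [B1 B10 h1] := rz' c; have [B2 B20 h2] := rd c.
  exists (B0 + B1 + B2); split; first by rewrite !addr_ge0.
  move=> i; split.
  - apply: (rep_le (leqnn _)) (h0 i); apply: (@le_trans _ _ B0).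
      by rewrite -[leRHS]mulr1; apply: ler_wpM2l.
    by rewrite -addrA lerDl addr_ge0.
  - apply: (rep_le (leqnn _)) (h1 i); apply: (@le_trans _ _ B1).
      by rewrite -[leRHS]mulr1; apply: ler_wpM2l.
    by rewrite addrAC lerDr addr_ge0.
  - apply: (rep_le (leqnn _)) (h2 i); apply: ler_wpM2r => //.
    by rewrite lerDr addr_ge0.
pose B1 := \sum_c B c.
have B10 : 0 <= B1 by apply: sumr_ge0 => c _; have [] := hB c.
have BB c : B c <= B1.
  by rewrite /B1 (bigD1 c) //= lerDl; apply: sumr_ge0 => c' _; have [] := hB c'.
exists (j%:R * (n%:R ^+ j * B1 ^+ j.-1 * M) * B1).
  by rewrite !mulr_ge0 ?exprn_ge0.
move=> i; have H := @rep_jetB R ell n (th i) (tau i) (sig i) j (A i) (fun c => z c i)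
  (fun c => z' c i) d B1 M (B1 * D i).
have -> : j%:R * (n%:R ^+ j * B1 ^+ j.-1 * M) * B1 * D i =
  j%:R * (n%:R ^+ j * B1 ^+ j.-1 * M) * (B1 * D i) by rewrite !mulrA.
apply: H => //.
- by move=> c; have [_ /(_ i) [h _ _]] := hB c; apply: rep_le (BB c) h.
- by move=> c; have [_ /(_ i) [_ h _]] := hB c; apply: rep_le (BB c) h.
- move=> c; have [_ /(_ i) [_ _ h]] := hB c; apply: rep_le h => //.
  by apply: ler_wpM2r.
- by move=> J sJ; exact: hM'.
- by rewrite mulr_ge0.
Qed.

Lemma bounded_cons A c j : bounded_arr A -> (j < L)%N ->
  exists2 M : R, 0 <= M & forall i J, size J = j -> `|A i (c :: J)| <= M.
Proof. by move=> [M M0 h] jL; exists M => // i J sJ; apply: h; rewrite /= sJ. Qed.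

Lemma repO_grad d A (z : 'I_n -> I -> modf R) : (forall c, repO 0 d g (z c)) ->
  bounded_arr A -> forall c,
  repO 0 (L * d) (fun=> 1) (fun i m => jet_grad (A i) (fun c => z c i m) c).
Proof.
move=> rz bA c; apply: repO_sum => // j _; apply: (repO_leB (B := fun=> 1 * 1)).
  by move=> i; rewrite mulr1.
apply: repOZ => //; first by apply: bO_le => i; exact: fact_inv_le1.
apply: (repO_deg (d := j * d)); first by rewrite leq_mul2r ltnW ?orbT.
by apply: (repO_jet (A := fun i J => A i (c :: J))) => //; exact: bounded_cons.
Qed.

Lemma repO_gradB d A (z z' : 'I_n -> I -> modf R) D : (forall c, repO 0 d g (z c)) ->
  (forall c, repO 0 d g (z' c)) -> (forall i, 0 <= D i) ->
  (forall c, repO 0 d D (fun i m => z c i m - z' c i m)) ->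
  bounded_arr A -> forall c,
  repO 0 (L * d) D (fun i m => jet_grad (A i) (fun c => z c i m) c - jet_grad (A i) (fun c => z' c i m) c).
Proof.
move=> rz rz' D0 rd bA c.
apply: (repO_ext (F := fun i m => \sum_(j < L) (j`!%:R^-1 : C) *:
   (jet j (fun J => A i (c :: J)) (fun c => z c i m) - jet j (fun J => A i (c :: J)) (fun c => z' c i m)))).
  by move=> i m; rewrite -sumrB; apply: eq_bigr => j _; rewrite scalerBr.
apply: repO_sum => // j _; apply: (repO_leB (B := fun i => 1 * D i)).
  by move=> i /=; rewrite mul1r.
apply: repOZ => //; first by apply: bO_le => i; rewrite fact_inv_le1.
apply: (repO_deg (d := j * d)); first by rewrite leq_mul2r ltnW ?orbT.
by apply: (repO_jetB (A := fun i J => A i (c :: J))) => //; exact: bounded_cons.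
Qed.

Let bg i : 0 <= g i ^+ 2 / tau i. Proof. by rewrite mulr_ge0 // sqr_ge0. Qed.

Lemma repO_w0Z d s D (G : I -> modf R) : (forall i, 0 <= D i) -> repO 0 d D G ->
  repO (wt s) d (fun i => g i ^+ 2 / tau i * D i) (fun i m => w0 s i *: G i m).
Proof.
move=> D0 [A A0 h]; have [A' A'0 h'] := hw s; exists (A' * A); first exact: mulr_ge0.
move=> i; apply: (rep_le (leqnn _)) (rep_w10 (tau1 i) (sig1 i) (wt s) (repZ (w0 s i) (h i))).
rewrite mulrA [sig i ^+ _ * _]mulrC [leRHS]mulrACA; apply: ler_pM => //.
- by rewrite mulr_ge0 ?cabs_ge0 // exprn_ge0 // (le_trans ler01).
- by rewrite mulr_ge0.
Qed.

Lemma repO_MxZ d s D Y : (forall i, 0 <= D i) -> (forall s, repO (wt s) d D (Y s)) ->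
  repO (wt s) d (fun i => g i / tau i * D i) (fun i m => \sum_s' Mx s s' i *: Y s' i m).
Proof.
move=> D0 rY; have gt0 i : 0 <= g i / tau i * D i by rewrite !mulr_ge0.
apply: repO_sum => // s' _; case: (hMw s s') => [e|e].
  by apply: repOZ => //; rewrite e.
by apply: repO_ext (repO0 _ _ gt0) => i m; rewrite e scale0r.
Qed.

Lemma repO_rhs d A e Y s : (forall s, repO (wt s) d g (Y s)) ->
  (forall c, bO g (fun i => cabs (e c i))) -> bounded_arr A ->
  repO (wt s) (L * d) (fun i => g i ^+ 2 / tau i) (rhs A e Y s).
Proof.
move=> rY he bA; apply: repOD.
  apply: (repO_deg (d := d)); first by rewrite leq_pmull.
  apply: repO_leB (repO_MxZ s g0 rY) => i; by rewrite expr2 mulrAC.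
have := repO_w0Z s (fun=> ler01) (repO_grad (repO_deviation rY he) bA (cc s)).
by apply: repO_leB => i; rewrite mulr1.
Qed.

(** The Lipschitz constant g / tau turns into g once the equation is solved, which is the
    contraction factor of the iteration. *)
Lemma repO_rhsB d A e Y Y' D s : (forall s, repO (wt s) d g (Y s)) ->
  (forall s, repO (wt s) d g (Y' s)) -> (forall i, 0 <= D i) ->
  (forall s, repO (wt s) d D (fun i m => Y s i m - Y' s i m)) ->
  (forall c, bO g (fun i => cabs (e c i))) -> bounded_arr A ->
  repO (wt s) (L * d) (fun i => g i * D i / tau i) (fun i m => rhs A e Y s i m - rhs A e Y' s i m).
Proof.
move=> rY rY' D0 rd he bA.
apply: (repO_ext (F := fun i m => \sum_s' Mx s s' i *: (Y s' i m - Y' s' i m) +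
   w0 s i *: (jet_grad (A i) (fun c => deviation e Y c i m) (cc s) - jet_grad (A i) (fun c => deviation e Y' c i m) (cc s)))).
  move=> i m; rewrite /rhs scalerBr opprD addrACA -sumrB; congr (_ + _).
  by apply: eq_bigr => s' _; rewrite scalerBr.
apply: repOD.
  apply: (repO_deg (d := d)); first by rewrite leq_pmull.
  by apply: repO_leB (repO_MxZ s D0 rd) => i; rewrite mulrAC.
have := repO_w0Z s D0 (repO_gradB (repO_deviation rY he) (repO_deviation rY' he) D0 (repO_deviationB e D0 rd) bA (cc s)).
apply: repO_leB => i; rewrite mulrAC; apply: ler_wpM2r => //; apply: ler_wpM2r => //.
by rewrite expr2 -[leRHS]mulr1; apply: ler_wpM2l.
Qed.

Section Picard.
Variables (A : I -> seq 'I_n -> R) (e : 'I_n -> I -> C) (y0 : T -> I -> C).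
Hypotheses (he : forall c, bO g (fun i => cabs (e c i))) (bA : bounded_arr A).
Hypothesis hy : forall s, bO g (fun i => cabs (y0 s i) * sig i ^+ wt s).

Definition is_step Y Y' := forall s i,
  (forall m, shf (Y' s i) m - chr (th i) (kap s) 1 *: Y' s i m = rhs A e Y s i m) /\
  (Y' s i 0).[0] = y0 s i.

Lemma chr_hom (c : C) k i m : shf (fun m => (c * chr (th i) k m) *: 'X^0) m =
  chr (th i) k 1 *: ((c * chr (th i) k m) *: 'X^0).
Proof. by rewrite shf_term big_ord1 bin0 mulr1 /= scalerA mulrCA mulrA (mulrC c). Qed.

Lemma chr_hom0 (c : C) k i : ((c * chr (th i) k 0) *: 'X^0 : {poly C}).[0] = c.
Proof. by rewrite chr_0 mulr1 expr0 hornerZ hornerC mulr1. Qed.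

Lemma picard_step d Y : (L * d <= K)%N -> (forall s, repO (wt s) d g (Y s)) ->
  exists2 Y', is_step Y Y' & forall s, repO (wt s) (L * d).+1 g (Y' s).
Proof.
move=> dK rY.
have /choice [F hF] : forall s, exists F : I -> modf R,
   repO (wt s) (L * d).+1 (fun i => tau i * (g i ^+ 2 / tau i)) F /\
   forall i, (forall m, shf (F i) m - chr (th i) (kap s) 1 *: F i m = rhs A e Y s i m)
      /\ (F i 0).[0] = 0.
  move=> s; apply: (solveO_ex (kw s) (w1 s) (gap s) dK); exact: repO_rhs.
exists (fun s i m => F s i m + (y0 s i * chr (th i) (kap s) m) *: 'X^0) => [s i|s].
  have [_ /(_ i) [eF F0]] := hF s; split.
    move=> m; rewrite shfD chr_hom scalerDr opprD addrACA subrr addr0; exact: eF.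
  by rewrite hornerD F0 add0r chr_hom0.
have [rF _] := hF s; apply: repOD.
  apply: repO_leB rF => i; rewrite mulrC divfK ?gt_eqF //.
  by rewrite expr2 -[leRHS]mulr1; apply: ler_wpM2l.
apply: repO_chr => //; by apply: leq_trans (leq_trans (kw s) (w1 s)) _.
Qed.

(** Degree of the j-th iterate: the Taylor polynomial of the force multiplies it by at most L and
    solving adds one resonant power of X. *)
Fixpoint pdeg j := if j is j'.+1 then (L * pdeg j').+1 else L.+1.

Lemma pdeg_ge j : (0 < pdeg j)%N. Proof. by case: j. Qed.

Lemma pdegS j : (pdeg j <= L * pdeg j)%N.
Proof. by rewrite leq_pmull. Qed.

(** The iteration starts from free characters with the prescribed initial values. All iterates share
    these values, so their differences have zero initial data and are governed by the contraction
    alone. *)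
Lemma picard j : (L * pdeg j <= K)%N -> exists Y Y', [/\
  forall s, repO (wt s) (pdeg j) g (Y s), forall s, repO (wt s) (pdeg j) g (Y' s),
  is_step Y Y' & forall s, repO (wt s) (pdeg j) (fun i => g i ^+ j.+2)
     (fun i m => Y' s i m - Y s i m)].
Proof.
elim: j => [|j IH] jK.
  pose Y s i m : {poly C} := (y0 s i * chr (th i) (kap s) m) *: 'X^0.
  have ks s : (lnorm (kap s) <= 1)%N by apply: leq_trans (kw s) (w1 s).
  have rY s : repO (wt s) 1 g (Y s) by apply: repO_chr.
  have [|Y' hY' rY'] := picard_step (d := 1) (Y := Y) _ rY.
    by apply: leq_trans jK; rewrite leq_mul2l pdeg_ge orbT.
  rewrite muln1 in rY'.
  have rYL s : repO (wt s) L.+1 g (Y s) by apply: repO_deg (rY s).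
  exists Y, Y'; split=> // s.
  have LK : (L * 1 <= K)%N by apply: leq_trans jK; rewrite leq_mul2l pdeg_ge orbT.
  have rR := repO_rhs s rY he bA.
  have := solveO (kw s) (w1 s) (gap s) LK rR (B0 := fun=> 0)
    (F := fun i m => Y' s i m - Y s i m).
  rewrite muln1 => H; apply: repO_leB (H _ _ _ _ _) => //=.
  - by move=> i; rewrite addr0 mulrC divfK ?gt_eqF.
  - by move=> i m; rewrite (repO_per i (rY' s)) (repO_per i (rY s)).
  - move=> i m; rewrite shfB scalerBr; have [<- _] := hY' s i.
    rewrite /Y chr_hom opprB addrA -[X in X - _]addrAC -addrA.
    by rewrite subrr addr0.
  - by apply: bO_le => i; rewrite hornerD hornerN chr_hom0 (proj2 (hY' s i)) subrr cabs0 mul0r.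
have [|Y [Y' [rY rY' sY rd]]] := IH.
  by apply: leq_trans jK; rewrite leq_mul2l /= ltnW ?orbT // ltnS pdegS.
have dK : (L * pdeg j <= K)%N.
  by apply: leq_trans jK; rewrite leq_mul2l /= ltnW ?orbT // ltnS pdegS.
have [Y'' sY'' rY''] := picard_step dK rY'.
exists Y', Y''; split=> // s.
  by apply: repO_deg (rY' s); rewrite ltnW // ltnS pdegS.
have gj i : 0 <= g i ^+ j.+2 by rewrite exprn_ge0.
have rR := repO_rhsB s rY' rY gj rd he bA.
have H := solveO (kw s) (w1 s) (gap s) dK rR (B0 := fun=> 0)
    (F := fun i m => Y'' s i m - Y' s i m).
apply: repO_leB (H _ _ _ _ _) => //=.
- by move=> i; rewrite addr0 mulrC divfK ?gt_eqF // -exprS.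
- by move=> i m; rewrite (repO_per i (rY'' s)) (repO_per i (rY' s)).
- move=> i m; rewrite shfB scalerBr; have [<- _] := sY'' s i; have [<- _] := sY s i.
  by rewrite opprB addrACA [in RHS]opprB [_ - shf (Y' s i) m]addrC -addrA; ring.
- by apply: bO_le => i; rewrite hornerD hornerN (proj2 (sY'' s i)) (proj2 (sY s i)) subrr cabs0 mul0r.
- by move=> i; rewrite mulr_ge0 // mulr_ge0.
Qed.

(** The defect of the last iterate is the difference of the right-hand sides at two consecutive
    iterates, hence small by the Lipschitz bound. *)
Lemma approx_solution j : (L * pdeg j <= K)%N -> exists Y, [/\
  forall s, repO (wt s) (L * pdeg j) g (Y s),
  forall s i, (Y s i 0).[0] = y0 s i &
  forall s, repO (wt s) (L * pdeg j) (fun i => g i ^+ j / tau i) (defect A e Y s)].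
Proof.
move=> jK; have [Y [Y' [rY rY' sY rd]]] := picard jK; exists Y'; split.
- by move=> s; apply: repO_deg (rY' s); exact: pdegS.
- by move=> s i; have [] := sY s i.
move=> s; have gj i : 0 <= g i ^+ j.+2 by rewrite exprn_ge0.
have rdN s' : repO (wt s') (pdeg j) (fun i => g i ^+ j.+2) (fun i m => Y s' i m - Y' s' i m).
  by apply: repO_ext (repON (rd s')) => i m; rewrite opprB.
apply: (repO_ext (F := fun i m => rhs A e Y s i m - rhs A e Y' s i m)).
  by move=> i m; rewrite /defect; have [-> _] := sY s i.
apply: repO_leB (repO_rhsB s rY rY' gj rdN he bA) => i.
apply: ler_wpM2r => //; rewrite -exprS; apply: ler_wiXn2l => //.
by rewrite -addn3 leq_addr.
Qed.

End Picard.

Section Stability.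
Variables (A : I -> seq 'I_n -> R) (e : 'I_n -> I -> C) (eta : I -> R).
Hypotheses (he : forall c, bO g (fun i => cabs (e c i))) (bA : bounded_arr A).
Hypothesis eta0 : forall i, 0 <= eta i.
Variables (Y Y' : T -> I -> modf R) (d0 : nat).
Hypotheses (d00 : (0 < d0)%N).
Hypotheses (rY : forall s, repO (wt s) d0 g (Y s)) (rY' : forall s, repO (wt s) d0 g (Y' s)).
Hypothesis dY : forall s, repO (wt s) d0 (fun i => eta i / tau i) (defect A e Y s).
Hypothesis dY' : forall s, repO (wt s) d0 (fun i => eta i / tau i) (defect A e Y' s).
Hypothesis iY : forall s, bO eta (fun i => cabs (Y s i 0 - Y' s i 0).[0] * sig i ^+ wt s).

Fixpoint sdeg j := if j is j'.+1 then (L * sdeg j').+1 else d0.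

Lemma sdeg_ge j : (d0 <= sdeg j)%N.
Proof.
elim: j => [//|j IH] /=; apply: (leq_trans IH).
by apply: leq_trans (leqnSn _); exact: leq_pmull.
Qed.

(** Each pass through the Lipschitz bound improves the difference by a factor g, until only eta
    remains, which accounts for both defects and for the initial difference. *)
Lemma stability j : (sdeg j <= K)%N ->
  forall s, repO (wt s) (sdeg j) (fun i => g i ^+ j.+1 + eta i) (fun i m => Y s i m - Y' s i m).
Proof.
elim: j => [|j IH] jK s.
  by apply: repO_leB (repOB (rY s) (rY' s)) => i; rewrite expr1 lerDl.
have jK' : (sdeg j <= K)%N.
  by apply: leq_trans jK; apply: leq_trans (leqnSn _); exact: leq_pmull.
have D0 i : 0 <= g i ^+ j.+1 + eta i by rewrite addr_ge0 // exprn_ge0.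
have rR := repO_rhsB s (fun s => repO_deg (sdeg_ge j) (rY s))
   (fun s => repO_deg (sdeg_ge j) (rY' s)) D0 (IH jK') he bA.
have dd : (d0 <= L * sdeg j)%N by apply: leq_trans (sdeg_ge j) _; exact: leq_pmull.
have rdd := repO_deg dd (repOB (dY s) (dY' s)).
have B0 i : 0 <= (g i ^+ j.+2 + eta i) / tau i.
  by rewrite mulr_ge0 // addr_ge0 // exprn_ge0.
have rG : repO (wt s) (L * sdeg j) (fun i => (g i ^+ j.+2 + eta i) / tau i)
   (fun i m => rhs A e Y s i m - rhs A e Y' s i m + (defect A e Y s i m - defect A e Y' s i m)).
  apply: repOD.
    apply: repO_leB rR => i; apply: ler_wpM2r => //; rewrite mulrDr -exprS lerD2l.
    by rewrite -[leRHS]mul1r; apply: ler_wpM2r.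
  apply: repO_leB rdd => i; apply: ler_wpM2r => //; by rewrite lerDr exprn_ge0.
have LK : (L * sdeg j <= K)%N by apply: ltnW.
have H := solveO (kw s) (w1 s) (gap s) LK rG (B0 := eta)
    (F := fun i m => Y s i m - Y' s i m).
apply: repO_le (H _ _ _ B0 eta0) => //.
- exists 2 => // i; rewrite mulrC divfK ?gt_eqF //.
  by have := eta0 i; have : 0 <= g i ^+ j.+2 by [rewrite exprn_ge0]; lra.
- by move=> i m; rewrite (repO_per i (rY s)) (repO_per i (rY' s)).
- move=> i m; rewrite shfB scalerBr /defect.
  set a := rhs _ _ _ _ _ _; set b := rhs _ _ _ _ _ _.
  have aux (V : comNzRingType) (p q p' q' a1 b1 : V) :
    p - p' - (q - q') = a1 - b1 + (p - q - a1 - (p' - q' - b1)) by ring.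
  exact: aux.
Qed.

End Stability.

End System.
End Families.

(** * Almost invariants of the averaged system *)

Section Primitive.
Variable F : numFieldType.
Definition primp (p : {poly F}) : {poly F} :=
  \poly_(i < (size p).+1) (if i is i'.+1 then p`_i' / i'.+1%:R else 0).

Lemma coef_primp p i : (primp p)`_i = if i is i'.+1 then p`_i' / i'.+1%:R else 0.
Proof.
rewrite coef_poly; case: i => [|i] //; rewrite ltnS; case: ltnP => // h.
by rewrite nth_default // mul0r.
Qed.

(** The integral over [0, 1] in formal form, as it is applied to polynomials with complex
    coefficients. It spans exactly one step of slow time. *)
Definition int01 (p : {poly F}) : F := (primp p).[1].

Lemma int01D p q : int01 (p + q) = int01 p + int01 q.
Proof.
rewrite /int01 -hornerD; congr (_.[1]); apply/polyP => -[|i]; rewrite coefD !coef_primp ?addr0 //.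
by rewrite coefD mulrDl.
Qed.
Lemma int01Z a p : int01 (a *: p) = a * int01 p.
Proof.
rewrite /int01 -hornerZ; congr (_.[1]); apply/polyP => -[|i]; rewrite coefZ !coef_primp ?mulr0 //.
by rewrite coefZ mulrA.
Qed.
Lemma int01N p : int01 (- p) = - int01 p.
Proof. by rewrite -scaleN1r int01Z mulN1r. Qed.
Lemma int01B p q : int01 (p - q) = int01 p - int01 q.
Proof. by rewrite int01D int01N. Qed.
Lemma int01_0 : int01 0 = 0.
Proof. by rewrite -(scale0r 0) int01Z mul0r. Qed.
Lemma int01_sum (I : Type) (s : seq I) (P : pred I) (f : I -> {poly F}) :
  int01 (\sum_(i <- s | P i) f i) = \sum_(i <- s | P i) int01 (f i).
Proof.
by elim/big_rec2: _ => [|i y1 y2 _ <-]; rewrite ?int01_0 // int01D.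
Qed.
Lemma int01_deriv p : int01 p^`() = p.[1] - p.[0].
Proof.
rewrite /int01; have -> : primp p^`() = p - (p.[0])%:P; last by rewrite hornerD hornerN hornerC.
apply/polyP => -[|i]; rewrite coefB coef_primp coefC /= ?subr0.
  by rewrite -horner_coef0 subrr.
by rewrite coef_deriv -(mulr_natr p`_i.+1 i.+1) mulfK ?pnatr_eq0 // subr0.
Qed.
Lemma int01_Xn l : int01 'X^l = l.+1%:R^-1.
Proof.
rewrite /int01; have -> : primp 'X^l = l.+1%:R^-1 *: 'X^(l.+1).
  apply/polyP => -[|i]; rewrite coef_primp coefZ !coefXn ?mulr0 // eqSS.
  by case: eqP => [->|]; rewrite ?mul1r ?mulr1 // mul0r mulr0.
by rewrite hornerZ hornerXn expr1n mulr1.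
Qed.
End Primitive.

Section Brackets.
Variables (R : realType) (Q : nat).
Local Notation C := R[i].
Local Notation modf := (modf R).
Hypothesis Q0 : (0 < Q)%N.
Implicit Types F G H : modf.

Definition mean_prod F G : {poly C} := mean Q (fun m => F m * G m).

Lemma brC F G : mean_prod F G = mean_prod G F.
Proof. by apply: mean_ext => m; rewrite mulrC. Qed.
Lemma brDl F F' G : mean_prod (fun m => F m + F' m) G = mean_prod F G + mean_prod F' G.
Proof. by rewrite /mean_prod -meanD; apply: mean_ext => m; rewrite mulrDl. Qed.
Lemma brDr F G G' : mean_prod F (fun m => G m + G' m) = mean_prod F G + mean_prod F G'.
Proof. by rewrite brC brDl !(brC F). Qed.
Lemma brZl a F G : mean_prod (fun m => a *: F m) G = a *: mean_prod F G.
Proof. by rewrite /mean_prod -meanZ; apply: mean_ext => m; rewrite scalerAl. Qed.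
Lemma brZr a F G : mean_prod F (fun m => a *: G m) = a *: mean_prod F G.
Proof. by rewrite brC brZl brC. Qed.
Lemma brNl F G : mean_prod (fun m => - F m) G = - mean_prod F G.
Proof. by rewrite /mean_prod -meanN; apply: mean_ext => m; rewrite mulNr. Qed.
Lemma brNr F G : mean_prod F (fun m => - G m) = - mean_prod F G.
Proof. by rewrite brC brNl brC. Qed.
Lemma brBl F F' G : mean_prod (fun m => F m - F' m) G = mean_prod F G - mean_prod F' G.
Proof. by rewrite brDl brNl. Qed.
Lemma brBr F G G' : mean_prod F (fun m => G m - G' m) = mean_prod F G - mean_prod F G'.
Proof. by rewrite brDr brNr. Qed.
Lemma mean_prod_shf F G : mperiodic Q F -> mperiodic Q G -> mean_prod (shf F) (shf G) = mean_prod F G \Po ('X + 1).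
Proof.
move=> pF pG; rewrite /mean_prod -mean_shf //; last by move=> m; rewrite pF pG.
by apply: mean_ext => m; rewrite shfM.
Qed.
Lemma br_ext F F' G G' : (forall m, F m = F' m) -> (forall m, G m = G' m) -> mean_prod F G = mean_prod F' G'.
Proof. by move=> e e'; apply: mean_ext => m; rewrite e e'. Qed.

Section Derivation.
Variable DD : modf -> modf.
Hypothesis DDlin : forall a F G, DD (fun m => a *: F m + G m) = (fun m => a *: DD F m + DD G m).
Hypothesis DDper : forall F, mperiodic Q F -> mperiodic Q (DD F).
Hypothesis DDshf : forall F, mperiodic Q F -> DD (shf F) = shf (DD F).

Lemma op_linD F G : DD (fun m => F m + G m) = fun m => DD F m + DD G m.
Proof.
have := DDlin 1 F G; under [fun m => 1 *: F m + G m]funext do rewrite scale1r.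
by move=> ->; apply/funext => m; rewrite scale1r.
Qed.
Lemma op_lin0 : DD (fun=> 0) = fun=> 0.
Proof.
have := DDlin (-1) (fun=> 0) (fun=> 0); under [fun m => -1 *: _ + _]funext do rewrite scaler0 addr0.
by move=> ->; apply/funext => m; rewrite scaleN1r addNr.
Qed.
Lemma op_linZ a F : DD (fun m => a *: F m) = fun m => a *: DD F m.
Proof.
have := DDlin a F (fun=> 0); under [fun m => a *: _ + _]funext do rewrite addr0.
by move=> ->; apply/funext => m; rewrite op_lin0 addr0.
Qed.

(** A discrete symplectic product twisted by DD. Its antisymmetry kills the self-interaction of a
    common forcing term. *)
Definition Xi F G : {poly C} := mean_prod (DD F) G - mean_prod F (DD G).

Lemma XiC F G : Xi F G = - Xi G F.
Proof. by rewrite /Xi opprB (brC (DD F)) (brC F). Qed.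
Lemma XiDl F F' G : Xi (fun m => F m + F' m) G = Xi F G + Xi F' G.
Proof. by rewrite /Xi op_linD !brDl; ring. Qed.
Lemma XiDr F G G' : Xi F (fun m => G m + G' m) = Xi F G + Xi F G'.
Proof. by rewrite XiC XiDl opprD -!(XiC F). Qed.
Lemma XiZl a F G : Xi (fun m => a *: F m) G = a *: Xi F G.
Proof. by rewrite /Xi op_linZ !brZl scalerBr. Qed.
Lemma XiZr a F G : Xi F (fun m => a *: G m) = a *: Xi F G.
Proof. by rewrite XiC XiZl -scalerN -XiC. Qed.
Lemma Xi_same F : Xi F F = 0.
Proof. by rewrite /Xi brC subrr. Qed.
Lemma Xi_shf F G : mperiodic Q F -> mperiodic Q G -> Xi (shf F) (shf G) = Xi F G \Po ('X + 1).
Proof.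
move=> pF pG; rewrite /Xi !DDshf // !mean_prod_shf //; try exact: DDper.
by rewrite raddfB.
Qed.

(** Work of the force on a slow coordinate, with d1 and d2 as defects. The last term is half a total
    derivative when DD is d/dX and vanishes when DD is antisymmetric for the mean product: this is
    where the two invariants differ. *)
Lemma slow_id (hc : C) (x u G d1 d2 : modf) : mperiodic Q x -> mperiodic Q u ->
  (forall m, shf x m = x m + hc *: shf u m + d1 m) ->
  (forall m, shf u m = u m - hc *: G m + d2 m) ->
  mean_prod (DD x) u \Po ('X + 1) - mean_prod (DD x) u =
  - hc *: mean_prod (DD x) G + mean_prod (DD x) d2 + mean_prod (DD d1) (shf u) + hc *: mean_prod (DD (shf u)) (shf u).
Proof.
move=> px pu ex eu; rewrite -mean_prod_shf //; last exact: DDper.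
rewrite -DDshf // (_ : shf x = fun m => (x m + hc *: shf u m) + d1 m); last exact/funext.
rewrite op_linD (op_linD x) op_linZ !brDl brZl.
have -> : mean_prod (DD x) (shf u) = mean_prod (DD x) u - hc *: mean_prod (DD x) G + mean_prod (DD x) d2.
  rewrite (br_ext (fun=> erefl) eu) brDr brBr brZr //.
by rewrite scaleNr; ring.
Qed.

(** The multipliers of f and k are inverse to each other, so the free motion preserves [Xi]. Both
    are driven by the same r, whose self-product vanishes, and the cross terms combine into the
    product of r with the position q. *)
Lemma fast_id (mu nu : C) (f k q r d1 d2 : modf) : mperiodic Q f -> mperiodic Q k ->
  mu * nu = 1 ->
  (forall m, shf f m = mu *: f m + (r m + d1 m)) ->
  (forall m, shf k m = nu *: k m + (r m + d2 m)) ->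
  (forall m, (mu - nu) *: q m = mu *: f m - nu *: k m) ->
  Xi f k \Po ('X + 1) - Xi f k = (mu - nu) *: Xi q r +
    (mu *: Xi f d2 - nu *: Xi k d1 + Xi r d2 + Xi d1 r + Xi d1 d2).
Proof.
move=> pf pk mn ef ek eq; rewrite -Xi_shf //.
rewrite (_ : shf f = fun m => mu *: f m + (r m + d1 m)); last exact/funext.
rewrite (_ : shf k = fun m => nu *: k m + (r m + d2 m)); last exact/funext.
have -> : (mu - nu) *: Xi q r = mu *: Xi f r - nu *: Xi k r.
  rewrite -XiZl (_ : (fun m => (mu - nu) *: q m) = fun m => mu *: f m + (- nu) *: k m).
    by rewrite XiDl !XiZl scaleNr.
  by apply/funext => m; rewrite eq scaleNr.
rewrite !(XiDl, XiDr, XiZl, XiZr) Xi_same scalerA mn scale1r (XiC r k) (XiC d1 k) !scalerN.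
move: (Xi f k) (mu *: Xi f r) (mu *: Xi f d2) (nu *: Xi k r) (nu *: Xi k d1).
move: (Xi r d2) (Xi d1 r) (Xi d1 d2) => a b c p1 p2 p3 p4 p5; ring.
Qed.
End Derivation.

Definition Dm (F : modf) : modf := fun m => (F m)^`().

Lemma Dm_lin a F G : Dm (fun m => a *: F m + G m) = (fun m => a *: Dm F m + Dm G m).
Proof. by apply/funext => m; rewrite /Dm derivD derivZ. Qed.
Lemma Dm_per F : mperiodic Q F -> mperiodic Q (Dm F).
Proof. by move=> pF m; rewrite /Dm pF. Qed.
Lemma Dm_shf F : Dm (shf F) = shf (Dm F).
Proof.
apply/funext => m; rewrite /Dm /shf deriv_comp derivD derivX -polyC1 derivC addr0 mulr1 //.
Qed.
Lemma mean_prod_deriv F G : (mean_prod F G)^`() = mean_prod (Dm F) G + mean_prod F (Dm G).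
Proof.
rewrite /mean_prod -mean_deriv -meanD; apply: mean_ext => m; by rewrite derivM.
Qed.
Lemma Xi_Dm F G : Xi Dm F G = 2 *: mean_prod (Dm F) G - (mean_prod F G)^`().
Proof.
by rewrite mean_prod_deriv /Xi scaler_nat mulr2n; move: (mean_prod (Dm F) G) (mean_prod F (Dm G)) => a b; ring.
Qed.

Lemma lin_slow (fn : {poly C} -> C) (A B g e1 e2 S : {poly C}) a :
  (forall p q, fn (p + q) = fn p + fn q) -> (forall b p, fn (b *: p) = b * fn p) ->
  A - B = - a *: g + e1 + e2 + a *: S -> fn A = fn B - a * fn g + fn (e1 + e2) + a * fn S.
Proof.
move=> fD fZ e; have -> : A = B + (- a) *: g + (e1 + e2) + a *: S.
  by rewrite -[LHS](subrK B) e; move: (_ *: g) (_ *: S) => p q; ring.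
by rewrite !(fD (_ + _)) fD !fZ mulNr.
Qed.

Lemma lin_fast (fn : {poly C} -> C) (A B X E : {poly C}) a :
  (forall p q, fn (p + q) = fn p + fn q) -> (forall b p, fn (b *: p) = b * fn p) ->
  A - B = a *: X + E -> fn A = fn B + a * fn X + fn E.
Proof.
move=> fD fZ e; have -> : A = B + a *: X + E.
  by rewrite -[LHS](subrK B) e; move: (_ *: X) => p; ring.
by rewrite (fD (_ + _)) fD fZ.
Qed.

Let h0D (p q : {poly C}) : (p + q).[0] = p.[0] + q.[0]. Proof. exact: hornerD. Qed.
Let h0Z a (p : {poly C}) : (a *: p).[0] = a * p.[0]. Proof. exact: hornerZ. Qed.

Section Functionals.
Variables (n : nat) (fast : pred 'I_n) (hc : C) (wc mu nu : 'I_n -> C).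
Hypotheses (hc0 : hc != 0) (wc0 : forall c, fast c -> wc c != 0).
Hypotheses (mn : forall c, fast c -> mu c * nu c = 1) (mn0 : forall c, fast c -> mu c - nu c != 0).

(* Noether invariants of the averaged system, at slow time between 0 and 1: of
   translation in X (slow_functional) and of the phase rotation DD = Theta
   (fast_functional). *)
Definition slow_functional (x u f k q G : 'I_n -> modf) (P : modf) : C := (mean Q P).[0]
  + \sum_(c | ~~ fast c) (hc^-1 * int01 (mean_prod (Dm (x c)) (u c)) - 2^-1 * (mean_prod (u c) (u c)).[1])
  + \sum_(c | fast c) ((2 * wc c * (mu c - nu c))^-1 * int01 (Xi Dm (f c) (k c))
       - 2^-1 * (mean_prod (q c) (G c)).[0]).

Definition fast_functional (DD : modf -> modf) (x u f k : 'I_n -> modf) : C :=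
  \sum_(c | ~~ fast c) (hc^-1 * (mean_prod (DD (x c)) (u c)).[0])
  + \sum_(c | fast c) ((2 * wc c * (mu c - nu c))^-1 * (Xi DD (f c) (k c)).[0]).

Definition slow_err (DD : modf -> modf) (x u d1 d2 : 'I_n -> modf) c : {poly C} :=
  mean_prod (DD (x c)) (d2 c) + mean_prod (DD (d1 c)) (shf (u c)).
Definition fast_err (DD : modf -> modf) (f k r d1 d2 : 'I_n -> modf) c : {poly C} :=
  mu c *: Xi DD (f c) (d2 c) - nu c *: Xi DD (k c) (d1 c) + Xi DD (r c) (d2 c)
    + Xi DD (d1 c) (r c) + Xi DD (d1 c) (d2 c).

Section Step.
Variables (x u f k q G d1 d2 : 'I_n -> modf).
Let r (c : 'I_n) (m : int) : {poly C} := - wc c *: G c m.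
Hypotheses (px : forall c, mperiodic Q (x c)) (pu : forall c, mperiodic Q (u c)).
Hypotheses (pf : forall c, mperiodic Q (f c)) (pk : forall c, mperiodic Q (k c)).
Hypotheses (pq : forall c, mperiodic Q (q c)) (pG : forall c, mperiodic Q (G c)).
Hypothesis ex : forall c, ~~ fast c -> forall m, shf (x c) m = x c m + hc *: shf (u c) m + d1 c m.
Hypothesis eu : forall c, ~~ fast c -> forall m, shf (u c) m = u c m - hc *: G c m + d2 c m.
Hypothesis ef : forall c, fast c -> forall m, shf (f c) m = mu c *: f c m + (r c m + d1 c m).
Hypothesis ek : forall c, fast c -> forall m, shf (k c) m = nu c *: k c m + (r c m + d2 c m).
Hypothesis eq : forall c, fast c -> forall m, (mu c - nu c) *: q c m = mu c *: f c m - nu c *: k c m.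
Hypothesis qx : forall c, ~~ fast c -> forall m, (q c m)^`() = (x c m)^`().

Let s1 (p : {poly C}) : (p \Po ('X + 1)).[0] = p.[1].
Proof. by rewrite horner_comp !hornerE. Qed.

Lemma fast_arith (a b e1 e2 v w W m : C) : W != 0 -> m != 0 ->
  a = b + m * (- W * (2 * e1 - (v - w))) + e2 ->
  (2 * W * m)^-1 * a - 2^-1 * v - ((2 * W * m)^-1 * b - 2^-1 * w) + e1 = (2 * W * m)^-1 * e2.
Proof. by move=> W0 m0 ->; field; rewrite m0 W0. Qed.

Let bs (F : 'I_n -> C) : \sum_c F c = \sum_(c | ~~ fast c) F c + \sum_(c | fast c) F c.
Proof. by rewrite (bigID fast) /= addrC. Qed.

(** Energy balance: the gain of mean potential over one step is the integrated work of G along the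
    velocity of q, which cancels the work terms of [slow_id] and [fast_id]. In slow components the
    remaining h <Du, u> integrates to half a difference of squares, cancelled by the kinetic
    correction; in fast ones an integration by parts produces the boundary term in <q, G>. *)
Lemma slow_functional_step P : mperiodic Q P -> (forall m, (P m)^`() = \sum_c G c m * (q c m)^`()) ->
  slow_functional (fun c => shf (x c)) (fun c => shf (u c)) (fun c => shf (f c)) (fun c => shf (k c))
     (fun c => shf (q c)) (fun c => shf (G c)) (shf P) - slow_functional x u f k q G P =
  \sum_(c | ~~ fast c) hc^-1 * int01 (slow_err Dm x u d1 d2 c) +
  \sum_(c | fast c) (2 * wc c * (mu c - nu c))^-1 * int01 (fast_err Dm f k r d1 d2 c).
Proof.
move=> pP eP; rewrite /slow_functional mean_shf // s1.
(* Fundamental theorem over one unit of slow time, with the chain rule [eP]. *)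
have -> : (mean Q P).[1] = (mean Q P).[0] + \sum_c int01 (mean_prod (G c) (Dm (q c))).
  apply/eqP; rewrite addrC -subr_eq -int01_deriv -mean_deriv -int01_sum; apply/eqP.
  by congr int01; rewrite /mean_prod -mean_sum; apply: mean_ext => m; rewrite eP.
rewrite (bs (fun c => int01 (mean_prod (G c) (Dm (q c))))).
set Ss := \sum_(c | ~~ fast c) int01 _; set Sf := \sum_(c | fast c) int01 _.
set a1 := \sum_(c | ~~ fast c) _; set a2 := \sum_(c | fast c) _.
set b1 := \sum_(c | ~~ fast c) _; set b2 := \sum_(c | fast c) _.
set c1 := \sum_(c | ~~ fast c) _; set c2 := \sum_(c | fast c) _.
suff [h1 h2] : a1 - b1 + Ss = c1 /\ a2 - b2 + Sf = c2.
  by rewrite -h1 -h2; ring.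
split.
  rewrite -sumrB -big_split /=; apply: eq_bigr => c sc.
  have id := slow_id Dm_lin Dm_per (fun F _ => Dm_shf F) (px c) (pu c) (ex sc) (eu sc).
  have := lin_slow (@int01D _) (@int01Z _) id.
  rewrite -mean_prod_shf //; last exact: Dm_per.
  rewrite -Dm_shf -/(slow_err Dm x u d1 d2 c).
  have -> : int01 (mean_prod (G c) (Dm (q c))) = int01 (mean_prod (Dm (x c)) (G c)).
    by congr int01; rewrite brC; apply: br_ext => // m; rewrite /Dm qx.
  have -> : int01 (mean_prod (Dm (shf (u c))) (shf (u c))) =
     2^-1 * ((mean_prod (shf (u c)) (shf (u c))).[1] - (mean_prod (u c) (u c)).[1]).
    rewrite -[(mean_prod (u c) (u c)).[1]]s1 -mean_prod_shf // -int01_deriv mean_prod_deriv (brC (shf _)).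
    by rewrite int01D; field.
  move: (int01 (mean_prod (Dm (shf (x c))) _)) (int01 (mean_prod (Dm (x c)) (u c))) => a b.
  move: (int01 (mean_prod (Dm (x c)) _)) (int01 (slow_err _ _ _ _ _ _)) => e1 e2.
  by move: ((mean_prod _ _).[1]) ((mean_prod _ _).[1]) => v w ->; field.
rewrite -sumrB -big_split /=; apply: eq_bigr => c fc.
have id := fast_id Dm_lin Dm_per (fun F _ => Dm_shf F) (pf c) (pk c) (mn fc) (ef fc) (ek fc) (eq fc).
have := lin_fast (@int01D _) (@int01Z _) id.
rewrite -(Xi_shf Dm_per (fun F _ => Dm_shf F)) // -/(fast_err Dm f k r d1 d2 c).
have xq : int01 (Xi Dm (q c) (G c)) = 2 * int01 (mean_prod (Dm (q c)) (G c)) -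
    ((mean_prod (q c) (G c)).[1] - (mean_prod (q c) (G c)).[0]).
  by rewrite Xi_Dm int01B int01Z int01_deriv.
rewrite (XiZr Dm_lin) int01Z xq (mean_prod_shf (pq c) (pG c)) s1 (brC (G c)).
by apply: fast_arith; rewrite ?mn0 ?wc0.
Qed.

(** No potential compensates the work here: the sum of the products of G with DD q is left over, and
    [force_balance] later shows that it is small. *)
Lemma fast_functional_step DD :
  (forall a F G, DD (fun m => a *: F m + G m) = (fun m => a *: DD F m + DD G m)) ->
  (forall F, mperiodic Q F -> mperiodic Q (DD F)) ->
  (forall F, mperiodic Q F -> DD (shf F) = shf (DD F)) ->
  (forall c, ~~ fast c -> mean_prod (DD (u c)) (u c) = 0) ->
  (forall c, fast c -> mean_prod (q c) (DD (G c)) = - mean_prod (DD (q c)) (G c)) ->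
  (forall c, ~~ fast c -> DD (q c) = DD (x c)) ->
  fast_functional DD (fun c => shf (x c)) (fun c => shf (u c)) (fun c => shf (f c)) (fun c => shf (k c))
   - fast_functional DD x u f k =
  - (\sum_c (mean_prod (G c) (DD (q c))).[0]) +
  \sum_(c | ~~ fast c) hc^-1 * (slow_err DD x u d1 d2 c).[0] +
  \sum_(c | fast c) (2 * wc c * (mu c - nu c))^-1 * (fast_err DD f k r d1 d2 c).[0].
Proof.
move=> lin per dshf uu qG DDqx; rewrite /fast_functional.
rewrite (bs (fun c => (mean_prod (G c) (DD (q c))).[0])).
set Ss := \sum_(c | ~~ fast c) (mean_prod _ _).[0]; set Sf := \sum_(c | fast c) (mean_prod _ _).[0].
set a1 := \sum_(c | ~~ fast c) _; set a2 := \sum_(c | fast c) _.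
set b1 := \sum_(c | ~~ fast c) _; set b2 := \sum_(c | fast c) _.
set c1 := \sum_(c | ~~ fast c) _; set c2 := \sum_(c | fast c) _.
suff [h1 h2] : a1 - b1 + Ss = c1 /\ a2 - b2 + Sf = c2.
  by rewrite -h1 -h2; ring.
split.
  rewrite -sumrB -big_split /=; apply: eq_bigr => c sc.
  have id := slow_id lin per dshf (px c) (pu c) (ex sc) (eu sc).
  have := lin_slow h0D h0Z id.
  rewrite -mean_prod_shf //; last exact: per.
  have -> : mean_prod (DD (shf (u c))) (shf (u c)) = 0.
    by rewrite dshf // mean_prod_shf // ?uu ?comp_poly0 //; exact: per.
  rewrite -dshf // horner0 mulr0 addr0 -DDqx // (brC (G c)).
  rewrite -/(slow_err DD x u d1 d2 c) !DDqx //.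
  move: ((mean_prod (DD (shf (x c))) _).[0]) ((mean_prod (DD (x c)) (u c)).[0]) => a b.
  move: ((mean_prod (DD (x c)) _).[0]) ((slow_err _ _ _ _ _ _).[0]) => e1 e2 ->.
  by field.
rewrite -sumrB -big_split /=; apply: eq_bigr => c fc.
have id := fast_id lin per dshf (pf c) (pk c) (mn fc) (ef fc) (ek fc) (eq fc).
have := lin_fast h0D h0Z id.
rewrite -(Xi_shf per dshf) // -/(fast_err DD f k r d1 d2 c) (XiZr lin).
rewrite [Xi DD (q c) (G c)]/Xi qG // opprK (brC (G c)) hornerZ (hornerD (mean_prod (DD (q c)) (G c))).
move=> h; have := @fast_arith (Xi DD (shf (f c)) (shf (k c))).[0] (Xi DD (f c) (k c)).[0]
  (mean_prod (DD (q c)) (G c)).[0] (fast_err DD f k r d1 d2 c).[0] 0 0 _ _ (wc0 fc) (mn0 fc).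
by rewrite !mulr0 !subr0; apply; rewrite mulr_natl mulr2n.
Qed.

End Step.
End Functionals.
End Brackets.

(** * Rotation of the phases *)

Section PhaseRotation.
Variables (R : realType) (ell : nat).
Local Notation C := R[i].
Local Notation modf := (modf R).
Variables (th : 'I_ell -> R) (Q : nat).
Hypotheses (Q0 : (0 < Q)%N) (chrQ : forall k, chr th k Q = 1).
Local Notation chr := (chr th).

Lemma min_label_ex (v : C) : (exists k, chr k 1 = v) ->
  exists k, chr k 1 = v /\ forall k', chr k' 1 = v -> (lnorm k <= lnorm k')%N.
Proof.
move=> [k0 hk0].
pose p n := `[< exists k, chr k 1 = v /\ lnorm k = n >].
have pex : exists n, p n by exists (lnorm k0); apply/asboolP; exists k0.
case: (ex_minnP pex) => n /asboolP [k [hk kn]] mn; exists k; split=> // k' hk'.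
by rewrite kn; apply: mn; apply/asboolP; exists k'.
Qed.

(** A shortest representative of a resonance class, so that phases read off from it are bounded by
    the order of any label in the class. The default 0 gives lift zero to values that no character
    takes. *)
Definition min_label (v : C) : lab ell :=
  if pselect (exists k, chr k 1 = v) is left h then projT1 (cid (min_label_ex h)) else 0.

Lemma min_labelP k : chr (min_label (chr k 1)) 1 = chr k 1 /\
  forall k', chr k' 1 = chr k 1 -> (lnorm (min_label (chr k 1)) <= lnorm k')%N.
Proof.
rewrite /min_label; case: pselect => [h|]; last by case; exists k.
by case: (cid (min_label_ex h)).
Qed.

Lemma min_label_norm k : (lnorm (min_label (chr k 1)) <= lnorm k)%N.
Proof. by have [_] := min_labelP k; apply. Qed.

Lemma chrV k m : (chr k m)^-1 = chr (- k) m.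
Proof. by rewrite chrN. Qed.

(* Half the difference of the minimal phases of v and v^-1, so that the lift is
   odd; on classes without resonance it is the phase itself. *)
Definition lift_phase v : R := 2^-1 * (phase th (min_label v) - phase th (min_label v^-1)).

Lemma lift_phaseV v : lift_phase v^-1 = - lift_phase v.
Proof. by rewrite /lift_phase invrK; ring. Qed.

Lemma lift_phase_out v : ~ (exists k, chr k 1 = v) -> lift_phase v = 0.
Proof.
move=> nk; have m0 w : (w = v \/ w = v^-1) -> min_label w = 0.
  move=> hw; rewrite /min_label; case: pselect => // -[k ek]; case: nk.
  case: hw => ew; first by exists k; rewrite ek.
  by exists (- k); rewrite -chrV ek ew invrK.
by rewrite /lift_phase (m0 v) ?(m0 v^-1) ?subrr ?mulr0 //; [right|left].
Qed.

(** The Q-th roots of unity: a finite set containing the values at 1 of all characters, over which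
    resonance classes can be summed. *)
Definition vals : seq C := undup (projT1 (closed_field_poly_normal ('X^Q - 1 : {poly C}))).

Lemma chr_vals k : chr k 1 \in vals.
Proof.
rewrite mem_undup; case: closed_field_poly_normal => s /= e.
have : root ('X^Q - 1) (chr k 1).
  by rewrite rootE !hornerE -chr_nat chrQ subrr.
have l1 : lead_coef ('X^Q - 1 : {poly C}) = 1.
  by apply/eqP; rewrite -monicE; apply: monicXnsubC.
by rewrite e l1 scale1r root_prod_XsubC.
Qed.

(** Generator of the phase rotation: i times the lifted phase on each resonance class. Built from
    projections, it depends on F alone and not on a list of terms representing F. *)
Definition Theta (F : modf) : modf :=
  fun m => \sum_(v <- vals) (0 +i* lift_phase v)%C *: lproj th Q (min_label v) F m.

Lemma Theta_lin a F G : Theta (fun m => a *: F m + G m) = (fun m => a *: Theta F m + Theta G m).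
Proof.
apply/funext => m; rewrite /Theta scaler_sumr -big_split; apply: eq_bigr => v _ /=.
have -> : lproj th Q (min_label v) (fun m => a *: F m + G m) m =
   a *: lproj th Q (min_label v) F m + lproj th Q (min_label v) G m.
  have -> : (fun m => a *: F m + G m) = (fun m => a *: F m - (- 1) *: G m).
    by apply/funext => m'; rewrite scaleN1r opprK.
  rewrite (proj_sub th Q (fun m => a *: F m) (fun m => -1 *: G m)) !(proj_scale).
  by rewrite scaleN1r opprK.
by rewrite scalerDr !scalerA (mulrC a).
Qed.

Lemma Theta_per F : mperiodic Q F -> mperiodic Q (Theta F).
Proof.
move=> pF m; apply: eq_bigr => v _; congr (_ *: _).
by rewrite /lproj chr_mod.
Qed.

Lemma Theta_shf F : mperiodic Q F -> Theta (shf F) = shf (Theta F).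
Proof.
move=> pF; apply/funext => m; rewrite /Theta.
rewrite (shf_sum _ _ (fun v m => (0 +i* lift_phase v)%C *: lproj th Q (min_label v) F m)).
by apply: eq_bigr => v _; rewrite shfZ -proj_shf.
Qed.

Definition tlift (t : mterm R ell) : mterm R ell :=
  ((0 +i* lift_phase (chr t.2 1))%C * t.1.1, t.1.2, t.2).

Lemma Theta_tfun t m : Theta (tfun th t) m = tfun th (tlift t) m.
Proof.
rewrite /Theta (bigD1_seq (chr t.2 1)) ?undup_uniq ?chr_vals //=.
rewrite proj_tfun // (proj1 (min_labelP t.2)) eqxx big1 => [|v vt].
  by rewrite addr0 /tfun /tlift /= scalerA mulrA.
rewrite proj_tfun //; case: ifP => [/eqP e|_]; last by rewrite scaler0.
case: (pselect (exists k, chr k 1 = v)) => [[k ek]|nk].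
  by move: vt e; rewrite -ek (proj1 (min_labelP k)) => /eqP h e; case: h; rewrite e.
by rewrite (lift_phase_out nk) scale0r.
Qed.

Lemma Theta_list T F : (forall m, F m = \sum_(t <- T) tfun th t m) ->
  forall m, Theta F m = \sum_(t <- T) tfun th (tlift t) m.
Proof.
move=> e; have -> : F = (fun m => \sum_(t <- T) tfun th t m) by apply/funext.
elim: T {F e} => [|t T IH] m.
  rewrite big_nil; rewrite (_ : (fun _ => _) = fun=> 0); last by apply/funext => m'; rewrite big_nil.
  by rewrite (op_lin0 Theta_lin).
rewrite big_cons -IH -Theta_tfun.
rewrite (_ : (fun m => \sum_(j <- t :: T) tfun th j m) = fun m => 1 *: tfun th t m + \sum_(j <- T) tfun th j m).
  by rewrite Theta_lin scale1r.
by apply/funext => m'; rewrite big_cons scale1r.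
Qed.

Section Bounds.
Variables (tau sig b : R).
Hypotheses (tau1 : 1 <= tau) (sig1 : 1 <= sig) (b0 : 0 <= b) (hb : forall j, `|th j| <= b).

Lemma phase_le k : `|phase th k| <= (lnorm k)%:R * b.
Proof.
apply: le_trans (ler_norm_sum _ _ _) _; rewrite /lnorm natr_sum mulr_suml.
apply: ler_sum => j _; rewrite normrM; apply: ler_pM => //.
by rewrite -intr_norm -abszE.
Qed.

Lemma lift_le k : `|lift_phase (chr k 1)| <= (lnorm k)%:R * b.
Proof.
have H k' : `|phase th (min_label (chr k' 1))| <= (lnorm k')%:R * b.
  by apply: le_trans (phase_le _) _; rewrite ler_wpM2r // ler_nat min_label_norm.
have := H k; have := H (- k); rewrite lnormN -chrV => h1 h2.
rewrite /lift_phase normrM ger0_norm ?invr_ge0 //.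
have := ler_normB (phase th (min_label (chr k 1))) (phase th (min_label (chr k 1)^-1)); lra.
Qed.

Lemma rep_Theta w d B F : rep th tau sig w d B F -> rep th tau sig w d (d%:R * b * B) (Theta F).
Proof.
move=> [T [h1 h2 h3]]; exists [seq tlift t | t <- T]; split.
- by rewrite all_map; apply: sub_all h1.
- rewrite big_map; apply: le_trans (ler_wpM2l _ h2); last by rewrite mulr_ge0.
  rewrite mulr_sumr big_seq [leRHS]big_seq; apply: ler_sum => t tT.
  rewrite /twt /= cabsM -!mulrA [leRHS]mulrA; apply: ler_wpM2r.
    by rewrite !mulr_ge0 ?exprn_ge0 ?cabs_ge0 // (le_trans ler01).
  have -> : cabs (0 +i* lift_phase (chr t.2 1))%C = `|lift_phase (chr t.2 1)|.
    by rewrite /cabs /= expr0n /= add0r sqrtr_sqr.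
  apply: le_trans (lift_le _) _; apply: ler_wpM2r => //; rewrite ler_nat.
  by apply: leq_trans (allP h1 _ tT); rewrite /tdeg leq_addl.
- by move=> m; rewrite big_map; exact: Theta_list.
Qed.
End Bounds.

(** The mean of a product pairs the class of v with that of v^-1 only, and the lift is odd. *)
Lemma Theta_anti tau sig w w' d d' B B' F G : rep th tau sig w d B F -> rep th tau sig w' d' B' G ->
  mean_prod Q (Theta F) G = - mean_prod Q F (Theta G).
Proof.
move=> [T [_ _ eF]] [T' [_ _ eG]].
have term t t' : mean_prod Q (tfun th (tlift t)) (tfun th t') = - mean_prod Q (tfun th t) (tfun th (tlift t')).
  have e1 (a b : mterm R ell) : mean_prod Q (tfun th a) (tfun th b) =
      mean Q (tfun th (a.1.1 * b.1.1, (a.1.2 + b.1.2)%N, a.2 + b.2)).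
    apply: mean_ext => m; rewrite /tfun /= chrD -scalerAl -scalerAr scalerA -exprD.
    by congr (_ *: _); rewrite mulrACA.
  rewrite !e1 !mean_tfun //=; case: ifP => [/eqP e|_]; last by rewrite oppr0.
  have -> : chr t'.2 1 = (chr t.2 1)^-1.
    by apply: (mulfI (chr_neq0 th t.2 1)); rewrite mulfV ?chr_neq0 // -chrD.
  rewrite lift_phaseV -scaleNr; congr (_ *: _).
  have -> : (0 +i* - lift_phase (chr t.2 1))%C = - (0 +i* lift_phase (chr t.2 1))%C.
    by rewrite -[in RHS]oppr0; congr (_ +i* _)%C; rewrite ?oppr0.
  by rewrite !mulNr mulrN opprK mulrCA !mulrA.
rewrite (br_ext Q (Theta_list eF) eG) (br_ext Q eF (Theta_list eG)).
have sumb (S S' : seq (mterm R ell)) (p r : mterm R ell -> mterm R ell) :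
  mean_prod Q (fun m => \sum_(t <- S) tfun th (p t) m) (fun m => \sum_(t <- S') tfun th (r t) m) =
  \sum_(t <- S) \sum_(t' <- S') mean_prod Q (tfun th (p t)) (tfun th (r t')).
  rewrite /mean_prod; under eq_bigr do rewrite -mean_sum.
  rewrite -mean_sum; apply: mean_ext => m; rewrite mulr_suml; apply: eq_bigr => t _.
  by rewrite mulr_sumr.
rewrite (sumb T T' tlift id) (sumb T T' id tlift) -sumrN; apply: eq_bigr => t _.
by rewrite -sumrN; apply: eq_bigr => t' _.
Qed.

Lemma Theta_same tau sig w d B F : rep th tau sig w d B F -> mean_prod Q (Theta F) F = 0.
Proof.
move=> rF; have := Theta_anti rF rF; rewrite (brC Q F) => /eqP.
by rewrite -subr_eq0 opprK -mulr2n -scaler_nat scaler_eq0 pnatr_eq0 /= => /eqP.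
Qed.

Lemma mean_chr k (p : {poly C}) : chr k 1 != 1 -> mean Q (fun m => chr k m *: p) = 0.
Proof.
move=> k1; rewrite /mean (_ : \sum_(i < Q) _ = (\sum_(i < Q) chr k 1 ^+ i) *: p); last first.
  by rewrite scaler_suml; apply: eq_bigr => i _; rewrite chr_nat.
by rewrite sum_pow_root ?scale0r ?scaler0 // -chr_nat chrQ.
Qed.

Lemma proj_cst k (p : {poly C}) m : chr k 1 != 1 -> lproj th Q k (fun=> p) m = 0.
Proof.
by move=> k1; rewrite /lproj mean_chr ?scaler0 // chrN invr_eq1.
Qed.

Lemma proj_idem k F m : lproj th Q k (lproj th Q k F) m = lproj th Q k F m.
Proof.
rewrite {1 3}/lproj; set p := mean Q (fun m => chr (- k) m *: F m).
rewrite (_ : mean Q _ = p) // -[RHS](mean_cst Q0); apply: mean_ext => m'; rewrite /lproj -/p.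
by rewrite scalerA -chrD addNr chr0 scale1r.
Qed.

Lemma Theta_cst p : Theta (fun=> p) = fun=> 0.
Proof.
apply/funext => m; rewrite /Theta big1 // => v _.
case: (eqVneq (chr (min_label v) 1) 1) => e; last by rewrite proj_cst ?scaler0.
case: (pselect (exists k, chr k 1 = v)) => [[k ek]|nk].
  have ev : v = 1 by rewrite -e -ek; have [] := min_labelP k.
  by rewrite /lift_phase ev invr1 subrr mulr0 scale0r.
by rewrite (lift_phase_out nk) scale0r.
Qed.

Lemma Theta_proj tau sig w d B k F m : rep th tau sig w d B F ->
  Theta (lproj th Q k F) m = (0 +i* lift_phase (chr k 1))%C *: lproj th Q k F m.
Proof.
move=> [T [_ _ eF]]; have eP := proj_list Q0 chrQ k eF.
rewrite (Theta_list eP) eP scaler_sumr big_seq [RHS]big_seq; apply: eq_bigr => t.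
rewrite mem_filter => /andP [/eqP e _].
by rewrite /tfun /tlift /= scalerA mulrA e.
Qed.

(** A shortest label of the class of k differs from k by a relation of order at most 2 lnorm k <= N,
    whose phase vanishes; the same holds for - k. *)
Lemma lift_phaseE N k : (forall k', (lnorm k' <= N)%N -> chr k' 1 = 1 -> phase th k' = 0) ->
  (2 * lnorm k <= N)%N -> lift_phase (chr k 1) = phase th k.
Proof.
move=> nr kN.
have H k0 : lnorm k0 = lnorm k -> phase th (min_label (chr k0 1)) = phase th k0.
  move=> ek; apply/esym/eqP; rewrite -subr_eq0 -phaseN -phaseD; apply/eqP; apply: nr.
    apply: leq_trans (lnormD _ _) _; rewrite lnormN; apply: leq_trans kN.
    rewrite mul2n -addnn ek leq_add2l -ek; exact: min_label_norm.
  by rewrite chrD chrN (proj1 (min_labelP k0)) mulfV // chr_neq0.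
by rewrite /lift_phase chrV !H ?lnormN // phaseN opprK; field.
Qed.

(** A term carries a coefficient, a power of X, two labels for a class and its inverse, and a common
    bound on their orders. [pfun'] multiplies by i times half the difference of the two phases, as
    [lift_phase] does. *)
Definition pterm := ((C * nat) * (lab ell * lab ell) * nat)%type.
Definition pfun (t : pterm) : modf := fun m => (t.1.1.1 * chr t.1.2.1 m) *: 'X^(t.1.1.2).
Definition pfun' (t : pterm) : modf := fun m =>
  (0 +i* (2^-1 * (phase th t.1.2.1 - phase th t.1.2.2)))%C *: pfun t m.
Definition pwf d (t : pterm) := [/\ (t.1.1.2 + t.2 <= d)%N, (lnorm t.1.2.1 <= t.2)%N,
  (lnorm t.1.2.2 <= t.2)%N & chr t.1.2.2 1 = (chr t.1.2.1 1)^-1].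

Section Joint.
Variables (tau sig b : R).
Hypotheses (tau1 : 1 <= tau) (sig1 : 1 <= sig) (b0 : 0 <= b) (hb : forall j, `|th j| <= b).
Let tau0 : 0 <= tau. Proof. exact: le_trans ler01 tau1. Qed.
Let sig0 : 0 <= sig. Proof. exact: le_trans ler01 sig1. Qed.

Definition pwt (t : pterm) := cabs t.1.1.1 * tau ^+ t.1.1.2 * sig ^+ t.2.

(* A common expansion of F and F' in which F' is F with each coefficient
   multiplied by the lift of its pair of labels: this makes the lift a
   derivation, at the price of no longer being a function of F. *)
Definition prep d (B : R) (F F' : modf) := exists T : seq pterm,
  [/\ forall t, t \in T -> pwf d t, \sum_(t <- T) pwt t <= B,
      forall m, F m = \sum_(t <- T) pfun t m & forall m, F' m = \sum_(t <- T) pfun' t m].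

Lemma prep_ext d B F F' G G' : (forall m, F m = G m) -> (forall m, F' m = G' m) ->
  prep d B F F' -> prep d B G G'.
Proof. by move=> e e' [T [h1 h2 h3 h4]]; exists T; split=> // m; rewrite -?e -?e'. Qed.

Lemma prep_le d d' B B' F F' : (d <= d')%N -> B <= B' -> prep d B F F' -> prep d' B' F F'.
Proof.
move=> dd BB [T [h1 h2 h3 h4]]; exists T; split=> //; last exact: le_trans h2 BB.
by move=> t /h1 [a1 a2 a3 a4]; split=> //; exact: leq_trans dd.
Qed.

Lemma prep0 d B : 0 <= B -> prep d B (fun=> 0) (fun=> 0).
Proof. by move=> B0; exists [::]; split=> [||m|m]; rewrite ?big_nil. Qed.

Lemma prepD d B B' F F' G G' : prep d B F F' -> prep d B' G G' ->
  prep d (B + B') (fun m => F m + G m) (fun m => F' m + G' m).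
Proof.
move=> [T [h1 h2 h3 h4]] [T' [h1' h2' h3' h4']]; exists (T ++ T'); split.
- by move=> t; rewrite mem_cat => /orP [/h1|/h1'].
- by rewrite big_cat lerD.
- by move=> m; rewrite big_cat h3 h3'.
- by move=> m; rewrite big_cat h4 h4'.
Qed.

Lemma prep_sum d (I : Type) (s : seq I) (B : I -> R) (F F' : I -> modf) :
  (forall i, prep d (B i) (F i) (F' i)) ->
  prep d (\sum_(i <- s) B i) (fun m => \sum_(i <- s) F i m) (fun m => \sum_(i <- s) F' i m).
Proof.
move=> h; elim: s => [|i s IH].
  by rewrite big_nil; apply: prep_ext (prep0 _ (lexx 0)) => m; rewrite big_nil.
by rewrite big_cons; apply: prep_ext (prepD (h i) IH) => m; rewrite big_cons.
Qed.

Lemma prepZ d B a F F' : prep d B F F' ->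
  prep d (cabs a * B) (fun m => a *: F m) (fun m => a *: F' m).
Proof.
move=> [T [h1 h2 h3 h4]].
exists [seq ((a * t.1.1.1, t.1.1.2), t.1.2, t.2) | t <- T]; split.
- by move=> _ /mapP [t /h1 [a1 a2 a3 a4] ->].
- rewrite big_map; apply: le_trans (ler_wpM2l (cabs_ge0 a) h2).
  by rewrite mulr_sumr; apply: ler_sum => t _; rewrite /pwt /= cabsM !mulrA.
- move=> m; rewrite big_map h3 scaler_sumr; apply: eq_bigr => t _.
  by rewrite /pfun /= scalerA mulrA.
- move=> m; rewrite big_map h4 scaler_sumr; apply: eq_bigr => t _.
  by rewrite /pfun' /pfun /= !scalerA; congr (_ *: _); ring.
Qed.

(** Labels add under multiplication and phases are additive in the labels, so the Leibniz rule holds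
    exactly; [Theta] itself need not satisfy it, since shortest labels do not add. *)
Lemma prepM d d' B B' F F' G G' : prep d B F F' -> prep d' B' G G' ->
  prep (d + d') (B * B') (fun m => F m * G m) (fun m => F' m * G m + F m * G' m).
Proof.
move=> [T [h1 h2 h3 h4]] [T' [h1' h2' h3' h4']].
exists [seq ((t.1.1.1 * t'.1.1.1, (t.1.1.2 + t'.1.1.2)%N),
   (t.1.2.1 + t'.1.2.1, t.1.2.2 + t'.1.2.2), (t.2 + t'.2)%N) | t <- T, t' <- T'].
have e m (t t' : pterm) :
  pfun ((t.1.1.1 * t'.1.1.1, (t.1.1.2 + t'.1.1.2)%N),
   (t.1.2.1 + t'.1.2.1, t.1.2.2 + t'.1.2.2), (t.2 + t'.2)%N) m = pfun t m * pfun t' m.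
  by rewrite /pfun /= chrD mulrACA exprD -[RHS]scalerAl -[in RHS]scalerAr [RHS]scalerA.
split.
- move=> _ /allpairsP [[t t'] /= [/h1 [a1 a2 a3 a4] /h1' [b1 b2 b3 b4] ->]]; split=> /=.
  + by rewrite addnACA leq_add.
  + by apply: leq_trans (lnormD _ _) _; rewrite leq_add.
  + by apply: leq_trans (lnormD _ _) _; rewrite leq_add.
  + by rewrite !chrD a4 b4 invfM.
- rewrite big_allpairs_dep /=.
  have p0 t : 0 <= pwt t by rewrite /pwt !mulr_ge0 ?exprn_ge0 ?cabs_ge0.
  apply: (@le_trans _ _ ((\sum_(t <- T) pwt t) * (\sum_(t <- T') pwt t))); last first.
    by apply: ler_pM => //; apply: sumr_ge0.
  rewrite mulr_suml; apply: ler_sum => t _; rewrite mulr_sumr; apply: ler_sum => t' _.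
  by rewrite /pwt /= cabsM !exprD le_eqVlt; apply/orP; left; apply/eqP; ring.
- move=> m; rewrite big_allpairs_dep h3 h3' mulr_suml; apply: eq_bigr => t _.
  by rewrite mulr_sumr; apply: eq_bigr => t' _; rewrite -e.
- move=> m; rewrite big_allpairs_dep h3 h3' h4 h4' !mulr_suml -big_split; apply: eq_bigr => t _.
  rewrite /= !mulr_sumr -big_split; apply: eq_bigr => t' _.
  rewrite /pfun' e; set p := pfun t m; set p' := pfun t' m.
  rewrite [LHS]/= -[X in X + _]scalerAl -[X in _ + X]scalerAr -scalerDl /= !phaseD; congr (_ *: _).
  by apply/eqP; rewrite eq_complex /= addr0 eqxx /=; apply/eqP; ring.
Qed.

Lemma prep_cst d c : prep d (cabs c) (fun=> c%:P) (fun=> 0).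
Proof.
exists [:: ((c, 0%N), (0, 0), 0%N)]; split.
- by move=> t; rewrite inE => /eqP ->; split; rewrite //= ?lnorm0 ?chr0 ?invr1.
- by rewrite big_seq1 /pwt /= !mulr1.
- by move=> m; rewrite big_seq1 /pfun /= chr0 mulr1 expr0 alg_polyC.
- by move=> m; rewrite big_seq1 /pfun' /pfun /= subrr mulr0 scale0r.
Qed.

Lemma prep_Theta d B F : rep th tau sig 0 d B F -> prep d B F (Theta F).
Proof.
move=> [T [h1 h2 h3]].
pose f (t : mterm R ell) : pterm :=
  (t.1, (min_label (chr t.2 1), min_label (chr t.2 1)^-1), lnorm t.2).
have ek k m : chr (min_label (chr k 1)) m = chr k m.
  by apply: chr_eq; have [] := min_labelP k.
exists [seq f t | t <- T]; split.
- move=> _ /mapP [t tT ->]; split; rewrite /f /=.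
  + exact: (allP h1 _ tT).
  + exact: min_label_norm.
  + by rewrite chrV -[leqRHS]lnormN; exact: min_label_norm.
  + by rewrite !ek chrV ek.
- rewrite big_map; apply: le_trans h2; apply: ler_sum => t _.
  by rewrite /pwt /twt /= maxn0.
- by move=> m; rewrite big_map h3; apply: eq_bigr => t _; rewrite /pfun /= ek.
- move=> m; rewrite big_map (Theta_list h3); apply: eq_bigr => t _.
  by rewrite /tfun /tlift /pfun' /pfun /f /= ek scalerA mulrA.
Qed.

(** Only terms with trivial character survive the mean. If their order is at most N both phases
    vanish, and otherwise their weight contains sig^(N + 1). *)
Lemma prep_mean N d B F F' :
  (forall k, (lnorm k <= N)%N -> chr k 1 = 1 -> phase th k = 0) ->
  prep d B F F' -> cabs (mean Q F').[0] <= d%:R * b * B / sig ^+ N.+1.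
Proof.
move=> nr [T [h1 h2 _ h4]].
rewrite (mean_ext _ h4) mean_sum horner_sum; apply: le_trans (cabs_sum _ _ _) _.
have sN : 0 < sig ^+ N.+1 by rewrite exprn_gt0 // (lt_le_trans ltr01).
rewrite ler_pdivlMr // mulr_suml.
apply: (@le_trans _ _ (\sum_(t <- T) d%:R * b * pwt t)); last first.
  by rewrite -mulr_sumr; apply: ler_wpM2l => //; rewrite mulr_ge0.
rewrite big_seq [leRHS]big_seq; apply: ler_sum => t /h1 [a1 a2 a3 a4].
have p0 : 0 <= d%:R * b * pwt t.
  by rewrite /pwt !mulr_ge0 ?exprn_ge0 ?cabs_ge0.
rewrite /pfun' meanZ (_ : mean Q (pfun t) = mean Q (tfun th (t.1.1, t.1.2.1))) //.
rewrite mean_tfun //=; case: ifP => [/eqP e|_]; last by rewrite scaler0 horner0 cabs0 mul0r.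
case: (leqP t.2 N) => tN.
  rewrite !nr ?subrr ?mulr0 ?scale0r ?horner0 ?cabs0 ?mul0r //.
  - exact: leq_trans a3 tN.
  - by rewrite a4 e invr1.
  - exact: leq_trans a2 tN.
rewrite !hornerZ hornerXn !cabsM.
have -> : cabs (0 +i* (2^-1 * (phase th t.1.2.1 - phase th t.1.2.2)))%C =
   `|2^-1 * (phase th t.1.2.1 - phase th t.1.2.2)|.
  by rewrite /cabs /= expr0n /= add0r sqrtr_sqr.
rewrite -[X in X <= _]mulrA; apply: ler_pM; rewrite ?mulr_ge0 ?cabs_ge0 ?exprn_ge0 //.
  have td : (t.2 <= d)%N by apply: leq_trans a1; exact: leq_addl.
  have H k : (lnorm k <= t.2)%N -> `|phase th k| <= d%:R * b.
    move=> kt; apply: le_trans (phase_le hb _) _; apply: ler_wpM2r => //.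
    by rewrite ler_nat; exact: leq_trans kt td.
  have := H _ a2; have := H _ a3.
  rewrite normrM ger0_norm ?invr_ge0 //.
  have := ler_normB (phase th t.1.2.1) (phase th t.1.2.2); lra.
rewrite /pwt -!mulrA; apply: ler_wpM2l; first exact: cabs_ge0.
apply: ler_pM; rewrite ?cabs_ge0 ?exprn_ge0 //; last by apply: ler_weXn2l.
case: (t.1.1.2) => [|l]; first by rewrite !expr0 cabs1.
by rewrite exprS mul0r cabs0 exprn_ge0.
Qed.
End Joint.
End PhaseRotation.

(** * Bounds uniform in the family *)

Section BigO.
Variables (R : realType) (I : Type).
Local Notation C := R[i].
Local Notation bO := (@bO R I).
Definition cO (B : I -> R) (f : I -> C) := bO B (fun i => cabs (f i)).

Lemma bO_trans B B' f : bO B' B -> bO B f -> bO B' f.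
Proof.
move=> [A A0 h] [A' A'0 h']; exists (A' * A); first exact: mulr_ge0.
by move=> i; apply: le_trans (h' i) _; rewrite -mulrA; apply: ler_wpM2l.
Qed.

Lemma bO_M b B x y : (forall i, 0 <= x i) -> (forall i, 0 <= y i) ->
  bO b x -> bO B y -> bO (fun i => b i * B i) (fun i => x i * y i).
Proof.
move=> x0 y0 [A A0 h] [A' A'0 h']; exists (A * A'); first exact: mulr_ge0.
by move=> i; rewrite mulrACA; apply: ler_pM.
Qed.

Lemma cO_ext B f f' : (forall i, f i = f' i) -> cO B f -> cO B f'.
Proof. by move=> e [A A0 h]; exists A => // i; rewrite -e. Qed.
Lemma cO_le B B' f : bO B' B -> cO B f -> cO B' f.
Proof. exact: bO_trans. Qed.
Lemma cO_leB B B' f : (forall i, B i <= B' i) -> cO B f -> cO B' f.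
Proof. by move=> h; apply: cO_le; exact: bO_le. Qed.
Lemma cO0 B : (forall i, 0 <= B i) -> cO B (fun=> 0).
Proof. by move=> B0; exists 0 => // i; rewrite cabs0 mul0r. Qed.
Lemma cOD B f f' : cO B f -> cO B f' -> cO B (fun i => f i + f' i).
Proof.
move=> [A A0 h] [A' A'0 h']; exists (A + A'); first exact: addr_ge0.
by move=> i; apply: le_trans (cabsD _ _) _; rewrite mulrDl lerD.
Qed.
Lemma cON B f : cO B f -> cO B (fun i => - f i).
Proof. by move=> [A A0 h]; exists A => // i; rewrite cabsN. Qed.
Lemma cOB B f f' : cO B f -> cO B f' -> cO B (fun i => f i - f' i).
Proof. by move=> h /cON; exact: cOD. Qed.
Lemma cOM B B' f f' : cO B f -> cO B' f' -> cO (fun i => B i * B' i) (fun i => f i * f' i).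
Proof.
move=> h h'; have [A A0 H] := bO_M (fun i => cabs_ge0 _) (fun i => cabs_ge0 _) h h'.
by exists A => // i; rewrite cabsM.
Qed.
Lemma cOMr B f f' : cO B f -> cO (fun=> 1) f' -> cO B (fun i => f i * f' i).
Proof. by move=> h h'; apply: cO_leB (cOM h h') => i; rewrite mulr1. Qed.
Lemma cO_sum B (T : Type) (s : seq T) (P : pred T) (f : T -> I -> C) : (forall i, 0 <= B i) ->
  (forall t, P t -> cO B (f t)) -> cO B (fun i => \sum_(t <- s | P t) f t i).
Proof.
move=> B0 h; elim: s => [|t s IH].
  by apply: cO_ext (cO0 B0) => i; rewrite big_nil.
case Pt: (P t); last by apply: cO_ext IH => i; rewrite big_cons Pt.
by apply: cO_ext (cOD (h _ Pt) IH) => i; rewrite big_cons Pt.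
Qed.
Lemma cO_cst B (a : C) : (forall i, 1 <= B i) -> cO B (fun=> a).
Proof.
move=> h; exists (cabs a) => [|i]; first exact: cabs_ge0.
by rewrite -[leLHS]mulr1; apply: ler_wpM2l; rewrite ?cabs_ge0.
Qed.
End BigO.

Section Unweighted.
Variables (R : realType) (ell : nat) (I : Type).
Local Notation C := R[i].
Variables (th : I -> 'I_ell -> R) (tau : I -> R) (Q : I -> nat) (b : R).
Hypotheses (tau1 : forall i, 1 <= tau i).
Hypotheses (Q0 : forall i, (0 < Q i)%N) (chrQ : forall i k, chr (th i) k (Q i) = 1).
Hypotheses (b0 : 0 <= b) (thb : forall i j, `|th i j| <= b).
Local Notation modf := (modf R).
Implicit Types (F G : I -> modf) (B : I -> R).

(** Once the expansions exist only sizes matter: weights are dropped and the degree is left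
    unspecified. *)
Definition unw B F := exists d, repO th tau (fun=> 1) 0 d B F.

Let one1 (i : I) : 1 <= (1 : R). Proof. exact: lexx. Qed.

Lemma U_ext B F G : (forall i m, F i m = G i m) -> unw B F -> unw B G.
Proof. by move=> e [d h]; exists d; exact: repO_ext h. Qed.
Lemma U_le B B' F : bO B' B -> unw B F -> unw B' F.
Proof. by move=> hB [d h]; exists d; apply: repO_le h. Qed.
Lemma U_leB B B' F : (forall i, B i <= B' i) -> unw B F -> unw B' F.
Proof. by move=> hB; apply: U_le; exact: bO_le. Qed.
Lemma U0 B : (forall i, 0 <= B i) -> unw B (fun _ _ => 0).
Proof. by move=> B0; exists 0%N; exact: repO0. Qed.
Lemma UD B F G : unw B F -> unw B G -> unw B (fun i m => F i m + G i m).
Proof.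
move=> [d h] [d' h']; exists (maxn d d'); apply: repOD.
  exact: (repO_deg (leq_maxl _ _) h).
exact: (repO_deg (leq_maxr _ _) h').
Qed.
Lemma UN B F : unw B F -> unw B (fun i m => - F i m).
Proof. by move=> [d h]; exists d; exact: repON. Qed.
Lemma UB B F G : unw B F -> unw B G -> unw B (fun i m => F i m - G i m).
Proof. by move=> h /UN; exact: UD. Qed.
Lemma U_sum (S : Type) (s : seq S) (P : pred S) B (F : S -> I -> modf) :
  (forall i, 0 <= B i) -> (forall k, P k -> unw B (F k)) ->
  unw B (fun i m => \sum_(k <- s | P k) F k i m).
Proof.
move=> B0 h; elim: s => [|k s IH].
  by apply: U_ext (U0 B0) => i m; rewrite big_nil.
case Pk: (P k); last by apply: U_ext IH => i m; rewrite big_cons Pk.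
by apply: U_ext (UD (h _ Pk) IH) => i m; rewrite big_cons Pk.
Qed.
Lemma UZ (a B : I -> R) (z : I -> C) F : cO a z -> (forall i, 0 <= B i) -> unw B F ->
  unw (fun i => a i * B i) (fun i m => z i *: F i m).
Proof. by move=> ha B0 [d h]; exists d; exact: repOZ. Qed.
Lemma UZr B (z : I -> C) F : cO (fun=> 1) z -> (forall i, 0 <= B i) -> unw B F ->
  unw B (fun i m => z i *: F i m).
Proof. by move=> hz B0 h; apply: U_leB (UZ hz B0 h) => i; rewrite mul1r. Qed.
Lemma UM B B' F G : unw B F -> unw B' G -> unw (fun i => B i * B' i) (fun i m => F i m * G i m).
Proof. by move=> [d h] [d' h']; exists (d + d')%N; exact: repOM. Qed.
Lemma U_shf B F : unw B F -> unw B (fun i => shf (F i)).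
Proof. by move=> [d h]; exists d; exact: repO_shf. Qed.
Lemma U_Dm B F : unw B F -> unw (fun i => B i / tau i) (fun i => Dm (F i)).
Proof. by move=> [d h]; exists d; exact: repO_deriv. Qed.
Lemma U_per B F i : unw B F -> mperiodic (Q i) (F i).
Proof. by move=> [d h]; apply: (repO_per _ i h). Qed.
Lemma repO_mean d B F : repO th tau (fun=> 1) 0 d B F ->
  repO th tau (fun=> 1) 0 d B (fun i _ => mean (Q i) (F i)).
Proof.
by move=> [A A0 h]; exists A => // i; exact: (rep_mean (Q0 i) (chrQ i) _ _ (h i)).
Qed.
Lemma U_mean B F : unw B F -> unw B (fun i _ => mean (Q i) (F i)).
Proof. by move=> [d h]; exists d; exact: repO_mean. Qed.
Lemma repO_proj (kap : I -> lab ell) d B F : repO th tau (fun=> 1) 0 d B F ->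
  repO th tau (fun=> 1) 0 d B (fun i => lproj (th i) (Q i) (kap i) (F i)).
Proof.
by move=> [A A0 h]; exists A => // i; exact: (rep_proj (Q0 i) (chrQ i) _ _ _ (h i)).
Qed.
Lemma U_proj (kap : I -> lab ell) B F : unw B F -> unw B (fun i => lproj (th i) (Q i) (kap i) (F i)).
Proof. by move=> [d h]; exists d; exact: repO_proj. Qed.
Lemma U_Theta B F : unw B F -> unw B (fun i => Theta (th i) (Q i) (F i)).
Proof.
move=> [d [A A0 h]]; exists d; exists (d%:R * b * A); first by rewrite !mulr_ge0.
move=> i; rewrite -mulrA; exact: (rep_Theta (Q0 i) (chrQ i) (tau1 i) _ b0 (thb i) (h i)).
Qed.
Lemma U_br B B' F G : unw B F -> unw B' G ->
  unw (fun i => B i * B' i) (fun i _ => mean_prod (Q i) (F i) (G i)).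
Proof. by move=> h h'; exact: U_mean (UM h h'). Qed.
Lemma U_brB B F F' G G' : unw (fun=> 1) F' -> unw (fun=> 1) G -> (forall i, 0 <= B i) ->
  unw B (fun i m => F i m - F' i m) -> unw B (fun i m => G i m - G' i m) ->
  unw B (fun i _ => mean_prod (Q i) (F i) (G i) - mean_prod (Q i) (F' i) (G' i)).
Proof.
move=> hF hG B0 dF dG.
apply: (U_ext (F := fun i _ => mean_prod (Q i) (fun m => F i m - F' i m) (G i) +
   mean_prod (Q i) (F' i) (fun m => G i m - G' i m))).
  by move=> i _; rewrite brBl brBr addrA subrK.
apply: UD.
  by apply: U_leB (U_br dF hG) => i; rewrite mulr1.
by apply: U_leB (U_br hF dG) => i; rewrite mul1r.
Qed.

Lemma U_fn (fn : {poly C} -> C) B F (m : I -> int) :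
  (forall p q, fn (p + q) = fn p + fn q) -> (forall a p, fn (a *: p) = a * fn p) ->
  (forall l, cabs (fn 'X^l) <= 1) -> unw B F -> cO B (fun i => fn (F i (m i))).
Proof.
move=> fD fZ f1 [d [A A0 h]]; exists A => // i; have [T [_ h2 ->]] := h i.
apply: le_trans h2; elim: T => [|t T IH].
  by rewrite !big_nil -(scale0r 0) fZ mul0r cabs0.
rewrite !big_cons fD; apply: le_trans (cabsD _ _) _; apply: lerD => //.
rewrite /tfun fZ !cabsM cabs_chr mulr1 /twt expr1n mulr1; apply: ler_wpM2l.
  exact: cabs_ge0.
by apply: le_trans (f1 _) _; apply: exprn_ege1.
Qed.
Lemma U_val0 B F (m : I -> int) : unw B F -> cO B (fun i => (F i (m i)).[0]).
Proof.
apply: (@U_fn (fun p => p.[0])) => [p q|a p|l]; rewrite ?hornerD ?hornerZ // hornerXn.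
by case: l => [|l]; rewrite ?expr0 ?cabs1 // exprS mul0r cabs0.
Qed.
Lemma U_val1 B F (m : I -> int) : unw B F -> cO B (fun i => (F i (m i)).[1]).
Proof.
apply: (@U_fn (fun p => p.[1])) => [p q|a p|l]; rewrite ?hornerD ?hornerZ // hornerXn.
by rewrite expr1n cabs1.
Qed.
Lemma U_int B F (m : I -> int) : unw B F -> cO B (fun i => int01 (F i (m i))).
Proof.
apply: (@U_fn (@int01 _)) => [||l]; [exact: int01D|exact: int01Z|].
by rewrite int01_Xn cabsV cabs_nat invf_le1 ?ler1n ?ltr0n.
Qed.
Lemma U_intX B F (m : I -> int) : unw B F -> cO B (fun i => int01 ('X * F i (m i))).
Proof.
apply: (@U_fn (fun p => int01 ('X * p))) => [p q|a p|l].
- by rewrite mulrDr int01D.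
- by rewrite -scalerAr int01Z.
by rewrite -exprS int01_Xn cabsV cabs_nat invf_le1 ?ler1n ?ltr0n.
Qed.

(** What is not constant in X carries a power of X, so factoring out one X gains 1 / tau. *)
Lemma U_slope B F : unw B F -> exists2 G, unw (fun i => B i / tau i) G &
  forall i m, F i m = ((F i m).[0])%:P + 'X * G i m.
Proof.
move=> [d [A A0 h]].
have /choice [G hG] : forall i, exists G : modf, rep (th i) (tau i) 1 0 d (A * (B i / tau i)) G /\
   forall m, F i m = ((F i m).[0])%:P + 'X * G m.
  move=> i; have [T [h1 h2 h3]] := h i.
  exists (fun m => \sum_(t <- [seq (t.1.1, t.1.2.-1, t.2) | t <- T & (0 < t.1.2)%N]) tfun (th i) t m).
  split; last first.
    move=> m; rewrite h3 big_map big_filter mulr_sumr horner_sum raddf_sum /=.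
    rewrite [in X in _ = _ + X]big_mkcond -big_split; apply: eq_bigr => -[[c l] k] _ /=.
    case: l => [|l] /=; first by rewrite /tfun /= expr0 hornerZ hornerC mulr1 addr0 alg_polyC.
    by rewrite /tfun /= hornerZ hornerXn expr0n mulr0 polyC0 add0r -scalerAr -exprS.
  exists [seq (t.1.1, t.1.2.-1, t.2) | t <- T & (0 < t.1.2)%N]; split=> //.
    rewrite all_map; apply/allP => -[[c l] k]; rewrite mem_filter => /andP [_ /(allP h1)].
    by rewrite /tdeg /=; lia.
  rewrite big_map big_filter /=.
  have t0 : 0 < tau i by exact: lt_le_trans ltr01 (tau1 i).
  rewrite mulrA ler_pdivlMr // mulr_suml; apply: le_trans h2.
  rewrite big_mkcond; apply: ler_sum => -[[c l] k] _ /=.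
  rewrite /twt /= !expr1n !mulr1; case: l => [|l] /=; last by rewrite -mulrA -exprSr.
  by rewrite mulr_ge0 ?cabs_ge0.
exists G; last by move=> i; have [] := hG i.
by exists d, A => // i; have [] := hG i.
Qed.

Section FromWeighted.
Variable sig : I -> R.
Hypothesis sig1 : forall i, 1 <= sig i.

Lemma repO_unweight w d B F : (w <= 1)%N -> repO th tau sig w d B F ->
  repO th tau (fun=> 1) 0 d (fun i => B i / sig i ^+ w) F.
Proof.
case: w => [_|[_|//]] [A A0 h]; exists A => // i; rewrite ?expr0 ?expr1.
  rewrite divr1; have [T [h1 h2 h3]] := h i; exists T; split=> //; apply: le_trans h2.
  apply: ler_sum => t _; rewrite /twt expr1n mulr1 -[leLHS]mulr1; apply: ler_wpM2l.
    by rewrite mulr_ge0 ?cabs_ge0 // exprn_ge0 // (le_trans ler01).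
  exact: exprn_ege1.
by rewrite mulrA; exact: (rep_fast1 (tau1 i) (sig1 i) (h i)).
Qed.
Lemma U_rep w d B F : (w <= 1)%N -> repO th tau sig w d B F ->
  unw (fun i => B i / sig i ^+ w) F.
Proof. by move=> w1 h; exists d; exact: repO_unweight. Qed.

Lemma repO_rest d B F : repO th tau sig 0 d B F ->
  repO th tau (fun=> 1) 0 d (fun i => B i / sig i) (fun i m => F i m - mean (Q i) (F i)).
Proof.
move=> [A A0 h]; exists A => // i; rewrite mulrA.
exact: (rep_rest1 (Q0 i) (chrQ i) (tau1 i) (sig1 i) (h i)).
Qed.
Lemma U_rest d B F : repO th tau sig 0 d B F ->
  unw (fun i => B i / sig i) (fun i m => F i m - mean (Q i) (F i)).
Proof. by exists d; exact: repO_rest. Qed.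
End FromWeighted.
End Unweighted.

(** * Taylor shifts of jets *)

Lemma triangle_sum (V : nmodType) n (f : nat -> nat -> V) :
  \sum_(m < n.+1) \sum_(i < m.+1) f (m - i)%N i = \sum_(k < n.+1) \sum_(i < n.+1 - k) f k i.
Proof.
elim: n => [|n IH]; first by rewrite !big_ord1 ?subn0 ?big_ord1 ?subnn.
rewrite big_ord_recr /= IH [in RHS]big_ord_recr /= subSnn big_ord1.
rewrite [X in _ + X = _]big_ord_recl /= subn0 [X in _ + X = _]addrC addrA; congr (_ + _).
rewrite [X in _ + X = _](reindex_inj rev_ord_inj) /= -big_split /=; apply: eq_bigr => k _.
have kn : (k <= n)%N by rewrite -ltnS.
rewrite [in RHS]subSn ?(leqW kn) // big_ord_recr /=; congr (_ + _).
by rewrite /bump /= add1n !subSS subKn // -subSn.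
Qed.

Section JetPoly.
Variables (R : realType) (n : nat).
Local Notation C := R[i].
Implicit Types (A : seq 'I_n -> R) (z w : 'I_n -> {poly C}).

Lemma jet_comp j A z p : jet j A z \Po p = jet j A (fun c => z c \Po p).
Proof.
elim: j A => [|j IH] A; first by rewrite !jetE0 comp_polyC.
by rewrite !jetS raddf_sum; apply: eq_bigr => c _ /=; rewrite rmorphM /= IH.
Qed.

Definition jet_pot L A z : {poly C} := \sum_(j < L.+1) (j`!%:R^-1 : C) *: jet j A z.
Definition jet_dpot L A z w : {poly C} := \sum_(j < L.+1) (j`!%:R^-1 : C) *: djet j A z w.

Lemma jet_pot_comp L A z p : jet_pot L A z \Po p = jet_pot L A (fun c => z c \Po p).
Proof. by rewrite raddf_sum; apply: eq_bigr => j _ /=; rewrite linearZ /= jet_comp. Qed.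

Lemma jet_grad_comp L A z c p : jet_grad L A z c \Po p = jet_grad L A (fun c => z c \Po p) c.
Proof. by rewrite raddf_sum; apply: eq_bigr => j _ /=; rewrite linearZ /= jet_comp. Qed.

Lemma jet_dpot_grad L A z w : jsym A -> jet_dpot L A z w = \sum_c jet_grad L A z c * w c.
Proof.
move=> sA; rewrite /jet_dpot big_ord_recl (_ : djet ord0 A z w = 0) // scaler0 add0r.
under [RHS]eq_bigr do rewrite mulr_suml.
rewrite exchange_big; apply: eq_bigr => j _.
rewrite (_ : djet (lift ord0 j) A z w = djet j.+1 A z w) // djetE // scalerA.
have -> : (lift ord0 j)`!%:R^-1 * j.+1%:R = j`!%:R^-1 :> C.
  rewrite lift0 factS natrM invfM -mulrA mulrCA mulVf ?mulr1 //.
rewrite scaler_sumr; apply: eq_bigr => c _.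
by rewrite -scalerAl mulrC.
Qed.

Lemma deriv_jet_pot L A z : (jet_pot L A z)^`() = jet_dpot L A z (fun c => (z c)^`()).
Proof. by rewrite raddf_sum; apply: eq_bigr => j _ /=; rewrite derivZ deriv_jet. Qed.

Lemma jet_val0 j A z t : (forall c, (z c).[t] = 0) -> (jet j.+1 A z).[t] = 0.
Proof.
by move=> z0; rewrite jetS horner_sum big1 // => c _; rewrite hornerM z0 mul0r.
Qed.

Lemma jet_pot_val0 L A z t : (forall c, (z c).[t] = 0) -> (jet_pot L A z).[t] = (A [::])%:C%C.
Proof.
move=> z0; rewrite /jet_pot big_ord_recl hornerD horner_sum big1 => [|j _]; last first.
  by rewrite hornerZ (_ : jet _ A z = jet j.+1 A z) // jet_val0 ?mulr0.
by rewrite addr0 hornerZ jetE0 hornerC invr1 mul1r.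
Qed.

Lemma jet_grad_val0 L A z c t : (0 < L)%N -> (forall c, (z c).[t] = 0) ->
  (jet_grad L A z c).[t] = (A [:: c])%:C%C.
Proof.
case: L => // L _ z0; rewrite /jet_grad big_ord_recl hornerD horner_sum big1 => [|j _]; last first.
  by rewrite hornerZ (_ : jet (lift ord0 j) _ z = jet j.+1 (fun J => A (c :: J)) z) // jet_val0 ?mulr0.
by rewrite addr0 hornerZ jetE0 hornerC invr1 mul1r.
Qed.

Definition tay (b : 'I_n -> R) A r J : R :=
  \sum_(i < r.+1) i`!%:R^-1 * iter i (jdir b) A J.

(** Re-expansion about a shifted base point, regrouped by powers of z: the coefficient of order k
    becomes the Taylor polynomial, truncated at order L - k, of the k-th derivative along b. *)
Lemma jet_tay L A z (b : 'I_n -> R) : jsym A ->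
  \sum_(m < L.+1) (m`!%:R^-1 : C) *: jet m A (fun c => z c + (b c)%:C%C%:P) =
  \sum_(k < L.+1) (k`!%:R^-1 : C) *: jet k (fun J => tay b A (L - k) J) z.
Proof.
move=> sA.
pose f k i : {poly C} := (k`!%:R^-1 * i`!%:R^-1 : C) *: jet k (iter i (jdir b) A) z.
transitivity (\sum_(m < L.+1) \sum_(i < m.+1) f (m - i)%N i).
  apply: eq_bigr => m _; rewrite jet_shift // scaler_sumr; apply: eq_bigr => i _.
  rewrite scalerA; congr (_ *: _).
  have im : (i <= m)%N by rewrite -ltnS.
  have /(congr1 (fun x : nat => x%:R : C)) := bin_fact im; rewrite !natrM => <-.
  field; rewrite !pnatr_eq0 -!lt0n !fact_gt0 /=.
  have := bin_gt0 m i; lia.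
rewrite triangle_sum; apply: eq_bigr => k _.
have kL : (k <= L)%N by rewrite -ltnS.
rewrite /tay jet_sum scaler_sumr subSn //; apply: eq_bigr => i _.
rewrite jetZ /f scalerA; congr (_ *: _); congr (_ * _).
by rewrite fmorphV rmorph_nat.
Qed.

Lemma jet_pot_base L A A' z b : jsym A -> jet_pot L A (fun c => z c + (b c)%:C%C%:P) - jet_pot L A' z =
  \sum_(k < L.+1) (k`!%:R^-1 : C) *: jet k (fun J => tay b A (L - k) J - A' J) z.
Proof.
move=> sA; rewrite /jet_pot jet_tay // -sumrB; apply: eq_bigr => k _.
rewrite -scalerBr; congr (_ *: _).
have -> : jet k (fun J => tay b A (L - k) J - A' J) z =
  jet k (fun J => tay b A (L - k) J + -1 * A' J) z by apply: jet_ext => J _; rewrite mulN1r.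
by rewrite (jetD _ _ (fun J => -1 * A' J)) jetZ rmorphN1 scaleN1r.
Qed.

Lemma jet_grad_base L A A' z b c : jsym A -> jet_grad L A (fun c => z c + (b c)%:C%C%:P) c - jet_grad L A' z c =
  \sum_(k < L) (k`!%:R^-1 : C) *: jet k (fun J => tay b A (L.-1 - k) (c :: J) - A' (c :: J)) z.
Proof.
case: L => [|L] sA; first by rewrite /jet_grad !big_ord0 subr0.
rewrite (_ : jet_grad L.+1 A _ c = jet_pot L (fun J => A (c :: J)) (fun c => z c + (b c)%:C%C%:P)) //.
rewrite (_ : jet_grad L.+1 A' z c = jet_pot L (fun J => A' (c :: J)) z) // jet_pot_base; last exact: jsym_cons.
apply: eq_bigr => k _; congr (_ *: _); apply: jet_ext => J _; congr (_ - _).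
by apply: eq_bigr => i _; rewrite jdir_iter_cons.
Qed.
End JetPoly.

Section JetFamilies.
Variables (R : realType) (ell n : nat) (I : Type).
Local Notation C := R[i].
Variables (th : I -> 'I_ell -> R) (tau sig : I -> R).
Hypotheses (tau1 : forall i, 1 <= tau i) (sig1 : forall i, 1 <= sig i).
Variables (g : I -> R) (L : nat).
Hypotheses (g0 : forall i, 0 <= g i) (g1 : forall i, g i <= 1) (L1 : (1 <= L)%N).
Local Notation modf := (modf R).
Local Notation repO := (repO th tau sig).
Implicit Types (A : I -> seq 'I_n -> R) (z : 'I_n -> I -> modf).

Let Kf (j : nat) : bO (fun _ : I => 1) (fun i => cabs (j`!%:R^-1 : C)).
Proof. by apply: bO_le => i; exact: fact_inv_le1. Qed.

Let one0 (i : I) : 0 <= 1 :> R. Proof. exact: ler01. Qed.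

Lemma repO_pot d A z : (forall c, repO 0 d g (z c)) -> bounded_arr L A ->
  repO 0 (L * d) (fun=> 1) (fun i m => jet_pot L (A i) (fun c => z c i m)).
Proof.
move=> rz [M M0 bA]; apply: repO_sum => // j _.
apply: (repO_leB (B := fun=> 1 * 1)) => [i|]; first by rewrite mulr1.
apply: repOZ => //.
have jL : (j <= L)%N by rewrite -ltnS.
apply: (repO_deg (d := j * d)); first by rewrite leq_mul2r jL orbT.
by apply: repO_jet => //; exists M => // i J sJ; apply: bA; rewrite sJ.
Qed.

Lemma repO_potB d A z z' D : (forall c, repO 0 d g (z c)) ->
  (forall c, repO 0 d g (z' c)) -> (forall i, 0 <= D i) ->
  (forall c, repO 0 d D (fun i m => z c i m - z' c i m)) -> bounded_arr L A ->
  repO 0 (L * d) D (fun i m => jet_pot L (A i) (fun c => z c i m) - jet_pot L (A i) (fun c => z' c i m)).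
Proof.
move=> rz rz' D0 rd [M M0 bA].
apply: (repO_ext (F := fun i m => \sum_(j < L.+1) (j`!%:R^-1 : C) *:
   (jet j (A i) (fun c => z c i m) - jet j (A i) (fun c => z' c i m)))).
  by move=> i m; rewrite -sumrB; apply: eq_bigr => j _; rewrite scalerBr.
apply: repO_sum => // j _; apply: (repO_leB (B := fun i => 1 * D i)) => [i|].
  by rewrite mul1r.
apply: repOZ => //.
have jL : (j <= L)%N by rewrite -ltnS.
apply: (repO_deg (d := j * d)); first by rewrite leq_mul2r jL orbT.
by apply: repO_jetB => //; exists M => // i J sJ; apply: bA; rewrite sJ.
Qed.

Section Rebase.
Variables (h : I -> R) (b : I -> 'I_n -> R) (A A' : I -> seq 'I_n -> R).
Hypotheses (h0 : forall i, 0 <= h i) (hg : forall i, h i <= g i).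
Hypothesis sA : forall i, jsym (A i).
(** A' is the array at the new base point. Higher derivatives have larger remainders, but they
    multiply as many more factors z of size g; with h <= g every contribution to the potential is of
    order g^(L + 1). *)
Definition taylor_arr := exists2 M : R, 0 <= M & forall i J, (size J <= L)%N ->
  `|tay (b i) (A i) (L - size J) J - A' i J| <= M * h i ^+ (L - size J).+1.
Hypothesis hA : taylor_arr.

Let pre d z (r k : nat) (D : I -> seq 'I_n -> R) : (forall c, repO 0 d g (z c)) ->
  (k <= r)%N -> (exists2 M : R, 0 <= M & forall i J, size J = k -> `|D i J| <= M * h i ^+ (r - k)) ->
  repO 0 (k * d) (fun i => g i ^+ r) (fun i m => jet k (D i) (fun c => z c i m)).
Proof.
move=> rz kr [M M0 hM]; have /choice [B hB] : forall c, exists B, 0 <= B /\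
  forall i, rep (th i) (tau i) (sig i) 0 d (B * g i) (z c i).
  by move=> c; have [B B0 hB] := rz c; exists B.
pose B1 := \sum_c B c.
have B10 : 0 <= B1 by apply: sumr_ge0 => c _; have [] := hB c.
have BB c : B c <= B1.
  by rewrite /B1 (bigD1 c) //= lerDl; apply: sumr_ge0 => c' _; have [] := hB c'.
exists ((n%:R * B1) ^+ k * M); first by rewrite mulr_ge0 ?exprn_ge0 ?mulr_ge0.
move=> i; have H := @rep_jet R ell n (th i) (tau i) (sig i) k (D i) (fun c => z c i) d (B1 * g i)
  (M * h i ^+ (r - k)) (sig1 i) _ (tau1 i) (hM i).
apply: (rep_le (leqnn _)) (H _) => //; last first.
  by move=> c; have [_ /(_ i)] := hB c; apply: rep_le => //; apply: ler_wpM2r.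
rewrite (_ : n%:R * (B1 * g i) = n%:R * B1 * g i) ?mulrA // exprMn -2!mulrA -[X in _ <= X]mulrA.
apply: ler_wpM2l; first by rewrite exprn_ge0 ?mulr_ge0.
rewrite mulrCA; apply: ler_wpM2l => //.
rewrite -[in leRHS](subnKC kr) exprD; apply: ler_wpM2l; first exact: exprn_ge0.
by apply: lerXn2r; rewrite // nnegrE.
Qed.

Lemma repO_pot_base d z : (forall c, repO 0 d g (z c)) ->
  repO 0 (L * d) (fun i => g i ^+ L.+1) (fun i m =>
    jet_pot L (A i) (fun c => z c i m + (b i c)%:C%C%:P) - jet_pot L (A' i) (fun c => z c i m)).
Proof.
move=> rz; have gL i : 0 <= g i ^+ L.+1 by rewrite exprn_ge0.
apply: (repO_ext (F := fun i m => \sum_(k < L.+1) (k`!%:R^-1 : C) *: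
   jet k (fun J => tay (b i) (A i) (L - k) J - A' i J) (fun c => z c i m))).
  by move=> i m; rewrite jet_pot_base.
apply: repO_sum => // k _; have kL : (k <= L)%N by rewrite -ltnS.
apply: (repO_leB (B := fun i => 1 * g i ^+ L.+1)) => [i|]; first by rewrite mul1r.
apply: repOZ => //.
apply: (repO_deg (d := k * d)); first by rewrite leq_mul2r kL orbT.
apply: (pre (D := fun i J => tay (b i) (A i) (L - k) J - A' i J)) => //; first exact: leqW.
have [M M0 hM] := hA; exists M => // i J sJ; rewrite -sJ subSn ?sJ //.
by have := hM i J; rewrite sJ => /(_ kL).
Qed.

Lemma repO_grad_base d z c : (forall c, repO 0 d g (z c)) ->
  repO 0 (L * d) (fun i => g i ^+ L) (fun i m =>
    jet_grad L (A i) (fun c => z c i m + (b i c)%:C%C%:P) c - jet_grad L (A' i) (fun c => z c i m) c).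
Proof.
move=> rz; have gL i : 0 <= g i ^+ L by rewrite exprn_ge0.
apply: (repO_ext (F := fun i m => \sum_(k < L) (k`!%:R^-1 : C) *:
   jet k (fun J => tay (b i) (A i) (L.-1 - k) (c :: J) - A' i (c :: J)) (fun c => z c i m))).
  by move=> i m; rewrite jet_grad_base.
apply: repO_sum => // k _.
apply: (repO_leB (B := fun i => 1 * g i ^+ L)) => [i|]; first by rewrite mul1r.
apply: repOZ => //.
apply: (repO_deg (d := k * d)); first by rewrite leq_mul2r ltnW ?orbT.
apply: (pre (D := fun i J => tay (b i) (A i) (L.-1 - k) (c :: J) - A' i (c :: J))) => //; first exact: ltnW.
have [M M0 hM] := hA; exists M => // i J sJ.
have := hM i (c :: J); rewrite /= sJ => /(_ (ltn_ord k)).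
rewrite (_ : (L - k.+1)%N = L.-1 - k)%N; last by move: (ltn_ord k); lia.
by rewrite (_ : (L.-1 - k).+1 = L - k)%N //; move: (ltn_ord k); lia.
Qed.
End Rebase.

Variable Q : I -> nat.
Variable bt : R.
Hypotheses (Q0 : forall i, (0 < Q i)%N) (chrQ : forall i k, chr (th i) k (Q i) = 1).
Hypotheses (bt0 : 0 <= bt) (thb : forall i j, `|th i j| <= bt).

Lemma prep_jet i d B M (z z' : 'I_n -> modf) j (A : seq 'I_n -> R) : 0 <= B ->
  (forall c, prep (th i) (tau i) (sig i) d B (z c) (z' c)) ->
  (forall J, size J = j -> `|A J| <= M) ->
  prep (th i) (tau i) (sig i) (j * d) ((n%:R * B) ^+ j * M)
   (fun m => jet j A (z^~ m)) (fun m => djet j A (z^~ m) (z'^~ m)).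
Proof.
move=> B0 pz; elim: j A => [|j IH] A hA.
  apply: (@prep_ext _ _ _ _ _ _ _ (fun=> (A [::])%:C%C%:P) (fun=> 0)) => //.
  apply: (prep_le (leqnn _) _ (prep_cst _ _ _ _ _)).
  by rewrite cabs_real mul1r hA.
have -> : (n%:R * B) ^+ j.+1 * M = \sum_(c < n) (B * ((n%:R * B) ^+ j * M)).
  by rewrite sumr_const card_ord -(mulr_natl _ n) exprS; ring.
have H c : prep (th i) (tau i) (sig i) (j.+1 * d) (B * ((n%:R * B) ^+ j * M))
    (fun m => z c m * jet j (fun J => A (c :: J)) (z^~ m))
    (fun m => z' c m * jet j (fun J => A (c :: J)) (z^~ m) +
       z c m * djet j (fun J => A (c :: J)) (z^~ m) (z'^~ m)).
  rewrite mulSn; apply: prepM => //; apply: IH => J sJ; apply: hA.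
  by rewrite /= sJ.
exact: prep_sum H.
Qed.

(* On classes admitting no relation of order N, invariance of the potential
   under the phase shifts makes the averaged force balance vanish to order N. *)
Lemma force_balance N d A z : (forall c, repO 0 d g (z c)) -> bounded_arr L A ->
  (forall i, jsym (A i)) ->
  (forall i k, (lnorm k <= N)%N -> chr (th i) k 1 = 1 -> phase (th i) k = 0) ->
  cO (fun i => (sig i ^+ N.+1)^-1) (fun i => \sum_c (mean_prod (Q i)
     (fun m => jet_grad L (A i) (fun c => z c i m) c) (Theta (th i) (Q i) (z c i))).[0]).
Proof.
move=> rz [M M0 bA] sA nr.
have /choice [B hB] : forall c, exists B, 0 <= B /\
  forall i, rep (th i) (tau i) (sig i) 0 d (B * g i) (z c i).
  by move=> c; have [B B0 hB] := rz c; exists B.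
pose B1 := \sum_c B c.
have B10 : 0 <= B1 by apply: sumr_ge0 => c _; have [] := hB c.
have BB c : B c <= B1.
  by rewrite /B1 (bigD1 c) //= lerDl; apply: sumr_ge0 => c' _; have [] := hB c'.
pose W : R := \sum_(j < L.+1) ((n%:R * B1) ^+ j * M).
have W0 : 0 <= W by apply: sumr_ge0 => j _; rewrite mulr_ge0 ?exprn_ge0 ?mulr_ge0.
exists ((L * d)%:R * bt * W) => [|i]; first by rewrite !mulr_ge0.
have pz c : prep (th i) (tau i) (sig i) d B1 (z c i) (Theta (th i) (Q i) (z c i)).
  apply: (prep_Theta (Q0 i) (chrQ i)); have [_ /(_ i)] := hB c; apply: rep_le => //.
  by apply: le_trans (BB c); rewrite -[leRHS]mulr1; apply: ler_wpM2l => //; have [] := hB c.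
(* Each z is paired with its rotation and the pairing is a derivation, so the companion of the
   potential is the force tested against the rotated z. *)
have pP : prep (th i) (tau i) (sig i) (L * d) W (fun m => jet_pot L (A i) (fun c => z c i m))
   (fun m => \sum_c jet_grad L (A i) (fun c => z c i m) c * Theta (th i) (Q i) (z c i) m).
  apply: (@prep_ext _ _ _ _ _ _ _ (fun m => \sum_(j < L.+1) (j`!%:R^-1 : C) *: jet j (A i) (fun c => z c i m))
    (fun m => \sum_(j < L.+1) (j`!%:R^-1 : C) *: djet j (A i) (fun c => z c i m) (fun c => Theta (th i) (Q i) (z c i) m))) => //.
    by move=> m; rewrite -jet_dpot_grad.
  have H (j : 'I_L.+1) : prep (th i) (tau i) (sig i) (L * d) ((n%:R * B1) ^+ j * M)
     (fun m => (j`!%:R^-1 : C) *: jet j (A i) (fun c => z c i m))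
     (fun m => (j`!%:R^-1 : C) *: djet j (A i) (fun c => z c i m) (fun c => Theta (th i) (Q i) (z c i) m)).
    have jL : (j <= L)%N by rewrite -ltnS.
    apply: (@prep_le _ _ _ _ _ (j * d) _ (cabs (j`!%:R^-1 : C) * ((n%:R * B1) ^+ j * M))).
    - by rewrite leq_mul2r jL orbT.
    - rewrite -[leRHS]mul1r; apply: ler_wpM2r; last exact: fact_inv_le1.
      by rewrite mulr_ge0 ?exprn_ge0 ?mulr_ge0.
    apply: prepZ; apply: (prep_jet (i := i) (z := fun c => z c i) (z' := fun c => Theta (th i) (Q i) (z c i)) B10 pz).
    by move=> J sJ; apply: bA; rewrite sJ.
  exact: prep_sum H.
apply: le_trans (_ : _ <= (L * d)%:R * bt * W / sig i ^+ N.+1) _; last by [].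
apply: le_trans (prep_mean (Q0 i) (chrQ i) (tau1 i) (sig1 i) bt0 (thb i) (nr i) pP).
by rewrite mean_sum horner_sum.
Qed.
End JetFamilies.

(** * The integrator in modulated form *)

Arguments cabs : simpl never.

Section Expi.
Variable R : realType.
Local Notation C := R[i].

Lemma cabs_re_im (a c : R) : cabs (a +i* c)%C <= `|a| + `|c|.
Proof.
have -> : (a +i* c)%C = a%:C%C + (0 +i* c)%C :> C by simpc.
apply: le_trans (cabsD _ _) _; rewrite cabs_real lerD2l.
by rewrite /cabs /= expr0n /= add0r sqrtr_sqr.
Qed.

Lemma lipschitz_of_derive (f df : R -> R) : (forall x : R, is_derive x 1 f (df x)) ->
  (forall x, `|df x| <= 1) -> forall a b, `|f a - f b| <= `|a - b|.
Proof.
move=> hf hd a b; wlog ab : a b / b <= a.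
  by move=> H; case: (leP b a) => [|/ltW] ab; [|rewrite distrC [leRHS]distrC]; exact: H.
have [|c _ ->] := @MVT_segment _ f df b a ab (fun x _ => hf x).
  apply/continuous_subspaceT => x; apply: differentiable_continuous.
  by apply/derivable1_diffP; have [] := hf x.
by rewrite normrM -[leRHS]mul1r; apply: ler_wpM2r.
Qed.

Lemma expi_lipschitz (a b : R) : cabs (expi a - expi b) <= 2 * `|a - b|.
Proof.
have -> : expi a - expi b = ((cos a - cos b) +i* (sin a - sin b))%C by [].
apply: le_trans (cabs_re_im _ _) _; rewrite mulr2n mulrDl mul1r; apply: lerD.
  apply: (@lipschitz_of_derive cos (fun x => - sin x)) => x.
  by rewrite normrN ler_norml sin_geN1 sin_le1.
apply: (@lipschitz_of_derive sin cos) => x.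
by rewrite ler_norml cos_geN1 cos_le1.
Qed.

Lemma expi_sin (t : R) : expi t - (expi t)^-1 = (0 +i* (2 * sin t))%C.
Proof.
rewrite -expiN /expi cosN sinN; apply/eqP; rewrite eq_complex /= subrr eqxx /=.
by apply/eqP; ring.
Qed.

Lemma cabs_im (c : R) : cabs (0 +i* c)%C = `|c|.
Proof. by rewrite /cabs /= expr0n /= add0r sqrtr_sqr. Qed.

Lemma sin_dist1 (t : R) : `|sin t| <= cabs (1 - expi t).
Proof.
have -> : 1 - expi t = ((1 - cos t) +i* - sin t)%C.
  by rewrite /expi; apply/eqP; rewrite eq_complex /= sub0r !eqxx.
rewrite /cabs /= -[leLHS]sqrtr_sqr; apply: ler_wsqrtr; rewrite sqrrN lerDr.
exact: sqr_ge0.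
Qed.
End Expi.

Section Model.
Variables (R : realType) (ell n : nat) (bl : 'I_n -> option 'I_ell).
Local Notation C := R[i].

(* th_ = h omega~ and its rational approximation tht_ of period Q_; tau_ is the
   inverse gap of tht_, and g_ a small power of h, in which the expansion is
   graded. *)
Record par := Par { h_ : R; g_ : R; tau_ : R; th_ : 'I_ell -> R; tht_ : 'I_ell -> R;
  chi_ : 'I_ell -> R; Q_ : nat }.

Definition sg p := g_ p / h_ p.

(** K bounds the labels needing a gap, J is the degree of the Taylor polynomial and the number of
    Picard steps, NN is the power of h reached by the local errors. [tau_h] makes both h^2 sg and h
    / g fit the sizes required by the abstract system, and [g_J] converts powers of g into powers of
    h. The factor 2 in [gap_] leaves room to replace [tht_] by [th_]. *)
Record par_ok (cs : R) (K J NN : nat) (p : par) : Prop := ParOk {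
  h_gt0 : 0 < h_ p; h_le_g : h_ p <= g_ p; g_le2 : g_ p <= 2^-1; tau_ge1 : 1 <= tau_ p;
  tau_h : tau_ p * h_ p <= g_ p ^+ 2; Q_gt0 : (0 < Q_ p)%N;
  chr_Q : forall k, chr (tht_ p) k (Q_ p) = 1;
  th_le : forall j, `|th_ p j| <= 4; tht_le : forall j, `|tht_ p j| <= 4;
  th_tht : forall j, `|th_ p j - tht_ p j| <= g_ p / tau_ p;
  gap_ : forall k, (lnorm k <= K.+1)%N ->
    chr (tht_ p) k 1 = 1 \/ 2 <= tau_ p * cabs (chr (tht_ p) k 1 - 1);
  tau_cs : 4 <= tau_ p * cs;
  chi_lo : forall j, cs <= chi_ p j; chi_hi : forall j, chi_ p j <= cs^-1;
  sin_lo : forall j, cs <= `|sin (th_ p j)|;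
  g_J : g_ p ^+ J.-1 <= h_ p ^+ NN }.

Definition mu c p : C := if bl c is Some j then expi (th_ p j) else 1.
Definition dlab (j : 'I_ell) : lab ell := [ffun j' => (j' == j)%:R].

Local Notation T := ('I_n * bool)%type.
(** Unknowns (c, b). For a slow coordinate, b = false is the displacement from q_n and b = true is g
    times the discrete velocity. For a fast one they are q_n - e^(-i th) q_(n-1) and its conjugate,
    which diagonalise the free recursion with multipliers e^(i th) and e^(-i th). *)
Definition kapT (s : T) : lab ell :=
  if bl s.1 is Some j then (if s.2 then - dlab j else dlab j) else 0.
Definition wtT (s : T) : nat := bl s.1 != None.
Definition ths (p : par) (j : 'I_ell) (b : bool) := if b then - th_ p j else th_ p j.
Definition thts (p : par) (j : 'I_ell) (b : bool) := if b then - tht_ p j else tht_ p j.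
(** For a fast unknown, the error made by using the rational frequency in the character, put back as
    a perturbation; for a slow one, the feeding of the position by the velocity rescaled by g. *)
Definition MxT (s s' : T) p : C :=
  if bl s.1 is Some j then (if s' == s then expi (ths p j s.2) - expi (thts p j s.2) else 0)
  else if ~~ s.2 && (s' == (s.1, true)) then (h_ p / g_ p)%:C%C else 0.
Definition w0T (s : T) p : C :=
  if bl s.1 is Some j then - (h_ p ^+ 2 * chi_ p j)%:C%C
  else if s.2 then - (g_ p * h_ p)%:C%C else - (h_ p ^+ 2)%:C%C.
(** A fast coordinate is (mu f - mu^-1 k) / (mu - mu^-1) in terms of its two amplitudes f and k. *)
Definition rhoT (c : 'I_n) (s : T) p : C :=
  if s.1 != c then 0 else
  if bl c is Some j then (if s.2 then - (mu c p)^-1 else mu c p) / (mu c p - (mu c p)^-1)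
  else if s.2 then 0 else 1.

(* y_ = q_n, x_ = q_(n-1), and [A_ S] is the derivative of the potential at q_n
   in the coordinate directions S. *)
Record pt := Pt { A_ : seq 'I_n -> R; y_ : 'I_n -> R; x_ : 'I_n -> R }.

Definition y0T (s : T) p v : C :=
  if bl s.1 is Some j then (y_ v s.1)%:C%C - expi (- ths p j s.2) * (x_ v s.1)%:C%C
  else if s.2 then (g_ p / h_ p * (y_ v s.1 - x_ v s.1))%:C%C else 0.
Definition eT (c : 'I_n) v : C := if bl c is Some _ then (y_ v c)%:C%C else 0.

(** These are the consequences of a bounded energy: slow increments and fast coordinates are of
    order h. *)
Record pt_ok (B : R) (J : nat) (p : par) (v : pt) : Prop := PtOk {
  A_bd : forall S, (size S <= J)%N -> `|A_ v S| <= B;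
  A_sym : jsym (A_ v);
  sl_bd : forall c, bl c = None -> `|y_ v c - x_ v c| <= B * h_ p;
  fs_bd : forall c j s, bl c = Some j ->
    cabs ((y_ v c)%:C%C - expi (- ths p j s) * (x_ v c)%:C%C) <= B * h_ p;
  y_bd : forall c j, bl c = Some j -> `|y_ v c| <= B * h_ p }.

Lemma lnorm_dlab j : lnorm (dlab j) = 1%N.
Proof.
rewrite /lnorm (bigD1 j) //= big1 => [|j' jj]; rewrite ffunE; first by rewrite eqxx addn0.
by rewrite (negPf jj).
Qed.

Lemma phase_dlab th j : phase th (dlab j) = th j :> R.
Proof.
rewrite /phase (bigD1 j) //= big1 => [|j' jj]; rewrite ffunE.
  by rewrite eqxx mul1r addr0.
by rewrite (negPf jj) mul0r.
Qed.

Lemma kw s : (lnorm (kapT s) <= wtT s)%N.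
Proof.
rewrite /kapT /wtT; case: (bl s.1) => [j|]; last by rewrite lnorm0.
by case: s.2; rewrite ?lnormN lnorm_dlab.
Qed.

Lemma w1 s : (wtT s <= 1)%N.
Proof. by rewrite /wtT; case: (bl _). Qed.

Lemma chr_kap p s : chr (tht_ p) (kapT s) 1 =
  if bl s.1 is Some j then expi (thts p j s.2) else 1.
Proof.
rewrite /kapT; case: (bl s.1) => [j|]; last by rewrite chr0.
by rewrite /thts /chr; case: s.2; rewrite ?phaseN phase_dlab mulr1.
Qed.

Lemma chr_dist (th : 'I_ell -> R) (k k' : lab ell) : cabs (chr th k 1 - chr th k' 1) = cabs (chr th (k - k') 1 - 1) :> R.
Proof.
rewrite chrD chrN -[X in _ = cabs (_ - X)](mulfV (chr_neq0 th k' 1)) -mulrBl cabsM cabsV cabs_chr.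
by rewrite invr1 mulr1.
Qed.

Section Families.
Variables (I : Type) (P : I -> par) (V : I -> pt) (cs B : R) (K J NN N : nat).
Hypotheses (cs0 : 0 < cs) (J2 : (1 < J)%N) (NN3 : (3 <= NN)%N) (B0 : 0 <= B).
Hypothesis okP : forall i, par_ok cs K J NN (P i).
Hypothesis okV : forall i, pt_ok B J (P i) (V i).
Let h i := h_ (P i). Let g i := g_ (P i). Let tau i := tau_ (P i). Let Q i := Q_ (P i).
Let th i := tht_ (P i). Let sig i := sg (P i).

Lemma tau1 i : 1 <= tau i. Proof. by case: (okP i). Qed.
Lemma g0 i : 0 < g i. Proof. by case: (okP i) => h0 hg *; exact: lt_le_trans h0 hg. Qed.
Lemma h0 i : 0 < h i. Proof. by case: (okP i). Qed.
Lemma sig1 i : 1 <= sig i.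
Proof. by rewrite /sig /sg ler_pdivlMr ?mul1r //; case: (okP i). Qed.
Lemma Q0 i : (0 < Q i)%N. Proof. by case: (okP i). Qed.
Lemma chrQ i k : chr (th i) k (Q i) = 1. Proof. by case: (okP i). Qed.
Lemma thb i j : `|th i j| <= 4. Proof. exact: tht_le (okP i) j. Qed.
Lemma L1 : (1 <= J)%N. Proof. exact: ltnW. Qed.
Lemma hg i : h i <= g i. Proof. by case: (okP i). Qed.
Lemma g2 i : g i <= 2^-1. Proof. by case: (okP i). Qed.
Lemma g1 i : g i <= 1. Proof. by apply: le_trans (g2 i) _; rewrite invf_le1 ?ler1n. Qed.
Lemma tauh i : tau i * h i <= g i ^+ 2. Proof. by case: (okP i). Qed.
Lemma gJ i : g i ^+ J.-1 <= h i ^+ NN. Proof. by case: (okP i). Qed.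

Lemma gapT s i : gapped (th i) (tau i) K (chr (th i) (kapT s) 1).
Proof.
move=> k kK; case: (gap_ (okP i) (k := k - kapT s)) => [|e|e].
- apply: leq_trans (lnormD _ _) _; rewrite lnormN -addn1 leq_add //.
  exact: leq_trans (kw s) (w1 s).
- left; apply/eqP; rewrite -subr_eq0 -cabs_eq0 chr_dist e subrr cabs0 //.
- by right; rewrite chr_dist; apply: le_trans e; rewrite ler1n.
Qed.

Lemma h_tau i : h i <= g i ^+ 2 / tau i.
Proof. by rewrite ler_pdivlMr ?(lt_le_trans ltr01 (tau1 i)) // mulrC tauh. Qed.

Lemma hMT s s' : bO (fun i => g i / tau i) (fun i => cabs (MxT s s' (P i))).
Proof.
have t0 i : 0 < tau i by exact: lt_le_trans ltr01 (tau1 i).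
have B1 i : 0 <= g i / tau i by rewrite divr_ge0 ?ltW ?g0.
rewrite /MxT; case: (bl s.1) => [j|].
  case: (s' == s); last by exists 0 => // i; rewrite cabs0 mul0r.
  exists 2 => // i; apply: le_trans (expi_lipschitz _ _) _; apply: ler_wpM2l => //.
  rewrite /ths /thts; case: s.2; rewrite -?opprD ?opprK; have := th_tht (okP i) j => //.
  by rewrite -normrN opprD.
case: (_ && _); last by exists 0 => // i; rewrite cabs0 mul0r.
apply: bO_le => i; rewrite cabs_real ger0_norm ?divr_ge0 ?(ltW (g0 i)) ?(ltW (h0 i)) //.
by rewrite ler_pdivrMr ?g0 // mulrAC -expr2 h_tau.
Qed.

Lemma hMwT s s' : wtT s = wtT s' \/ forall i, MxT s s' (P i) = 0.
Proof.
rewrite /wtT /MxT; case e: (bl s.1) => [j|].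
  case: (s' =P s) => [->|_]; last by right.
  by left; rewrite e.
case: (boolP (_ && _)) => [/andP [_ /eqP ->]|_]; last by right.
by left; rewrite e.
Qed.

Let h0' i : 0 <= h i. Proof. exact/ltW/h0. Qed.
Let g0' i : 0 <= g i. Proof. exact/ltW/g0. Qed.

Lemma hwT s : bO (fun i => g i ^+ 2 / tau i) (fun i => cabs (w0T s (P i)) * sig i ^+ wtT s).
Proof.
have hgt i : g i * h i <= g i ^+ 2 / tau i.
  by apply: le_trans (h_tau i); rewrite -[leRHS]mul1r; apply: ler_wpM2r; rewrite ?h0' ?g1.
have hh i : h i ^+ 2 <= g i * h i by rewrite expr2; apply: ler_wpM2r; rewrite ?h0' ?hg.
rewrite /w0T /wtT; case: (bl s.1) => [j|] /=.
  exists cs^-1 => [|i]; first by rewrite invr_ge0 ltW.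
  rewrite expr1 cabsN cabs_real normrM ger0_norm ?exprn_ge0 ?h0' //.
  have [chl chh] := (chi_lo (okP i) j, chi_hi (okP i) j).
  rewrite ger0_norm; last exact: le_trans (ltW cs0) chl.
  have -> : h_ (P i) ^+ 2 * chi_ (P i) j * sig i = chi_ (P i) j * (g i * h i).
    by rewrite /sig /sg; have := h0 i; rewrite /g /h => hp; field; rewrite gt_eqF.
  apply: ler_pM => //; first exact: le_trans (ltW cs0) chl.
  exact: mulr_ge0.
case: s.2; apply: bO_le => i; rewrite expr0 mulr1 cabsN cabs_real ger0_norm ?mulr_ge0 ?exprn_ge0 ?h0' ?g0' //.
  exact: hgt.
exact: le_trans (hh i) (hgt i).
Qed.

Lemma mu_gap c j i : bl c = Some j -> 2 * cs <= cabs (mu c (P i) - (mu c (P i))^-1).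
Proof.
move=> e; rewrite /mu e expi_sin cabs_im normrM ger0_norm //.
by apply: ler_wpM2l => //; exact: sin_lo (okP i) j.
Qed.

Lemma cabs_mu c i : cabs (mu c (P i)) = 1.
Proof. by rewrite /mu; case: (bl c) => [j|]; rewrite ?cabs_expi ?cabs1. Qed.

Lemma hrhoT c s : bO (fun=> 1) (fun i => cabs (rhoT c s (P i))).
Proof.
exists ((2 * cs)^-1 + 1) => [|i]; first by rewrite addr_ge0 // invr_ge0 mulr_ge0 // ltW.
have c20 : 0 <= (2 * cs)^-1 by rewrite invr_ge0 mulr_ge0 // ltW.
rewrite mulr1 /rhoT; case: ifP => _; first by rewrite cabs0 addr_ge0.
case e: (bl c) => [j|]; last by case: s.2; rewrite ?cabs0 ?cabs1 ?lerDr ?addr_ge0.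
rewrite cabsM cabsV (_ : cabs (if _ then _ else _) = 1); last first.
  by case: s.2; rewrite ?cabsN ?cabsV cabs_mu ?invr1.
rewrite mul1r (le_trans _ (_ : (2 * cs)^-1 <= _)) ?lerDl //.
have h2 := mu_gap i e; have p2 : 0 < 2 * cs by rewrite mulr_gt0.
by rewrite lef_pV2 // posrE; exact: lt_le_trans h2.
Qed.

Lemma heT c : bO g (fun i => cabs (eT c (V i))).
Proof.
rewrite /eT; case e: (bl c) => [j|]; last by exists 0 => // i; rewrite cabs0 mul0r.
exists B => // i; rewrite cabs_real; apply: le_trans (y_bd (okV i) e) _.
by apply: ler_wpM2l => //; exact: hg.
Qed.

Lemma bAT : bounded_arr J (fun i => A_ (V i)).
Proof. by exists B => // i S; exact: (A_bd (okV i)). Qed.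

Lemma hyT s : bO g (fun i => cabs (y0T s (P i) (V i)) * sig i ^+ wtT s).
Proof.
exists B => // i; rewrite /y0T /wtT; case e: (bl s.1) => [j|].
  rewrite expr1; apply: (@le_trans _ _ (B * h i * sig i)).
    by apply: ler_wpM2r; [exact: le_trans ler01 (sig1 i)|exact: (fs_bd (okV i) _ e)].
  by rewrite -mulrA /sig /sg mulrC -/(g i) -/(h i) mulrC [h i * _]mulrC divfK // gt_eqF // h0.
rewrite expr0 mulr1; case: s.2; last by rewrite cabs0 mulr_ge0.
rewrite cabs_real normrM ger0_norm; last by rewrite divr_ge0 ?h0' ?g0'.
apply: le_trans (ler_wpM2l _ (sl_bd (okV i) e)) _; first by rewrite divr_ge0 ?h0' ?g0'.
by rewrite mulrCA divfK // gt_eqF // h0.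
Qed.

Definition rhoI c s i := rhoT c s (P i).
Definition MxI s s' i := MxT s s' (P i).
Definition w0I s i := w0T s (P i).
Definition eI c i := eT c (V i).
Definition AI i := A_ (V i).
Definition y0I s i := y0T s (P i) (V i).
Definition dY := (J * pdeg J J)%N.

Record is_expansion (Y : T -> I -> modf R) : Prop := IsSol {
  sol_rep : forall s, repO th tau sig (wtT s) dY g (Y s);
  sol_init : forall s i, (Y s i 0).[0] = y0I s i;
  sol_defect : forall s, repO th tau sig (wtT s) dY (fun i => g i ^+ J / tau i)
    (defect th J kapT (@fst _ _) MxI w0I rhoI AI eI Y s) }.

Lemma expansion_ex : (dY <= K)%N -> exists Y, is_expansion Y.
Proof.
move=> dK; have [Y [h1 h2 h3]] := @approx_solution R ell I th tau sig Q tau1 sig1 Q0 chrQ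
  n J _ kapT wtT (@fst _ _) MxI w0I rhoI g K kw w1 g0' g1 L1 gapT hMT hMwT hwT hrhoT
  AI eI y0I heT bAT hyT J dK.
by exists Y; split.
Qed.

Definition fastc : pred 'I_n := fun c => bl c != None.
Definition wc c i : C := if bl c is Some j then (h i ^+ 2 * chi_ (P i) j)%:C%C else 0.
Definition muF c i := mu c (P i).
Definition nuF c i := (mu c (P i))^-1.

Section Energies.
Implicit Type Y : T -> I -> modf R.
Definition velocity Y c i m : {poly C} := (g i)^-1%:C%C *: Y (c, true) i m.
Definition position Y c i m : {poly C} := \sum_s rhoI c s i *: Y s i m.
Definition displacement Y c i m : {poly C} := deviation rhoI eI Y c i m.
Definition force Y c i m : {poly C} := jet_grad J (AI i) (fun c => displacement Y c i m) c.
Definition potential Y i m : {poly C} := jet_pot J (AI i) (fun c => displacement Y c i m).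
Definition ThetaI i := Theta (th i) (Q i).

Definition slow_inv Y i : C := slow_functional (Q i) fastc (h i)%:C%C (wc^~ i) (muF^~ i) (nuF^~ i)
  (fun c => Y (c, false) i) (fun c => velocity Y c i) (fun c => Y (c, false) i) (fun c => Y (c, true) i)
  (fun c => position Y c i) (fun c => force Y c i) (potential Y i).
Definition fast_inv Y i : C := fast_functional (Q i) fastc (h i)%:C%C (wc^~ i) (muF^~ i) (nuF^~ i) (ThetaI i)
  (fun c => Y (c, false) i) (fun c => velocity Y c i) (fun c => Y (c, false) i) (fun c => Y (c, true) i).
Definition sh Y s i := shf (Y s i).

Lemma displacementE Y c i m : displacement Y c i m = position Y c i m - (eI c i)%:P.
Proof. by []. Qed.

Lemma velocity_sh Y c i : velocity (sh Y) c i = shf (velocity Y c i).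
Proof. by apply/funext => m; rewrite shfZ. Qed.
Lemma position_sh Y c i : position (sh Y) c i = shf (position Y c i).
Proof. by apply/funext => m; rewrite shf_sum; apply: eq_bigr => s _; rewrite shfZ. Qed.
Lemma displacement_sh Y c i m : displacement (sh Y) c i m = displacement Y c i (m + 1) \Po ('X + 1).
Proof.
rewrite !displacementE position_sh -/(shf (position Y c i) m) raddfB /= comp_polyC //.
Qed.
Lemma force_sh Y c i : force (sh Y) c i = shf (force Y c i).
Proof.
apply/funext => m; rewrite /shf /force jet_grad_comp; congr jet_grad.
by apply/funext => c'; rewrite displacement_sh.
Qed.
Lemma potential_sh Y i : potential (sh Y) i = shf (potential Y i).
Proof.
apply/funext => m; rewrite /shf /potential jet_pot_comp; congr jet_pot.
by apply/funext => c'; rewrite displacement_sh.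
Qed.

Lemma sumT (M : nmodType) (F : T -> M) c : (forall s, s.1 != c -> F s = 0) ->
  \sum_s F s = F (c, false) + F (c, true).
Proof.
move=> F0; rewrite (eq_bigr (fun s => F (s.1, s.2))) => [|[] //].
rewrite -(pair_bigA _ (fun c b => F (c, b))) /= (bigD1 c) //= [X in _ + X]big1.
  by rewrite addr0 big_bool addrC.
by move=> c' cc; rewrite big1 // => b _; apply: F0.
Qed.

Lemma sum_MxI Y s i m : \sum_s' MxI s s' i *: Y s' i m =
  if bl s.1 is Some j then (expi (ths (P i) j s.2) - expi (thts (P i) j s.2)) *: Y s i m
  else if s.2 then 0 else (h i / g i)%:C%C *: Y (s.1, true) i m.
Proof.
rewrite /MxI /MxT; case: (bl s.1) => [j|].
  by rewrite (bigD1 s) //= eqxx big1 ?addr0 // => s' /negPf ->; rewrite scale0r.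
case: s => c [] /=; first by rewrite big1 // => s' _; rewrite scale0r.
rewrite (bigD1 (c, true)) //= eqxx big1 ?addr0 // => s' /negPf ->; by rewrite scale0r.
Qed.

Lemma positionE Y c i m : position Y c i m = if bl c is Some _
  then (muF c i - nuF c i)^-1 *: (muF c i *: Y (c, false) i m - nuF c i *: Y (c, true) i m)
  else Y (c, false) i m.
Proof.
rewrite /position (sumT (c := c)) => [|s sc]; last by rewrite /rhoI /rhoT (negPf sc) scale0r.
rewrite /rhoI /rhoT /= eqxx; case: (bl c) => [j|]; last by rewrite scale1r scale0r addr0.
by rewrite scalerBr !scalerA [_^-1 * muF _ _]mulrC [_^-1 * nuF _ _]mulrC mulNr scaleNr.
Qed.

Definition dfF Y s i m : {poly C} := defect th J kapT (@fst _ _) MxI w0I rhoI AI eI Y s i m.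

Lemma sh_eq Y s i m : shf (Y s i) m = chr (th i) (kapT s) 1 *: Y s i m +
  (\sum_s' MxI s s' i *: Y s' i m + w0I s i *: force Y s.1 i m) + dfF Y s i m.
Proof.
have aux (M : zmodType) (a b d : M) : a = b + d + (a - b - d).
  by rewrite -(addrA a) -opprD [RHS]addrC subrK.
exact: aux.
Qed.

(** [MxT] restores the true multiplier, so the two multipliers are exactly inverse, and both
    amplitudes receive the same force, as [fast_id] requires. *)
Lemma sh_fast Y c j b i m : bl c = Some j ->
  shf (Y (c, b) i) m = expi (ths (P i) j b) *: Y (c, b) i m +
    (- wc c i *: force Y c i m + dfF Y (c, b) i m).
Proof.
move=> e; rewrite sh_eq sum_MxI chr_kap /= e /w0I /w0T /= e /wc e.
rewrite scalerBl -/(h i); set p := Y _ i m; set G := _ *: force Y c i m; set D := dfF _ _ _ _.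
by move: (_ *: p) (_ *: p) => a a'; ring.
Qed.

Lemma sh_slow_u Y c i m : bl c = None ->
  shf (velocity Y c i) m = velocity Y c i m - (h i)%:C%C *: force Y c i m + (g i)^-1%:C%C *: dfF Y (c, true) i m.
Proof.
move=> e; rewrite /velocity shfZ sh_eq sum_MxI chr_kap /= e /w0I /w0T /= e /=.
rewrite scale1r add0r !scalerDr scalerA; congr (_ + _ + _); rewrite -scaleNr; congr (_ *: _).
rewrite mulrN -rmorphM /= -/(h i) -/(g i) mulrA mulVf ?mul1r //.
by rewrite gt_eqF // g0.
Qed.

Lemma sh_slow_x Y c i m : bl c = None ->
  shf (Y (c, false) i) m = Y (c, false) i m + (h i)%:C%C *: shf (velocity Y c i) m +
    (dfF Y (c, false) i m - (h i / g i)%:C%C *: dfF Y (c, true) i m).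
Proof.
move=> e; rewrite sh_slow_u // sh_eq sum_MxI chr_kap /= e /w0I /w0T /= e /=.
move: (dfF Y (c, false) i m) (dfF Y (c, true) i m) => D D'.
rewrite scale1r /velocity !scalerDr scalerN !scalerA -!rmorphM /= -/(h i) -/(g i) -expr2 scaleNr.
set a := Y _ i m; set b := _ *: Y _ i m; set G := _ *: force Y c i m; set D1 := _ *: D'.
by move: a b G D1 => a b G D1; ring.
Qed.
End Energies.

Local Notation UU := (unw th tau).
Let one0 (i : I) : 0 <= 1 :> R. Proof. exact: ler01. Qed.
Let tau0 i : 0 < tau i. Proof. exact: lt_le_trans ltr01 (tau1 i). Qed.
Let hc0 i : (h i)%:C%C != 0.
Proof. by rewrite -cabs_eq0 cabs_real normr_eq0 gt_eqF // h0. Qed.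

Lemma gsig i : g i / sig i = h i.
Proof. by rewrite /sig /sg invf_div mulrCA mulfV ?mulr1 // gt_eqF // g0. Qed.
Lemma h1 i : h i <= 1. Proof. exact: le_trans (hg i) (g1 i). Qed.
Lemma wc_neq0 c i : fastc c -> wc c i != 0.
Proof.
rewrite /fastc /wc; case: (bl c) => // j _; rewrite -cabs_eq0 cabs_real normr_eq0 mulf_neq0 //.
  by rewrite expf_neq0 // gt_eqF // h0.
by rewrite gt_eqF // (lt_le_trans cs0 (chi_lo (okP i) j)).
Qed.
Lemma munu c i : muF c i * nuF c i = 1.
Proof. by rewrite /nuF mulfV // -cabs_eq0 cabs_mu oner_eq0. Qed.
Lemma munu_neq0 c i : fastc c -> muF c i - nuF c i != 0.
Proof.
rewrite /fastc; case e: (bl c) => [j|//] _; rewrite -cabs_eq0 gt_eqF //.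
by apply: lt_le_trans (mu_gap i e); rewrite mulr_gt0.
Qed.
Lemma cO_mu c : cO (fun=> 1) (muF c).
Proof. by apply: bO_le => i; rewrite cabs_mu. Qed.
Lemma cO_nu c : cO (fun=> 1) (nuF c).
Proof. by apply: bO_le => i; rewrite cabsV cabs_mu invr1. Qed.
Lemma cO_wc c : cO (fun i => h i ^+ 2) (wc c).
Proof.
exists cs^-1 => [|i]; first by rewrite invr_ge0 ltW.
rewrite /wc; case: (bl c) => [j|]; last by rewrite cabs0 mulr_ge0 ?exprn_ge0 ?invr_ge0 // ltW.
rewrite cabs_real ger0_norm; last first.
  by rewrite mulr_ge0 ?exprn_ge0 // (le_trans (ltW cs0) (chi_lo (okP i) j)).
by rewrite mulrC; apply: ler_wpM2r; rewrite ?exprn_ge0 // (chi_hi (okP i) j).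
Qed.

Lemma cO_hinv : cO (fun i => (h i)^-1) (fun i => (h i)%:C%C^-1).
Proof. by apply: bO_le => i; rewrite cabsV cabs_real ger0_norm. Qed.

Lemma cO_coef c : fastc c ->
  cO (fun i => (h i ^+ 2)^-1) (fun i => (2 * wc c i * (muF c i - nuF c i))^-1).
Proof.
rewrite /fastc /wc; case e: (bl c) => [j|//] _.
have cc : 0 < 2 * cs * (2 * cs) by rewrite !mulr_gt0.
exists (2 * cs * (2 * cs))^-1 => [|i]; first by rewrite invr_ge0 ltW.
have h2 : 0 < h i ^+ 2 by rewrite exprn_gt0 // h0.
rewrite cabsV -invfM lef_pV2 ?posrE.
- rewrite !cabsM cabs_nat cabs_real normrM (ger0_norm (ltW h2)).
  rewrite (_ : 2 * cs * (2 * cs) * h i ^+ 2 = 2 * (h i ^+ 2 * cs) * (2 * cs)); last by ring.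
  apply: ler_pM; rewrite ?mulr_ge0 ?(ltW h2) ?(ltW cs0) //; last exact: mu_gap i e.
  apply: ler_wpM2l => //; apply: ler_wpM2l; first exact: ltW.
  by apply: le_trans (ler_norm _); exact: chi_lo (okP i) j.
- rewrite cabsM mulr_gt0 //; last by apply: lt_le_trans (mu_gap i e); rewrite mulr_gt0.
  rewrite cabsM cabs_nat mulr_gt0 // cabs_real normr_gt0 mulf_neq0 ?gt_eqF //.
  exact: lt_le_trans cs0 (chi_lo (okP i) j).
- by rewrite mulr_gt0.
Qed.

Definition op_ok (DD : I -> modf R -> modf R) := forall Bf F,
  (forall i, 0 <= Bf i) -> UU Bf F -> UU Bf (fun i => DD i (F i)).

Lemma op_Dm : op_ok (fun=> @Dm R).
Proof.
move=> Bf F B1 velocity; apply: U_leB (U_Dm tau1 velocity) => i.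
by rewrite ler_pdivrMr // ler_peMr // tau1.
Qed.
Lemma op_Theta : op_ok ThetaI.
Proof. by move=> Bf F B1 velocity; apply: (U_Theta tau1 Q0 chrQ _ thb velocity). Qed.

Lemma U_br1 Bf F G : (forall i, 0 <= Bf i) -> UU (fun=> 1) F -> UU Bf G ->
  UU Bf (fun i _ => mean_prod (Q i) (F i) (G i)).
Proof. by move=> B1 u v; apply: U_leB (U_br tau1 Q0 chrQ u v) => i; rewrite mul1r. Qed.

Lemma U_Xi DD Bf F G : op_ok DD -> (forall i, 0 <= Bf i) -> UU (fun=> 1) F -> UU Bf G ->
  UU Bf (fun i _ => Xi (Q i) (DD i) (F i) (G i)).
Proof.
move=> o B1 u v; apply: UB; first exact: U_br1 (o _ _ one0 u) v.
exact: U_br1 u (o _ _ B1 v).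
Qed.

Lemma U_XiC DD Bf F G : op_ok DD -> (forall i, 0 <= Bf i) -> UU Bf F -> UU (fun=> 1) G ->
  UU Bf (fun i _ => Xi (Q i) (DD i) (F i) (G i)).
Proof.
move=> o B1 u v; apply: (U_ext (F := fun i _ => - Xi (Q i) (DD i) (G i) (F i))).
  by move=> i m; rewrite -XiC.
exact/UN/U_Xi.
Qed.

Lemma U_slow_err DD e (x u d1 d2 : I -> 'I_n -> modf R) c : op_ok DD -> (forall i, 0 <= e i) ->
  UU (fun=> 1) (fun i => x i c) -> UU (fun=> 1) (fun i => u i c) ->
  UU e (fun i => d1 i c) -> UU e (fun i => d2 i c) ->
  UU e (fun i _ => slow_err (Q i) (DD i) (x i) (u i) (d1 i) (d2 i) c).
Proof.
move=> o e0 ux uu ud1 ud2; apply: UD.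
  by apply: (U_br1 (F := fun i => DD i (x i c))) => //; exact: o.
apply: (U_ext (F := fun i _ => mean_prod (Q i) (shf (u i c)) (DD i (d1 i c)))).
  by move=> i m; rewrite brC.
by apply: (U_br1 (F := fun i => shf (u i c))); [|apply: (U_shf tau1)|exact: o].
Qed.

Lemma U_fast_err DD e (f k r d1 d2 : I -> 'I_n -> modf R) c : op_ok DD -> (forall i, 0 <= e i) ->
  (forall i, e i <= 1) ->
  UU (fun=> 1) (fun i => f i c) -> UU (fun=> 1) (fun i => k i c) -> UU (fun=> 1) (fun i => r i c) ->
  UU e (fun i => d1 i c) -> UU e (fun i => d2 i c) ->
  UU e (fun i _ => fast_err (Q i) (muF^~ i) (nuF^~ i) (DD i) (f i) (k i) (r i) (d1 i) (d2 i) c).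
Proof.
move=> o e0 e1 uf uk ur ud1 ud2.
have ud1' : UU (fun=> 1) (fun i => d1 i c) by apply: U_leB ud1.
apply: UD; last exact: (U_Xi (F := fun i => d1 i c)).
apply: UD; last exact: (U_XiC (G := fun i => r i c)).
apply: UD; last exact: (U_Xi (F := fun i => r i c)).
apply: UB.
  by apply: (UZr (cO_mu c) e0); apply: (U_Xi (F := fun i => f i c)).
by apply: (UZr (cO_nu c) e0); apply: (U_Xi (F := fun i => k i c)).
Qed.

(** * Drift over one step and leading value of the two invariants *)

Section Solution.
Variable Y : T -> I -> modf R.
Hypothesis sY : is_expansion Y.
Let e_ i := h i ^+ NN.
Let e0 i : 0 <= e_ i. Proof. by rewrite exprn_ge0. Qed.
Let e1 i : e_ i <= 1. Proof. by rewrite exprn_ile1 // h1. Qed.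

Lemma U_slow c b : bl c = None -> UU g (Y (c, b)).
Proof.
move=> e; apply: U_leB (U_rep tau1 sig1 (w1 _) (sol_rep sY (c, b))) => i.
by rewrite /wtT /= e expr0 divr1.
Qed.
Lemma U_fast c j b : bl c = Some j -> UU h (Y (c, b)).
Proof.
move=> e; apply: U_leB (U_rep tau1 sig1 (w1 _) (sol_rep sY (c, b))) => i.
by rewrite /wtT /= e expr1 gsig.
Qed.
Lemma U_Y s : UU (fun=> 1) (Y s).
Proof.
case: s => c b; case e: (bl c) => [j|].
  by apply: U_leB (U_fast _ e) => i; exact: h1.
by apply: U_leB (U_slow _ e) => i; exact: g1.
Qed.
Lemma U_u c : bl c = None -> UU (fun=> 1) (velocity Y c).
Proof.
move=> e; apply: U_leB (UZ (a := fun i => (g i)^-1) _ g0' (U_slow true e)) => [i|].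
  by rewrite mulVf // gt_eqF // g0.
by apply: bO_le => i; rewrite cabs_real ger0_norm // invr_ge0.
Qed.
Lemma U_df s : UU (fun i => g i * e_ i) (dfF Y s).
Proof.
apply: U_leB (U_rep tau1 sig1 (w1 _) (sol_defect sY s)) => i.
have s0 : 0 < sig i by exact: lt_le_trans ltr01 (sig1 i).
apply: (@le_trans _ _ (g i ^+ J)).
  rewrite -mulrA ler_piMr ?exprn_ge0 // -invfM invf_le1 ?mulr_gt0 ?exprn_gt0 //.
  by rewrite -[leLHS]mulr1; apply: ler_pM; rewrite // ?tau1 // exprn_ege1 // sig1.
rewrite -(ltn_predK J2) exprS; apply: ler_wpM2l => //; exact: gJ.
Qed.
Lemma wt_z c : repO th tau sig 0 dY g (fun i m => displacement Y c i m).
Proof. exact: (repO_deviation tau1 sig1 w1 g0' hrhoT (sol_rep sY) heT). Qed.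
Lemma wt_q c : repO th tau sig 0 dY g (fun i m => position Y c i m).
Proof.
have H : forall c : 'I_n, bO g (fun i => cabs ((fun _ _ => 0 : C) c i)).
  by move=> c'; exists 0 => // i; rewrite cabs0 mul0r.
by apply: (repO_ext _ (repO_deviation tau1 sig1 w1 g0' hrhoT (sol_rep sY) H c)) => i m; rewrite /deviation polyC0 subr0.
Qed.
Lemma wt_G c : repO th tau sig 0 (J * dY) (fun=> 1) (force Y c).
Proof. exact: (repO_grad tau1 sig1 g0' g1 wt_z bAT). Qed.
Lemma wt_P : repO th tau sig 0 (J * dY) (fun=> 1) (potential Y).
Proof. exact: (repO_pot tau1 sig1 g0' g1 wt_z bAT). Qed.
Lemma U_G c : UU (fun=> 1) (force Y c).
Proof. by apply: U_leB (U_rep tau1 sig1 (leq0n 1) (wt_G c)) => i; rewrite expr0 divr1. Qed.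

Definition d1F c i : modf R := if bl c is Some _ then dfF Y (c, false) i
  else fun m => dfF Y (c, false) i m - (h i / g i)%:C%C *: dfF Y (c, true) i m.
Definition d2F c i : modf R := if bl c is Some _ then dfF Y (c, true) i
  else fun m => (g i)^-1%:C%C *: dfF Y (c, true) i m.

Let ge i : g i * e_ i <= e_ i. Proof. by rewrite ler_piMl // g1. Qed.

Lemma U_d1 c : UU e_ (d1F c).
Proof.
have H b : UU e_ (dfF Y (c, b)) by apply: U_leB (U_df _) => i; exact: ge.
rewrite /d1F; case: (bl c) => [_|]; first exact: H.
apply: UB; first exact: H.
apply: UZr (H true) => //; apply: bO_le => i.
by rewrite cabs_real ger0_norm ?divr_ge0 // ler_pdivrMr ?g0 // mul1r hg.
Qed.
Lemma U_d2 c : UU e_ (d2F c).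
Proof.
rewrite /d2F; case: (bl c) => [_|]; first by apply: U_leB (U_df _) => i; exact: ge.
apply: U_leB (UZ (a := fun i => (g i)^-1) _ _ (U_df (c, true))) => [i||i]; last by rewrite mulr_ge0.
  by rewrite mulKf // gt_eqF // g0.
by apply: bO_le => i; rewrite cabs_real ger0_norm // invr_ge0.
Qed.

Let pY s i : mperiodic (Q i) (Y s i). Proof. exact: (U_per chrQ i (U_Y s)). Qed.
Let pu c i : mperiodic (Q i) (velocity Y c i). Proof. by move=> m; rewrite /velocity pY. Qed.
Let pq c i : mperiodic (Q i) (position Y c i).
Proof. by move=> m; apply: eq_bigr => s _; rewrite pY. Qed.
Let pz c i m : displacement Y c i (m + (Q i)%:Z) = displacement Y c i m.
Proof. by rewrite !displacementE pq. Qed.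
Let pG c i : mperiodic (Q i) (force Y c i). 
Proof. by move=> m; rewrite /force; congr jet_grad; apply/funext => c'; exact: pz. Qed.
Let pP i : mperiodic (Q i) (potential Y i). 
Proof. by move=> m; rewrite /potential; congr jet_pot; apply/funext => c'; exact: pz. Qed.

Let fastF c : ~~ fastc c -> bl c = None.
Proof. by rewrite /fastc; case: (bl c). Qed.

Let ex c i : ~~ fastc c -> forall m, shf (Y (c, false) i) m =
  Y (c, false) i m + (h i)%:C%C *: shf (velocity Y c i) m + d1F c i m.
Proof. by move=> /fastF e m; rewrite sh_slow_x // /d1F e. Qed.
Let eu c i : ~~ fastc c -> forall m, shf (velocity Y c i) m =
  velocity Y c i m - (h i)%:C%C *: force Y c i m + d2F c i m.
Proof. by move=> /fastF e m; rewrite sh_slow_u // /d2F e. Qed.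
Let ef c i : fastc c -> forall m, shf (Y (c, false) i) m =
  muF c i *: Y (c, false) i m + (- wc c i *: force Y c i m + d1F c i m).
Proof.
rewrite /fastc; case e: (bl c) => [j|//] _ m; rewrite (sh_fast _ _ _ _ e) /d1F e.
by rewrite /muF /mu e.
Qed.
Let ek c i : fastc c -> forall m, shf (Y (c, true) i) m =
  nuF c i *: Y (c, true) i m + (- wc c i *: force Y c i m + d2F c i m).
Proof.
rewrite /fastc; case e: (bl c) => [j|//] _ m; rewrite (sh_fast _ _ _ _ e) /d2F e.
by rewrite /nuF /mu e /ths -expiN.
Qed.
Let eq_ c i : fastc c -> forall m, (muF c i - nuF c i) *: position Y c i m =
  muF c i *: Y (c, false) i m - nuF c i *: Y (c, true) i m.
Proof.
move=> fc m; rewrite positionE; have := munu_neq0 i fc; move: fc; rewrite /fastc.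
by case: (bl c) => // j _ m0; rewrite scalerA mulfV // scale1r.
Qed.

(** The defects are of order h^NN; the loss h^-2 comes from the normalisation of the fast terms. *)
Lemma slow_inv_shf : cO (fun i => e_ i / h i ^+ 2) (fun i => slow_inv (sh Y) i - slow_inv Y i).
Proof.
have B1 i : 0 <= e_ i / h i ^+ 2 by rewrite divr_ge0 ?exprn_ge0.
pose r i c m : {poly C} := - wc c i *: force Y c i m.
apply: (cO_ext (f := fun i =>
  \sum_(c | ~~ fastc c) (h i)%:C%C^-1 * int01 (slow_err (Q i) (@Dm R) (fun c => Y (c, false) i)
     (fun c => velocity Y c i) (d1F^~ i) (d2F^~ i) c) +
  \sum_(c | fastc c) (2 * wc c i * (muF c i - nuF c i))^-1 * int01 (fast_err (Q i) (muF^~ i) (nuF^~ i)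
     (@Dm R) (fun c => Y (c, false) i) (fun c => Y (c, true) i) (r i) (d1F^~ i) (d2F^~ i) c))).
  move=> i; rewrite /r; have := slow_functional_step (Q0 i) (hc0 i) (fun c => @wc_neq0 c i)
    (fun c _ => munu c i) (fun c => @munu_neq0 c i) (fun c => pY (c, false) i) (fun c => pu c i)
    (fun c => pY (c, false) i) (fun c => pY (c, true) i) (fun c => pq c i) (fun c => pG c i)
    (fun c => @ex c i) (fun c => @eu c i) (fun c => @ef c i) (fun c => @ek c i) (fun c => @eq_ c i)
    _ (pP i) _ => <-.
  - rewrite /slow_inv; congr (slow_functional _ _ _ _ _ _ _ _ _ _ _ _ _ - _).
    + by apply/funext => c; rewrite velocity_sh.
    + by apply/funext => c; rewrite position_sh.
    + by apply/funext => c; rewrite force_sh.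
    + by rewrite potential_sh.
  - by move=> c sc m; rewrite positionE (fastF sc).
  - move=> m; rewrite deriv_jet_pot jet_dpot_grad; last exact: A_sym (okV i).
    by apply: eq_bigr => c _; rewrite displacementE derivB derivC subr0.
apply: cOD; apply: cO_sum => // c fc.
  apply: cO_leB (cOM cO_hinv (U_int tau1 (fun=> 0) (U_slow_err
    (DD := fun=> @Dm R) (x := fun i c => Y (c, false) i) (u := fun i c => velocity Y c i)
    (d1 := fun i => d1F^~ i) (d2 := fun i => d2F^~ i) (c := c) op_Dm e0 (U_Y _) _ (U_d1 c) (U_d2 c)))).
    move=> i; rewrite mulrC; apply: ler_wpM2l => //; rewrite expr2 invfM ler_peMl ?invr_ge0 //.
    by rewrite invf_ge1 ?h0 // h1.
  exact: U_u (fastF fc).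
apply: cO_leB (cOM (cO_coef fc) (U_int tau1 (fun=> 0) (U_fast_err
    (DD := fun=> @Dm R) (f := fun i c => Y (c, false) i) (k := fun i c => Y (c, true) i) (r := r)
    (d1 := fun i => d1F^~ i) (d2 := fun i => d2F^~ i) (c := c) op_Dm e0 e1 (U_Y _) (U_Y _) _ (U_d1 c) (U_d2 c)))).
  by move=> i; rewrite mulrC.
apply: UZr => //; last exact: U_G.
by apply: cON; apply: cO_leB (cO_wc c) => i; rewrite exprn_ile1 // h1.
Qed.

Lemma Theta_zq c i : ThetaI i (displacement Y c i) = ThetaI i (position Y c i).
Proof.
rewrite (_ : displacement Y c i = fun m => 1 *: position Y c i m + (- eI c i)%:P).
  by rewrite /ThetaI Theta_lin (Theta_cst (chrQ i)); apply/funext => m; rewrite scale1r addr0.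
by apply/funext => m; rewrite displacementE scale1r polyCN.
Qed.

(** Relations are controlled up to order N + 1, so the work left over by [fast_functional_step] is
    of order sig^-(N + 2) by [force_balance]; the remaining terms come from the defects as for the
    slow invariant. *)
Lemma fast_inv_shf : (forall i k, (lnorm k <= N.+1)%N -> chr (th i) k 1 = 1 -> phase (th i) k = 0) ->
  cO (fun i => (sig i ^+ N.+2)^-1 + e_ i / h i ^+ 2) (fun i => fast_inv (sh Y) i - fast_inv Y i).
Proof.
move=> nr; have B1 i : 0 <= e_ i / h i ^+ 2 by rewrite divr_ge0 ?exprn_ge0.
have B2 i : 0 <= (sig i ^+ N.+2)^-1 + e_ i / h i ^+ 2.
  by rewrite addr_ge0 // invr_ge0 exprn_ge0 // (le_trans ler01) ?sig1.
pose r i c m : {poly C} := - wc c i *: force Y c i m.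
apply: (cO_ext (f := fun i =>
  - (\sum_c (mean_prod (Q i) (force Y c i) (ThetaI i (position Y c i))).[0]) +
  \sum_(c | ~~ fastc c) (h i)%:C%C^-1 * (slow_err (Q i) (ThetaI i) (fun c => Y (c, false) i)
     (fun c => velocity Y c i) (d1F^~ i) (d2F^~ i) c).[0] +
  \sum_(c | fastc c) (2 * wc c i * (muF c i - nuF c i))^-1 * (fast_err (Q i) (muF^~ i) (nuF^~ i)
     (ThetaI i) (fun c => Y (c, false) i) (fun c => Y (c, true) i) (r i) (d1F^~ i) (d2F^~ i) c).[0])).
  move=> i; rewrite /r; have := fast_functional_step (Q0 i) (hc0 i) (fun c => @wc_neq0 c i)
    (fun c _ => munu c i) (fun c => @munu_neq0 c i) (fun c => pY (c, false) i) (fun c => pu c i)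
    (fun c => pY (c, false) i) (fun c => pY (c, true) i)
    (fun c => @ex c i) (fun c => @eu c i) (fun c => @ef c i) (fun c => @ek c i) (fun c => @eq_ c i)
    (DD := ThetaI i) => <-.
  - by rewrite /fast_inv; congr (fast_functional _ _ _ _ _ _ _ _ _ _ _ - _); apply/funext => c; rewrite velocity_sh.
  - exact: Theta_lin.
  - by move=> F; exact: (Theta_per (chrQ i)).
  - by move=> F; exact: (Theta_shf (Q0 i) (chrQ i)).
  - move=> c sc; have [d [A _ hA]] := U_u (fastF sc).
    exact: (Theta_same (Q0 i) (chrQ i) (hA i)).
  - move=> c _; have [A _ hA] := wt_q c; have [A' _ hA'] := wt_G c.
    by apply/eqP; rewrite -eqr_oppLR -(Theta_anti (Q0 i) (chrQ i) (hA i) (hA' i)).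
  - by move=> c sc; congr (ThetaI i _); apply/funext => m; rewrite positionE (fastF sc).
apply: cOD; first apply: cOD.
- apply: cON; apply: (cO_ext (f := fun i => \sum_c (mean_prod (Q i) (force Y c i) (ThetaI i (displacement Y c i))).[0])).
    by move=> i; apply: eq_bigr => c _; rewrite Theta_zq.
  apply: cO_leB (force_balance tau1 sig1 g1 Q0 chrQ _ thb wt_z bAT _ nr) => //.
    by move=> i; rewrite lerDl.
  by move=> i; exact: A_sym (okV i).
- apply: cO_sum => // c fc.
  apply: cO_leB (cOM cO_hinv (U_val0 tau1 (fun=> 0) (U_slow_err
    (DD := ThetaI) (x := fun i c => Y (c, false) i) (u := fun i c => velocity Y c i)
    (d1 := fun i => d1F^~ i) (d2 := fun i => d2F^~ i) (c := c) op_Theta e0 (U_Y _) _ (U_d1 c) (U_d2 c)))).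
    move=> i; apply: (@le_trans _ _ (e_ i / h i ^+ 2)); last first.
      by rewrite lerDr invr_ge0 exprn_ge0 // (le_trans ler01) ?sig1.
    rewrite mulrC; apply: ler_wpM2l => //; rewrite expr2 invfM ler_peMl ?invr_ge0 //.
    by rewrite invf_ge1 ?h0 // h1.
  exact: U_u (fastF fc).
apply: cO_sum => // c fc.
apply: cO_leB (cOM (cO_coef fc) (U_val0 tau1 (fun=> 0) (U_fast_err
    (DD := ThetaI) (f := fun i c => Y (c, false) i) (k := fun i c => Y (c, true) i) (r := r)
    (d1 := fun i => d1F^~ i) (d2 := fun i => d2F^~ i) (c := c) op_Theta e0 e1 (U_Y _) (U_Y _) _ (U_d1 c) (U_d2 c)))).
  move=> i; rewrite mulrC lerDr invr_ge0 exprn_ge0 //.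
  exact: le_trans ler01 (sig1 i).
apply: UZr => //; last exact: U_G.
by apply: cON; apply: cO_leB (cO_wc c) => i; rewrite exprn_ile1 // h1.
Qed.

Lemma br_rest (F G : modf R) i : mean_prod (Q i) F G = mean (Q i) F * mean (Q i) G +
  mean_prod (Q i) (fun m => F m - mean (Q i) F) (fun m => G m - mean (Q i) G).
Proof.
have br_c (p : {poly C}) (H : modf R) : mean_prod (Q i) (fun=> p) H = p * mean (Q i) H.
  rewrite /mean_prod /mean -scalerAr; congr (_ *: _); by rewrite mulr_sumr.
rewrite (brBl (Q i) F (fun=> mean (Q i) F)) (brBr (Q i) F G (fun=> mean (Q i) G)).
rewrite (brBr (Q i) (fun=> mean (Q i) F) G (fun=> mean (Q i) G)).
rewrite (brC (Q i) F (fun=> mean (Q i) G)) !br_c (mean_cst (Q0 i)).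
by rewrite (mulrC (mean _ G)); move: (_ * _) (mean_prod _ _ _) => a b; ring.
Qed.

(** At the start the expansion sits at the base point of the Taylor polynomial, so force and
    potential reduce there to the derivatives at q_n. *)
Lemma displacement_val0 c i : (displacement Y c i 0).[0] = 0.
Proof.
rewrite displacementE positionE hornerD hornerN hornerC /eI /eT; have [_ i0 _] := sY.
case e: (bl c) => [j|]; last by rewrite i0 /y0I /y0T /= e subrr.
have fc : fastc c by rewrite /fastc e.
rewrite hornerZ hornerD hornerN !hornerZ !i0 /y0I /y0T /= e /ths opprK.
have h1 : expi (- th_ (P i) j) = nuF c i by rewrite /nuF /mu e expiN.
have h2 : expi (th_ (P i) j) = muF c i by rewrite /muF /mu e.
rewrite h1 h2; move: (munu_neq0 i fc) (y_ _ _)%:C%C (x_ _ _)%:C%C => m0 a b.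
by move: (muF c i) (nuF c i) m0 => m k m0; field.
Qed.

Definition un c i : C := ((y_ (V i) c - x_ (V i) c) / h i)%:C%C.

Lemma velocity_val0 c i : bl c = None -> (velocity Y c i 0).[0] = un c i.
Proof.
move=> e; rewrite hornerZ (sol_init sY) /y0I /y0T /= e -rmorphM /= /un; congr (_%:C%C).
by rewrite -/(g i) -/(h i) mulrA mulrA mulVf ?gt_eqF ?g0 // mul1r mulrC.
Qed.

Lemma cO_un c : bl c = None -> cO (fun=> 1) (un c).
Proof.
move=> e; exists B => // i; rewrite mulr1 cabs_real normrM normfV (ger0_norm (h0' i)).
by rewrite ler_pdivrMr ?h0 //; exact: (sl_bd (okV i) e).
Qed.

Variable er : I -> R.
Hypotheses (er1 : forall i, (tau i)^-1 <= er i) (er2 : forall i, h i / g i <= er i).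
Hypothesis er3 : forall i, g i / (tau i ^+ 2 * h i) <= er i.
Let er0 i : 0 <= er i. Proof. by apply: le_trans (er2 i); rewrite divr_ge0. Qed.
Let hg0 i : 0 <= h i / g i. Proof. by rewrite divr_ge0. Qed.
Let hg1 i : h i / g i <= 1. Proof. by rewrite ler_pdivrMr ?g0 // mul1r hg. Qed.
Let her i : h i <= er i.
Proof. by apply: le_trans (er2 i); rewrite ler_pdivlMr ?g0 // ler_piMr // g1. Qed.
Let eer i : e_ i / h i <= er i.
Proof.
apply: le_trans (her i); rewrite ler_pdivrMr ?h0 // -expr2.
by apply: ler_wiXn2l; rewrite // ?h1 // ltnW.
Qed.
Let gsg i : g i / sig i = h i. Proof. exact: gsig. Qed.
Let sgi i : (sig i)^-1 = h i / g i. Proof. by rewrite /sig /sg invf_div. Qed.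

Lemma U_P_val : cO er (fun i => (mean (Q i) (potential Y i)).[0] - (A_ (V i) [::])%:C%C).
Proof.
apply: (cO_ext (f := fun i => - (potential Y i 0 - mean (Q i) (potential Y i)).[0])).
  move=> i; rewrite hornerD hornerN opprB.
  have -> // : (potential Y i 0).[0] = (A_ (V i) [::])%:C%C.
  by apply: jet_pot_val0 => c; exact: displacement_val0.
apply: cON; apply: cO_leB (U_val0 tau1 (fun=> 0) (U_rest tau1 Q0 chrQ sig1 wt_P)) => i.
by rewrite mul1r sgi er2.
Qed.

Section Slow.
Variable c : 'I_n.
Hypothesis e : bl c = None.
Let x i := Y (c, false) i.
Let u i := velocity Y c i.
Let sc : ~~ fastc c. Proof. by rewrite /fastc e. Qed.

Lemma U_xrest : UU h (fun i m => x i m - mean (Q i) (x i)).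
Proof.
have := sol_rep sY (c, false); rewrite /wtT /= e => rx.
by apply: U_leB (U_rest tau1 Q0 chrQ sig1 rx) => i; rewrite gsg.
Qed.
Lemma U_urest : UU (fun i => h i / g i) (fun i m => u i m - mean (Q i) (u i)).
Proof.
have := sol_rep sY (c, true); rewrite /wtT /= e => rx.
apply: (U_ext (F := fun i m => (g i)^-1%:C%C *: (Y (c, true) i m - mean (Q i) (Y (c, true) i)))).
  by move=> i m; rewrite /u /velocity scalerBr -meanZ.
apply: U_leB (UZ (a := fun i => (g i)^-1) _ _ (U_rest tau1 Q0 chrQ sig1 rx)) => [i||i] /=.
- by rewrite gsg mulrC.
- by apply: bO_le => i; rewrite cabs_real ger0_norm // invr_ge0.
- by rewrite gsg.
Qed.

Lemma U_ubar : UU (fun=> 1) (fun i _ => mean (Q i) (u i)).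
Proof. exact: (U_mean tau1 Q0 chrQ (U_u e)). Qed.

Let ub i := mean (Q i) (u i).
Let xb i := mean (Q i) (x i).

Lemma xb_incr i : (xb i).[1] = (xb i).[0] + (h i)%:C%C * (ub i).[1] + (mean (Q i) (d1F c i)).[0].
Proof.
have := congr1 (fun p : {poly C} => p.[0]) (mean_ext (Q i) (@ex c i sc)).
have s1 (p : {poly C}) : (p \Po ('X + 1)).[0] = p.[1] by rewrite horner_comp !hornerE.
rewrite !meanD meanZ !mean_shf ?Q0 //.
rewrite -/(xb i) -/(ub i) s1; move: (xb i) (ub i) (mean _ (d1F c i)) => p r s.
by rewrite !hornerD hornerZ s1.
Qed.

(** Over one unit of slow time the mean of x grows by h times the velocity, so the normalised
    integral of <x', u> is the square of the velocity up to errors; subtracting half of it leaves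
    the kinetic energy. *)
Lemma slow_val : cO er (fun i => (h i)%:C%C^-1 * int01 (mean_prod (Q i) (Dm (x i)) (u i))
   - 2^-1 * (mean_prod (Q i) (u i) (u i)).[1] - 2^-1 * un c i ^+ 2).
Proof.
have [s Us eS] := U_slope tau1 (ler0n _ 4) U_ubar.
(* The errors: [R1] and [R3] from the oscillating parts of <x', u> and <u, u>, [R2] from the slope
   of the mean velocity, [dd] from the defect in the growth of x. *)
pose R1 i := int01 (mean_prod (Q i) (fun m => (Dm (x i)) m - mean (Q i) (Dm (x i))) (fun m => u i m - ub i)).
pose R2 i := int01 ('X * ((xb i)^`() * s i 0)).
pose R3 i := (mean_prod (Q i) (fun m => u i m - ub i) (fun m => u i m - ub i)).[1].
pose dd i := (mean (Q i) (d1F c i)).[0].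
have uz i : (ub i).[0] = un c i - (u i 0 - ub i).[0].
  by rewrite -velocity_val0 // hornerD hornerN; ring.
have eu1 i : (ub i).[1] = (ub i).[0] + (s i 0).[1].
  by rewrite /ub {1}(eS i 0) hornerD hornerC hornerM hornerX mul1r.
have c1 : cO er (fun i => (h i)%:C%C^-1 * R1 i).
  have U1 : UU (fun i => h i / tau i) (fun i m => Dm (x i) m - mean (Q i) (Dm (x i))).
    apply: (U_ext (F := fun i => Dm (fun m => x i m - xb i))).
      by move=> i m; rewrite /Dm derivB -mean_deriv.
    exact: (U_Dm tau1 U_xrest).
  apply: cO_leB (cOM cO_hinv (U_int tau1 (fun=> 0) (U_br tau1 Q0 chrQ U1 U_urest))) => i.
  rewrite -!mulrA mulKf ?gt_eqF ?h0 //; apply: le_trans (er2 i).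
  by rewrite ler_piMl // invf_le1 ?tau0 ?tau1.
have c2 : cO er (fun i => (h i)%:C%C^-1 * R2 i).
  have U1 : UU (fun i => g i / tau i) (fun i _ => (xb i)^`()).
    apply: (U_ext (F := fun i => Dm (fun _ => xb i))) => //.
    exact: (U_Dm tau1 (U_mean tau1 Q0 chrQ (U_slow false e))).
  apply: cO_leB (cOM cO_hinv (U_intX tau1 (fun=> 0) (UM tau1 U1 Us))) => i.
  rewrite div1r; apply: le_trans (er3 i); rewrite le_eqVlt; apply/orP; left; apply/eqP.
  by field; rewrite !gt_eqF // h0.
have c3 : cO er (fun i => R3 i).
  apply: cO_leB (U_val1 tau1 (fun=> 0) (U_br tau1 Q0 chrQ U_urest U_urest)) => i.
  by apply: le_trans (er2 i); rewrite ler_piMl.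
have c4 : cO er (fun i => (h i)%:C%C^-1 * dd i).
  apply: cO_leB (cOM cO_hinv (U_val0 tau1 (fun=> 0) (U_mean tau1 Q0 chrQ (U_d1 c)))) => i.
  by rewrite mulrC eer.
have c5 : cO er (fun i => (s i 0).[1]).
  by apply: cO_leB (U_val1 tau1 (fun=> 0) Us) => i; rewrite div1r.
have c6 : cO er (fun i => (u i 0 - ub i).[0]).
  by apply: cO_leB (U_val0 tau1 (fun=> 0) U_urest) => i.
have b1 : cO (fun=> 1) (un c) by exact: cO_un.
have b2 : cO (fun=> 1) (fun i => (ub i).[0]) by exact: (U_val0 tau1 (fun=> 0) U_ubar).
have b3 : cO (fun=> 1) (fun i => (s i 0).[1]).
  by apply: cO_leB (U_val1 tau1 (fun=> 0) Us) => i; rewrite div1r invf_le1 ?tau0 ?tau1.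
have half : cO (fun=> 1) (fun _ : I => (2^-1 : C)) by exact: cO_cst.
apply: (cO_ext (f := fun i => (h i)%:C%C^-1 * R1 i + (h i)%:C%C^-1 * R2 i - R3 i * 2^-1
   + (h i)%:C%C^-1 * dd i * (ub i).[0] - (s i 0).[1] * (2^-1 * (s i 0).[1])
   - (u i 0 - ub i).[0] * (2^-1 * (un c i + (ub i).[0])))) => [i|]; last first.
  have hM f f' : cO (fun=> 1) f -> cO (fun=> 1) f' -> cO (fun=> 1) (fun i : I => f i * f' i).
    by move=> ff ff'; exact: cOMr.
  apply: cOB; last by apply: cOMr => //; apply: hM => //; exact: cOD.
  apply: cOB; last by apply: cOMr => //; exact: hM.
  apply: cOD; last exact: cOMr.
  by apply: cOB; [exact: cOD|exact: cOMr].
rewrite (br_rest (Dm (x i))) (br_rest (u i) (u i)) -/(ub i) int01D -/(R1 i).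
rewrite [int01 (_ * ub i)](_ : _ = ((xb i).[1] - (xb i).[0]) * (ub i).[0] + R2 i); last first.
  have -> : mean (Q i) (Dm (x i)) = (xb i)^`() by exact: mean_deriv.
  rewrite {1}/ub {1}(eS i 0) -/(ub i) mulrDr int01D; congr (_ + _).
    by rewrite mulrC mul_polyC int01Z int01_deriv mulrC.
  by rewrite /R2 mulrCA.
rewrite xb_incr -/(dd i) (hornerD (ub i * _)) hornerM -/(R3 i) eu1 uz.
move: (hc0 i) (R1 i) (R2 i) (R3 i) (dd i) ((xb i).[0]) (un c i) ((u i 0 - ub i).[0]) ((s i 0).[1]).
by move: ((h i)%:C%C) => H H0 r1 r2 r3 d1 xx uu ur ss; field.
Qed.
End Slow.

Lemma U_q c : fastc c -> UU h (position Y c).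
Proof.
rewrite /fastc; case e: (bl c) => [j|//] _.
apply: (U_ext (F := fun i m => ((muF c i - nuF c i)^-1 * muF c i) *: Y (c, false) i m -
   ((muF c i - nuF c i)^-1 * nuF c i) *: Y (c, true) i m)).
  by move=> i m; rewrite positionE e scalerBr !scalerA.
have k : cO (fun=> 1) (fun i => (muF c i - nuF c i)^-1).
  exists (2 * cs)^-1 => [|i]; first by rewrite invr_ge0 mulr_ge0 // ltW.
  rewrite mulr1 cabsV; have h2 := mu_gap i e; have p2 : 0 < 2 * cs by rewrite mulr_gt0.
  by rewrite lef_pV2 // posrE; exact: lt_le_trans h2.
apply: UB; apply: UZr => //.
- by apply: cOMr => //; exact: cO_mu.
- exact: U_fast e.
- by apply: cOMr => //; exact: cO_nu.
- exact: U_fast e.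
Qed.

(** The fast terms are errors: differentiation in X gains 1 / tau and outweighs nothing else, since
    the two amplitudes of size h compensate the coefficient h^-2; the boundary term in <q, G> is of
    size h. *)
Lemma slow_inv_val : cO er (fun i => slow_inv Y i - ((A_ (V i) [::])%:C%C + \sum_(c | ~~ fastc c) 2^-1 * un c i ^+ 2)).
Proof.
apply: (cO_ext (f := fun i => ((mean (Q i) (potential Y i)).[0] - (A_ (V i) [::])%:C%C) +
  \sum_(c | ~~ fastc c) ((h i)%:C%C^-1 * int01 (mean_prod (Q i) (Dm (Y (c, false) i)) (velocity Y c i))
   - 2^-1 * (mean_prod (Q i) (velocity Y c i) (velocity Y c i)).[1] - 2^-1 * un c i ^+ 2) +
  \sum_(c | fastc c) ((2 * wc c i * (muF c i - nuF c i))^-1 * int01 (Xi (Q i) (@Dm R) (Y (c, false) i) (Y (c, true) i))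
       - 2^-1 * (mean_prod (Q i) (position Y c i) (force Y c i)).[0]))).
  by move=> i; rewrite /slow_inv /slow_functional sumrB; ring.
apply: cOD; first apply: cOD; first exact: U_P_val.
  by apply: cO_sum => // c sc; apply: slow_val; exact: fastF.
apply: cO_sum => // c fc; move: (fc); rewrite {1}/fastc; case e: (bl c) => [j|//] _.
apply: cOB.
  have U1 b : UU (fun i => h i / tau i) (fun i => Dm (Y (c, b) i)) by exact: (U_Dm tau1 (U_fast b e)).
  have U2 : UU (fun i => h i / tau i * h i) (fun i _ => Xi (Q i) (@Dm R) (Y (c, false) i) (Y (c, true) i)).
    apply: UB; first exact: (U_br tau1 Q0 chrQ (U1 false) (U_fast true e)).
    by apply: U_leB (U_br tau1 Q0 chrQ (U_fast false e) (U1 true)) => i; rewrite mulrC.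
  apply: cO_leB (cOM (cO_coef fc) (U_int tau1 (fun=> 0) U2)) => i; apply: le_trans (er1 i).
  by rewrite le_eqVlt; apply/orP; left; apply/eqP; field; rewrite !gt_eqF // h0.
apply: (cO_ext (f := fun i => (mean_prod (Q i) (position Y c i) (force Y c i)).[0] * 2^-1)).
  by move=> i; rewrite mulrC.
apply: cOMr; last exact: cO_cst.
apply: cO_leB (U_val0 tau1 (fun=> 0) (U_br tau1 Q0 chrQ (U_q fc) (U_G c))) => i.
by rewrite mulr1.
Qed.

(** * Leading value of the oscillatory invariant *)

Section Resonant.
Hypotheses (N1 : (1 <= N)%N) (dK : (J * dY <= K)%N).
Hypothesis nr : forall i k, (lnorm k <= N.+1)%N -> chr (th i) k 1 = 1 -> phase (th i) k = 0.

(** The bound on the sine keeps e^(i th) at distance cs from 1, and [tau_cs] makes the passage to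
    the rational frequency smaller than that. *)
Lemma chr_kap_neq1 c j b i : bl c = Some j -> chr (th i) (kapT (c, b)) 1 != 1.
Proof.
move=> e; rewrite chr_kap /= e eq_sym -subr_eq0 -cabs_eq0 gt_eqF //.
have hs : cs <= cabs (1 - expi (ths (P i) j b)).
  apply: le_trans (sin_dist1 _); apply: le_trans (sin_lo (okP i) j) _.
  by rewrite /ths; case: b; rewrite ?sinN ?normrN.
have hd : cabs (expi (ths (P i) j b) - expi (thts (P i) j b)) <= 2 * (g i / tau i).
  apply: le_trans (expi_lipschitz _ _) _; apply: ler_wpM2l => //.
  rewrite /ths /thts; case: b {hs}; rewrite -?opprD ?opprK; have := th_tht (okP i) j => //.
  by rewrite -normrN opprD.
have := cabsD (1 - expi (thts (P i) j b)) (expi (thts (P i) j b) - expi (ths (P i) j b)).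
have <- : cabs (expi (ths (P i) j b) - expi (thts (P i) j b)) =
  cabs (expi (thts (P i) j b) - expi (ths (P i) j b)) by rewrite -cabsN opprB.
rewrite addrA subrK => h3.
have h4 : g i / tau i <= cs / 4.
  rewrite ler_pdivrMr ?tau0 // -mulrA mulrC -mulrA.
  have := tau_cs (okP i); rewrite -/(tau i) => h4; have := g1 i.
  rewrite mulrC; lra.
move: (cs0) hs hd h3 h4; move: (cabs _) (cabs _) (cabs _) (g i / tau i) => a a1 a2 a3.
lra.
Qed.

(** Replacing the character of the fast label by the true multiplier costs at most 2 g / tau; as g
    <= 1/2, the factor 2 in [gap_] absorbs it. *)
Lemma gap_mu c j b i k : bl c = Some j -> (lnorm k <= K)%N ->
  chr (th i) k 1 = chr (th i) (kapT (c, b)) 1 \/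
  1 <= tau i * cabs (chr (th i) k 1 - expi (ths (P i) j b)).
Proof.
move=> e kK; case: (gap_ (okP i) (k := k - kapT (c, b))) => [|f1|f1].
- apply: leq_trans (lnormD _ _) _; rewrite lnormN -addn1 leq_add //.
  exact: leq_trans (kw _) (w1 _).
- by left; apply/eqP; rewrite -subr_eq0 -cabs_eq0 chr_dist f1 subrr cabs0.
right; move: f1; rewrite -chr_dist chr_kap /= e => f1.
have hd : cabs (expi (ths (P i) j b) - expi (thts (P i) j b)) <= 2 * (g i / tau i).
  apply: le_trans (expi_lipschitz _ _) _; apply: ler_wpM2l => //.
  rewrite /ths /thts; case: b {f1}; rewrite -?opprD ?opprK; have := th_tht (okP i) j => //.
  by rewrite -normrN opprD.
have := cabsD (chr (th i) k 1 - expi (ths (P i) j b)) (expi (ths (P i) j b) - expi (thts (P i) j b)).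
rewrite addrA subrK => h3.
have h4 : tau i * (2 * (g i / tau i)) = 2 * g i by field; rewrite gt_eqF ?tau0.
have h5 : tau i * cabs (chr (th i) k 1 - expi (thts (P i) j b)) <=
   tau i * cabs (chr (th i) k 1 - expi (ths (P i) j b)) + 2 * g i.
  rewrite -h4 -mulrDr; apply: ler_wpM2l; first exact: ltW (tau0 i).
  exact: le_trans h3 (lerD (lexx _) hd).
have := g2 i; move: f1; rewrite -/(tau i) -/(th i); lra.
Qed.

(** Outside its own class a fast amplitude is of order h^2 instead of h. The force has coefficient
    h^2; its mean is divided by 1 - mu of order one, and its oscillating part has an extra factor h
    / g <= 1 / tau, which pays for the divisor. *)
Lemma fast_rest c j b : bl c = Some j ->
  UU (fun i => h i ^+ 2) (fun i m => Y (c, b) i m - lproj (th i) (Q i) (kapT (c, b)) (Y (c, b) i) m).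
Proof.
move=> e; pose kap := kapT (c, b).
pose mui i := expi (ths (P i) j b).
pose Rt i m : {poly C} := - wc c i *: force Y c i m + dfF Y (c, b) i m.
have eR i m : shf (Y (c, b) i) m - mui i *: Y (c, b) i m = Rt i m.
  by rewrite (sh_fast _ _ _ _ e) addrC addKr.
pose Gb i := mean (Q i) (force Y c i).
pose H i m := force Y c i m - Gb i.
(* [R1] gathers the mean of the force and all that lies in the class of kap, as [solve_rest]
   expects; [R2] is the small remainder. *)
pose R1 i m : {poly C} := - wc c i *: Gb i + lproj (th i) (Q i) kap (Rt i) m.
pose R2 i m : {poly C} := Rt i m - R1 i m.
have k1 i : chr (th i) kap 1 != 1 by exact: chr_kap_neq1 e.
have mR1 i : mean (Q i) (R1 i) = - wc c i *: Gb i.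
  rewrite /R1 (meanD (Q i) (fun=> _) (lproj (th i) (Q i) kap (Rt i))) (mean_cst (Q0 i)).
  by rewrite /lproj (mean_chr (chrQ i)) ?addr0.
have pR1 i m : lproj (th i) (Q i) kap (R1 i) m = R1 i m - mean (Q i) (R1 i).
  rewrite mR1 /R1 [RHS]addrAC subrr add0r.
  rewrite (_ : (fun m => _ + _) = fun m => - wc c i *: Gb i - -1 *: lproj (th i) (Q i) kap (Rt i) m); last first.
    by apply/funext => m'; rewrite scaleN1r opprK.
  rewrite (proj_sub _ _ (fun=> _) (fun m => -1 *: lproj (th i) (Q i) kap (Rt i) m)) (proj_cst (chrQ i)) //.
  rewrite (proj_scale _ _ (lproj (th i) (Q i) kap (Rt i)) (-1)) proj_idem ?Q0 //.
  by rewrite scaleN1r sub0r opprK.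
have eR2 i m : R2 i m = - wc c i *: (H i m - lproj (th i) (Q i) kap (H i) m) +
   (dfF Y (c, b) i m - lproj (th i) (Q i) kap (dfF Y (c, b) i) m).
  have q1 : lproj (th i) (Q i) kap (H i) m = lproj (th i) (Q i) kap (force Y c i) m.
    by rewrite /H (proj_sub _ _ (force Y c i) (fun=> Gb i)) (proj_cst (chrQ i)) // subr0.
  have q2 : lproj (th i) (Q i) kap (Rt i) m = - wc c i *: lproj (th i) (Q i) kap (force Y c i) m +
     lproj (th i) (Q i) kap (dfF Y (c, b) i) m.
    rewrite /Rt (_ : (fun m => _ + _) = fun m => - wc c i *: force Y c i m - -1 *: dfF Y (c, b) i m); last first.
      by apply/funext => m'; rewrite scaleN1r opprK.
    rewrite (proj_sub _ _ (fun m => - wc c i *: force Y c i m) (fun m => -1 *: dfF Y (c, b) i m)).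
    by rewrite !proj_scale scaleN1r opprK.
  rewrite q1 /R2 /R1 q2 /Rt /H !scalerBr.
  have aux (M : comNzRingType) (a1 a2 a3 a4 a5 : M) :
    a1 + a2 - (a3 + (a4 + a5)) = a1 - a3 - a4 + (a2 - a5) by ring.
  exact: aux.
have dYJ : (dY <= J * dY)%N by rewrite leq_pmull // L1.
have cw : cO (fun i => h i ^+ 2) (fun i => - wc c i) by exact/cON/cO_wc.
have hh2 i : 0 <= h i ^+ 2 by rewrite exprn_ge0.
have [A1 A10 r1] : repO th tau (fun=> 1) 0 (J * dY) (fun i => h i ^+ 2) (fun i _ => mean (Q i) (R1 i)).
  apply: (repO_ext (F := fun i _ => - wc c i *: Gb i)) => [i m|]; first by rewrite mR1.
  have rG := repO_mean tau1 Q0 chrQ (repO_unweight tau1 sig1 (leq0n 1) (wt_G c)).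
  have G0 (i : I) : 0 <= 1 / sig i ^+ 0 by rewrite expr0 divr1.
  by apply: repO_leB (repOZ cw G0 rG) => i; rewrite expr0 divr1 mulr1.
have [A2 A20 r2] : repO th tau (fun=> 1) 0 (J * dY) (fun i => h i ^+ 2 / tau i) R2.
  have ht2 i : h i ^+ 2 * (h i / g i) <= h i ^+ 2 / tau i.
    apply: ler_wpM2l => //; rewrite ler_pdivrMr ?g0 // ler_pdivlMl ?tau0 //.
    by apply: le_trans (tauh i) _; rewrite expr2 ler_piMl // g1.
  apply: (repO_ext (F := fun i m => - wc c i *: (H i m - lproj (th i) (Q i) kap (H i) m) +
   (dfF Y (c, b) i m - lproj (th i) (Q i) kap (dfF Y (c, b) i) m))) => [i m|]; first by rewrite eR2.
  have rH : repO th tau (fun=> 1) 0 (J * dY) (fun i => 1 / sig i) H.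
    exact: (repO_rest tau1 Q0 chrQ sig1 (wt_G c)).
  have := sol_defect sY (c, b); rewrite /wtT /= e => rd.
  have {}rd := repO_deg dYJ (repO_unweight tau1 sig1 (leqnn 1) rd).
  apply: repOD.
    apply: repO_leB (repOZ cw _ (repOB rH (repO_proj tau1 Q0 chrQ (fun=> kap) rH))) => i.
      by rewrite div1r sgi.
    by rewrite div1r sgi.
  apply: repO_leB (repOB rd (repO_proj tau1 Q0 chrQ (fun=> kap) rd)) => i.
  rewrite expr1 mulrAC; apply: ler_wpM2r; first by rewrite invr_ge0 ltW ?tau0.
  rewrite -(ltn_predK J2) exprS mulrAC gsg.
  apply: le_trans (ler_wpM2l (h0' i) (gJ i)) _; rewrite -exprS.
  by apply: ler_wiXn2l; rewrite // ?h1 // ltnS ltnW // ltnW.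
have rY : repO th tau (fun=> 1) 0 dY h (Y (c, b)).
  have := sol_rep sY (c, b); rewrite /wtT /= e => rx.
  by apply: repO_leB (repO_unweight tau1 sig1 (leqnn 1) rx) => i; rewrite expr1 gsg.
have [A0 A00 r0] := rY.
have [A A_0 rA] := solve_term_nonres R ell (J * dY).
have hA i : rep (th i) (tau i) 1 0 (J * dY)
   (A * (A1 * h i ^+ 2 / cs + tau i * (A2 * (h i ^+ 2 / tau i))))
   (fun m => Y (c, b) i m - lproj (th i) (Q i) kap (Y (c, b) i) m).
  apply: (solve_rest (Q0 i) (chrQ i) (mu := mui i) (R1 := R1 i) A_0 rA (tau1 i) (lexx 1) cs0 _ _ _ (k1 i) _ (r0 i) _ _ (r2 i)).
  - by apply: le_trans (tau_cs (okP i)); rewrite ler1n.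
  - exact: expi_neq0.
  - apply: le_trans (sin_dist1 _); apply: le_trans (sin_lo (okP i) j) _.
    by rewrite /mui /ths; case: (b); rewrite ?sinN ?normrN.
  - move=> k; rewrite (maxn_idPl dYJ) => kd; apply: (@gap_mu c j b i k e).
    exact: leq_trans kd dK.
  - by move=> m; rewrite eR /R2 addrC subrK.
  - exact: r1.
  - exact: pR1.
exists (J * dY)%N, (A * (A1 / cs + A2)) => [|i].
  by rewrite mulr_ge0 // addr_ge0 // divr_ge0 // ltW.
apply: (rep_le (leqnn _) _ (hA i)); rewrite -[X in _ <= X]mulrA; apply: ler_wpM2l => //.
rewrite le_eqVlt; apply/orP; left; apply/eqP; field.
by rewrite !gt_eqF // tau0.
Qed.

(** A fast label has order 1, so relations of order up to 2 must be harmless; this is where N >= 1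
    enters. *)
Lemma lift_phase_kap c j b i : bl c = Some j -> lift_phase (th i) (chr (th i) (kapT (c, b)) 1) = thts (P i) j b.
Proof.
move=> e; rewrite (lift_phaseE (@nr i)) /kapT /= e; case: b; rewrite /thts ?phaseN ?phase_dlab //.
  by rewrite lnormN lnorm_dlab.
by rewrite lnorm_dlab.
Qed.

Definition osc_val c i : C := if bl c is Some j then
  (wc c i * (muF c i - nuF c i))^-1 * (0 +i* th_ (P i) j)%C * (y0I (c, false) i * y0I (c, true) i) else 0.

(** On its own class [Theta] multiplies by i [tht_], and the antisymmetry doubles the product. Parts
    outside the class are of order h^2 by [fast_rest], so they contribute h^3 against the
    coefficient h^-2. *)
Lemma fast_val c : fastc c -> cO er (fun i =>
  (2 * wc c i * (muF c i - nuF c i))^-1 * (Xi (Q i) (ThetaI i) (Y (c, false) i) (Y (c, true) i)).[0] - osc_val c i).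
Proof.
move=> fc; move: (fc); rewrite {1}/fastc /osc_val; case e: (bl c) => [j|//] _.
pose f i := Y (c, false) i; pose k i := Y (c, true) i.
pose phi i := lproj (th i) (Q i) (kapT (c, false)) (f i).
pose psi i := lproj (th i) (Q i) (kapT (c, true)) (k i).
pose r i m : {poly C} := f i m - phi i m; pose s i m : {poly C} := k i m - psi i m.
pose il i : C := (0 +i* tht_ (P i) j)%C.
have Uf := U_fast false e; have Uk := U_fast true e.
have Ur : UU (fun i => h i ^+ 2) r by exact: (fast_rest false e).
have Us : UU (fun i => h i ^+ 2) s by exact: (fast_rest true e).
have Uphi : UU h phi by exact: (U_proj tau1 Q0 chrQ (fun=> _) Uf).
have ekap : kapT (c, true) = - kapT (c, false) by rewrite /kapT /= e.
have Thphi i : ThetaI i (phi i) = fun m => il i *: phi i m.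
  apply/funext => m; have [d [A _ hA]] := Uf.
  by rewrite /ThetaI /phi (Theta_proj (Q0 i) (chrQ i) _ _ (hA i)) (lift_phase_kap false _ e).
have brpp i : (mean_prod (Q i) (phi i) (psi i)).[0] = (phi i 0).[0] * (psi i 0).[0].
  rewrite /mean_prod (_ : mean (Q i) _ = phi i 0 * psi i 0) ?hornerM //.
  rewrite -[RHS](mean_cst (Q0 i)); apply: mean_ext => m.
  rewrite /phi /psi /lproj !chr_0 !scale1r -scalerAl -scalerAr scalerA -chrD ekap subrr.
  by rewrite chr0 scale1r.
pose X1 i := (mean_prod (Q i) (ThetaI i (phi i)) (s i)).[0].
pose X2 i := (mean_prod (Q i) (ThetaI i (r i)) (k i)).[0].
have XiE i : (Xi (Q i) (ThetaI i) (f i) (k i)).[0] = 2 * (il i * (mean_prod (Q i) (phi i) (psi i)).[0] + X1 i + X2 i).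
  have [d [A _ hA]] := Uf; have [d' [A' _ hA']] := Uk.
  rewrite /Xi -[mean_prod (Q i) (f i) _]opprK -(Theta_anti (Q0 i) (chrQ i) (hA i) (hA' i)) opprK.
  rewrite -/(ThetaI i (f i)).
  have -> : f i = fun m => phi i m + r i m by apply/funext => m; rewrite /r addrC subrK.
  rewrite {1 2}/ThetaI (op_linD (@Theta_lin R ell (th i) (Q i))) -/(ThetaI i) brDl -/(k i).
  have -> : mean_prod (Q i) (ThetaI i (phi i)) (k i) = il i *: mean_prod (Q i) (phi i) (psi i) + mean_prod (Q i) (ThetaI i (phi i)) (s i).
    have {1}-> : k i = fun m => psi i m + s i m by apply/funext => m; rewrite /s addrC subrK.
    by rewrite brDr {1}Thphi brZl.
  rewrite /X1 /X2; move: (mean_prod _ (phi i) _) (mean_prod _ _ (s i)) (mean_prod _ _ (k i)) (il i) => p1 p2 p3 a.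
  by rewrite !hornerD !hornerZ; ring.
have k1 : cO (fun i => (h i ^+ 2)^-1) (fun i => (wc c i * (muF c i - nuF c i))^-1).
  apply: (cO_ext (f := fun i => (2 * wc c i * (muF c i - nuF c i))^-1 * 2)) => [i|].
    by rewrite -mulrA invfM mulrAC mulVf ?mul1r // pnatr_eq0.
  by apply: cOMr; [exact: cO_coef|exact: cO_cst].
have kt : cO (fun=> 1) il.
  by exists 4 => // i; rewrite cabs_im mulr1; exact: thb i j.
have h3e i : (h i ^+ 2)^-1 * (h i * h i ^+ 2) <= er i.
  by rewrite mulrCA mulVf ?mulr1 ?her // gt_eqF // exprn_gt0 // h0.
have hh2 i : 0 <= h i ^+ 2 by rewrite exprn_ge0.
have c1 : cO er (fun i => (wc c i * (muF c i - nuF c i))^-1 * X1 i).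
  exact: cO_leB (cOM k1 (U_val0 tau1 (fun=> 0) (U_br tau1 Q0 chrQ (op_Theta h0' Uphi) Us))).
have c2 : cO er (fun i => (wc c i * (muF c i - nuF c i))^-1 * X2 i).
  apply: cO_leB (cOM k1 (U_val0 tau1 (fun=> 0) (U_br tau1 Q0 chrQ (op_Theta hh2 Ur) Uk))) => i.
  by rewrite [_ * h i]mulrC.
have cf b : cO h (fun i => (Y (c, b) i 0).[0]) by exact: (U_val0 tau1 (fun=> 0) (U_fast b e)).
have cp : cO h (fun i => (phi i 0).[0]) by exact: (U_val0 tau1 (fun=> 0) Uphi).
have cr : cO (fun i => h i ^+ 2) (fun i => (r i 0).[0]) by exact: (U_val0 tau1 (fun=> 0) Ur).
have cs' : cO (fun i => h i ^+ 2) (fun i => (s i 0).[0]) by exact: (U_val0 tau1 (fun=> 0) Us).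
have c3 : cO er (fun i => (wc c i * (muF c i - nuF c i))^-1 * ((r i 0).[0] * (k i 0).[0] * il i)).
  apply: cO_leB (cOM k1 (cOMr (cOM cr (cf true)) kt)) => i.
  by rewrite [_ * h i]mulrC.
have c4 : cO er (fun i => (wc c i * (muF c i - nuF c i))^-1 * ((phi i 0).[0] * (s i 0).[0] * il i)).
  exact: cO_leB (cOM k1 (cOMr (cOM cp cs') kt)).
have c5 : cO er (fun i => (wc c i * (muF c i - nuF c i))^-1 *
    ((f i 0).[0] * (k i 0).[0] * (il i - (0 +i* th_ (P i) j)%C))).
  have kd : cO er (fun i => il i - (0 +i* th_ (P i) j)%C).
    apply: bO_le => i; have -> : il i - (0 +i* th_ (P i) j)%C = (0 +i* (tht_ (P i) j - th_ (P i) j))%C.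
      by rewrite /il; apply/eqP; rewrite eq_complex /= subrr !eqxx.
    rewrite cabs_im distrC; apply: le_trans (th_tht (okP i) j) _.
    by apply: le_trans (er1 i); rewrite ler_piMl ?invr_ge0 ?(ltW (tau0 i)) // g1.
  apply: cO_leB (cOM k1 (cOM (cOM (cf false) (cf true)) kd)) => i.
  by rewrite -expr2 mulKf // gt_eqF // exprn_gt0 // h0.
apply: (cO_ext (f := fun i => (wc c i * (muF c i - nuF c i))^-1 * X1 i +
  (wc c i * (muF c i - nuF c i))^-1 * X2 i
  - (wc c i * (muF c i - nuF c i))^-1 * ((r i 0).[0] * (k i 0).[0] * il i)
  - (wc c i * (muF c i - nuF c i))^-1 * ((phi i 0).[0] * (s i 0).[0] * il i)
  + (wc c i * (muF c i - nuF c i))^-1 *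
    ((f i 0).[0] * (k i 0).[0] * (il i - (0 +i* th_ (P i) j)%C)))) => [i|]; last first.
  by apply: cOD => //; apply: cOB => //; apply: cOB => //; apply: cOD.
rewrite -/(f i) -/(k i) XiE brpp -(sol_init sY (c, false) i) -(sol_init sY (c, true) i).
rewrite -/(f i) -/(k i) -[2 * wc c i * _]mulrA.
have -> : (phi i 0).[0] = (f i 0).[0] - (r i 0).[0].
  by rewrite /r hornerD hornerN opprB addrC subrK.
have -> : (psi i 0).[0] = (k i 0).[0] - (s i 0).[0].
  by rewrite /s hornerD hornerN opprB addrC subrK.
have := mulf_neq0 (wc_neq0 i fc) (munu_neq0 i fc); move: (_ * (_ - _)) => w w0.
move: (X1 i) (X2 i) ((r i 0).[0]) ((s i 0).[0]) ((f i 0).[0]) ((k i 0).[0]) (il i) (0 +i* _)%C.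
by move=> x1 x2 r0 s0 f0 k0 l l'; field.
Qed.

(** [Theta] kills constants in m and is antisymmetric, so for slow coordinates only the oscillating
    parts of position and velocity pair, and these are of sizes h and h / g. *)
Lemma fast_inv_val : cO er (fun i => fast_inv Y i - \sum_(c | fastc c) osc_val c i).
Proof.
apply: (cO_ext (f := fun i =>
  \sum_(c | ~~ fastc c) ((h i)%:C%C^-1 * (mean_prod (Q i) (ThetaI i (Y (c, false) i)) (velocity Y c i)).[0]) +
  \sum_(c | fastc c) ((2 * wc c i * (muF c i - nuF c i))^-1 *
      (Xi (Q i) (ThetaI i) (Y (c, false) i) (Y (c, true) i)).[0] - osc_val c i))).
  by move=> i; rewrite /fast_inv /fast_functional sumrB addrA.
apply: cOD; apply: cO_sum => // c fc; last exact: fast_val.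
have e := fastF fc.
pose xr i m : {poly C} := Y (c, false) i m - mean (Q i) (Y (c, false) i).
pose ur i m : {poly C} := velocity Y c i m - mean (Q i) (velocity Y c i).
have Uxr : UU h xr by exact: U_xrest.
have Uur : UU (fun i => h i / g i) ur by exact: U_urest.
have -> : (fun i => (h i)%:C%C^-1 * (mean_prod (Q i) (ThetaI i (Y (c, false) i)) (velocity Y c i)).[0]) =
   (fun i => (h i)%:C%C^-1 * (mean_prod (Q i) (ThetaI i (xr i)) (ur i)).[0]).
  apply/funext => i; congr (_ * _.[0]).
  have ThE (F : modf R) (p : {poly C}) : ThetaI i (fun m => F m - p) = ThetaI i F.
    rewrite (_ : (fun m => _) = fun m => 1 *: F m + (- p)); last by apply/funext => m; rewrite scale1r.
    by rewrite /ThetaI Theta_lin (Theta_cst (chrQ i)); apply/funext => m; rewrite scale1r addr0.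
  rewrite ThE /ur (brBr (Q i) _ (velocity Y c i) (fun=> mean (Q i) (velocity Y c i))).
  suff -> : mean_prod (Q i) (ThetaI i (Y (c, false) i)) (fun=> mean (Q i) (velocity Y c i)) = 0 by rewrite subr0.
  have [d [A _ hA]] := U_slow false e; have [d' [A' _ hA']] := U_ubar e.
  rewrite /ThetaI (Theta_anti (Q0 i) (chrQ i) (hA i) (hA' i)) (Theta_cst (chrQ i)).
  rewrite /mean_prod (mean_ext (Q i) (G := fun=> 0)) ?(mean_cst (Q0 i)) ?oppr0 // => m.
  by rewrite mulr0.
apply: cO_leB (cOM cO_hinv (U_val0 tau1 (fun=> 0) (U_br tau1 Q0 chrQ (op_Theta h0' Uxr) Uur))) => i.
by rewrite mulKf ?er2 // gt_eqF // h0.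
Qed.
End Resonant.
End Solution.

End Families.
End Model.

(** * Restarting the expansion at the next step *)

Section Rebase.
Variables (R : realType) (ell n : nat) (bl : 'I_n -> option 'I_ell).
Local Notation C := R[i].
Local Notation T := ('I_n * bool)%type.
Local Notation modf := (modf R).
Variables (I : Type) (P : I -> par R ell) (cs B : R) (K J NN : nat).
Hypotheses (cs0 : 0 < cs) (J2 : (1 < J)%N) (B0 : 0 <= B).
Hypothesis okP : forall i, par_ok cs K J NN (P i).
Let h i := h_ (P i). Let g i := g_ (P i). Let tau i := tau_ (P i). Let Q i := Q_ (P i).
Let th i := tht_ (P i). Let sig i := sg (P i).
Local Notation UU := (unw th tau).
Let tau1 : forall i, 1 <= tau i := tau1 okP.
Let sig1 : forall i, 1 <= sig i := sig1 okP.
Let Q0 : forall i, (0 < Q i)%N := Q0 okP.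
Let chrQ : forall i k, chr (th i) k (Q i) = 1 := chrQ okP.
Let tau0 i : 0 < tau i. Proof. exact: lt_le_trans ltr01 (tau1 i). Qed.
Let h0 i : 0 < h i := h0 okP i.
Let g0 i : 0 < g i := g0 okP i.
Let h0' i : 0 <= h i. Proof. exact/ltW/h0. Qed.
Let g0' i : 0 <= g i. Proof. exact/ltW/g0. Qed.
Local Notation fast := (fastc bl).

(** * Stability of both functionals under small changes of the expansion *)

Section Close.
Variable e : I -> R.
Hypothesis e0 : forall i, 0 <= e i.
Let eh i : 0 <= e i / h i ^+ 2. Proof. by rewrite divr_ge0 // exprn_ge0. Qed.
Let e_le i : e i <= e i / h i ^+ 2.
Proof. by rewrite ler_peMr // invf_ge1 ?exprn_gt0 ?exprn_ile1 ?(h1 okP). Qed.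
Let e_le1 i : (h i)^-1 * e i <= e i / h i ^+ 2.
Proof.
rewrite mulrC; apply: ler_wpM2l => //; rewrite expr2 invfM ler_peMl ?invr_ge0 //.
by rewrite invf_ge1 // (h1 okP).
Qed.

(** Boundedness of both functions is included because products are compared. *)
Definition close (F F' : I -> modf) :=
  [/\ UU (fun=> 1) F, UU (fun=> 1) F' & UU e (fun i m => F i m - F' i m)].

Lemma br_close F F' G G' : close F F' -> close G G' ->
  UU e (fun i _ => mean_prod (Q i) (F i) (G i) - mean_prod (Q i) (F' i) (G' i)).
Proof. by move=> [_ u1 d1] [u2 _ d2]; exact: (U_brB tau1 Q0 chrQ u1 u2 e0 d1 d2). Qed.

Lemma Xi_close DD F F' G G' : close F F' -> close G G' ->
  close (fun i => DD i (F i)) (fun i => DD i (F' i)) ->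
  close (fun i => DD i (G i)) (fun i => DD i (G' i)) ->
  UU e (fun i _ => Xi (Q i) (DD i) (F i) (G i) - Xi (Q i) (DD i) (F' i) (G' i)).
Proof.
move=> cF cG dF dG; apply: (U_ext (F := fun i _ =>
  (mean_prod (Q i) (DD i (F i)) (G i) - mean_prod (Q i) (DD i (F' i)) (G' i)) -
  (mean_prod (Q i) (F i) (DD i (G i)) - mean_prod (Q i) (F' i) (DD i (G' i))))).
  have aux (M : comNzRingType) (a1 a2 a3 a4 : M) : a1 - a2 - (a3 - a4) = a1 - a3 - (a2 - a4) by ring.
  by move=> i _; exact: aux.
by apply: UB; exact: br_close.
Qed.

Variables (x u f k q G x' u' f' k' q' G' : 'I_n -> I -> modf) (Pp Pp' : I -> modf).
Let mu c i := muF bl P c i.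
Let nu c i := nuF bl P c i.
Hypotheses (cu : forall c, ~~ fast c -> close (u c) (u' c)).
Hypotheses (cf : forall c, fast c -> close (f c) (f' c)) (ck : forall c, fast c -> close (k c) (k' c)).

Lemma fast_functional_close (DD : I -> modf -> modf) :
  (forall c, ~~ fast c -> close (fun i => DD i (x c i)) (fun i => DD i (x' c i))) ->
  (forall c, fast c -> close (fun i => DD i (f c i)) (fun i => DD i (f' c i))) ->
  (forall c, fast c -> close (fun i => DD i (k c i)) (fun i => DD i (k' c i))) ->
  cO (fun i => e i / h i ^+ 2) (fun i =>
    fast_functional (Q i) fast (h i)%:C%C ((wc bl P)^~ i) (mu^~ i) (nu^~ i) (DD i) (x^~ i) (u^~ i) (f^~ i) (k^~ i) -
    fast_functional (Q i) fast (h i)%:C%C ((wc bl P)^~ i) (mu^~ i) (nu^~ i) (DD i) (x'^~ i) (u'^~ i) (f'^~ i) (k'^~ i)).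
Proof.
move=> dx df dk.
apply: (cO_ext (f := fun i =>
  \sum_(c | ~~ fast c) ((h i)%:C%C^-1 * (mean_prod (Q i) (DD i (x c i)) (u c i) - mean_prod (Q i) (DD i (x' c i)) (u' c i)).[0])
  + \sum_(c | fast c) ((2 * wc bl P c i * (mu c i - nu c i))^-1 *
     (Xi (Q i) (DD i) (f c i) (k c i) - Xi (Q i) (DD i) (f' c i) (k' c i)).[0]))).
  move=> i; rewrite /fast_functional opprD addrACA -!sumrB; congr (_ + _).
    by apply: eq_bigr => c _; rewrite hornerD hornerN mulrBr.
  by apply: eq_bigr => c _; rewrite hornerD hornerN mulrBr.
apply: cOD; apply: cO_sum => // c fc.
  exact: cO_leB (cOM (cO_hinv okP) (U_val0 tau1 (fun=> 0) (br_close (dx c fc) (cu fc)))).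
apply: cO_leB (cOM (cO_coef cs0 okP fc) (U_val0 tau1 (fun=> 0) (Xi_close (cf fc) (ck fc) (df c fc) (dk c fc)))) => i.
by rewrite mulrC.
Qed.

Let op_lin0 : I -> modf -> modf := fun=> @Dm R.
Hypotheses (cq : forall c, fast c -> close (q c) (q' c)) (cG : forall c, fast c -> close (G c) (G' c)).
Hypothesis cP : UU e (fun i m => Pp i m - Pp' i m).

Lemma slow_functional_close :
  (forall c, ~~ fast c -> close (fun i => Dm (x c i)) (fun i => Dm (x' c i))) ->
  (forall c, fast c -> close (fun i => Dm (f c i)) (fun i => Dm (f' c i))) ->
  (forall c, fast c -> close (fun i => Dm (k c i)) (fun i => Dm (k' c i))) ->
  cO (fun i => e i / h i ^+ 2) (fun i =>
    slow_functional (Q i) fast (h i)%:C%C ((wc bl P)^~ i) (mu^~ i) (nu^~ i) (x^~ i) (u^~ i) (f^~ i) (k^~ i) (q^~ i) (G^~ i) (Pp i) -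
    slow_functional (Q i) fast (h i)%:C%C ((wc bl P)^~ i) (mu^~ i) (nu^~ i) (x'^~ i) (u'^~ i) (f'^~ i) (k'^~ i) (q'^~ i) (G'^~ i) (Pp' i)).
Proof.
move=> dx df dk.
have half (w : I -> C) : cO (fun i => e i / h i ^+ 2) w -> cO (fun i => e i / h i ^+ 2) (fun i => 2^-1 * w i).
  move=> cw; apply: (cO_ext (f := fun i => w i * 2^-1)) => [i|]; first by rewrite mulrC.
  by apply: cOMr => //; exact: cO_cst.
apply: (cO_ext (f := fun i => (mean (Q i) (fun m => Pp i m - Pp' i m)).[0] +
  \sum_(c | ~~ fast c) ((h i)%:C%C^-1 * int01 (mean_prod (Q i) (Dm (x c i)) (u c i) - mean_prod (Q i) (Dm (x' c i)) (u' c i))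
    - 2^-1 * (mean_prod (Q i) (u c i) (u c i) - mean_prod (Q i) (u' c i) (u' c i)).[1])
  + \sum_(c | fast c) ((2 * wc bl P c i * (mu c i - nu c i))^-1 *
     int01 (Xi (Q i) (@Dm R) (f c i) (k c i) - Xi (Q i) (@Dm R) (f' c i) (k' c i))
     - 2^-1 * (mean_prod (Q i) (q c i) (G c i) - mean_prod (Q i) (q' c i) (G' c i)).[0]))).
  move=> i; rewrite /slow_functional !opprD addrACA (addrACA _ _ (- _)) -!sumrB; congr (_ + _ + _).
  - by rewrite meanB hornerD hornerN.
  - by apply: eq_bigr => c _; rewrite hornerD hornerN int01B; ring.
  - by apply: eq_bigr => c _; rewrite hornerD hornerN int01B; ring.
apply: cOD; first apply: cOD.
- exact: cO_leB (U_val0 tau1 (fun=> 0) (U_mean tau1 Q0 chrQ cP)).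
- apply: cO_sum => // c fc; apply: cOB.
    exact: cO_leB (cOM (cO_hinv okP) (U_int tau1 (fun=> 0) (br_close (dx c fc) (cu fc)))).
  apply: half; exact: cO_leB (U_val1 tau1 (fun=> 0) (br_close (cu fc) (cu fc))).
- apply: cO_sum => // c fc; apply: cOB.
    apply: cO_leB (cOM (cO_coef cs0 okP fc) (U_int tau1 (fun=> 0) (Xi_close (DD := op_lin0) (cf fc) (ck fc) (df c fc) (dk c fc)))) => i.
    by rewrite mulrC.
  apply: half; exact: cO_leB (U_val0 tau1 (fun=> 0) (br_close (cq fc) (cG fc))).
Qed.
End Close.

Variables (V V' : I -> pt R n).
Hypotheses (okV : forall i, pt_ok bl B J (P i) (V i)) (okV' : forall i, pt_ok bl B J (P i) (V' i)).
Definition shift_vec (v v' : pt R n) c : R := y_ v' c - y_ v c.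
Record next_pt (p : par R ell) (v v' : pt R n) : Prop := NextPt {
  nx_x : forall c, x_ v' c = y_ v c;
  nx_slow : forall c, bl c = None -> y_ v' c = 2 * y_ v c - x_ v c - h_ p ^+ 2 * A_ v [:: c];
  nx_fast : forall c j, bl c = Some j ->
    y_ v' c = 2 * cos (th_ p j) * y_ v c - x_ v c - h_ p ^+ 2 * chi_ p j * A_ v [:: c] }.
Hypothesis nxt : forall i, next_pt (P i) (V i) (V' i).
Let b i := shift_vec (V i) (V' i).
Hypothesis tay : taylor_arr J h b (fun i => A_ (V i)) (fun i => A_ (V' i)).
Variables (Y Y' : T -> I -> modf).
Hypotheses (sY : is_expansion bl P V J Y) (sY' : is_expansion bl P V' J Y').

Definition dS := (J * dY J)%N.
Hypothesis dK : (sdeg J dS J.-1 <= K)%N.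

(** A slow position is measured from the current base point, so moving the base point to q_(n+1)
    subtracts the displacement. Fast amplitudes are absolute, and their base point sits in [eT]. *)
Definition cst_b (s : T) i : {poly C} := if (bl s.1 == None) && ~~ s.2 then (b i s.1)%:C%C%:P else 0.
Definition rebased s i m : {poly C} := shf (Y s i) m - cst_b s i.

Lemma b_le c i : `|b i c| <= 2 * B * h i.
Proof.
rewrite /b /shift_vec; case e: (bl c) => [j|].
  apply: le_trans (ler_normB _ _) _.
  have := y_bd (okV i) e; have := y_bd (okV' i) e; rewrite -/(h i).
  by move: (h i) `|_| `|_| => h1 a1 a2; lra.
rewrite -(nx_x (nxt i) c); apply: le_trans (sl_bd (okV' i) e) _.
by rewrite -/(h i) -mulrA ler_peMl ?mulr_ge0 // ler1n.
Qed.

Lemma rebased_rep s : repO th tau sig (wtT bl s) (dY J) g (rebased s).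
Proof.
apply: repOB; first exact: (repO_shf tau1 sig1 (sol_rep sY s)).
rewrite /cst_b; case cb: (_ && _); last exact: repO0.
move: cb => /andP [/eqP e _].
apply: (repO_ext (F := fun i m => ((b i s.1)%:C%C * chr (th i) 0 m) *: 'X^0)) => [i m|].
  by rewrite chr0 mulr1 expr0 alg_polyC.
apply: repO_chr; rewrite ?lnorm0 // /wtT e /=; exists (2 * B) => [|i]; first exact: mulr_ge0.
rewrite expr0 mulr1 cabs_real; apply: le_trans (b_le _ _) _.
by apply: ler_wpM2l; [exact: mulr_ge0|exact: (hg okP)].
Qed.

Lemma displacement_rebased c i m : displacement bl P V (sh Y) c i m = displacement bl P V' rebased c i m + (b i c)%:C%C%:P.
Proof.
rewrite !displacementE !positionE /rebased /cst_b /sh /eI /eT /b /shift_vec /=.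
case e: (bl c) => [j|] /=; last by rewrite polyC0 !subr0 subrK.
rewrite !subr0 rmorphB polyCB /=; move: (_ *: _) => p.
by move: (y_ (V i) c)%:C%C%:P (y_ (V' i) c)%:C%C%:P => a a'; ring.
Qed.

Definition base_err c i m : {poly C} := force bl P V J (sh Y) c i m - force bl P V' J rebased c i m.

Lemma displacement_rep c : repO th tau sig 0 (dY J) g (fun i m => displacement bl P V' rebased c i m).
Proof. exact: (repO_deviation tau1 sig1 (w1 bl) g0' (hrhoT bl cs0 okP) rebased_rep (heT B0 okP okV')). Qed.

Lemma base_err_rep c : repO th tau sig 0 dS (fun i => g i ^+ J) (base_err c).
Proof.
have H := repO_grad_base tau1 sig1 g0' (ltnW J2) (b := b) h0' (hg okP) (fun i => A_sym (okV i)) tay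
  (z := fun c i m => displacement bl P V' rebased c i m) c displacement_rep.
apply: repO_ext H => i m; rewrite /base_err /force; congr (_ - _); congr jet_grad.
by apply/funext => c'; rewrite displacement_rebased.
Qed.

Lemma base_P_rep : repO th tau sig 0 dS (fun i => g i ^+ J.+1)
  (fun i m => potential bl P V J (sh Y) i m - potential bl P V' J rebased i m).
Proof.
have H := repO_pot_base tau1 sig1 g0' (b := b) h0' (hg okP) (fun i => A_sym (okV i)) tay
  (z := fun c i m => displacement bl P V' rebased c i m) displacement_rep.
apply: repO_ext H => i m; rewrite /potential; congr (_ - _); congr jet_pot.
by apply/funext => c'; rewrite displacement_rebased.
Qed.

Lemma sum_rebased s i m : \sum_s' MxI bl P s s' i *: rebased s' i m = \sum_s' MxI bl P s s' i *: shf (Y s' i) m.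
Proof.
rewrite (sum_MxI bl P rebased) (sum_MxI bl P (sh Y)) /rebased /cst_b /sh /=; case e: (bl s.1) => [j|] /=; first by rewrite subr0.
by case: s.2; rewrite ?subr0.
Qed.

(** The shifted expansion solves the system of the next pair, up to its own shifted defect and to
    the change of base point in the Taylor polynomial of the force. *)
Lemma defect_rebased s i m : defect th J (kapT bl) (@fst _ _) (MxI bl P) (w0I bl P) (rhoI bl P)
    (AI V') (eI bl V') rebased s i m =
  shf (dfF bl P V J Y s i) m + w0I bl P s i *: base_err s.1 i m.
Proof.
rewrite /defect /rhs -/(force bl P V' J rebased s.1 i m) sum_rebased.
have e1 : shf (rebased s i) m = shf (shf (Y s i)) m - cst_b s i.
  rewrite /rebased shfB; congr (_ - _); rewrite /cst_b; case: ifP => _; rewrite /shf ?comp_polyC ?comp_poly0 //.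
have e2 : chr (th i) (kapT bl s) 1 *: rebased s i m = chr (th i) (kapT bl s) 1 *: shf (Y s i) m - cst_b s i.
  rewrite /rebased scalerBr; congr (_ - _); rewrite /cst_b; case: ifP => [/andP [/eqP e _]|_]; last by rewrite scaler0.
  by rewrite /kapT e chr0 scale1r.
have e3 : shf (shf (Y s i)) m = chr (th i) (kapT bl s) 1 *: shf (Y s i) m +
  (\sum_s' MxI bl P s s' i *: shf (Y s' i) m + w0I bl P s i *: force bl P V J (sh Y) s.1 i m) +
  shf (dfF bl P V J Y s i) m.
  rewrite {1}(_ : shf (Y s i) = fun m => chr (th i) (kapT bl s) 1 *: Y s i m +
     (\sum_s' MxI bl P s s' i *: Y s' i m + w0I bl P s i *: force bl P V J Y s.1 i m) + dfF bl P V J Y s i m).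
    rewrite (shfD (fun m => _ + _)) (shfD (fun m => _ *: _)) (shfD (fun m => \sum_s' _)) !shfZ force_sh.
    by rewrite shf_sum; under eq_bigr do rewrite shfZ.
  by apply/funext => m'; rewrite (sh_eq bl P V J).
rewrite e1 e2 e3 /base_err scalerBr.
have aux (M : comNzRingType) (a1 a2 a3 a4 a5 a6 : M) :
  a1 + (a2 + a3) + a4 - a5 - (a1 - a5) - (a2 + a6) = a4 + (a3 - a6) by ring.
exact: aux.
Qed.

(** The next pair comes from the recursion with the force at q_n, which is also the value of the
    modelled force at the base point, so only the defect separates the initial values. *)
Lemma init_rebased s i : (rebased s i 0 - Y' s i 0).[0] = (dfF bl P V J Y s i 0).[0].
Proof.
have GF0 c : (force bl P V J Y c i 0).[0] = (A_ (V i) [:: c])%:C%C.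
  by apply: jet_grad_val0 => [|c']; [exact: ltnW|exact: (displacement_val0 cs0 okP sY)].
rewrite /rebased hornerD !hornerN hornerD hornerN (sol_init sY') /y0I /y0T.
case: s => c bb /=; case e: (bl c) => [j|] /=.
  have hn : (h i)%:C%C != 0 :> C by rewrite -cabs_eq0 cabs_real normr_eq0 gt_eqF.
  rewrite /cst_b /= e /= horner0 subr0 (sh_fast P V J Y bb i 0 e) hornerD hornerZ hornerD hornerZ GF0.
  rewrite (sol_init sY) /y0I /y0T /= e (nx_x (nxt i)) (nx_fast (nxt i) e) /wc e -/(h i).
  have two : (2 : R)%:C%C = 2 :> C by rewrite rmorph_nat.
  rewrite !rmorphB !rmorphM /= two.
  have -> : ((cos (th_ (P i) j))%:C%C : C) = 2^-1 * (expi (ths (P i) j bb) + expi (- ths (P i) j bb)).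
    have -> : cos (th_ (P i) j) = cos (ths (P i) j bb) by rewrite /ths; case: bb; rewrite ?cosN.
    rewrite /expi cosN sinN; move: (cos _) (sin _) => a d.
    apply: (@mulfI _ (2 : C)); rewrite ?pnatr_eq0 // mulVKf ?pnatr_eq0 // -two; simpc.
    by rewrite mulr_natl mulr2n.
  have := expi_neq0 (ths (P i) j bb); rewrite expiN.
  move: (expi _) (y_ _ _)%:C%C (x_ _ _)%:C%C ((chi_ _ _)%:C%C) ((A_ _ _)%:C%C) ((h i)%:C%C) ((dfF _ _ _ _ _ _ _ _).[0]).
  by move=> z a d k A H D z0; field.
have hn : (h i)%:C%C != 0 :> C by rewrite -cabs_eq0 cabs_real normr_eq0 gt_eqF.
have gn : (g i)%:C%C != 0 :> C by rewrite -cabs_eq0 cabs_real normr_eq0 gt_eqF.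
rewrite (sh_eq bl P V J) sum_MxI /= e /= /cst_b /= e /= /kapT /= e chr0 scale1r /w0I /w0T /= e.
move: (dfF bl P V J Y (c, bb) i 0) => D; rewrite !hornerD !hornerZ GF0 (sol_init sY) /y0I /y0T /= e -/(h i) -/(g i).
have two : (2 : R)%:C%C = 2 :> C by rewrite rmorph_nat.
case: bb; rewrite /= ?horner0 ?hornerZ ?hornerC ?(sol_init sY) /y0I /y0T /= ?e -/(h i) -/(g i);
  rewrite /b /shift_vec ?(nx_x (nxt i)) (nx_slow (nxt i) e) -/(h i) !(rmorphB, rmorphM, fmorphV, rmorphXn) /= two.
  move: (y_ _ _)%:C%C (x_ _ _)%:C%C ((A_ _ _)%:C%C) ((h i)%:C%C) ((g i)%:C%C) hn gn (D.[0]).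
  by move=> a d A H G {}hn {}gn D0; field.
move: (y_ _ _)%:C%C (x_ _ _)%:C%C ((A_ _ _)%:C%C) ((h i)%:C%C) ((g i)%:C%C) hn gn (D.[0]).
by move=> a d A H G {}hn {}gn D0; field; rewrite hn gn.
Qed.

Let eta i := g i ^+ J.
Let eta0 i : 0 <= eta i. Proof. by rewrite exprn_ge0. Qed.

(** J - 1 passes of [stability], the first bound being g, reach the order g^J of the defects and of
    the initial difference. *)
Lemma wt_diff s : repO th tau sig (wtT bl s) (sdeg J dS J.-1) eta (fun i m => rebased s i m - Y' s i m).
Proof.
have dd : (dY J <= dS)%N by rewrite leq_pmull // ltnW.
have bg i : 0 <= g i ^+ 2 / tau i by rewrite divr_ge0 ?exprn_ge0 // ltW.
have d1 s' : repO th tau sig (wtT bl s') dS (fun i => eta i / tau i)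
    (defect th J (kapT bl) (@fst _ _) (MxI bl P) (w0I bl P) (rhoI bl P) (AI V') (eI bl V') rebased s').
  apply: (repO_ext (F := fun i m => shf (dfF bl P V J Y s' i) m + w0I bl P s' i *: base_err s'.1 i m)).
    by move=> i m; rewrite defect_rebased.
  apply: repOD; first exact: (repO_shf tau1 sig1 (repO_deg dd (sol_defect sY s'))).
  have rw : repO th tau sig (wtT bl s') dS (fun i => g i ^+ 2 / tau i * eta i)
     (fun i m => w0I bl P s' i *: base_err s'.1 i m).
    exact: (repO_w0Z tau1 sig1 (w0 := w0I bl P) (hwT bl cs0 okP) s' eta0 (base_err_rep s'.1)).
  apply: repO_leB rw => i.
  rewrite mulrAC; apply: ler_wpM2r; first by rewrite invr_ge0 ltW.
  by rewrite -[leRHS]mul1r; apply: ler_wpM2r => //; rewrite exprn_ile1 // (g1 okP).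
have iv s' : bO eta (fun i => cabs (rebased s' i 0 - Y' s' i 0).[0] * sig i ^+ wtT bl s').
  have [A A0 hA] := sol_defect sY s'; exists A => // i; rewrite init_rebased.
  have := rep_val_wt (tau1 i) (sig1 i) 0 (hA i) (t := 0); rewrite normr0 => /(_ (ltW (tau0 i))) H.
  apply: le_trans H _; apply: ler_wpM2l => //.
  change (eta i / tau i <= eta i); rewrite ler_pdivrMr; last exact: tau0.
  by rewrite ler_peMr.
have := @stability R ell I th tau sig Q tau1 sig1 Q0 chrQ n J _ (kapT bl) (wtT bl) (@fst _ _)
  (MxI bl P) (w0I bl P) (rhoI bl P) g K (kw bl) (w1 bl) g0' (g1 okP) (ltnW J2) (gapT bl okP)
  (hMT bl okP) (hMwT bl P) (hwT bl cs0 okP) (hrhoT bl cs0 okP) (AI V') (eI bl V') eta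
  (heT B0 okP okV') (bAT B0 okV') eta0 rebased Y' dS _ _ d1 _ iv J.-1 dK s.
move=> H; apply: repO_le (H _ _ _) => //.
- exists 2 => // i; rewrite (ltn_predK J2) /eta; lra.
- by move=> s'; exact: repO_deg dd (rebased_rep s').
- by move=> s'; exact: repO_deg dd (sol_rep sY' s').
- by move=> s'; exact: repO_deg dd (sol_defect sY' s').
Qed.

Let e_ i := h i ^+ NN.
Let e0 i : 0 <= e_ i. Proof. by rewrite exprn_ge0. Qed.
Local Notation cls := (close e_).
Let ge i : eta i <= g i * e_ i.
Proof. by rewrite /eta -(ltn_predK J2) exprS; apply: ler_wpM2l => //; exact: (gJ okP). Qed.
Let sg0 i w : 0 < sig i ^+ w. Proof. by rewrite exprn_gt0 // (lt_le_trans ltr01). Qed.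

Lemma U_diff s : UU (fun i => g i * e_ i) (fun i m => rebased s i m - Y' s i m).
Proof.
apply: U_leB (U_rep tau1 sig1 (w1 bl s) (wt_diff s)) => i; apply: le_trans (ge i).
by rewrite ler_pdivrMr // ler_peMr // exprn_ege1.
Qed.
Lemma U_rebased s : UU g (rebased s).
Proof.
apply: U_leB (U_rep tau1 sig1 (w1 bl s) (rebased_rep s)) => i.
by rewrite ler_pdivrMr // ler_peMr // exprn_ege1.
Qed.
Let gle i : g i <= 1 := g1 okP i.
Let gee i : g i * e_ i <= e_ i. Proof. by rewrite ler_piMl. Qed.

Lemma close_rebased s : cls (rebased s) (Y' s).
Proof.
by split; [apply: U_leB (U_rebased s)|exact: (U_Y okP sY')|apply: U_leB (U_diff s)].
Qed.

Lemma close_op DD F F' : op_ok P DD -> (forall i a F1 F2,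
    DD i (fun m => a *: F1 m + F2 m) = fun m => a *: DD i F1 m + DD i F2 m) ->
  cls F F' -> cls (fun i => DD i (F i)) (fun i => DD i (F' i)).
Proof.
move=> o lin [u1 u2 u3]; split; [exact: o|exact: o|].
apply: (U_ext (F := fun i => DD i (fun m => F i m - F' i m))); last exact: (o _ (fun i m => F i m - F' i m)).
move=> i m; rewrite (_ : (fun m => F i m - F' i m) = fun m => (-1) *: F' i m + F i m).
  by rewrite lin scaleN1r addrC.
by apply/funext => m'; rewrite scaleN1r addrC.
Qed.

Lemma close_ext F F' G G' : (forall i m, F i m = G i m) -> (forall i m, F' i m = G' i m) ->
  cls F F' -> cls G G'.
Proof.
move=> a a' [u1 u2 u3]; split; [exact: U_ext u1|exact: U_ext u2|].
by apply: U_ext u3 => i m; rewrite a a'.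
Qed.

Lemma rebased_fast c j bb i m : bl c = Some j -> rebased (c, bb) i m = shf (Y (c, bb) i) m.
Proof. by move=> e; rewrite /rebased /cst_b /= e subr0. Qed.
Lemma rebased_slow c i m : rebased (c, true) i m = shf (Y (c, true) i) m.
Proof. by rewrite /rebased /cst_b andbF subr0. Qed.

Lemma close_fast c bb : fast c -> cls (sh Y (c, bb)) (Y' (c, bb)).
Proof.
rewrite /fastc; case e: (bl c) => [j|//] _.
by apply: (close_ext _ _ (close_rebased (c, bb))) => // i m; rewrite (rebased_fast _ _ _ e).
Qed.

Lemma close_u c : cls (velocity P (sh Y) c) (velocity P Y' c).
Proof.
have k : cO (fun i => (g i)^-1) (fun i => (g i)^-1%:C%C).
  by apply: bO_le => i; rewrite cabs_real ger0_norm // invr_ge0.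
have gg i : (g i)^-1 * g i = 1 by rewrite mulVf // gt_eqF.
split.
- apply: (U_ext (F := fun i m => (g i)^-1%:C%C *: rebased (c, true) i m)); first by move=> i m; rewrite rebased_slow.
  by apply: U_leB (UZ k g0' (U_rebased _)) => i; rewrite gg.
- have u : UU g (Y' (c, true)).
    apply: U_leB (U_rep tau1 sig1 (w1 bl _) (sol_rep sY' (c, true))) => i.
    rewrite -/(g i).
    by rewrite ler_pdivrMr // ler_peMr // exprn_ege1.
  by apply: U_leB (UZ k g0' u) => i; rewrite gg.
- apply: (U_ext (F := fun i m => (g i)^-1%:C%C *: (rebased (c, true) i m - Y' (c, true) i m))).
    by move=> i m; rewrite rebased_slow scalerBr.
  apply: U_leB (UZ k _ (U_diff _)) => i; first by rewrite mulrA gg mul1r.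
  by rewrite mulr_ge0.
Qed.

Lemma close_q c : fast c -> cls (position bl P (sh Y) c) (position bl P Y' c).
Proof.
rewrite /fastc; case e: (bl c) => [j|//] _.
apply: (@close_ext (position bl P rebased c) (position bl P Y' c)) => //.
  by move=> i m; rewrite !positionE e !(rebased_fast _ _ _ e).
have Us (Z : T -> I -> modf) Bf : (forall i, 0 <= Bf i) -> (forall s, UU Bf (Z s)) ->
    UU Bf (fun i m => \sum_s rhoI bl P c s i *: Z s i m).
  by move=> Bf0 uZ; apply: U_sum => // s _; apply: UZr => //; exact: (hrhoT bl cs0 okP c s).
split.
- by apply: Us => // s; have [] := close_rebased s.
- by apply: Us => // s; have [] := close_rebased s.
apply: (U_ext (F := fun i m => \sum_s rhoI bl P c s i *: (rebased s i m - Y' s i m))).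
  by move=> i m; rewrite /position -sumrB; apply: eq_bigr => s _; rewrite scalerBr.
by apply: (Us (fun s i m => rebased s i m - Y' s i m)) => // s; have [] := close_rebased s.
Qed.

Let dd1 : (dY J <= sdeg J dS J.-1)%N.
Proof. by apply: leq_trans (sdeg_ge (ltnW J2) _ _); rewrite leq_pmull // ltnW. Qed.

Let z1 c : repO th tau sig 0 (sdeg J dS J.-1) g (fun i m => displacement bl P V' rebased c i m).
Proof. exact: repO_deg dd1 (displacement_rep c). Qed.
Let z2 c : repO th tau sig 0 (sdeg J dS J.-1) g (fun i m => displacement bl P V' Y' c i m).
Proof. exact: repO_deg dd1 (wt_z cs0 B0 okP okV' sY' c). Qed.
Let z12 c : repO th tau sig 0 (sdeg J dS J.-1) eta (fun i m => displacement bl P V' rebased c i m - displacement bl P V' Y' c i m).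
Proof. exact: (repO_deviationB tau1 sig1 (w1 bl) (hrhoT bl cs0 okP) (eI bl V') eta0 wt_diff). Qed.

Let eta_e i : eta i <= e_ i. Proof. exact: le_trans (ge i) (gee i). Qed.
Let U_of d Bf (F : I -> modf) : (forall i, Bf i <= e_ i) -> repO th tau sig 0 d Bf F -> UU e_ F.
Proof. by move=> hB r; apply: U_leB (U_rep tau1 sig1 (leq0n 1) r) => i; rewrite expr0 divr1. Qed.

Lemma close_G c : cls (force bl P V J (sh Y) c) (force bl P V' J Y' c).
Proof.
split.
- apply: (U_ext (F := fun i => shf (force bl P V J Y c i))); first by move=> i m; rewrite force_sh.
  exact: (U_shf tau1 (U_G cs0 B0 okP okV sY c)).
- exact: (U_G cs0 B0 okP okV' sY' c).
apply: (U_ext (F := fun i m => base_err c i m + (force bl P V' J rebased c i m - force bl P V' J Y' c i m))).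
  by move=> i m; rewrite /base_err addrA subrK.
apply: UD; first exact: (U_of _ (base_err_rep c)).
have H := repO_gradB tau1 sig1 (g1 okP) (A := AI V') (z := fun c i m => displacement bl P V' rebased c i m)
  (z' := fun c i m => displacement bl P V' Y' c i m) z1 z2 eta0 z12 (bAT B0 okV') c.
exact: (U_of eta_e H).
Qed.

Lemma close_P : UU e_ (fun i m => potential bl P V J (sh Y) i m - potential bl P V' J Y' i m).
Proof.
apply: (U_ext (F := fun i m => (potential bl P V J (sh Y) i m - potential bl P V' J rebased i m) +
   (potential bl P V' J rebased i m - potential bl P V' J Y' i m))).
  by move=> i m; rewrite addrA subrK.
apply: UD.
  apply: (U_of _ base_P_rep) => i; apply: le_trans (eta_e i).
  by rewrite /eta exprS ler_piMl // exprn_ge0.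
have H := repO_potB tau1 sig1 (g1 okP) (A := AI V') (z := fun c i m => displacement bl P V' rebased c i m)
  (z' := fun c i m => displacement bl P V' Y' c i m) z1 z2 eta0 z12 (bAT B0 okV').
exact: (U_of eta_e H).
Qed.

Let opD := op_Dm okP.
Let opT := op_Theta okP.
Let linD (i : I) a (F1 F2 : modf) := Dm_lin a F1 F2.
Let linT (i : I) a (F1 F2 : modf) := Theta_lin (th i) (Q i) a F1 F2.

Lemma close_x DD c : op_ok P DD -> (forall i a F1 F2,
    DD i (fun m => a *: F1 m + F2 m) = fun m => a *: DD i F1 m + DD i F2 m) ->
  (forall i F (p : {poly C}), (exists a : C, p = a%:P) -> DD i (fun m => F m - p) = DD i F) ->
  cls (fun i => DD i (sh Y (c, false) i)) (fun i => DD i (Y' (c, false) i)).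
Proof.
move=> o lin cst; apply: (close_ext _ _ (close_op o lin (close_rebased (c, false)))) => // i m.
rewrite (cst i (shf (Y (c, false) i))) // /cst_b; case: ifP => _; first by eexists.
by exists 0; rewrite polyC0.
Qed.

Lemma slow_inv_rebase : cO (fun i => e_ i / h i ^+ 2) (fun i => slow_inv bl P V J (sh Y) i - slow_inv bl P V' J Y' i).
Proof.
apply: (slow_functional_close e0 (x := fun c i => sh Y (c, false) i) (u := velocity P (sh Y)) (f := fun c i => sh Y (c, false) i)
  (k := fun c i => sh Y (c, true) i) (q := position bl P (sh Y)) (G := force bl P V J (sh Y)) (Pp := potential bl P V J (sh Y))
  (x' := fun c i => Y' (c, false) i) (u' := velocity P Y') (f' := fun c i => Y' (c, false) i)
  (k' := fun c i => Y' (c, true) i) (q' := position bl P Y') (G' := force bl P V' J Y') (Pp' := potential bl P V' J Y')).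
- by move=> c _; exact: close_u.
- exact: (fun c => @close_fast c false).
- exact: (fun c => @close_fast c true).
- exact: close_q.
- by move=> c _; exact: close_G.
- exact: close_P.
- move=> c _; apply: (close_x (DD := fun=> @Dm R)) => [||i F _ [a ->]]; [exact: opD|exact: linD|].
  by apply/funext => m; rewrite /Dm derivB derivC subr0.
- by move=> c fc; apply: (close_op (DD := fun=> @Dm R) opD linD); exact: close_fast.
- by move=> c fc; apply: (close_op (DD := fun=> @Dm R) opD linD); exact: close_fast.
Qed.

Lemma fast_inv_rebase : cO (fun i => e_ i / h i ^+ 2) (fun i => fast_inv bl P (sh Y) i - fast_inv bl P Y' i).
Proof.
apply: (fast_functional_close e0 (x := fun c i => sh Y (c, false) i) (u := velocity P (sh Y)) (f := fun c i => sh Y (c, false) i)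
  (k := fun c i => sh Y (c, true) i)
  (x' := fun c i => Y' (c, false) i) (u' := velocity P Y') (f' := fun c i => Y' (c, false) i)
  (k' := fun c i => Y' (c, true) i) _ _ _ (DD := ThetaI P)).
- by move=> c _; exact: close_u.
- exact: (fun c => @close_fast c false).
- exact: (fun c => @close_fast c true).
- move=> c _; apply: (close_x (DD := ThetaI P)) => [||i F _ [a ->]]; [exact: opT|exact: linT|].
  rewrite (_ : (fun m => F m - a%:P) = fun m => 1 *: F m + (- a%:P)).
    by rewrite /ThetaI Theta_lin (Theta_cst (chrQ i)); apply/funext => m; rewrite scale1r addr0.
  by apply/funext => m; rewrite scale1r.
- by move=> c fc; apply: (close_op (DD := ThetaI P) opT linT); exact: close_fast.
- by move=> c fc; apply: (close_op (DD := ThetaI P) opT linT); exact: close_fast.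
Qed.
End Rebase.

(** * Long-time drift *)

Section Drift.
Variables (R : realType) (ell n : nat) (bl : 'I_n -> option 'I_ell).
Local Notation C := R[i].
Variables (cs B : R) (K J NN : nat).
Hypotheses (cs0 : 0 < cs) (J2 : (1 < J)%N) (B0 : 0 <= B) (NN3 : (2 < NN)%N).
Hypothesis dK : (sdeg J (dS J) J.-1 <= K)%N.

Let dSK : (dS J <= K)%N.
Proof. by apply: leq_trans dK; apply: sdeg_ge; exact: ltnW. Qed.
Let dYK : (dY J <= K)%N.
Proof. by apply: leq_trans dSK; rewrite leq_pmull // ltnW. Qed.

Definition link (p : par R ell) (v v' : pt R n) :=
  next_pt bl p v v' /\ forall S, (size S <= J)%N ->
  `|tay (shift_vec v v') (A_ v) (J - size S) S - A_ v' S| <= B * h_ p ^+ (J - size S).+1.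

Definition slow_energy (p : par R ell) (v : pt R n) : R :=
  A_ v [::] + \sum_(c | ~~ fastc bl c) 2^-1 * ((y_ v c - x_ v c) / h_ p) ^+ 2.
(** The quadratic form in (q_n, q_(n-1)) preserved by the free recursion q_(n+1) = 2 cos(th) q_n -
    q_(n-1), scaled so as to be close to the modified oscillatory energy. *)
Definition fast_energy (p : par R ell) (v : pt R n) : R :=
  \sum_(c | fastc bl c) (if bl c is Some j then
    th_ p j / (2 * h_ p ^+ 2 * chi_ p j * sin (th_ p j)) *
     (y_ v c ^+ 2 - 2 * cos (th_ p j) * x_ v c * y_ v c + x_ v c ^+ 2) else 0).

Definition nonres_par N (p : par R ell) := forall k : lab ell,
  (lnorm k <= N.+1)%N -> chr (tht_ p) k 1 = 1 -> phase (tht_ p) k = 0.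

Section Fam.
Variable X : par R ell -> Prop.
(** The families are indexed by all admissible data at once, which turns a constant of one family
    into a constant for all parameters and pairs. The condition X is void for the slow invariant and
    is [nonres_par] for the fast one. *)
Record valid_pt := ValidPt { ip : par R ell; iv : pt R n; i_ok : par_ok cs K J NN ip;
  i_pt : pt_ok bl B J ip iv; i_X : X ip }.
Record valid_step := ValidStep { jp : par R ell; jv : pt R n; jw : pt R n; j_ok : par_ok cs K J NN jp;
  j_pv : pt_ok bl B J jp jv; j_pw : pt_ok bl B J jp jw; j_X : X jp; j_link : link jp jv jw }.
Definition step_fst j := ValidPt (j_ok j) (j_pv j) (j_X j).
Definition step_snd j := ValidPt (j_ok j) (j_pw j) (j_X j).

Lemma sol_pull Y f : is_expansion bl ip iv J Y ->
  is_expansion bl (fun j : valid_step => ip (f j)) (fun j => iv (f j)) J (fun s j => Y s (f j)).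
Proof.
case=> h1 h2 h3; split.
- by move=> s; have [A A0 hA] := h1 s; exists A => // j; exact: hA.
- by move=> s j; exact: h2.
- by move=> s; have [A A0 hA] := h3 s; exists A => // j; exact: (hA (f j)).
Qed.

Lemma fam_link : taylor_arr J (fun i => h_ (jp i)) (fun i => shift_vec (jv i) (jw i))
  (fun i => A_ (jv i)) (fun i => A_ (jw i)).
Proof. by exists B => // i S hS; case: (j_link i) => _; exact. Qed.

(* A function of valid pairs extended by 0: the invariants of all pairs come
   from one family of expansions. *)
Definition glue (E : valid_pt -> C) p v : C :=
  if pselect (par_ok cs K J NN p /\ X p /\ pt_ok bl B J p v) is left q then E (ValidPt q.1 q.2.2 q.2.1) else 0.
Lemma glueE E i : glue E (ip i) (iv i) = E i.
Proof.
case: i => p v a b c; rewrite /glue /=; case: pselect => [q|[]//].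
by congr (E (ValidPt _ _ _)); exact: Prop_irrelevance.
Qed.
Lemma glue_drift E (e : par R ell -> R) (a : valid_pt -> C) (a' : valid_step -> C) :
  cO (fun i => e (ip i)) (fun i => a i - E i) -> cO (fun j => e (jp j)) (fun j => a' j - E (step_snd j)) ->
  (forall j, a' j = a (step_fst j)) ->
  exists2 A, 0 <= A & forall p v w, par_ok cs K J NN p -> X p -> pt_ok bl B J p v -> pt_ok bl B J p w ->
    link p v w -> cabs (glue E p w - glue E p v) <= A * e p.
Proof.
move=> [A A0 hA] [A' A'0 hA'] aa; exists (A + A'); first exact: addr_ge0.
move=> p v w okp Xp okv okw lk; pose j := ValidStep okp okv okw Xp lk.
rewrite (glueE E (step_fst j)) (glueE E (step_snd j)).
have := lerD (hA (step_fst j)) (hA' j); rewrite -mulrDl; apply: le_trans.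
rewrite -[X in _ <= _ + X](cabsN (a' j - _)); apply: le_trans (cabsD _ _).
rewrite le_eqVlt; apply/orP; left; apply/eqP; congr cabs; rewrite aa opprB.
by move: (a _) (E _) (E _) => x y z; ring.
Qed.

Lemma fam_slow : exists2 F : par R ell -> pt R n -> C,
  (forall er : par R ell -> R, (forall p, par_ok cs K J NN p -> X p ->
     [/\ (tau_ p)^-1 <= er p, h_ p / g_ p <= er p & g_ p / (tau_ p ^+ 2 * h_ p) <= er p]) ->
   exists2 A, 0 <= A & forall p v, par_ok cs K J NN p -> X p -> pt_ok bl B J p v ->
     cabs (F p v - (slow_energy p v)%:C%C) <= A * er p) &
  exists2 A, 0 <= A & forall p v w, par_ok cs K J NN p -> X p -> pt_ok bl B J p v -> pt_ok bl B J p w ->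
    link p v w -> cabs (F p w - F p v) <= A * (h_ p ^+ NN / h_ p ^+ 2).
Proof.
have [Y sY] := expansion_ex cs0 J2 B0 i_ok i_pt dYK.
exists (glue (slow_inv bl ip iv J Y)).
  move=> er her.
  have [] := slow_inv_val cs0 J2 NN3 B0 i_ok i_pt sY (er := fun i => er (ip i)).
  - by move=> i; have [] := her _ (i_ok i) (i_X i).
  - by move=> i; have [] := her _ (i_ok i) (i_X i).
  - by move=> i; have [] := her _ (i_ok i) (i_X i).
  move=> A A0 hA; exists A => // p v okp Xp okv.
  rewrite (glueE _ (ValidPt okp okv Xp)).
  apply: le_trans (hA (ValidPt okp okv Xp)); rewrite le_eqVlt; apply/orP; left.
  apply/eqP; congr (cabs (_ - _)); rewrite /slow_energy rmorphD rmorph_sum /=; congr (_ + _).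
  by apply: eq_bigr => c _; rewrite /un /= rmorphM rmorphXn fmorphV rmorph_nat.
apply: (glue_drift (e := fun p => h_ p ^+ NN / h_ p ^+ 2) (slow_inv_shf cs0 J2 B0 i_ok i_pt sY)
  (slow_inv_rebase cs0 J2 B0 j_ok j_pv j_pw (fun j => (j_link j).1) fam_link
  (sol_pull step_fst sY) (sol_pull step_snd sY) dK)) => j.
by [].
Qed.

Lemma fast_energyE (I : Type) (P : I -> par R ell) (V : I -> pt R n) c i j : bl c = Some j ->
  par_ok cs K J NN (P i) ->
  osc_val bl P V c i =
  (th_ (P i) j / (2 * h_ (P i) ^+ 2 * chi_ (P i) j * sin (th_ (P i) j)) *
     (y_ (V i) c ^+ 2 - 2 * cos (th_ (P i) j) * x_ (V i) c * y_ (V i) c + x_ (V i) c ^+ 2))%:C%C.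
Proof.
move=> e okp; rewrite /osc_val e /y0I /y0T /= e /wc e /muF /nuF /mu e /ths /=.
have h0 : (h_ (P i))%:C%C != 0 :> C by rewrite -cabs_eq0 cabs_real normr_eq0 gt_eqF ?(h_gt0 okp).
have c0 : (chi_ (P i) j)%:C%C != 0 :> C.
  by rewrite -cabs_eq0 cabs_real normr_eq0 gt_eqF // (lt_le_trans cs0) ?(chi_lo okp).
have s0 : (sin (th_ (P i) j))%:C%C != 0 :> C.
  by rewrite -cabs_eq0 cabs_real gt_eqF // (lt_le_trans cs0) ?(sin_lo okp).
have two : (2 : R)%:C%C = 2 :> C by rewrite rmorph_nat.
pose i1 : C := (0 +i* 1)%C.
have i10 : i1 != 0 by rewrite eq_complex /= oner_eq0 andbF.
have ii : i1 ^+ 2 = -1 by exact: sqr_i.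
have eE x : expi x = (cos x)%:C%C + i1 * (sin x)%:C%C :> C.
  by rewrite /expi /i1; simpc.
rewrite -expiN opprK !eE cosN sinN.
have -> : (0 +i* th_ (P i) j)%C = i1 * (th_ (P i) j)%:C%C by rewrite /i1; simpc.
have := congr1 (fun x : R => x%:C%C : C) (cos2Dsin2 (th_ (P i) j)); rewrite rmorph1.
move: two; move: (2 : R) => t2 two.
rewrite !(rmorphB, rmorphM, fmorphV, rmorphXn, rmorphD, rmorphN) /= two.
move: (cos _)%:C%C (sin _)%:C%C s0 (h_ _)%:C%C h0 (chi_ _ _)%:C%C c0 (y_ _ _)%:C%C (x_ _ _)%:C%C (th_ _ _)%:C%C.
move=> a b b0 hh h0 k k0 y x t ab.
have -> : a + i1 * b - (a + i1 * - b) = i1 * (2 * b) by ring.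
have -> : (y - (a + i1 * - b) * x) * (y - (a + i1 * b) * x) = y * y - 2 * a * x * y + x * x.
  transitivity (y * y - 2 * a * x * y + (a * a - i1 ^+ 2 * (b * b)) * (x * x)); first by ring.
  by rewrite ii mulN1r opprK ab mul1r.
clear ii eE; clearbody i1; by field; rewrite k0 b0 h0 i10.
Qed.

Lemma fam_fast N : (0 < N)%N -> (forall p, X p -> nonres_par N p) ->
  exists2 F : par R ell -> pt R n -> C,
  (forall er : par R ell -> R, (forall p, par_ok cs K J NN p -> X p ->
     [/\ (tau_ p)^-1 <= er p & h_ p / g_ p <= er p]) ->
   exists2 A, 0 <= A & forall p v, par_ok cs K J NN p -> X p -> pt_ok bl B J p v ->
     cabs (F p v - (fast_energy p v)%:C%C) <= A * er p) &
  exists2 A, 0 <= A & forall p v w, par_ok cs K J NN p -> X p -> pt_ok bl B J p v -> pt_ok bl B J p w ->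
    link p v w -> cabs (F p w - F p v) <= A * ((sg p ^+ N.+2)^-1 + h_ p ^+ NN / h_ p ^+ 2).
Proof.
move=> N0 hX.
have [Y sY] := expansion_ex cs0 J2 B0 i_ok i_pt dYK.
exists (glue (fast_inv bl ip Y)).
  move=> er her.
  have [] := fast_inv_val cs0 J2 NN3 B0 i_ok i_pt sY (er := fun i => er (ip i)) _ _ N0 dSK (fun i => hX _ (i_X i)).
  - by move=> i; have [] := her _ (i_ok i) (i_X i).
  - by move=> i; have [] := her _ (i_ok i) (i_X i).
  move=> A A0 hA; exists A => // p v okp Xp okv.
  rewrite (glueE _ (ValidPt okp okv Xp)).
  apply: le_trans (hA (ValidPt okp okv Xp)); rewrite le_eqVlt; apply/orP; left.
  apply/eqP; congr (cabs (_ - _)); rewrite /fast_energy rmorph_sum /=.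
  apply: eq_bigr => c; rewrite /fastc; case e: (bl c) => [j|//] _.
  by rewrite (@fast_energyE valid_pt ip iv c _ j).
have [A' A'0 hA'] := fast_inv_rebase cs0 J2 B0 j_ok j_pv j_pw (fun j => (j_link j).1) fam_link
  (sol_pull step_fst sY) (sol_pull step_snd sY) dK.
apply: (glue_drift (e := fun p => (sg p ^+ N.+2)^-1 + h_ p ^+ NN / h_ p ^+ 2)
  (fast_inv_shf cs0 J2 B0 i_ok i_pt sY (fun i => hX _ (i_X i)))
  (a' := fun j => fast_inv bl jp (sh (fun s j => Y s (step_fst j))) j)).
  exists A' => // j; apply: le_trans (hA' j) _; apply: ler_wpM2l => //.
  by rewrite lerDr invr_ge0 exprn_ge0 // ltW // (lt_le_trans ltr01) // (sig1 j_ok).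
by [].
Qed.
End Fam.

Lemma telescope_bound (F : nat -> C) e m : (forall k, (k < m)%N -> cabs (F k.+1 - F k) <= e) ->
  cabs (F m - F 0%N) <= m%:R * e.
Proof.
elim: m => [|m IH] H; first by rewrite subrr cabs0 mul0r.
have -> : F m.+1 - F 0%N = (F m.+1 - F m) + (F m - F 0%N) by ring.
apply: le_trans (cabsD _ _) _; rewrite -natr1 mulrDl mul1r addrC.
by apply: lerD; [apply: IH => k km; apply: H; exact: ltnW | exact: H].
Qed.

Let drift_of (F : par R ell -> pt R n -> C) (S : par R ell -> pt R n -> R) (X : par R ell -> Prop)
  (er e : par R ell -> R) :
  (exists2 A, 0 <= A & forall p v, par_ok cs K J NN p -> X p -> pt_ok bl B J p v ->
     cabs (F p v - (S p v)%:C%C) <= A * er p) ->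
  (exists2 A, 0 <= A & forall p v w, par_ok cs K J NN p -> X p -> pt_ok bl B J p v -> pt_ok bl B J p w ->
    link p v w -> cabs (F p w - F p v) <= A * e p) ->
  (forall p, par_ok cs K J NN p -> 0 <= er p /\ 0 <= e p) ->
  exists2 A, 0 <= A & forall p (v : nat -> pt R n) m, par_ok cs K J NN p -> X p ->
    (forall k, (k <= m)%N -> pt_ok bl B J p (v k)) -> (forall k, (k < m)%N -> link p (v k) (v k.+1)) ->
    `|S p (v m) - S p (v 0%N)| <= A * (er p + m%:R * e p).
Proof.
move=> [A A0 hA] [A' A'0 hA'] pos; exists (A *+ 2 + A'); first by rewrite addr_ge0 ?mulrn_wge0.
move=> p v m okp Xp okv lk; have [er0 e0] := pos p okp.
have H1 := hA p _ okp Xp (okv m (leqnn m)); have H0 := hA p _ okp Xp (okv 0%N (leq0n m)).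
have H : cabs (F p (v m) - F p (v 0%N)) <= m%:R * (A' * e p).
  apply: (telescope_bound (F := fun k => F p (v k))) => k km.
  by apply: hA' => //; [apply: okv; exact: ltnW|exact: okv|exact: lk].
rewrite -(cabs_real (S p (v m) - _)) rmorphB /=.
have -> : (S p (v m))%:C%C - (S p (v 0%N))%:C%C = - (F p (v m) - (S p (v m))%:C%C)
  + (F p (v m) - F p (v 0%N)) + (F p (v 0%N) - (S p (v 0%N))%:C%C) :> C by ring.
apply: le_trans (cabsD _ _) _; apply: le_trans (lerD (cabsD _ _) (lexx _)) _; rewrite cabsN.
apply: le_trans (lerD (lerD H1 H) H0) _.
have a1 : 0 <= A' * er p by rewrite mulr_ge0.
have a2 : 0 <= A * (m%:R * e p) by rewrite !mulr_ge0.
rewrite mulrDl mulrnAl !mulrDr mulrCA; lra.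
Qed.

Lemma slow_drift : exists2 A, 0 <= A & forall p (v : nat -> pt R n) m, par_ok cs K J NN p ->
  (forall k, (k <= m)%N -> pt_ok bl B J p (v k)) -> (forall k, (k < m)%N -> link p (v k) (v k.+1)) ->
  `|slow_energy p (v m) - slow_energy p (v 0%N)| <=
     A * ((tau_ p)^-1 + h_ p / g_ p + g_ p / (tau_ p ^+ 2 * h_ p) + m%:R * (h_ p ^+ NN / h_ p ^+ 2)).
Proof.
have [F hF hF'] := fam_slow (fun=> True).
have pos (p : par R ell) : par_ok cs K J NN p -> [/\ 0 <= (tau_ p)^-1, 0 <= h_ p / g_ p,
   0 <= g_ p / (tau_ p ^+ 2 * h_ p) & 0 <= h_ p ^+ NN / h_ p ^+ 2].
  move=> okp; have h0 := ltW (h_gt0 okp); have g0 := le_trans h0 (h_le_g okp).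
  have t0 := le_trans ler01 (tau_ge1 okp).
  split; rewrite ?divr_ge0 ?invr_ge0 ?mulr_ge0 ?exprn_ge0 //.
have [] := drift_of (hF (fun p => (tau_ p)^-1 + h_ p / g_ p + g_ p / (tau_ p ^+ 2 * h_ p)) _) hF'.
- by move=> p okp _; have [] := pos p okp; split; lra.
- by move=> p okp; have [] := pos p okp; split=> //; lra.
by move=> A A0 hA; exists A => // p v m okp okv lk; exact: hA.
Qed.

Lemma fast_drift N : (0 < N)%N -> exists2 A, 0 <= A & forall p (v : nat -> pt R n) m,
  par_ok cs K J NN p -> nonres_par N p ->
  (forall k, (k <= m)%N -> pt_ok bl B J p (v k)) -> (forall k, (k < m)%N -> link p (v k) (v k.+1)) ->
  `|fast_energy p (v m) - fast_energy p (v 0%N)| <=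
     A * ((tau_ p)^-1 + h_ p / g_ p + m%:R * ((sg p ^+ N.+2)^-1 + h_ p ^+ NN / h_ p ^+ 2)).
Proof.
move=> N0; have [F hF hF'] := fam_fast (X := nonres_par N) N0 (fun p => id).
have pos (p : par R ell) : par_ok cs K J NN p -> [/\ 0 <= (tau_ p)^-1, 0 <= h_ p / g_ p,
   0 <= (sg p ^+ N.+2)^-1 & 0 <= h_ p ^+ NN / h_ p ^+ 2].
  move=> okp; have h0 := ltW (h_gt0 okp); have g0 := le_trans h0 (h_le_g okp).
  have t0 := le_trans ler01 (tau_ge1 okp).
  have s0 : 0 <= sg p by rewrite divr_ge0.
  split; rewrite ?divr_ge0 ?invr_ge0 ?exprn_ge0 //; exact: exprn_ge0.
have [] := drift_of (hF (fun p => (tau_ p)^-1 + h_ p / g_ p) _) hF'.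
- by move=> p okp _; have [] := pos p okp; split; lra.
- by move=> p okp; have [] := pos p okp; split; lra.
by move=> A A0 hA; exists A => // p v m okp okv lk; exact: hA.
Qed.
End Drift.

(** * Approximation by exactly resonant frequencies *)

Lemma int_small (z : rat) : z \is a Num.int -> `|z| < 1 -> z = 0.
Proof.
case/intrP => n ->; rewrite -intr_norm -[1]/(1%:~R) ltr_int => H.
by have -> : n = 0 by lia.
Qed.

Section RationalFix.
Variables (ell m : nat) (B : 'M[int]_(m, ell)).
Definition lab_mx (S : {set 'I_m}) : 'M[rat]_(m, ell) :=
  \matrix_(a, j) (if a \in S then (B a j)%:~R else 0).
Local Notation P S := (pinvmx (lab_mx S)).
(** A common denominator of the pseudoinverses for all sets S of labels: neither it nor the bounds
    below depend on which relations nearly hold. *)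
Definition lab_den : rat := \prod_(S : {set 'I_m}) \prod_i \prod_j (denq (P S i j))%:~R.
Definition pinv_bd : rat := 1 + \sum_(S : {set 'I_m}) \sum_i \sum_j `|P S i j|.
Definition lab_bd : rat := \sum_a \sum_j `|(B a j)%:~R|.

Lemma lab_den_gt0 : 0 < lab_den.
Proof. by do 3!(apply: prodr_gt0 => ? _); rewrite ltr0z. Qed.

Lemma lab_denP S i j : lab_den * P S i j \is a Num.int.
Proof.
have di q : q * (denq q)%:~R \is a Num.int by rewrite -numqE; exact: intr_int.
rewrite /lab_den (bigD1 S) //= (bigD1 i) //= (bigD1 j) //=.
rewrite mulrC !mulrA; apply: rpredM; last by do 3!(apply: rpred_prod => ? _); exact: intr_int.
apply: rpredM; last by do 2!(apply: rpred_prod => ? _); exact: intr_int.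
by apply: rpredM; [exact: di|apply: rpred_prod => S' _; exact: intr_int].
Qed.

Lemma pinv_bd_ge1 : 1 <= pinv_bd.
Proof. by rewrite lerDl; do 3!(apply: sumr_ge0 => ? _). Qed.
Lemma pinv_bdP S i : \sum_j `|P S i j| <= pinv_bd.
Proof.
rewrite /pinv_bd (bigD1 S) //= (bigD1 i) //=.
have h1 : 0 <= \sum_(i0 | i0 != i) \sum_j `|P S i0 j| by do 2!(apply: sumr_ge0 => ? _).
have h2 : 0 <= \sum_(i0 | i0 != S) \sum_i \sum_j `|P i0 i j| by do 3!(apply: sumr_ge0 => ? _).
by lra.
Qed.
Lemma lab_bd_ge0 : 0 <= lab_bd.
Proof. by do 2!(apply: sumr_ge0 => ? _). Qed.
Lemma lab_bdP a : \sum_j `|(B a j)%:~R| <= lab_bd.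
Proof. by rewrite /lab_bd (bigD1 a) //= lerDl; do 2!(apply: sumr_ge0 => ? _). Qed.

Lemma mx_bound n p (A : 'M[rat]_(n, p)) (v : 'cV_p) (M e : rat) a : \sum_j `|A a j| <= M -> 0 <= e ->
  (forall j, `|v j 0| <= e) -> `|(A *m v) a 0| <= M * e.
Proof.
move=> hM e0 hv; rewrite mxE; apply: le_trans (ler_norm_sum _ _ _) _.
apply: (@le_trans _ _ (\sum_j `|A a j| * e)).
  by apply: ler_sum => j _; rewrite normrM; apply: ler_wpM2l.
by rewrite -mulr_suml; apply: ler_wpM2r.
Qed.

(* The linear relations among the labels in S have bounded denominators, so the
   small vector e satisfies them exactly and can be corrected. *)
Lemma exact_labels (S : {set 'I_m}) (x : 'cV[rat]_ell) (r : 'I_m -> int) (e : rat) : 0 <= e ->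
  lab_den * (1 + lab_bd * pinv_bd) * e < 1 ->
  (forall a, a \in S -> `|(\sum_j (B a j)%:~R * x j 0) - (r a)%:~R| <= e) ->
  exists x' : 'cV[rat]_ell, (forall j, `|x' j 0 - x j 0| <= pinv_bd * e) /\
    forall k : 'rV[int]_ell, (map_mx intr k <= lab_mx S)%MS ->
      lab_den * (\sum_j (k 0 j)%:~R * x' j 0) \is a Num.int.
Proof.
move=> e0 small near.
pose es : 'cV[rat]_m := \col_a (if a \in S then (\sum_j (B a j)%:~R * x j 0) - (r a)%:~R else 0).
pose rs : 'cV[rat]_m := \col_a (if a \in S then (r a)%:~R else 0).
have Bx : lab_mx S *m x = rs + es.
  apply/matrixP => a b; rewrite !mxE (ord1 b).
  case: ifP => aS; last by rewrite add0r big1 // => j _; rewrite mxE aS mul0r.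
  by rewrite addrC subrK; apply: eq_bigr => j _; rewrite mxE aS.
have es_e a : `|es a 0| <= e by rewrite mxE; case: ifP => [/near|_ //]; rewrite ?normr0.
have BPB : lab_mx S *m P S *m lab_mx S = lab_mx S by rewrite mulmxKpV.
(* [lab_mx S] times x is the integer vector [rs] plus the small [es], so the failure of [es] to lie
   in the column space equals that of [rs]. It is thus a multiple of 1 / [lab_den] that is too small
   to be nonzero. *)
have ees : lab_mx S *m (P S *m es) = es.
  apply/matrixP => a b; rewrite (ord1 b); apply/eqP; rewrite -subr_eq0; apply/eqP.
  have t : (lab_mx S *m (P S *m es)) a 0 - es a 0 = rs a 0 - (lab_mx S *m (P S *m rs)) a 0.
    have := congr1 (fun M => (M *m x) a 0) BPB.
    rewrite -mulmxA Bx -mulmxA mulmxDr mulmxDr !mxE => H; move: H.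
    move: (\sum_j _ * _) (\sum_j _ * _) (if _ then _ else _) (if _ then _ else _) => u v w z H; lra.
  apply: (mulfI (lt0r_neq0 lab_den_gt0)); rewrite mulr0; apply: int_small.
    rewrite t mulrBr; apply: rpredB.
      apply: rpredM; last by rewrite mxE; case: ifP => // _; exact: intr_int.
      by do 3!(apply: rpred_prod => ? _); exact: intr_int.
    rewrite mxE mulr_sumr; apply: rpred_sum => j _; rewrite mulrCA; apply: rpredM.
      by rewrite mxE; case: ifP => // _; exact: intr_int.
    rewrite mxE mulr_sumr; apply: rpred_sum => a' _; rewrite mulrA; apply: rpredM (lab_denP _ _ _) _.
    by rewrite mxE; case: ifP => // _; exact: intr_int.
  apply: le_lt_trans small; rewrite normrM (gtr0_norm lab_den_gt0) -mulrA.
  apply: ler_wpM2l; first exact/ltW/lab_den_gt0.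
  apply: le_trans (ler_normB _ _) _; rewrite mulrDl mul1r addrC; apply: lerD => //.
  rewrite -mulrA; apply: mx_bound.
  - apply: le_trans (lab_bdP a); apply: ler_sum => j _; rewrite mxE; case: ifP => // _.
    by rewrite normr0.
  - by apply: mulr_ge0 => //; apply: le_trans pinv_bd_ge1.
  - by move=> j; apply: mx_bound => //; exact: pinv_bdP.
exists (x - P S *m es); split=> [j|k kS].
  rewrite [X in `|X - _|]mxE [X in `|_ + X - _|]mxE addrC addKr normrN.
  by apply: mx_bound => //; exact: pinv_bdP.
have Bx' : lab_mx S *m (x - P S *m es) = rs by rewrite mulmxBr Bx ees addrK.
have -> : \sum_j (k 0 j)%:~R * (x - P S *m es) j 0 = (map_mx intr k *m (P S *m rs)) 0 0 :> rat.
  have kE : map_mx intr k *m P S *m lab_mx S = map_mx intr k := mulmxKpV kS.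
  rewrite -Bx' (mulmxA (P S)) (mulmxA (map_mx intr k)) (mulmxA (map_mx intr k)) kE.
  by rewrite [RHS]mxE; apply: eq_bigr => j _; congr (_ * _); rewrite [RHS]mxE.
rewrite mxE mulr_sumr; apply: rpred_sum => j _; rewrite mulrCA; apply: rpredM.
  by rewrite mxE; exact: intr_int.
rewrite mxE mulr_sumr; apply: rpred_sum => a' _; rewrite mulrA; apply: rpredM (lab_denP _ _ _) _.
by rewrite mxE; case: ifP => // _; exact: intr_int.
Qed.
End RationalFix.

Section Thresholds.
Variables (R : realType) (ell m : nat) (B : 'M[int]_(m, ell)).

(** Chosen to dominate at once the four quantities listed in [res_const_ge]. *)
Definition res_const : rat :=
  (lab_den B * (1 + lab_bd B * pinv_bd B) + 1) * (1 + lab_bd B) * pinv_bd B * 4.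

Let lc x a : rat := \sum_j (B a j)%:~R * (x : 'I_ell -> rat) j.
Let nint (q : rat) : int := Num.floor (q + 2^-1).

Lemma nintP q (r : int) : `|q - (nint q)%:~R| <= `|q - r%:~R|.
Proof.
have h1 : (nint q)%:~R <= q + 2^-1 := floor_le _.
have h2 : q + 2^-1 < (nint q + 1)%:~R := floorD1_gt _.
have [->//|] := eqVneq r (nint q); rewrite intrD in h2.
rewrite neq_lt => /orP [rn|rn].
  have : r%:~R + 1 <= (nint q)%:~R :> rat by rewrite -[1]/(1%:~R) -intrD ler_int lezD1.
  move: (r%:~R) ((nint q)%:~R) h1 h2 => u v h1 h2 h3.
  by rewrite ler_norml; apply/andP; split; [have := ler_norm (q - u)|have := ler_norm (q - u)]; lra.
have : (nint q)%:~R + 1 <= r%:~R :> rat by rewrite -[1]/(1%:~R) -intrD ler_int lezD1.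
move: (r%:~R) ((nint q)%:~R) h1 h2 => u v h1 h2 h3.
have := ler_norm (- (q - u)); rewrite normrN => h4.
by rewrite ler_norml; apply/andP; split; lra.
Qed.

Let big1 (b c : rat) : 0 <= b -> 0 <= c -> 0 <= b * c. Proof. exact: mulr_ge0. Qed.
Lemma res_const_ge : [/\ 1 <= res_const, lab_den B * (1 + lab_bd B * pinv_bd B) <= res_const,
  lab_bd B * pinv_bd B * 4 <= res_const & pinv_bd B <= res_const].
Proof.
rewrite /res_const; have := pinv_bd_ge1 B; have := lab_bd_ge0 B; have := lab_den_gt0 B.
move: (pinv_bd B) (lab_bd B) (lab_den B) => p b d d0 b0 p1.
have u0 : 0 <= d * (1 + b * p) by rewrite mulr_ge0 ?addr_ge0 ?mulr_ge0 //; lra.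
have p0 : 0 <= p by lra.
have bp0 : 0 <= b * p by exact: mulr_ge0.
move: (d * (1 + b * p)) u0 => u u0.
have up0 : 0 <= u * p by exact: mulr_ge0.
have ubp0 : 0 <= u * (b * p) by exact: mulr_ge0.
have up1 : u <= u * p by rewrite ler_peMr.
have -> : (u + 1) * (1 + b) * p * 4 = 4 * (u * p + u * (b * p) + p + b * p) by ring.
by split; lra.
Qed.

(* Among ell + 2 thresholds two consecutive ones select labels of the same rank;
   making the first set exactly resonant does so for the second. *)
Lemma resonance (x : 'I_ell -> rat) (eta : nat -> R) : (forall i, 0 < eta i) ->
  (forall i, (i <= ell)%N -> ratr res_const * eta i <= eta i.+1) -> ratr res_const * eta ell.+1 < 1 ->
  exists i (x' : 'I_ell -> rat), [/\ (i <= ell)%N, forall j, `|ratr (x' j) - ratr (x j)| <= ratr res_const * eta i &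
    forall a, lc x' a \is a Num.int \/ forall r : int, eta i.+1 / 2 <= `|ratr (lc x' a) - r%:~R|].
Proof.
move=> eta0 eta_step eta1; have [c1 c2 c3 c4] := res_const_ge.
have rc1 : 1 <= ratr res_const :> R by rewrite -(rmorph1 ratr) ler_rat.
pose r a := nint (lc x a); pose e a := `|lc x a - (r a)%:~R|.
pose S i := [set a | ratr (e a) < eta i]%SET.
have etaS i : (i <= ell)%N -> eta i <= eta i.+1.
  by move=> il; apply: le_trans (eta_step i il); rewrite ler_peMl // ltW.
have etaL i : (i <= ell.+1)%N -> eta i <= eta ell.+1.
  move=> il; rewrite -(subKn il); elim: (ell.+1 - i)%N (leq_subr i ell.+1) => [|k IH] kl; first by rewrite subn0.
  by apply: le_trans (IH (ltnW kl)); rewrite -(subnSK kl); apply: etaS; lia.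
have S_sub i : (i <= ell)%N -> (lab_mx B (S i) <= lab_mx B (S i.+1))%MS.
  move=> il; apply/row_subP => a; have [aS|aS] := boolP (a \in S i); last first.
    by rewrite (_ : row a _ = 0) ?sub0mx //; apply/rowP => j; rewrite !mxE (negPf aS).
  rewrite (_ : row a _ = row a (lab_mx B (S i.+1))) ?row_sub //; apply/rowP => j; rewrite !mxE aS.
  by rewrite ifT //; move: aS; rewrite !inE => /lt_le_trans -> //; exact: etaS.
(* Otherwise the rank would grow at each of ell + 1 thresholds and exceed the number ell of
   columns. *)
have [i il rk] : exists2 i, (i <= ell)%N & \rank (lab_mx B (S i)) = \rank (lab_mx B (S i.+1)).
  apply: contrapT => H; have rkge : forall k, (k <= ell.+1)%N -> (k <= \rank (lab_mx B (S k)))%N.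
    elim=> // k IH kl; apply: (leq_ltn_trans (IH (ltnW kl))).
    rewrite ltn_neqAle; apply/andP; split; last by apply: mxrankS; apply: S_sub.
    by apply/negP => /eqP rk; apply: H; exists k.
  by have := leq_trans (rkge _ (leqnn _)) (rank_leq_col _); rewrite ltnn.
have sub_i : (lab_mx B (S i.+1) <= lab_mx B (S i))%MS.
  by have := mxrank_leqif_sup (S_sub i il); rewrite rk => -[_ <-].
(* The thresholds are real whereas the linear algebra is over [rat]; the largest distance within the
   finite set is a rational bound below the threshold. *)
have [e' [e'0 e'S e'eta]] : exists e' : rat, [/\ 0 <= e', forall a, a \in S i -> e a <= e' & ratr e' < eta i].
  exists (\big[Order.max/0]_(a in S i) e a); split.
  - exact: bigmax_ge_id.
  - by move=> a aS; apply: le_bigmax_cond.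
  - elim/big_ind: _ => [|u v hu hv|a]; first by rewrite rmorph0.
      by rewrite /Order.max; case: ifP.
    by rewrite inE.
have ile : eta i <= eta ell.+1 by apply: etaL; lia.
have iSle : eta i.+1 <= eta ell.+1 by apply: etaL.
have De : (ratr (lab_den B * (1 + lab_bd B * pinv_bd B)) : R) * eta ell.+1 < 1.
  by apply: le_lt_trans eta1; apply: ler_wpM2r; rewrite ?ler_rat // ltW.
have p1 := pinv_bd_ge1 B; have b0 := lab_bd_ge0 B; have d0 := lab_den_gt0 B.
have bp0 : 0 <= lab_bd B * pinv_bd B by apply: mulr_ge0 => //; lra.
have D0 : 0 <= lab_den B * (1 + lab_bd B * pinv_bd B) by apply: mulr_ge0; [exact: ltW|lra].
have sm : lab_den B * (1 + lab_bd B * pinv_bd B) * e' < 1.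
  rewrite -(ltr_rat R) rmorph1 rmorphM /=; apply: le_lt_trans De; apply: ler_wpM2l.
    by rewrite -(rmorph0 ratr) ler_rat.
  by apply: le_trans ile; exact: ltW.
have [|x'' [x'x x'i]] := @exact_labels _ _ B (S i) (\col_j x j) r e' e'0 sm.
  by move=> a /e'S; apply: le_trans; rewrite /e /lc; under eq_bigr do rewrite mxE.
pose x' j := x'' j 0; have {}x'x j : `|x' j - x j| <= pinv_bd B * e' by have := x'x j; rewrite mxE.
have rle u v : 0 <= u -> u <= v -> ratr (u * e') <= ratr v * eta i :> R.
  move=> u0 uv; rewrite rmorphM; apply: (@le_trans _ _ (ratr u * eta i)).
    by apply: ler_wpM2l; [rewrite -(rmorph0 ratr) ler_rat|exact: ltW].
  by apply: ler_wpM2r; [exact: ltW|rewrite ler_rat].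
have lcx a : `|lc x' a - lc x a| <= lab_bd B * pinv_bd B * e'.
  rewrite /lc -sumrB -mulrA; apply: le_trans (ler_norm_sum _ _ _) _.
  apply: (@le_trans _ _ (\sum_j `|(B a j)%:~R| * (pinv_bd B * e'))).
    by apply: ler_sum => j _; rewrite -mulrBr normrM; apply: ler_wpM2l.
  rewrite -mulr_suml; apply: ler_wpM2r; last exact: lab_bdP.
  by apply: mulr_ge0 => //; lra.
exists i, x'; split=> // [j|a].
  rewrite -rmorphB -ratr_norm; apply: (@le_trans _ _ (ratr (pinv_bd B * e'))); first by rewrite ler_rat.
  by apply: rle => //; lra.
have lcr (k : int) : `|ratr (lc x' a) - k%:~R| = ratr `|lc x' a - k%:~R| :> R.
  by rewrite ratr_norm rmorphB /= ratr_int.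
have [aS|aS] := boolP (a \in S i.+1); [left|right].
  have ra : (map_mx intr (row a B) <= lab_mx B (S i))%MS.
    apply: submx_trans sub_i; rewrite (_ : map_mx _ _ = row a (lab_mx B (S i.+1))) ?row_sub //.
    by apply/rowP => j; rewrite !mxE aS.
  have := x'i _ ra; rewrite (_ : \sum_j _ = lc x' a); last by apply: eq_bigr => j _; rewrite mxE.
  move=> Di; have : lab_den B * (lc x' a - (r a)%:~R) = 0.
    apply: int_small.
      rewrite mulrBr; apply: rpredB => //; apply: rpredM; last exact: intr_int.
      by do 3!(apply: rpred_prod => ? _); exact: intr_int.
    rewrite -(ltr_rat R) rmorph1 normrM (gtr0_norm d0); apply: le_lt_trans De.
    rewrite [leLHS]rmorphM [X in _ <= X * _]rmorphM -[leRHS]mulrA; apply: ler_wpM2l; first by rewrite -(rmorph0 ratr) ler_rat ltW.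
    have -> : lc x' a - (r a)%:~R = (lc x a - (r a)%:~R) + (lc x' a - lc x a) by ring.
    apply: (@le_trans _ _ (ratr (e a) + ratr (lab_bd B * pinv_bd B * e'))).
      rewrite -rmorphD ler_rat; apply: le_trans (ler_normD _ _) _; exact: lerD.
    rewrite rmorphD /= rmorph1 mulrDl mul1r; apply: lerD.
      by apply: le_trans iSle; apply: ltW; move: aS; rewrite inE.
    apply: le_trans (rle _ _ bp0 (lexx _)) _; apply: ler_wpM2l => //.
    by rewrite -(rmorph0 ratr) ler_rat.
  move/eqP; rewrite mulf_eq0 (gt_eqF d0) /= subr_eq0 => /eqP ->; exact: intr_int.
move=> k; rewrite lcr; have ea : eta i.+1 <= ratr (e a) by rewrite leNgt; move: aS; rewrite inE.
have h1 : ratr (e a) <= ratr `|lc x a - k%:~R| :> R by rewrite ler_rat; exact: nintP.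
have h2 : ratr (lab_bd B * pinv_bd B * 4 * e') <= eta i.+1 :> R.
  by apply: le_trans (eta_step i il); apply: rle => //; rewrite mulr_ge0.
have h3 : ratr `|lc x a - k%:~R| <= ratr `|lc x' a - k%:~R| + ratr (lab_bd B * pinv_bd B * e') :> R.
  rewrite -rmorphD ler_rat; have -> : lc x a - k%:~R = (lc x' a - k%:~R) - (lc x' a - lc x a) by ring.
  by apply: le_trans (ler_normB _ _) _; rewrite lerD2l.
have h4 : ratr (lab_bd B * pinv_bd B * 4 * e') = 4 * ratr (lab_bd B * pinv_bd B * e') :> R.
  by rewrite -(ratr_nat R 4) -rmorphM; congr ratr; ring.
rewrite h4 in h2; have := eta0 i.+1; lra.
Qed.
End Thresholds.

(** * Real frequencies and gaps of characters *)

Section Frequencies.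
Variable R : realType.
Implicit Types (x y z s t : R).

Lemma sin_ge_half z : 0 <= z -> z <= 2^-1 -> z / 2 <= sin z.
Proof.
rewrite le_eqVlt => /orP [/eqP <-|z0 z2]; first by rewrite sin0 mul0r.
have [|c /itvP cz] := @MVT_segment R sin cos 0 z (ltW z0) _ _.
  by apply: continuous_subspaceT => u; exact: continuous_sin.
rewrite sin0 !subr0 => ->; rewrite mulrC; apply: ler_wpM2r; first exact: ltW.
have c0 : 0 <= c by rewrite cz.
have cz' : c <= z by rewrite cz.
have : `|cos c - cos 0| <= `|c - 0|.
  apply: (@lipschitz_of_derive R cos (fun x => - sin x)) => x.
  by rewrite normrN ler_norml sin_geN1 sin_le1.
rewrite cos0 subr0 (ger0_norm c0) ler_norml => /andP [h _]; lra.
Qed.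

Lemma expi_dist1 z : cabs (expi (z *+ 2) - 1) = 2 * `|sin z|.
Proof.
have -> : expi (z *+ 2) - 1 = expi z * (expi z - (expi z)^-1).
  by rewrite mulrBr -expiN -!expiD subrr expi0 -mulr2n.
rewrite cabsM cabs_expi mul1r expi_sin.
by rewrite /cabs /= expr0n add0r sqrtr_sqr normrM (ger0_norm (ler0n _ 2)).
Qed.

Lemma expi_int (k : int) : expi (2 * pi * k%:~R : R) = 1.
Proof.
have e1 : expi (2 * pi : R) = 1 by rewrite mulr_natl /expi cos2pi sin2pi.
have en (m : nat) : expi (2 * pi * m%:R : R) = 1.
  by elim: m => [|m IH]; [rewrite mulr0 expi0 | rewrite -(natr1 m) mulrDr mulr1 expiD IH e1 mulr1].
by case: k => m; rewrite ?NegzE ?mulrNz ?mulrN ?expiN en ?invr1.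
Qed.

Lemma sin_ge_quarter t s : 0 <= s -> s <= 8^-1 -> s <= `|t| -> `|t| <= 2^-1 -> s <= `|sin (pi * t)|.
Proof.
move=> s0 s8; have [p2 p4] : (2 <= pi :> R) /\ (pi < 4 :> R).
  by split; [exact: pi_ge2|have := pihalf_lt2 R; lra].
wlog t0 : t / 0 <= t.
  move=> H; case: (leP 0 t) => [|/ltW] t0; first exact: H.
  by move=> h1 h2; rewrite -normrN -sinN -mulrN; apply: H; rewrite ?normrN ?oppr_ge0.
rewrite (ger0_norm t0) => st t2.
have ps : pi * s <= pi * t by apply: ler_wpM2l => //; lra.
have ps0 : 0 <= pi * s by apply: mulr_ge0 => //; lra.
have pt : pi * t <= pi / 2 by apply: ler_wpM2l => //; lra.
have ps2 : pi * s <= 2^-1.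
  apply: (@le_trans _ _ (4 * s)); [apply: ler_wpM2r => //; lra | lra].
have h := sin_ge_half ps0 ps2.
have h' : s <= pi * s / 2 by have : 2 * s <= pi * s by [apply: ler_wpM2r]; lra.
apply: (@le_trans _ _ (sin (pi * t))); last exact: ler_norm.
apply: (le_trans h'); apply: (le_trans h); move: ps; rewrite le_eqVlt => /orP [/eqP ->//|ps].
by apply/ltW; rewrite ltr_sin // in_itv /=; apply/andP; split; lra.
Qed.

(* The nearest integer to t reduces to |t| <= 1/2, where sin is monotone. *)
Lemma expi_gap t s : 0 <= s -> s <= 8^-1 -> (forall r : int, s <= `|t - r%:~R|) ->
  2 * s <= cabs (expi (2 * pi * t) - 1).
Proof.
move=> s0 s8 far.
have h1 : (Num.floor (t + 2^-1))%:~R <= t + 2^-1 := floor_le _.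
have h2 : t + 2^-1 < (Num.floor (t + 2^-1) + 1)%:~R := floorD1_gt _.
move: (Num.floor _) h1 h2 => r h1 h2; rewrite intrD in h2.
have -> : expi (2 * pi * t) = expi ((pi * (t - r%:~R)) *+ 2).
  rewrite -(mul1r (expi (_ *+ 2))) -(expi_int r) -expiD; congr expi; ring.
rewrite expi_dist1; apply: ler_wpM2l => //; apply: sin_ge_quarter => //.
by rewrite ler_norml; apply/andP; split; lra.
Qed.

Section Labels.
Variables (ell K0 : nat).
Let Lf := {ffun 'I_ell -> 'I_(2 * K0).+1}.
Definition label_mx : 'M[int]_(#|{: Lf}|, ell) :=
  \matrix_(a, j) (((enum_val a : Lf) j)%:Z - K0%:Z).

Lemma label_mxP (k : lab ell) : (lnorm k <= K0)%N -> exists a, forall j, label_mx a j = k j.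
Proof.
move=> hk; have kj j : (absz (k j) <= K0)%N.
  by apply: leq_trans hk; rewrite /lnorm (bigD1 j) //= leq_addr.
pose f : Lf := [ffun j => inord (absz (k j + K0%:Z))].
exists (enum_rank f) => j; rewrite mxE enum_rankK ffunE inordK; have := kj j; lia.
Qed.
End Labels.

(** The frequencies in units of 2 pi are first approximated by rationals within the lowest
    threshold, since ranks and denominators are handled over [rat], and then corrected by
    [resonance]. The period Q is the product of the denominators; it may be huge, but averages are
    normalised and no estimate contains it. *)
Lemma resonant_frequencies (ell K0 : nat) : exists2 C1 : R, 4 <= C1 &
  forall (th : 'I_ell -> R) (eta : nat -> R), (forall i, 0 < eta i) ->
  (forall i, (i <= ell)%N -> C1 * eta i <= eta i.+1) -> C1 * eta ell.+1 < 1 ->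
  exists i (th' : 'I_ell -> R) (Q : nat), [/\ (i <= ell)%N, (0 < Q)%N,
    (forall k, chr th' k Q = 1), (forall j, `|th j - th' j| <= C1 * eta i) &
    forall k, (lnorm k <= K0)%N -> (exists r : int, phase th' k = 2 * pi * r%:~R) \/ eta i.+1 <= cabs (chr th' k 1 - 1)].
Proof.
pose B := label_mx ell K0; have [c1 _ _ _] := res_const_ge B.
have rc1 : 1 <= ratr (res_const B) :> R by rewrite -(rmorph1 ratr) ler_rat.
have [p2 p4] : (2 <= pi :> R) /\ (pi < 4 :> R).
  by split; [exact: pi_ge2|have := pihalf_lt2 R; lra].
exists (16 * ratr (res_const B)); first lra.
move=> th eta eta0 eta_step etaN.
have /choice [x hx] : forall j, exists q : rat, `|ratr q - th j / (2 * pi)| <= eta 0%N.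
  move=> j; have [|q] := @rat_in_itvoo R (th j / (2 * pi)) (th j / (2 * pi) + eta 0%N).
    by rewrite ltrDl.
  rewrite in_itv /= => /andP [q1 q2]; exists q; rewrite ger0_norm; lra.
have [||i [x' [il x'x gap]]] := @resonance R _ _ B x eta eta0.
- move=> i il; apply: le_trans (eta_step i il); apply: ler_wpM2r; [exact/ltW|lra].
- by apply: le_lt_trans etaN; apply: ler_wpM2r; [exact/ltW|lra].
pose th' j : R := 2 * pi * ratr (x' j).
pose Q := absz (\prod_j denq (x' j)).
have ph k : phase th' k = 2 * pi * ratr (\sum_j (k j)%:~R * x' j).
  rewrite /phase rmorph_sum mulr_sumr; apply: eq_bigr => j _.
  by rewrite rmorphM /= ratr_int mulrCA.
have etaS i' : (i' <= ell)%N -> eta i' <= eta i'.+1.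
  move=> il'; apply: le_trans (eta_step i' il'); rewrite ler_peMl ?(ltW (eta0 _)) //; lra.
have eta_le i' k : (i' + k <= ell.+1)%N -> eta i' <= eta (i' + k)%N.
  elim: k => [|k IH] ik; first by rewrite addn0.
  by rewrite addnS in ik *; apply: le_trans (IH (ltnW ik)) _; exact: etaS.
exists i, th', Q; split=> //.
- by rewrite absz_gt0; apply/prodf_neq0 => j _; exact: denq_neq0.
- move=> k; rewrite /chr ph -mulrA.
  have Qp : (Q%:Z = \prod_j denq (x' j)).
    by rewrite /Q gez0_abs // prodr_ge0 // => j _; exact: denq_ge0.
  have : (\sum_j (k j)%:~R * x' j) * Q%:~R \is a Num.int.
    rewrite mulr_suml; apply: rpred_sum => j _; rewrite -mulrA; apply: rpredM; first exact: intr_int.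
    rewrite Qp rmorph_prod (bigD1 j) //= mulrA -numqE; apply: rpredM; first exact: intr_int.
    by apply: rpred_prod => j' _; exact: intr_int.
  by case/intrP => r hr; rewrite -(ratr_int R Q) -rmorphM /= hr ratr_int expi_int.
- move=> j; have e0i : eta 0%N <= eta i by apply: (eta_le 0%N i); exact: leqW.
  have -> : th j - th' j = - (2 * pi) * ((ratr (x' j) - ratr (x j)) + (ratr (x j) - th j / (2 * pi))).
    have {1}-> : th j = 2 * pi * (th j / (2 * pi)) by rewrite mulrC divfK // gt_eqF //; lra.
    by rewrite /th'; move: (th j / _) => u; ring.
  have np : `|- (2 * pi)| = 2 * pi :> R by rewrite normrN ger0_norm //; lra.
  rewrite normrM np.
  apply: (@le_trans _ _ (8 * (ratr (res_const B) * eta i + eta i))).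
    apply: ler_pM => //; [lra|lra|].
    by apply: le_trans (ler_normD _ _) _; apply: lerD => //; apply: le_trans e0i.
  have : eta i <= ratr (res_const B) * eta i by rewrite ler_peMl // ltW.
  have aux (rc u : R) : u <= rc * u -> 8 * (rc * u + u) <= 16 * rc * u by move=> h; lra.
  exact: aux.
move=> k /label_mxP [a ka]; case: (gap a) => [|{}gap].
  under eq_bigr do rewrite ka; case/intrP => r hr; left; exists r.
  by rewrite ph hr ratr_int.
right; rewrite /chr ph mulr1 [leLHS](_ : _ = 2 * (eta i.+1 / 2)); last by field.
apply: expi_gap.
- by rewrite divr_ge0 // ltW.
- have h1 : eta i.+1 <= eta ell.+1 by have := eta_le i.+1 (ell - i)%N; rewrite addSn subnKC //; apply.
  have : 16 * eta ell.+1 <= 16 * ratr (res_const B) * eta ell.+1.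
    by apply: ler_wpM2r; [exact/ltW|lra].
  by move=> h2; have := eta0 ell.+1; lra.
by move=> r; have := gap r; under eq_bigr do rewrite ka.
Qed.
End Frequencies.

(** * Choice of the powers of h and of the thresholds *)

Section Scales.
Variables (R : realType) (ell N : nat) (delta cs : R).
Hypotheses (delta0 : 0 < delta) (delta1 : delta <= 1) (cs0 : 0 < cs).

(** Exceeds the losses in powers of g, at most 4 ell + 9 from the thresholds and N + 2 from the
    harmonics; a q with this number at most q delta turns them into h^(-delta). *)
Definition scale_const := (4 * ell + N + 20)%N.
Lemma scale_ex : exists q : nat, scale_const%:R <= q%:R * delta.
Proof.
exists (Num.bound (scale_const%:R / delta)).
by rewrite -ler_pdivrMr //; apply: ltW; apply: archi_boundP; rewrite divr_ge0 ?ler0n ?ltW.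
Qed.

Lemma pow_small (g : R) (q s : nat) : 0 < g -> g <= 1 -> s%:R <= q%:R * delta ->
  g ^+ (q - s) <= (g ^+ q) `^ (1 - delta).
Proof.
move=> g0 g1 sq; have sq' : (s <= q)%N.
  by rewrite -(ler_nat R); apply: (le_trans sq); rewrite ler_piMr.
rewrite -!powR_mulrn ?(ltW g0) // -powRrM natrB //.
by apply: ger_powR; [rewrite g0 | lra].
Qed.

(** The exponents J, NN, K and the bound [h1] are fixed before the frequencies; only the threshold
    index, hence [tau_], the rational frequencies and their period, depends on them. *)
Lemma params_ex : exists (J NN K : nat) (h1 : R), [/\ (1 < J)%N, (2 < NN)%N,
  (sdeg J (dS J) J.-1 <= K)%N & 0 < h1 /\
  forall (h : R) (th chi : 'I_ell -> R), 0 < h -> h <= h1 ->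
   (forall j, 0 <= th j <= pi) -> (forall j, cs <= `|sin (th j)|) -> (forall j, cs <= chi j <= cs^-1) ->
   exists p : par R ell, [/\ par_ok cs K J NN p, h_ p = h, th_ p = th, chi_ p = chi &
     [/\ (forall m, m%:R * h <= h ^- N -> (tau_ p)^-1 + h_ p / g_ p + g_ p / (tau_ p ^+ 2 * h_ p)
            + m%:R * (h_ p ^+ NN / h_ p ^+ 2) <= 4 * h `^ (1 - delta)),
         (forall m, m%:R * h <= h ^- N -> (tau_ p)^-1 + h_ p / g_ p
            + m%:R * ((sg p ^+ N.+2)^-1 + h_ p ^+ NN / h_ p ^+ 2) <= 4 * h `^ (1 - delta)) &
         ((forall (r : int) (k : lab ell), r != 0 -> (lnorm k <= N.+1)%N ->
            Num.sqrt h <= `|phase th k - 2 * pi * r%:~R|) -> nonres_par N p)]]].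
Proof.
(* q is even so that sqrt h = g^q1 is an integral power of g, to be compared with the gap at the
   end. *)
have [q1 hq1] := scale_ex; pose q := (2 * q1)%N.
have q1big : (scale_const <= q1)%N.
  by rewrite -(ler_nat R); apply: (le_trans hq1); rewrite ler_piMr.
have hq : scale_const%:R <= q%:R * delta.
  apply: (le_trans hq1); rewrite ler_pM2r // ler_nat /q; lia.
(* NN - 2 = N + 2: at most h^(-N - 1) steps leave a factor h. With this J, g^(J - 1) is exactly
   h^NN. *)
pose NN := (N + 4)%N; pose J := (q * NN).+1.
have [K dK] : exists K, sdeg J (dS J) J.-1 = K by eexists.
have [C1 C14 hC1] := resonant_frequencies R ell K.+1.
have p2 : 0 < 4 - pi :> R by have := pihalf_lt2 R; lra.
(* One summand for each requirement g u <= 1 below. The term in 4 - pi keeps the moved frequencies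
   below 4, the original ones being at most pi. *)
pose g1 : R := (2 * C1 + 2 / cs + 2 + (4 - pi)^-1 + N.+2%:R)^-1.
have s1 : 0 < 2 / cs by apply: divr_gt0.
have s2 : 0 < (4 - pi)^-1 :> R by rewrite invr_gt0.
have s3 : 0 <= N.+2%:R :> R by [].
have g10 : 0 < g1 by rewrite invr_gt0; lra.
have [q0 qbig] : (0 < q)%N /\ (2 * scale_const <= q)%N by move: q1big; rewrite /q /scale_const; clear; lia.
exists J, NN, K, (g1 ^+ q); split; [by rewrite ltnS muln_gt0 q0 /NN addnC|by rewrite /NN addnC|by rewrite dK|].
split=> [|h th chi h0 hh1 hth hsin hchi]; first exact: exprn_gt0.
pose g := h `^ q%:R^-1.
have g0 : 0 < g by exact: powR_gt0.
have hg : h = g ^+ q.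
  by rewrite -powR_mulrn ?(ltW g0) // -powRrM mulVf ?powRr1 ?(ltW h0) // pnatr_eq0 -lt0n.
have gg1 : g <= g1.
  rewrite leNgt; apply/negP => lt; have : g1 ^+ q < h by rewrite hg ltrXn2r -?lt0n // ltW.
  by move=> H; have := lt_le_trans H hh1; rewrite ltxx.
have gbound (u : R) : 0 < u -> u <= 2 * C1 + 2 / cs + 2 + (4 - pi)^-1 + N.+2%:R -> g * u <= 1.
  move=> u0 ub; rewrite -ler_pdivlMr // div1r; apply: (le_trans gg1).
  by rewrite lef_pV2 ?posrE //; lra.
have gC : g * (2 * C1) <= 1 by apply: gbound; lra.
have gcs : g * (2 / cs) <= 1 by apply: gbound; lra.
have g2 : g * 2 <= 1 by apply: gbound; lra.
have gpi : g * (4 - pi)^-1 <= 1 by apply: gbound; lra.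
have gN : g * N.+2%:R <= 1 by apply: gbound; rewrite ?ltr0n //; lra.
have gle1 : g <= 1 by lra.
have gp (a b : nat) : (b <= a)%N -> g ^+ a <= g ^+ b by move=> ab; apply: ler_wiXn2l => //; exact: ltW.
(* Consecutive thresholds differ by g^2: one factor g pays for the constant [C1], the other for the
   factor g in |th - tht| <= g / tau. The offset 3 leaves room for [tau_h]. *)
pose eta i := if (i <= ell.+1)%N then g ^+ (q - 3 - 2 * i) else 1.
have etaE i : (i <= ell.+1)%N -> eta i = g ^+ (q - 3 - 2 * i) by move=> il; rewrite /eta il.
rewrite /scale_const in qbig q1big hq.
have [||| i [th' [Q [il Q0 chrQ thth' gap]]]] := hC1 th eta.
- by move=> i; rewrite /eta; case: ifP => // _; exact: exprn_gt0.
- move=> i il; rewrite !etaE //; last exact: leqW.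
  have -> : (q - 3 - 2 * i = (q - 3 - 2 * i.+1).+2)%N by clearbody q; clear -il qbig; lia.
  rewrite exprSr exprSr mulrA mulrC !mulrA; set u := g ^+ _.
  have u0 : 0 <= u by rewrite exprn_ge0 // ltW.
  have : C1 * g * g <= 1.
    apply: (@le_trans _ _ (1 * 1)); last by rewrite mulr1.
    by apply: ler_pM; rewrite ?mulr_ge0 ?(ltW g0) //; lra.
  by move=> H; have := ler_wpM2r u0 H; rewrite mul1r; apply: le_trans; rewrite le_eqVlt; apply/orP; left; apply/eqP; ring.
- rewrite etaE //; have : g ^+ (q - 3 - 2 * ell.+1) <= g ^+ 1 by apply: gp; clearbody q; clear -qbig; lia.
  rewrite expr1 => H; apply: (@le_lt_trans _ _ (C1 * g)); [apply: ler_wpM2l => //; lra|lra].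
pose eb := eta i.+1; have ebE : eb = g ^+ (q - 5 - 2 * i).
  by rewrite /eb etaE ?ltnS //; congr (g ^+ _); clearbody q; clear -il qbig; lia.
have eb0 : 0 < eb by rewrite ebE exprn_gt0.
have ebl : eb <= g ^+ (q - 5 - 2 * ell) by rewrite ebE; apply: gp; clearbody q; clear -il qbig; lia.
have ebg : eb <= g by rewrite ebE -[leRHS]expr1; apply: gp; clearbody q; clear -il qbig; lia.
(* The numerator provides the factor 2 demanded by [gap_]. *)
pose tau := 2 / eb; have tau0 : 0 < tau by exact: divr_gt0.
have tauV : tau^-1 = eb / 2 by rewrite /tau invf_div.
have thd j : `|th j - th' j| <= g / tau.
  apply: (le_trans (thth' j)); rewrite tauV ebE etaE; last exact: leqW.
  have -> : (q - 3 - 2 * i = (q - 5 - 2 * i).+2)%N by clearbody q; clear -il qbig; lia.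
  rewrite !exprS; set u := g ^+ _; have u0 : 0 <= g * u by rewrite mulr_ge0 ?exprn_ge0 // ltW.
  have := ler_wpM2r u0 gC; lra.
have hle : h <= g by rewrite hg -[leRHS]expr1; apply: gp.
pose p := Par h g tau th th' chi Q.
have g_ge0 : 0 <= g by exact: ltW.
have h_eq : h = g * g ^+ q.-1 by rewrite hg -exprS prednK.
have th4 j : `|th j| <= 4.
  by have /andP [t0 t1] := hth j; rewrite ger0_norm //; lra.
have gtau : g / tau = g * eb / 2 by rewrite tauV mulrA.
have heb : h <= g ^+ 3 * eb.
  by rewrite hg ebE -exprD; apply: gp; clearbody q; clear -il qbig; lia.
have g3 : g ^+ 3 * 2 <= g ^+ 2.
  by rewrite exprSr -mulrA -[leRHS]mulr1; apply: ler_wpM2l; rewrite ?exprn_ge0.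
have th'4 j : `|th' j| <= 4.
  have /andP [t0 t1] := hth j; have := thd j; rewrite gtau => H.
  have gp4 : g <= 4 - pi by move: gpi; rewrite ler_pdivrMr // mul1r.
  have : g * eb <= g * 1 by apply: ler_wpM2l => //; lra.
  have -> : th' j = th j - (th j - th' j) by ring.
  move=> H'; apply: le_trans (ler_normB _ _) _; rewrite (ger0_norm t0); lra.
have okp : par_ok cs K J NN p.
  split=> //=.
  - lra.
  - by rewrite -invf_le1 // tauV; lra.
  - rewrite -ler_pdivlMl // tauV; apply: (le_trans heb); have := ler_wpM2r (ltW eb0) g3; lra.
  - move=> k hk; case: (gap k hk) => [[r hr]|H]; [left|right].
      by rewrite /chr mulr1 hr expi_int.
    by rewrite /tau mulrAC ler_pdivlMr // ler_wpM2l.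
  - rewrite /tau mulrAC ler_pdivlMr //; have : g * 2 <= cs.
      by move: gcs; rewrite mulrA ler_pdivrMr // mul1r.
    lra.
  - by move=> j; have /andP [] := hchi j.
  - by move=> j; have /andP [] := hchi j.
  - by rewrite /J /= hg -exprM.
have small s : (s <= scale_const)%N -> g ^+ (q - s) <= h `^ (1 - delta).
  move=> hs; rewrite {1}hg; apply: pow_small => //; apply: le_trans hq.
  by rewrite ler_nat.
have e1 : tau^-1 <= h `^ (1 - delta).
  have : eb <= h `^ (1 - delta).
    apply: (le_trans ebl); rewrite -subnDA; apply: small; rewrite /scale_const; clear; lia.
  rewrite tauV; lra.
have e2 : h / g <= h `^ (1 - delta).
  rewrite {1}h_eq mulrC mulrA mulVf ?mul1r ?gt_eqF // -subn1; apply: small.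
  by rewrite /scale_const; clear; lia.
have e3 : g / (tau ^+ 2 * h) <= h `^ (1 - delta).
  have -> : g / (tau ^+ 2 * h) = g * (eb / 2) ^+ 2 / h.
    by rewrite -tauV exprVn invfM; move: (_ ^-1) (_ ^-1) => u v; ring.
  rewrite ler_pdivrMr //; apply: (@le_trans _ _ (g * eb ^+ 2)).
    apply: ler_wpM2l => //; rewrite expr_div_n ler_pdivrMr ?exprn_gt0 //.
    by rewrite ler_peMr ?exprn_ge0 // ?(ltW eb0) // exprn_ege1 // ler1n.
  apply: (@le_trans _ _ (g ^+ (q - (9 + 4 * ell)) * h)).
    rewrite hg ebE -exprM -exprS -exprD; apply: gp; clearbody q; clear -il qbig; lia.
  by apply: ler_wpM2r; [exact: ltW|apply: small; rewrite /scale_const; clear; lia].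
have e4 m : m%:R * h <= h ^- N -> m%:R * (h ^+ NN / h ^+ 2) <= h `^ (1 - delta).
  move=> hm; have h1 : h <= h `^ (1 - delta).
    by have := small 0%N (leq0n _); rewrite subn0 -hg.
  apply: le_trans h1; have -> : h ^+ NN / h ^+ 2 = h * h ^+ N * h.
    rewrite /NN addn4 -[N.+4]addn2 exprD mulfK ?expf_neq0 ?gt_eqF //.
    by rewrite exprSr exprS.
  rewrite !mulrA; apply: ler_piMl; first exact: ltW.
  by rewrite -ler_pdivlMr ?exprn_gt0 // div1r.
have e5 m : m%:R * h <= h ^- N -> m%:R * (sg p ^+ N.+2)^-1 <= h `^ (1 - delta).
  move=> hm; have hs : g ^+ (q - N.+2) <= h `^ (1 - delta).
    by apply: small; rewrite /scale_const; clear; lia.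
  apply: le_trans hs; have -> : (sg p ^+ N.+2)^-1 = h * h ^+ N * g ^+ (q - N.+2).
    rewrite /sg /= expr_div_n invf_div -exprS exprSr -mulrA; congr (_ * _).
    rewrite {1}hg -[in LHS](@subnK N.+2 q) ?exprD ?mulfK ?expf_neq0 ?gt_eqF //.
    by move: qbig; clearbody q; rewrite /scale_const; clear; lia.
  rewrite !mulrA; apply: ler_piMl; first exact: exprn_ge0.
  by rewrite -ler_pdivlMr ?exprn_gt0 // div1r.
exists p; split=> //; split=> /=.
- by move=> m /e4 e4m; lra.
- by move=> m hm; have := e4 m hm; have := e5 m hm; rewrite mulrDr; lra.
(* An exact relation of the moved frequencies with r != 0 would put the original phase within (N +
   1) g / tau of 2 pi r, which is less than sqrt h. *)
move=> far k hk ck /=; case: (gap k _) => [|[r hr]|].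
- apply: (leq_trans hk); rewrite ltnS -dK; apply: (@leq_trans (dS J)); last first.
    by apply: sdeg_ge; rewrite /J.
  rewrite /dS /dY; apply: (@leq_trans J).
    by apply: leqW; rewrite /NN mulnDr; apply: (leq_trans _ (leq_addr _ _)); exact: leq_pmull.
  by apply: leq_pmulr; rewrite muln_gt0 pdeg_ge.
- have [r0|r0] := eqVneq r 0; first by rewrite hr r0 mulr0.
  have := far r k r0 hk; rewrite -hr.
  have : `|phase th k - phase th' k| <= N.+1%:R * (g / tau).
    rewrite /phase -sumrB; apply: le_trans (ler_norm_sum _ _ _) _.
    apply: (@le_trans _ _ (\sum_j (absz (k j))%:R * (g / tau))).
      apply: ler_sum => j _; rewrite -mulrBr normrM; apply: ler_pM => //.
      by rewrite -intr_norm -abszE -pmulrn.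
    rewrite -mulr_suml -natr_sum; apply: ler_wpM2r; last by rewrite ler_nat.
    by rewrite gtau divr_ge0 // mulr_ge0 // ltW.
  move=> H1 H2; have := le_trans H2 H1; rewrite leNgt => /negP [].
  have -> : Num.sqrt h = g ^+ q1.
    by rewrite hg /q mulnC exprM sqrtr_sqr ger0_norm // exprn_ge0.
  have h5 : eb <= g ^+ q1.
    apply: (le_trans ebl); apply: gp; move: q1big; rewrite /q /scale_const; clear; lia.
  apply: lt_le_trans h5; rewrite gtau -(natr1 N.+1) -(natr1 N) in gN *; move: (N%:R : R) gN (ler0n R N) => n gN n0.
  have : (g * (n + 1 + 1)) * eb <= 1 * eb by apply: ler_wpM2r => //; exact: ltW.
  have : 0 < g * eb by apply: mulr_gt0.
  by lra.
by rewrite ck subrr cabs0 leNgt -/eb eb0.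
Qed.
End Scales.

(** * Coordinates of block vectors *)

Section Blocks.
Variables (R : realType) (ell : nat) (d : 'I_ell.+1 -> nat).
Local Notation n := (\sum_i d i)%N.
Definition block_of (c : 'I_n) : 'I_ell.+1 := tagnat.sig1 c.
Definition fast_index (c : 'I_n) : option 'I_ell := unlift ord0 (block_of c).

Lemma fast_indexP c j : fast_index c = Some j -> block_of c = lift ord0 j.
Proof. by rewrite /fast_index; case: unliftP => [k ->|//] [->]. Qed.
Lemma slow_indexP c : fast_index c = None -> block_of c = ord0.
Proof. by rewrite /fast_index; case: unliftP => [k ->|//]. Qed.

Lemma sum_blocks (G : 'I_ell.+1 -> R -> R) (x : state R d) :
  \sum_j \sum_i G j (submxrow x j 0 i) = \sum_c G (block_of c) (x 0 c).
Proof.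
rewrite sig_big_dep /= (reindex _ tagnat.sig_bij_on) /=.
by apply: eq_bigr => c _; rewrite mxE; congr (G _ (x _ _)); exact: (tagnat.sig2K c).
Qed.

Lemma sum_fast (F : 'I_ell -> R) (x : state R d) :
  \sum_j F j * sqnorm (submxrow x (lift ord0 j)) =
  \sum_(c | fast_index c != None) (if fast_index c is Some j then F j else 0) * x 0 c ^+ 2.
Proof.
have := sum_blocks (fun k a => (if unlift ord0 k is Some j then F j else 0) * a ^+ 2) x.
rewrite big_ord_recl /= big1 ?add0r; last by move=> i _; rewrite unlift_none mul0r.
move=> H; rewrite [RHS]big_mkcond /=; transitivity (\sum_c (if unlift ord0 (block_of c) is Some j then F j else 0) * x 0 c ^+ 2).
  by rewrite -H; apply: eq_bigr => j _; rewrite liftK mulr_sumr.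
by apply: eq_bigr => c _; rewrite /fast_index; case: (unlift ord0 _) => //=; rewrite mul0r.
Qed.

Lemma sum_slow (x : state R d) : sqnorm (submxrow x ord0) = \sum_(c | fast_index c == None) x 0 c ^+ 2.
Proof.
have := sum_blocks (fun k a => (if unlift ord0 k is Some j then 0 else 1) * a ^+ 2) x.
rewrite big_ord_recl /= [X in _ + X]big1 ?addr0; last first.
  by move=> j _; rewrite big1 // => i _; rewrite liftK mul0r.
move=> H; rewrite [RHS]big_mkcond /=.
transitivity (\sum_(i < d ord0) (if unlift ord0 (ord0 : 'I_ell.+1) is Some j then 0 else 1) * submxrow x ord0 0 i ^+ 2).
  by apply: eq_bigr => i _; rewrite unlift_none mul1r.
rewrite H; apply: eq_bigr => c _.
by rewrite /fast_index; case: (unlift ord0 _) => [j|] /=; rewrite ?mul0r ?mul1r.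
Qed.

Lemma mul_Omega (omega : 'I_ell.+1 -> R) (x : state R d) c :
  (x *m Omega_mx d omega) 0 c = omega (block_of c) * x 0 c.
Proof.
rewrite -{1}[x]submxrowK /Omega_mx mul_mxrow_mxdiag mxE mul_mx_scalar !mxE.
by congr (_ * x _ _); exact: (tagnat.sig2K c).
Qed.

Lemma mul_Omega2 (omega : 'I_ell.+1 -> R) (x : state R d) c :
  (x *m Omega_mx d omega ^+ 2) 0 c = omega (block_of c) ^+ 2 * x 0 c.
Proof. by rewrite expr2 mulmxA !mul_Omega mulrA -expr2. Qed.

End Blocks.

Section Euclid.
Variables (R : realType) (n : nat).

Lemma enorm_le (x : 'rV[R]_n) B : 0 <= B -> (forall c, `|x 0 c| <= B) -> enorm x <= n%:R * B.
Proof.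
move=> B0 hB; have nB : 0 <= n%:R * B by rewrite mulr_ge0.
rewrite /enorm -(ger0_norm nB) -sqrtr_sqr; apply: ler_wsqrtr.
apply: (@le_trans _ _ (\sum_(c < n) B ^+ 2)).
  by apply: ler_sum => c _; rewrite -[x 0 c ^+ 2]real_normK ?num_real // lerXn2r ?nnegrE.
rewrite sumr_const card_ord -[leLHS]mulr_natl exprMn; apply: ler_wpM2r; first exact: sqr_ge0.
by rewrite -natrX ler_nat expnS expn1; case: (n) => // k; rewrite leq_pmulr.
Qed.

Lemma enormZ a (x : 'rV[R]_n) : enorm (a *: x) = `|a| * enorm x.
Proof.
rewrite /enorm /sqnorm -sqrtr_sqr -sqrtrM ?sqr_ge0 //; congr Num.sqrt.
by rewrite mulr_sumr; apply: eq_bigr => i _; rewrite mxE exprMn.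
Qed.

Lemma enorm_ge0 (x : 'rV[R]_n) : 0 <= enorm x. Proof. exact: sqrtr_ge0. Qed.

Lemma enormD (x y : 'rV[R]_n) : enorm (x + y) <= enorm x + enorm y.
Proof.
have s0 (z : 'rV[R]_n) : 0 <= sqnorm z by apply: sumr_ge0 => i _; exact: sqr_ge0.
have e2 (z : 'rV[R]_n) : enorm z ^+ 2 = sqnorm z by rewrite sqr_sqrtr.
suff H : enorm (x + y) ^+ 2 <= (enorm x + enorm y) ^+ 2.
  by move: H; rewrite ler_sqr ?nnegrE ?addr_ge0 ?enorm_ge0.
rewrite sqrrD !e2; pose dt := \sum_i x 0 i * y 0 i.
have -> : sqnorm (x + y) = sqnorm x + dt *+ 2 + sqnorm y.
  rewrite /sqnorm /dt -sumrMnl -!big_split /=; apply: eq_bigr => i _.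
  by rewrite mxE sqrrD.
rewrite lerD2r lerD2l lerMn2r /=; apply: le_trans (ler_norm _) _.
rewrite -sqrtr_sqr /enorm -sqrtrM //; apply: ler_wsqrtr.
(* Cauchy-Schwarz through the Lagrange identity *)
have : 0 <= \sum_i \sum_j (x 0 i * y 0 j - x 0 j * y 0 i) ^+ 2.
  by apply: sumr_ge0 => i _; apply: sumr_ge0 => j _; exact: sqr_ge0.
have -> : \sum_i \sum_j (x 0 i * y 0 j - x 0 j * y 0 i) ^+ 2 =
    (sqnorm x * sqnorm y) *+ 2 - dt ^+ 2 *+ 2.
  have sqE1 : sqnorm x * sqnorm y = \sum_i \sum_j x 0 i ^+ 2 * y 0 j ^+ 2.
    by rewrite /sqnorm mulr_suml; apply: eq_bigr => i _; rewrite mulr_sumr.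
  have sqE2 : sqnorm x * sqnorm y = \sum_i \sum_j x 0 j ^+ 2 * y 0 i ^+ 2 by rewrite sqE1 exchange_big.
  have sqE3 : dt ^+ 2 = \sum_i \sum_j (x 0 i * y 0 i) * (x 0 j * y 0 j).
    by rewrite expr2 {1}/dt mulr_suml; apply: eq_bigr => i _; rewrite mulr_sumr.
  rewrite [in RHS]mulr2n {1}sqE1 sqE2 sqE3 -sumrMnl -big_split -sumrB /=; apply: eq_bigr => i _.
  rewrite -sumrMnl -big_split -sumrB /=; apply: eq_bigr => j _; ring.
by rewrite subr_ge0 lerMn2r.
Qed.

Lemma enorm_delta c : enorm (delta_mx 0 c : 'rV[R]_n) = 1.
Proof.
rewrite /enorm /sqnorm (bigD1 c) //= big1 => [|i ic]; rewrite mxE ?eqxx /=.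
  by rewrite expr1n addr0 sqrtr1.
by rewrite (negPf ic) expr0n.
Qed.
End Euclid.

(** * The numerical frequencies *)

Section FrequencyBounds.
Variables (R : realType) (alpha c1 theta c0 : R).
Hypotheses (theta1 : theta < 1) (c00 : 0 < c0).

Let Wm : R := c1 ^+ 2 + 4 * theta ^+ 2 / `|1 - 4 * alpha|.
Let Wm0 : 0 <= Wm.
Proof. by rewrite addr_ge0 ?sqr_ge0 // mulr_ge0 // mulr_ge0 // sqr_ge0. Qed.
Let mm : R := Num.min 1 (1 - theta).
Let mm0 : 0 < mm. Proof. by rewrite lt_min ltr01 subr_gt0. Qed.

(** For alpha < 1/4 the restriction reads (1 - 4 alpha) a^2 <= 4 theta^2, and theta < 1 leaves a
    margin that bounds h omega~ away from pi; for alpha >= 1/4 the corresponding term has the good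
    sign and only the bound by c1 is used. *)
Let stiffness_bounds (a : R) : c0 <= a -> (4^-1 <= alpha -> a <= c1) ->
  (alpha < 4^-1 -> a <= 2 * theta / Num.sqrt (1 - 4 * alpha)) ->
  [/\ a ^+ 2 <= Wm, (1 + 4 * `|alpha|)^-1 <= 1 + alpha * a ^+ 2,
      1 + alpha * a ^+ 2 <= 1 + `|alpha| * Wm & 4 * mm <= 4 - (1 - 4 * alpha) * a ^+ 2].
Proof.
move=> ca H1 H2; have a0 : 0 < a by exact: lt_le_trans ca.
have mm1 : mm <= 1 by rewrite /mm ge_min lexx.
have mmt : mm <= 1 - theta by rewrite /mm ge_min lexx orbT.
have W0 : 0 <= a ^+ 2 by exact: sqr_ge0.
have inv1 : (1 + 4 * `|alpha|)^-1 <= 1 by rewrite invf_le1 ?lerDl ?mulr_ge0 // addrC ltr_wpDl ?mulr_ge0.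
suff [h1 h2 h3] : [/\ a ^+ 2 <= Wm, (1 + 4 * `|alpha|)^-1 <= 1 + alpha * a ^+ 2 & 4 * mm <= 4 - (1 - 4 * alpha) * a ^+ 2].
  split=> //; rewrite lerD2l; apply: le_trans (ler_norm _) _; rewrite normrM (ger0_norm W0).
  by apply: ler_wpM2l.
have [al|al] := leP 4^-1 alpha.
  have ac := H1 al; have c10 : 0 <= c1 := le_trans (ltW a0) ac.
  have : a ^+ 2 <= c1 ^+ 2 by rewrite lerXn2r ?nnegrE // ltW.
  have : 0 <= 4 * theta ^+ 2 / `|1 - 4 * alpha| by rewrite mulr_ge0 // mulr_ge0 // sqr_ge0.
  have : 0 <= alpha * a ^+ 2 by rewrite mulr_ge0 //; lra.
  have : 0 <= (4 * alpha - 1) * a ^+ 2 by rewrite mulr_ge0 //; lra.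
  by rewrite /Wm; split; lra.
have k0 : 0 < 1 - 4 * alpha by lra.
have ac := H2 al; have sk : 0 < Num.sqrt (1 - 4 * alpha) by rewrite sqrtr_gt0.
have th0 : 0 < theta.
  by have := lt_le_trans a0 ac; rewrite pmulr_lgt0 ?invr_gt0 // pmulr_rgt0.
have kW : (1 - 4 * alpha) * a ^+ 2 <= 4 * theta ^+ 2.
  move: ac; rewrite ler_pdivlMr // => ac.
  have : (a * Num.sqrt (1 - 4 * alpha)) ^+ 2 <= (2 * theta) ^+ 2.
    have b0 : 0 <= 2 * theta by rewrite mulr_ge0 // ltW.
    have b1 : 0 <= a * Num.sqrt (1 - 4 * alpha) by rewrite mulr_ge0 // ltW.
    by rewrite lerXn2r ?nnegrE.
  rewrite !exprMn sqr_sqrtr ?(ltW k0) //; lra.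
have th2 : theta ^+ 2 <= theta by rewrite expr2 ler_piMl ?ltW.
have th3 : 0 <= 1 - theta ^+ 2 by move: theta1 th2; lra.
split.
- rewrite /Wm (gtr0_norm k0) -[leLHS]add0r; apply: lerD; first exact: sqr_ge0.
  by rewrite ler_pdivlMr // mulrC.
- have [a1|a1] := leP 0 alpha.
    have : 0 <= alpha * a ^+ 2 by rewrite mulr_ge0.
    lra.
  rewrite (ltr0_norm a1) mulrN -div1r ler_pdivrMr // mulrDl mul1r.
  have : alpha * (4 * theta ^+ 2) <= alpha * ((1 - 4 * alpha) * a ^+ 2).
    by apply: ler_wnM2l => //; exact: ltW.
  have : 0 <= - alpha * (4 * (1 - theta ^+ 2)) by rewrite !mulr_ge0 // oppr_ge0 ltW.
  have -> : alpha * a ^+ 2 * (1 - 4 * alpha) = alpha * ((1 - 4 * alpha) * a ^+ 2) by ring.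
  lra.
- lra.
Qed.

(** Everything is explicit in D = 1 + alpha a^2: chi = 1 / D and sin(t)^2 = a^2 (4 - (1 - 4 alpha)
    a^2) / (4 D^2). The sine stays away from 0 because a >= c0 and because of the margin in
    [stiffness_bounds]. *)
Lemma frequency_bounds : exists2 cs : R, 0 < cs & forall a t : R, c0 <= a ->
  (4^-1 <= alpha -> a <= c1) -> (alpha < 4^-1 -> a <= 2 * theta / Num.sqrt (1 - 4 * alpha)) ->
  0 <= t <= pi -> sin (2^-1 * t) = 2^-1 * a / Num.sqrt (1 + alpha * a ^+ 2) ->
  [/\ cs <= chi alpha t <= cs^-1, cs <= sin t, a <= cs^-1,
      chi alpha t * (1 + alpha * a ^+ 2) = 1 & 2 * cos t = 2 - a ^+ 2 * chi alpha t].
Proof.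
pose lo := (1 + `|alpha| * Wm)^-1; pose hi := 1 + 4 * `|alpha|.
have lo0 : 0 < lo by rewrite invr_gt0 addrC ltr_wpDl ?mulr_ge0.
have hi0 : 0 < hi by rewrite /hi addrC ltr_wpDl ?mulr_ge0.
pose sl := Num.sqrt (c0 ^+ 2 * mm) * lo.
have sl0 : 0 < sl by rewrite mulr_gt0 // sqrtr_gt0 mulr_gt0 // exprn_gt0.
pose cs := Num.min (Num.min lo hi^-1) (Num.min sl (1 + Wm)^-1).
have W1 : 0 < 1 + Wm by rewrite addrC ltr_wpDl.
have cs0 : 0 < cs by rewrite !lt_min lo0 sl0 !invr_gt0 hi0 W1.
exists cs => // a t ca h1 h2 /andP [t0 tpi] ht.
have [aW Dlo Dhi mmW] := stiffness_bounds ca h1 h2.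
have a0 : 0 < a by exact: lt_le_trans ca.
set D := 1 + alpha * a ^+ 2 in Dlo Dhi ht *.
have D0 : 0 < D by apply: lt_le_trans Dlo; rewrite invr_gt0.
have s2 : sin (2^-1 * t) ^+ 2 = 4^-1 * a ^+ 2 / D.
  have r0 : Num.sqrt D != 0 by rewrite gt_eqF // sqrtr_gt0.
  by rewrite ht -[in RHS](sqr_sqrtr (ltW D0)); move: (Num.sqrt D) r0 => r r0; field.
have cE : chi alpha t = D^-1.
  rewrite /chi s2 -[RHS]mul1r; apply: (mulIf (lt0r_neq0 D0)); rewrite divfK ?gt_eqF //.
  rewrite mulrBl mul1r -!mulrA mulVf ?gt_eqF // mulr1 /D; by field.
have D1 : D^-1 * D = 1 by rewrite mulVf ?gt_eqF.
have clo : lo <= D^-1 by rewrite lef_pV2 ?posrE // (lt_le_trans D0).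
have cVhi : D^-1 <= hi by rewrite -[hi]invrK lef_pV2 ?posrE ?invr_gt0.
have tE : t = (2^-1 * t) *+ 2 by rewrite -mulr_natr mulrAC mulVf ?mul1r.
have sin0 : 0 <= sin t by apply: sin_ge0_pi; rewrite t0.
have sin2 : sin t ^+ 2 = a ^+ 2 / D * ((4 - (1 - 4 * alpha) * a ^+ 2) / 4 / D).
  have c2 : cos (2^-1 * t) ^+ 2 = 1 - sin (2^-1 * t) ^+ 2 by have := cos2Dsin2 (2^-1 * t); lra.
  have e : 1 - 4^-1 * a ^+ 2 / D = (4 - (1 - 4 * alpha) * a ^+ 2) / 4 / D.
    by apply: (mulIf (lt0r_neq0 D0)); rewrite mulrBl mul1r !divfK ?gt_eqF // /D; field.
  rewrite {1}tE sin_mulr2n; have -> (u v : R) : (u * v *+ 2) ^+ 2 = 4 * (u ^+ 2 * v ^+ 2) by ring.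
  by rewrite c2 s2 e; move: (D^-1) => v; field.
have cs_lo : cs <= lo by rewrite !ge_min lexx.
have cs_hi : cs <= hi^-1 by rewrite !ge_min lexx !orbT.
have cs_sl : cs <= sl by rewrite !ge_min lexx !orbT.
have cs_W : cs <= (1 + Wm)^-1 by rewrite !ge_min lexx !orbT.
rewrite cE; split=> //.
- rewrite (le_trans cs_lo clo) /=; apply: (le_trans cVhi).
  by rewrite -[leLHS]invrK lef_pV2 ?posrE ?invr_gt0.
- apply: (le_trans cs_sl); rewrite -[sin t](ger0_norm sin0) -[sl](ger0_norm (ltW sl0)) -!sqrtr_sqr.
  apply: ler_wsqrtr; rewrite sin2 /sl exprMn sqr_sqrtr; last by rewrite mulr_ge0 ?sqr_ge0 // ltW.
  have -> : c0 ^+ 2 * mm * lo ^+ 2 = (c0 ^+ 2 * lo) * (mm * lo) by ring.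
  have l0 := ltW lo0; have m0 := ltW mm0.
  have z1 : 0 <= c0 ^+ 2 * lo by apply: mulr_ge0 => //; exact: sqr_ge0.
  have z2 : 0 <= mm * lo by apply: mulr_ge0.
  have z3 : c0 ^+ 2 <= a ^+ 2 by rewrite lerXn2r ?nnegrE // ltW.
  apply: ler_pM => //; first by apply: ler_pM => //; exact: sqr_ge0.
  by apply: ler_pM => //; lra.
- apply: (@le_trans _ _ (1 + Wm)); last by rewrite -[leLHS]invrK lef_pV2 ?posrE ?invr_gt0.
  have := sqr_ge0 (a - 1); rewrite sqrrB expr1n mulr1 => h; lra.
- rewrite {1}tE cos_mulr2n; have -> : cos (2^-1 * t) ^+ 2 = 1 - sin (2^-1 * t) ^+ 2.
    by have := cos2Dsin2 (2^-1 * t); lra.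
  rewrite s2; move: (a ^+ 2) (D^-1) => u v; lra.
Qed.
End FrequencyBounds.

(** * The numerical trajectory *)

Section Trajectory.
Variables (R : realType) (ell : nat) (d : 'I_ell.+1 -> nat) (alpha cs c0 Bm rho h : R) (J : nat).
Variables (M : nat -> R) (omega omegat : 'I_ell.+1 -> R) (U : state R d -> R) (K : set 'rV[R]_(d ord0)).
Variables (p q Qs : nat -> state R d) (P : par R ell).
Local Notation n := (\sum_i d i)%N.
Local Notation bl := (@fast_index ell d).
Hypotheses (h0 : 0 < h) (h1 : h <= 1) (cs0 : 0 < cs) (c00 : 0 < c0) (Bm0 : 0 <= Bm).
Hypotheses (hP : h_ P = h) (thP : forall j, th_ P j = h * omegat (lift ord0 j))
  (chiP : forall j, chi_ P j = chi alpha (th_ P j)).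
Hypothesis freq : forall j, [/\ cs <= chi_ P j <= cs^-1, cs <= sin (th_ P j),
   h * omega (lift ord0 j) <= cs^-1, chi_ P j * (1 + alpha * (h * omega (lift ord0 j)) ^+ 2) = 1 &
   2 * cos (th_ P j) = 2 - (h * omega (lift ord0 j)) ^+ 2 * chi_ P j].
Hypothesis th_rng : forall j, 0 <= th_ P j <= 4.
Hypotheses (om_lo : forall j, c0 <= h * omega (lift ord0 j)) (om0 : omega ord0 = 0).
Hypotheses (smU : smooth U) (dbd : derivatives_bounded_on M (neighbourhood K rho) U)
  (hBm : forall m, (m <= J.+1)%N -> M m <= Bm).
Hypotheses (qQ : forall k, Qs k.+1 = q k)
  (peq : forall k, position_eq alpha h omega U (Qs k) (Qs k.+1) (Qs k.+2))
  (meq : forall k, momentum_eq alpha h omega (Qs k) (Qs k.+2) (p k)).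

(** [Qs] is the sequence of positions delayed by one step, so that q_(-1) is available and the pair
    at index 0 is treated like all the others. *)
Definition traj_pt k : pt R n := Pt (darr U (q k)) (q k 0) (Qs k 0).
Definition chi_coord c : R := if bl c is Some j then chi_ P j else 1.
Definition cos_coord c : R := if bl c is Some j then cos (th_ P j) else 1.

Lemma chi_coordP c : [/\ chi_coord c * (1 + alpha * (h * omega (block_of c)) ^+ 2) = 1,
  2 * cos_coord c = 2 - (h * omega (block_of c)) ^+ 2 * chi_coord c, 0 < chi_coord c & `|cos_coord c| <= 1].
Proof.
rewrite /chi_coord /cos_coord; case e: (bl c) => [j|].
  have [/andP [k0 _] _ _ e1 e2] := freq j; rewrite (fast_indexP e); split=> //.
    exact: lt_le_trans k0.
  by rewrite ler_norml cos_geN1 cos_le1.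
by rewrite (slow_indexP e) om0 mulr0 expr0n mulr0 addr0 mulr1 mul0r subr0 mulr1 normr1; split.
Qed.

Lemma chi_coord_le c : chi_coord c <= 1 + cs^-1.
Proof.
rewrite /chi_coord; case: (bl c) => [j|]; last by rewrite lerDl invr_ge0 ltW.
by have [/andP [_ k1] _ _ _ _] := freq j; apply: (le_trans k1); rewrite lerDr.
Qed.

Let gr k c : R := darr U (q k) [:: c].

(** Multiplication by chi, the inverse of 1 + alpha (h omega)^2, turns the implicit-explicit scheme
    into a two-step recursion with the numerical frequency. *)
Lemma step_eq k c : Qs k.+2 0 c = 2 * cos_coord c * q k 0 c - Qs k 0 c - h ^+ 2 * chi_coord c * gr k c.
Proof.
have [e1 e2 k0 _] := chi_coordP c.
have gE : 'D_(delta_mx 0 c) U (Qs k.+1) = gr k c by rewrite qQ.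
have yE : Qs k.+1 0 c = q k 0 c by rewrite qQ.
have := congr1 (fun v : state R d => v 0 c) (peq k).
have om2 (v : state R d) : (\sum_i v 0 i * (Omega_mx d omega ^+ 2) i c) = omega (block_of c) ^+ 2 * v 0 c.
  by rewrite -mul_Omega2 mxE.
rewrite !mxE !om2 !mxE gE yE e2.
move: (Qs k.+2 0 c) (q k 0 c) (Qs k 0 c) (gr k c) (omega (block_of c)) (chi_coord c) e1 => z y x g w a e1 H.
have : a * ((1 + alpha * (h * w) ^+ 2) * (z - 2 * y + x) + (h * w) ^+ 2 * y + h ^+ 2 * g) = 0.
  rewrite (_ : _ + _ = 0) ?mulr0 //; move/eqP: H; rewrite -subr_eq0 => /eqP <-; ring.
move=> Hn; apply/eqP; rewrite -subr_eq0; apply/eqP.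
transitivity ((1 - a * (1 + alpha * (h * w) ^+ 2)) * (z - 2 * y + x) +
   a * ((1 + alpha * (h * w) ^+ 2) * (z - 2 * y + x) + (h * w) ^+ 2 * y + h ^+ 2 * g)); first ring.
by rewrite e1 subrr mul0r add0r.
Qed.

Lemma momentum_coord k c : 2 * h * chi_coord c * p k 0 c = Qs k.+2 0 c - Qs k 0 c.
Proof.
have [e1 _ _ _] := chi_coordP c; have := congr1 (fun v : state R d => v 0 c) (meq k).
rewrite mulmxDr mulmx1 -scalemxAr !mxE /=.
have om2 (v : state R d) : (\sum_i v 0 i * (Omega_mx d omega ^+ 2) i c) = omega (block_of c) ^+ 2 * v 0 c.
  by rewrite -mul_Omega2 mxE.
rewrite om2 !mxE /=; move: (Qs k.+2 0 c) (Qs k 0 c) (p k 0 c) (omega (block_of c)) (chi_coord c) e1 => z x m w a e1 H.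
transitivity (a * (2 * h * m)); first by ring.
rewrite H; transitivity (a * (1 + alpha * (h * w) ^+ 2) * (z - x)); first by ring.
by rewrite e1 mul1r.
Qed.

Lemma prev_coord k c : Qs k 0 c = cos_coord c * q k 0 c - h * chi_coord c * p k 0 c - h ^+ 2 * chi_coord c * gr k c / 2.
Proof.
have e1 := step_eq k c; have e2 := momentum_coord k c.
move: (Qs k.+2 0 c) (Qs k 0 c) (q k 0 c) (p k 0 c) (gr k c) e1 e2 => z x y m g e1 e2.
rewrite e1 in e2; lra.
Qed.

Local Notation Krho := (neighbourhood K rho).
Local Notation Kh := (neighbourhood K (rho / 2)).
Hypothesis rho0 : 0 < rho.
Lemma nbhd_half x : Kh x -> Krho x.
Proof. by case=> y [h1' h2 h3]; exists y; split=> //; apply: lt_trans h3 _; rewrite ltr_pdivrMr // mulr_natr mulr2n ltrDl. Qed.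

Lemma prod_delta (S : seq 'I_n) : \prod_(c <- S) enorm (delta_mx 0 c : state R d) = 1.
Proof. by elim: S => [|c S IH]; rewrite ?big_nil // big_cons IH enorm_delta mulr1. Qed.

Lemma darr_bd x S : Krho x -> (size S <= J.+1)%N -> `|darr U x S| <= Bm.
Proof.
move=> Kx hS; rewrite /darr; apply: le_trans (dbd _ Kx) _; rewrite size_map big_map.
by rewrite prod_delta mulr1; exact: hBm.
Qed.

Definition traj_pt_ok B k := pt_ok bl B J P (traj_pt k).
Hypothesis J1 : (1 < J)%N.

Lemma pt_ok_mono B B' k : B <= B' -> traj_pt_ok B k -> traj_pt_ok B' k.
Proof.
move=> BB [a1 a2 a3 a4 a5]; have hh : B * h_ P <= B' * h_ P by rewrite hP; apply: ler_wpM2r => //; exact: ltW.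
split=> //.
- by move=> S hS; apply: le_trans (a1 S hS) BB.
- by move=> c e; apply: le_trans (a3 c e) hh.
- by move=> c j s e; apply: le_trans (a4 c j s e) hh.
- by move=> c j e; apply: le_trans (a5 c j e) hh.
Qed.

Let gr_bd k c : Krho (q k) -> `|gr k c| <= Bm.
Proof. by move=> Kq; apply: darr_bd. Qed.

Let cs1' : 0 < cs^-1. Proof. by rewrite invr_gt0. Qed.
Let h0' : 0 <= h := ltW h0.

Let cabs_pt (y x t : R) : cabs (y%:C%C - expi t * x%:C%C) <= `|y| + `|x|.
Proof. by apply: le_trans (cabsD _ _) _; rewrite cabsN cabsM cabs_expi mul1r !cabs_real. Qed.

Definition energy_pt_const P1 := P1 / c0 *+ 2 + (1 + cs^-1) * (P1 + Bm) + Bm.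
Lemma pt_of_bounds P1 k : 0 <= P1 -> Krho (q k) -> (forall c, `|p k 0 c| <= P1) ->
  (forall c j, bl c = Some j -> omega (lift ord0 j) * `|q k 0 c| <= P1) -> traj_pt_ok (energy_pt_const P1) k.
Proof.
move=> P10 Kq hp hq.
have y_bd c j : bl c = Some j -> `|q k 0 c| <= P1 / c0 * h.
  move=> e; rewrite mulrAC ler_pdivlMr // mulrC; apply: (@le_trans _ _ (h * omega (lift ord0 j) * `|q k 0 c|)).
    by apply: ler_wpM2r => //; exact: om_lo.
  rewrite -mulrA mulrC; apply: ler_wpM2r => //; exact: hq.
have u0 : 0 <= P1 / c0 by rewrite divr_ge0 // ltW.
have v0 : 0 <= (1 + cs^-1) * (P1 + Bm) by rewrite mulr_ge0 ?addr_ge0 // ltW.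
have corr c : `|h * chi_coord c * p k 0 c + h ^+ 2 * chi_coord c * gr k c / 2| <= (1 + cs^-1) * (P1 + Bm) * h.
  have [_ _ k0 _] := chi_coordP c; have k1 := chi_coord_le c.
  have -> : h * chi_coord c * p k 0 c + h ^+ 2 * chi_coord c * gr k c / 2 = h * (chi_coord c * (p k 0 c + h * gr k c / 2)) by ring.
  rewrite normrM (ger0_norm h0') mulrC; apply: ler_wpM2r => //.
  rewrite normrM (gtr0_norm k0); apply: ler_pM => //; first exact: ltW.
  apply: le_trans (ler_normD _ _) _; apply: lerD => //; rewrite normrM normrM (ger0_norm h0').
  rewrite (@ger0_norm _ (2^-1)) //; have g1 := gr_bd c Kq; have : h * `|gr k c| <= 1 * `|gr k c| by apply: ler_wpM2r.
  have : 0 <= `|gr k c| by []. lra.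
have x_bd c j : bl c = Some j -> `|Qs k 0 c| <= (P1 / c0 + (1 + cs^-1) * (P1 + Bm)) * h.
  move=> e; rewrite prev_coord -addrA -opprD mulrDl; apply: le_trans (ler_normB _ _) _.
  apply: lerD (corr c); rewrite normrM; have [_ _ _ c1] := chi_coordP c.
  by apply: le_trans (y_bd _ _ e); rewrite ler_piMl.
have [b1 b2 b3 b4] : [/\ Bm <= energy_pt_const P1, P1 / c0 <= energy_pt_const P1, (1 + cs^-1) * (P1 + Bm) <= energy_pt_const P1 &
    P1 / c0 + (P1 / c0 + (1 + cs^-1) * (P1 + Bm)) <= energy_pt_const P1].
  rewrite /energy_pt_const mulr2n; move: u0 v0; move: (P1 / c0) (_ * (P1 + Bm)) => u v u0 v0; have := Bm0; split; lra.
split=> /=; rewrite ?hP.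
- by move=> S hS; apply: le_trans (darr_bd Kq (leqW hS)) _.
- exact: darr_sym.
- move=> c e; rewrite prev_coord /cos_coord e mul1r.
  have -> : q k 0 c - (q k 0 c - h * chi_coord c * p k 0 c - h ^+ 2 * chi_coord c * gr k c / 2) =
    h * chi_coord c * p k 0 c + h ^+ 2 * chi_coord c * gr k c / 2 by ring.
  by apply: le_trans (corr c) _; apply: ler_wpM2r.
- move=> c j s e; apply: le_trans (cabs_pt _ _ _) _.
  apply: le_trans (lerD (y_bd _ _ e) (x_bd _ _ e)) _; by rewrite -mulrDl; apply: ler_wpM2r.
- by move=> c j e; apply: le_trans (y_bd _ _ e) _; apply: ler_wpM2r.
Qed.

Definition next_pt_const B := 5 * B + (2 + cs^-1) * Bm.

Lemma fast_prev B k c j : bl c = Some j -> traj_pt_ok B k -> `|Qs k 0 c| <= 2 * B * h.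
Proof.
move=> e [_ _ _ /(_ c j false e) /= f /(_ c j e) /= y]; rewrite hP in f y.
have -> : `|Qs k 0 c| = cabs ((q k 0 c)%:C%C - ((q k 0 c)%:C%C - expi (- ths P j false) * (Qs k 0 c)%:C%C)).
  by rewrite opprB addrC subrK cabsM cabs_expi mul1r cabs_real.
apply: le_trans (cabsD _ _) _; rewrite cabsN cabs_real; move: (lerD y f); lra.
Qed.

Let hsq (a : R) : 0 <= a -> h ^+ 2 * a <= h * a.
Proof. by move=> a0; apply: ler_wpM2r => //; rewrite expr2 ler_piMl. Qed.

Let force_bd k c : Krho (q k) -> `|h ^+ 2 * chi_coord c * gr k c| <= (1 + cs^-1) * Bm * h.
Proof.
move=> Kq; have [_ _ k0 _] := chi_coordP c; have k1 := chi_coord_le c.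
rewrite -mulrA normrM (ger0_norm (exprn_ge0 _ h0')); apply: le_trans (hsq _) _ => //.
rewrite mulrC; apply: ler_wpM2r => //; rewrite normrM (gtr0_norm k0).
by apply: ler_pM => //; [exact: ltW|exact: gr_bd].
Qed.

(** One step enlarges the bound by a fixed amount and uses no energy bound at the new point; this
    gives the bootstrap its first information there. *)
Lemma pt_next B k : 0 <= B -> traj_pt_ok B k -> Krho (q k) -> Krho (q k.+1) -> traj_pt_ok (next_pt_const B) k.+1.
Proof.
move=> B0 ok Kq Kq'; have ok' := ok; case: ok' => _ _ sl _ yb; rewrite hP in sl yb.
have w0 : 0 <= cs^-1 * Bm by rewrite mulr_ge0 // ltW.
have y' c j : bl c = Some j -> `|q k.+1 0 c| <= (4 * B + (1 + cs^-1) * Bm) * h.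
  move=> e; rewrite -qQ step_eq; apply: le_trans (ler_normB _ _) _; rewrite [leRHS]mulrDl; apply: lerD (force_bd c Kq).
  apply: le_trans (ler_normB _ _) _; have := fast_prev e ok; have /= := yb c j e.
  have [_ _ _ c1] := chi_coordP c.
  have -> : `|2 * cos_coord c * q k 0 c| = 2 * (`|cos_coord c| * `|q k 0 c|) by rewrite -mulrA normrM normrM ger0_norm.
  have : `|cos_coord c| * `|q k 0 c| <= `|q k 0 c| by rewrite ler_piMl.
  lra.
have Bq : (2 + cs^-1) * Bm = (1 + cs^-1) * Bm + Bm by ring.
split=> /=; rewrite ?hP ?qQ.
- move=> S hS; apply: le_trans (darr_bd Kq' (leqW hS)) _; rewrite /next_pt_const Bq; have := Bm0; lra.
- exact: darr_sym.
- move=> c e; rewrite -qQ step_eq /cos_coord e mulr1; have /= s := sl c e.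
  have f := force_bd c Kq.
  have -> : 2 * q k 0 c - Qs k 0 c - h ^+ 2 * chi_coord c * gr k c - q k 0 c =
    (q k 0 c - Qs k 0 c) - h ^+ 2 * chi_coord c * gr k c by ring.
  apply: le_trans (ler_normB _ _) _; apply: le_trans (lerD s f) _; rewrite -mulrDl.
  by apply: ler_wpM2r => //; rewrite /next_pt_const Bq; have := Bm0; lra.
- move=> c j s e; apply: le_trans (cabs_pt _ _ _) _.
  apply: le_trans (lerD (y' c j e) (yb c j e)) _; rewrite -mulrDl.
  by apply: ler_wpM2r => //; rewrite /next_pt_const Bq; have := Bm0; lra.
- move=> c j e; apply: le_trans (y' c j e) _; apply: ler_wpM2r => //; rewrite /next_pt_const Bq; have := Bm0; lra.
Qed.

Definition link_const B := Bm * (1 + n%:R * (2 * B)) ^+ J.+1.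

(** A step moves q by at most rho / 2, so the segment from a point of the half neighbourhood stays
    where the derivatives are bounded, and Taylor expansion along it applies to every derivative. *)
Lemma link_point B k : 0 <= B -> n%:R * (2 * B) * h <= rho / 2 -> traj_pt_ok B k -> traj_pt_ok B k.+1 ->
  Kh (q k) -> link bl (link_const B) J P (traj_pt k) (traj_pt k.+1).
Proof.
move=> B0 hB ok ok' Kq; split.
  split=> /= [c|c e|c j e]; rewrite ?qQ // -qQ step_eq /cos_coord /chi_coord e ?hP ?mulr1 //.
set b : state R d := q k.+1 - q k.
have bc c : `|b 0 c| <= 2 * B * h.
  rewrite !mxE; case e: (bl c) => [j|].
    have := y_bd ok e; have := y_bd ok' e; rewrite /= !hP => y1 y2.
    by apply: le_trans (ler_normB _ _) _; lra.
  by have := sl_bd ok' e; rewrite /= qQ hP => s; have := mulr_ge0 B0 h0'; lra.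
have b_le : enorm b <= n%:R * (2 * B) * h.
  by rewrite -mulrA; apply: enorm_le => //; rewrite !mulr_ge0.
have seg s : 0 <= s <= 1 -> Krho (q k + s *: b).
  move=> /andP [s0 s1]; case: Kq => y [y1 y2 y3]; exists y; split=> //.
  rewrite addrAC; apply: le_lt_trans (enormD _ _) _.
  have : enorm (s *: b) <= rho / 2.
    by apply: le_trans hB; apply: le_trans b_le; rewrite enormZ ger0_norm // ler_piMl // enorm_ge0.
  by move: y3; lra.
move=> S hS; rewrite hP.
have -> : shift_vec (traj_pt k) (traj_pt k.+1) = fun c => b 0 c by apply/funext => c; rewrite /shift_vec /= !mxE.
set r := (J - size S)%N; rewrite distrC /=.
have sz i : size (nseq i b ++ [seq delta_mx 0 c | c <- S] : seq (state R d)) = (i + size S)%N.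
  by rewrite size_cat size_nseq size_map.
have e0 := enorm_ge0 b.
have D0 : 0 <= Bm * enorm b ^+ r.+1 by rewrite mulr_ge0 // exprn_ge0.
have := @taylor_line R n (iter_derive U [seq delta_mx 0 c | c <- S]) (q k) b r (Bm * enorm b ^+ r.+1)
  (smooth_iter _ smU) D0 _ 1 _.
have qb : q k + 1 *: b = q k.+1 by rewrite scale1r /b addrC subrK.
rewrite qb => H.
have {}H : `|darr U (q k.+1) S - tay (fun c => b 0 c) (darr U (q k)) r S| <= Bm * enorm b ^+ r.+1.
  have -> : tay (fun c => b 0 c) (darr U (q k)) r S = \sum_(i < r.+1)
      1 ^+ i / i`!%:R * iter_derive (iter_derive U [seq delta_mx 0 c | c <- S]) (nseq i b) (q k).
    by apply: eq_bigr => i _; rewrite darr_dir // iter_derive_cat expr1n div1r.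
  apply: H; last by rewrite ler01 lexx.
  move=> s hs; rewrite -iter_derive_cat; apply: le_trans (dbd _ (seg _ hs)) _.
  set pr := \prod_(v <- _) _.
  have -> : pr = enorm b ^+ r.+1.
    by rewrite /pr big_cat big_map prod_delta big_nseq iter_mulr_1; exact: mulr1.
  by apply: ler_wpM2r; [exact: exprn_ge0|rewrite sz; apply: hBm; rewrite addSn subnK].
apply: (le_trans H); rewrite /link_const -mulrA; apply: ler_wpM2l => //.
apply: (@le_trans _ _ ((n%:R * (2 * B)) ^+ r.+1 * h ^+ r.+1)).
  by rewrite -exprMn; apply: lerXn2r; rewrite ?nnegrE ?mulr_ge0.
apply: ler_wpM2r; first exact: exprn_ge0.
have nB : 0 <= n%:R * (2 * B) by rewrite !mulr_ge0.
apply: (@le_trans _ _ ((1 + n%:R * (2 * B)) ^+ r.+1)).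
  by apply: lerXn2r; rewrite ?nnegrE ?addr_ge0 // lerDr.
by apply: ler_weXn2l; rewrite ?lerDl // ltnS leq_subr.
Qed.

Lemma sum_bound (Pc : pred 'I_n) (F : 'I_n -> R) b : 0 <= b -> (forall c, Pc c -> `|F c| <= b) ->
  `|\sum_(c | Pc c) F c| <= n%:R * b.
Proof.
move=> b0 hF; apply: le_trans (ler_norm_sum _ _ _) _.
apply: (@le_trans _ _ (\sum_(c < n) b)); last by rewrite sumr_const card_ord -[leLHS]mulr_natl.
by rewrite big_mkcond; apply: ler_sum => c _; case: ifP => // /hF.
Qed.

Lemma slow_approx B k : 0 <= B -> traj_pt_ok B k -> Krho (q k) ->
  `|Hslow U (p k) (q k) - slow_energy bl P (traj_pt k)| <= n%:R * (Bm * (B + Bm)) * h.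
Proof.
move=> B0 ok Kq; rewrite /Hslow /slow_energy sum_slow mulr_sumr /=.
have -> (a b u : R) : a + u - (u + b) = a - b by ring.
under [X in _ - X]eq_bigl do rewrite /fastc negbK.
rewrite -sumrB -mulrA; apply: sum_bound => [|c /eqP e].
  by rewrite !mulr_ge0 ?addr_ge0.
have := sl_bd ok e; rewrite /= !hP prev_coord /cos_coord /chi_coord e !mulr1 mul1r.
have g1 := gr_bd c Kq; move: (p k 0 c) (q k 0 c) (gr k c) g1 => m y g g1.
have -> : y - (y - h * m - h ^+ 2 * g / 2) = h * (m + h * g / 2) by ring.
rewrite normrM (ger0_norm h0') (mulrC B) ler_pM2l // => v1.
have -> : h * (m + h * g / 2) / h = m + h * g / 2 by rewrite mulrC mulrA mulVf ?mul1r ?gt_eqF.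
have -> : 2^-1 * m ^+ 2 - 2^-1 * (m + h * g / 2) ^+ 2 = h * (- (g / 4) * (2 * (m + h * g / 2) - h * g / 2)) by field.
rewrite normrM (ger0_norm h0') mulrC; apply: ler_wpM2r => //.
rewrite normrM normrN.
have -> : Bm * (B + Bm) = Bm / 4 * (4 * (B + Bm)) by field.
apply: ler_pM => //; first by rewrite normrM (ger0_norm (_ : 0 <= 4^-1)) // ler_wpM2r.
apply: le_trans (ler_normB _ _) _; rewrite !normrM (ger0_norm h0') !(@ger0_norm _ 2) // (@ger0_norm _ 2^-1) //.
have : h * `|g| <= 1 * `|g| by apply: ler_wpM2r.
have := normr_ge0 g; have := Bm0; move: v1 g1 B0; lra.
Qed.

Definition mod_coeff_p j : R := 2^-1 * (chi_ P j * th_ P j / sin (th_ P j)).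
Definition mod_coeff_q j : R := 2^-1 * (sin (th_ P j) * th_ P j / (chi_ P j * h ^+ 2)).
Lemma Hmod_coord k : Hmod alpha h omegat (p k) (q k) =
  \sum_(c | fast_index c != None) (if fast_index c is Some j then mod_coeff_p j * p k 0 c ^+ 2 + mod_coeff_q j * q k 0 c ^+ 2 else 0).
Proof.
rewrite /Hmod; transitivity (\sum_j mod_coeff_p j * sqnorm (submxrow (p k) (lift ord0 j)) +
   \sum_j mod_coeff_q j * sqnorm (submxrow (q k) (lift ord0 j))).
  rewrite -big_split /=; apply: eq_bigr => j _; have [/andP [k0 _] s0 _ _ _] := freq j.
  rewrite /sigma -!thP -!chiP /sinc /mod_coeff_p /mod_coeff_q.
  have t0 : th_ P j != 0.
    apply/eqP => e; move: s0; rewrite e sin0 => s0; have := lt_le_trans cs0 s0; by rewrite ltxx.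
  have s1 : sin (th_ P j) != 0 by rewrite gt_eqF // (lt_le_trans cs0).
  have k1 : chi_ P j != 0 by rewrite gt_eqF // (lt_le_trans cs0).
  have h2 : h != 0 by rewrite gt_eqF.
  have -> : omegat (lift ord0 j) = th_ P j / h by rewrite thP mulrAC mulfV ?mul1r.
  move: (sqnorm _) (sqnorm _) (th_ P j) (sin _) (chi_ P j) t0 s1 k1 => u v t s a t0 s1 k1.
  by field; rewrite t0 s1 k1 h2.
by rewrite !sum_fast -big_split /=; apply: eq_bigr => c; case: (fast_index c) => [j|].
Qed.

Lemma Hosc_coord k : Hosc omega (p k) (q k) = \sum_(c | fast_index c != None)
  (if fast_index c is Some j then 2^-1 * (p k 0 c ^+ 2 + omega (lift ord0 j) ^+ 2 * q k 0 c ^+ 2) else 0).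
Proof.
transitivity (\sum_j 2^-1 * sqnorm (submxrow (p k) (lift ord0 j)) +
   \sum_j (2^-1 * omega (lift ord0 j) ^+ 2) * sqnorm (submxrow (q k) (lift ord0 j))).
  by rewrite -big_split /=; apply: eq_bigr => j _; rewrite mulrDr mulrA.
rewrite (sum_fast (fun=> 2^-1)) sum_fast -big_split /=; apply: eq_bigr => c; case: (fast_index c) => [j _|//].
by rewrite [RHS]mulrDr -[X in _ + X]mulrA.
Qed.

Definition fast_approx_const B := 2 * cs^-1 ^+ 3 * Bm * (6 * B + cs^-1 * Bm).
(** Written in (q_n, q_(n-1)), the momentum differs from a linear expression only by a force term of
    order h^2; without that term the two energies would coincide. *)
Lemma fast_approx B k : 0 <= B -> traj_pt_ok B k -> Krho (q k) ->
  `|Hmod alpha h omegat (p k) (q k) - fast_energy bl P (traj_pt k)| <= n%:R * fast_approx_const B * h.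
Proof.
move=> B0 ok Kq; have ci := ltW cs1'.
rewrite Hmod_coord /fast_energy -sumrB -mulrA; apply: sum_bound => [|c].
  by rewrite /fast_approx_const !mulr_ge0 ?addr_ge0 ?exprn_ge0 // mulr_ge0.
case e: (fast_index c) => [j|//] _ /=; rewrite hP.
have [/andP [k0 k1] s0 _ _ _] := freq j; have /andP [t0 t4] := th_rng j.
have kp := lt_le_trans cs0 k0; have sp := lt_le_trans cs0 s0.
have x1 := fast_prev e ok; have := y_bd ok e; rewrite /= hP => y1.
have g1 := gr_bd c Kq.
have pE := prev_coord k c; rewrite /cos_coord /chi_coord e in pE.
have cos1 : `|cos (th_ P j)| <= 1 by rewrite ler_norml cos_geN1 cos_le1.
have := cos2Dsin2 (th_ P j); rewrite /mod_coeff_p /mod_coeff_q.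
move: (p k 0 c) (q k 0 c) (Qs k 0 c) (gr k c) (th_ P j) (sin _) (cos _) (chi_ P j) x1 y1 g1 pE cos1 t0 t4 sp s0 kp k0 k1.
move=> m y x g t s a z x1 y1 g1 pE a1 t0 t4 sp s0 kp k0 k1 as1.
(* h chi p = Z - r by [prev_coord], and replacing Z - r by Z in H* gives exactly the fast energy. *)
pose r := h ^+ 2 * z * g / 2; pose Z := a * y - x.
have hm : m = (Z - r) / (h * z).
  rewrite /Z pE /r; apply: (mulIf (mulf_neq0 (lt0r_neq0 h0) (lt0r_neq0 kp))).
  by rewrite divfK ?mulf_neq0 ?gt_eqF //; ring.
have -> : 2^-1 * (z * t / s) * m ^+ 2 + 2^-1 * (s * t / (z * h ^+ 2)) * y ^+ 2 -
   t / (2 * h ^+ 2 * z * s) * (y ^+ 2 - 2 * a * x * y + x ^+ 2) =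
   - (t / (2 * h ^+ 2 * z * s)) * (r * (2 * Z - r)).
  have -> : y ^+ 2 - 2 * a * x * y + x ^+ 2 = Z ^+ 2 + s ^+ 2 * y ^+ 2.
    transitivity ((a ^+ 2 + s ^+ 2) * y ^+ 2 - 2 * a * x * y + x ^+ 2); first by rewrite as1 mul1r.
    by rewrite /Z; ring.
  rewrite hm; clear hm; move: Z r => Z r; have h2 := lt0r_neq0 h0; have z0 := lt0r_neq0 kp; have s1 := lt0r_neq0 sp.
  by field; rewrite z0 s1 h2.
have z1 : 0 <= z^-1 <= cs^-1 by rewrite invr_ge0 (ltW kp) lef_pV2 ?posrE.
have s1 : 0 <= s^-1 <= cs^-1 by rewrite invr_ge0 (ltW sp) lef_pV2 ?posrE.
move: z1 s1 => /andP [zi zi1] /andP [si si1].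
have h2 : 0 <= (h ^+ 2)^-1 by rewrite invr_ge0 exprn_ge0.
have -> : t / (2 * h ^+ 2 * z * s) = t / 2 * (z^-1 * s^-1) * (h ^+ 2)^-1.
  by field; rewrite !gt_eqF.
have r1 : `|r| <= h ^+ 2 * (cs^-1 * Bm).
  rewrite /r normrM (ger0_norm (_ : 0 <= 2^-1)) // -mulrA normrM (ger0_norm (exprn_ge0 _ h0')) -mulrA.
  apply: ler_wpM2l; first exact: exprn_ge0.
  have : `|z * g| <= cs^-1 * Bm by rewrite normrM (gtr0_norm kp); apply: ler_pM => //; exact: ltW.
  have := normr_ge0 (z * g); lra.
have Z1 : `|2 * Z - r| <= (6 * B + cs^-1 * Bm) * h.
  have w0 : 0 <= cs^-1 * Bm by rewrite mulr_ge0.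
  apply: le_trans (ler_normB _ _) _; move: (hsq w0) r1.
  have : `|Z| <= `|y| + `|x|.
    by apply: le_trans (ler_normB _ _) _; rewrite lerD2r normrM ler_piMl.
  have -> : `|2 * Z| = 2 * `|Z| by rewrite normrM ger0_norm.
  by move: x1 y1; lra.
set X := t / 2 * (z^-1 * s^-1) * (h ^+ 2)^-1.
have X0 : 0 <= X by rewrite /X !mulr_ge0.
have X1 : X <= 2 * (cs^-1 * cs^-1) * (h ^+ 2)^-1.
  apply: ler_wpM2r => //; apply: ler_pM; rewrite ?mulr_ge0 //; last by apply: ler_pM.
  by move: t4; lra.
rewrite normrM normrN (ger0_norm X0) normrM.
apply: (@le_trans _ _ (2 * (cs^-1 * cs^-1) * (h ^+ 2)^-1 * (h ^+ 2 * (cs^-1 * Bm) * ((6 * B + cs^-1 * Bm) * h)))).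
  by apply: ler_pM; rewrite ?mulr_ge0 //; apply: ler_pM.
rewrite le_eqVlt /fast_approx_const; apply/orP; left; apply/eqP.
by have hn := lt0r_neq0 h0; move: (cs^-1) => v; field.
Qed.

Let half_sq_ge0 (a w b : R) : 0 <= 2^-1 * (a ^+ 2 + w ^+ 2 * b ^+ 2).
Proof. by rewrite -exprMn mulr_ge0 // addr_ge0 // sqr_ge0. Qed.
Let quad_le (m a b a' b' x y : R) : a <= m * a' -> b <= m * b' ->
  a * x ^+ 2 + b * y ^+ 2 <= m * (a' * x ^+ 2 + b' * y ^+ 2).
Proof.
by move=> ha hb; rewrite [leRHS]mulrDr (mulrA m a') (mulrA m b'); apply: lerD; apply: ler_wpM2r => //; exact: sqr_ge0.
Qed.
Let half_sq (a w b : R) : 2^-1 * (a ^+ 2 + w ^+ 2 * b ^+ 2) = 2^-1 * a ^+ 2 + (2^-1 * w ^+ 2) * b ^+ 2.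
Proof. by ring. Qed.

Definition Hosc_const := cs^-1 + cs^-1 ^+ 5.
Definition Hmod_const := 4 * cs^-1 ^+ 2 + 4 * cs^-1 / c0 ^+ 2.

(** H* and the oscillatory energy are equivalent with constants depending on cs and c0 only: chi,
    sin and h omega lie between positive constants, and sin(t) <= t <= 4. This lets control of H*
    bound the energy. *)
Let coeff j : [/\ 2^-1 <= Hosc_const * mod_coeff_p j, 2^-1 * omega (lift ord0 j) ^+ 2 <= Hosc_const * mod_coeff_q j,
  mod_coeff_p j <= Hmod_const * 2^-1 & mod_coeff_q j <= Hmod_const * (2^-1 * omega (lift ord0 j) ^+ 2)].
Proof.
have [/andP [k0 k1] s0 w1 _ _] := freq j; have /andP [t0 t4] := th_rng j; have w0 := om_lo j.
have ts : sin (th_ P j) <= th_ P j.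
  have := @lipschitz_of_derive R sin cos _ _ (th_ P j) 0.
  rewrite sin0 !subr0 (ger0_norm t0) => H; apply: le_trans (ler_norm _) (H _ _) => x.
  by rewrite ler_norml cos_geN1 cos_le1.
have sl := sin_le1 (th_ P j); rewrite /mod_coeff_p /mod_coeff_q.
move: (th_ P j) (sin _) (chi_ P j) (omega _) k0 k1 s0 w1 t0 t4 w0 ts sl => t s z w k0 k1 s0 w1 t0 t4 w0 ts s1.
have zp := lt_le_trans cs0 k0; have sp := lt_le_trans cs0 s0; have ci := ltW cs1'; have c0' := ltW c00.
have zi : z^-1 <= cs^-1 by rewrite lef_pV2 ?posrE.
have zl : cs <= z^-1 by rewrite -[cs]invrK lef_pV2 ?posrE ?invr_gt0.
have si : s^-1 <= cs^-1 by rewrite lef_pV2 ?posrE.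
have tsi : 1 <= t / s by rewrite ler_pdivlMr // mul1r.
have hi : 0 < (h ^+ 2)^-1 by rewrite invr_gt0 exprn_gt0.
have zi0 : 0 <= z^-1 by rewrite invr_ge0 ltW.
have si0 : 0 <= s^-1 by rewrite invr_ge0 ltW.
have hn := lt0r_neq0 h0; have zn := lt0r_neq0 zp; have csn := lt0r_neq0 cs0.
have cai : 0 <= 2^-1 * (z * t / s) by rewrite !mulr_ge0 // ltW.
have cbi : 0 <= 2^-1 * (s * t / (z * h ^+ 2)) by rewrite !mulr_ge0 ?invr_ge0 ?mulr_ge0 ?exprn_ge0 // ltW.
have c5 : 0 <= cs^-1 ^+ 5 by rewrite exprn_ge0.
have cc0 : 0 <= 4 * cs^-1 / c0 ^+ 2 by apply: divr_ge0; [rewrite mulr_ge0|exact: exprn_ge0].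
have w2 : w ^+ 2 = (h * w) ^+ 2 * (h ^+ 2)^-1 by field.
have hw0 : 0 <= h * w by apply: le_trans w0.
have ww : 0 <= w ^+ 2 by exact: sqr_ge0.
split; rewrite /Hosc_const /Hmod_const.
- rewrite mulrDl; have : 0 <= cs^-1 ^+ 5 * (2^-1 * (z * t / s)) by exact: mulr_ge0.
  have : 1 <= cs^-1 * (z * (t / s)).
    apply: (@le_trans _ _ (cs^-1 * (cs * 1))); first by rewrite mulr1 mulVf.
    by apply: ler_wpM2l => //; apply: ler_pM => //; exact: ltW.
  have -> : cs^-1 * (2^-1 * (z * t / s)) = 2^-1 * (cs^-1 * (z * (t / s))) by rewrite -(mulrA z) mulrCA.
  lra.
- rewrite mulrDl; have : 0 <= cs^-1 * (2^-1 * (s * t / (z * h ^+ 2))) by exact: mulr_ge0.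
  suff : 2^-1 * w ^+ 2 <= cs^-1 ^+ 5 * (2^-1 * (s * t / (z * h ^+ 2))) by lra.
  have -> : s * t / (z * h ^+ 2) = s * t * z^-1 * (h ^+ 2)^-1 by field; rewrite hn.
  have -> : cs^-1 ^+ 5 * (2^-1 * (s * t * z^-1 * (h ^+ 2)^-1)) = 2^-1 * (cs^-1 ^+ 5 * (s * t * z^-1) * (h ^+ 2)^-1).
    by rewrite mulrCA (mulrA (cs^-1 ^+ 5)).
  rewrite w2; apply: ler_wpM2l => //; apply: ler_wpM2r; first exact: ltW.
  apply: (@le_trans _ _ (cs^-1 ^+ 2)); first by apply: lerXn2r; rewrite ?nnegrE.
  apply: (@le_trans _ _ (cs^-1 ^+ 5 * (cs * cs * cs))).
    by rewrite le_eqVlt; apply/orP; left; apply/eqP; field.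
  apply: ler_wpM2l => //; apply: ler_pM; rewrite ?mulr_ge0 // ?(ltW cs0) //.
  by apply: ler_pM; rewrite ?(ltW cs0) //; apply: le_trans ts.
- have : z * t / s <= cs^-1 * 4 * cs^-1.
    by apply: ler_pM => //; [rewrite mulr_ge0 // ltW|apply: ler_pM => //; exact: ltW].
  move=> H; have : 0 <= 4 * cs^-1 / c0 ^+ 2 by []. rewrite mulrDl expr2; lra.
- rewrite [leRHS]mulrCA; apply: ler_wpM2l => //.
  rewrite mulrDl; have : 0 <= 4 * cs^-1 ^+ 2 * w ^+ 2 by apply: mulr_ge0 => //; apply: mulr_ge0 => //; exact: exprn_ge0.
  suff : s * t / (z * h ^+ 2) <= 4 * cs^-1 / c0 ^+ 2 * w ^+ 2 by lra.
  have -> : s * t / (z * h ^+ 2) = s * t * z^-1 * (h ^+ 2)^-1 by field; rewrite hn.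
  rewrite w2 mulrA; apply: ler_wpM2r; first exact: ltW.
  have c1 : 1 <= (h * w) ^+ 2 / c0 ^+ 2.
    by rewrite ler_pdivlMr ?exprn_gt0 // mul1r; apply: lerXn2r; rewrite ?nnegrE.
  have -> : 4 * cs^-1 / c0 ^+ 2 * (h * w) ^+ 2 = (1 * 4 * cs^-1) * ((h * w) ^+ 2 / c0 ^+ 2).
    by move: (cs^-1) ((c0 ^+ 2)^-1) => u v; ring.
  apply: (@le_trans _ _ (1 * 4 * cs^-1)); last by rewrite ler_peMr // !mulr_ge0.
  by apply: ler_pM => //; [rewrite mulr_ge0 // ltW|apply: ler_pM => //; exact: ltW].
Qed.

Lemma Hosc_le k : Hosc omega (p k) (q k) <= Hosc_const * Hmod alpha h omegat (p k) (q k).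
Proof.
rewrite Hosc_coord Hmod_coord mulr_sumr; apply: ler_sum => c; case: (fast_index c) => [j _|//].
by have [a1 a2 _ _] := coeff j; rewrite half_sq; exact: quad_le.
Qed.

Lemma Hmod_le k : Hmod alpha h omegat (p k) (q k) <= Hmod_const * Hosc omega (p k) (q k).
Proof.
rewrite Hosc_coord Hmod_coord mulr_sumr; apply: ler_sum => c; case: (fast_index c) => [j _|//].
by have [_ _ a1 a2] := coeff j; rewrite half_sq; exact: quad_le.
Qed.

Lemma Hosc_ge0 k : 0 <= Hosc omega (p k) (q k).
Proof.
rewrite Hosc_coord; apply: sumr_ge0 => c; case: (fast_index c) => [j _|//].
exact: half_sq_ge0.
Qed.

Lemma Hslow_ge k : Krho (q k) -> - Bm <= Hslow U (p k) (q k).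
Proof.
move=> Kq; have := @darr_bd _ [::] Kq isT; rewrite /darr /= ler_norml => /andP [u _].
have s0 : 0 <= 2^-1 * sqnorm (submxrow (p k) ord0).
  by apply: mulr_ge0 => //; apply: sumr_ge0 => i _; exact: sqr_ge0.
rewrite /Hslow; lra.
Qed.

Lemma pt_of_energy Co k : Krho (q k) -> Htotal omega U (p k) (q k) <= Co -> traj_pt_ok (energy_pt_const (1 + 2 * (`|Co| + Bm))) k.
Proof.
move=> Kq HC; set P1 := 1 + _.
have E0 : 0 <= 2 * (`|Co| + Bm) by rewrite mulr_ge0 // addr_ge0.
have sq (a : R) : a ^+ 2 <= 2 * (`|Co| + Bm) -> `|a| <= P1.
  move=> ha; have := sqr_ge0 (`|a| - 1); rewrite sqrrB real_normK ?num_real // expr1n mulr1 /P1.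
  have := normr_ge0 a; lra.
have := @darr_bd _ [::] Kq isT; rewrite /darr /= ler_norml => /andP [u _].
have s0 : 0 <= 2^-1 * sqnorm (submxrow (p k) ord0).
  by apply: mulr_ge0 => //; apply: sumr_ge0 => i _; exact: sqr_ge0.
have o0 := Hosc_ge0 k; rewrite /Htotal /Hslow in HC; have := ler_norm Co => hCo.
have sl : 2^-1 * sqnorm (submxrow (p k) ord0) <= `|Co| + Bm by lra.
have os : Hosc omega (p k) (q k) <= `|Co| + Bm by lra.
have fc c j : fast_index c = Some j -> 2^-1 * (p k 0 c ^+ 2 + omega (lift ord0 j) ^+ 2 * q k 0 c ^+ 2) <= `|Co| + Bm.
  move=> e; apply: le_trans os; rewrite Hosc_coord (bigD1 c) ?e //= lerDl.
  apply: sumr_ge0 => i _; case: (fast_index i) => [j'|//].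
  exact: half_sq_ge0.
apply: pt_of_bounds => //; first by rewrite addr_ge0.
  move=> c; apply: sq; case e: (fast_index c) => [j|].
    have := fc c j e; have : 0 <= omega (lift ord0 j) ^+ 2 * q k 0 c ^+ 2 by rewrite mulr_ge0 ?sqr_ge0.
    lra.
  move: sl; rewrite sum_slow (bigD1 c) ?e //=; set S := \sum_(i < _ | _ && _) _.
  have : 0 <= S by apply: sumr_ge0 => i _; exact: sqr_ge0.
  lra.
move=> c j e; have w0 : 0 <= omega (lift ord0 j).
  by rewrite -(pmulr_rge0 _ h0); apply: le_trans (om_lo j); exact: ltW.
rewrite -{1}(ger0_norm w0) -normrM; apply: sq; rewrite exprMn.
have := fc c j e; have := sqr_ge0 (p k 0 c); lra.
Qed.

(** * Transfer of the drift bounds and bootstrap of the energy *)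

Section Drift.
Variables (E CC A1 A2 er B4 : R) (T : nat -> Prop).
Let B2 := energy_pt_const (1 + 2 * (`|CC| + Bm)).
Let B3 := next_pt_const B2.
Hypotheses (hB : n%:R * (2 * B3) * h <= rho / 2) (B34 : B3 <= B4) (Blk : link_const B3 <= B4).
Hypotheses (TK : forall k, T k -> Kh (q k)) (Tpred : forall k, T k.+1 -> T k).
Definition slow_ctl := forall m, T m -> (forall k, (k <= m)%N -> pt_ok bl B4 J P (traj_pt k)) ->
  (forall k, (k < m)%N -> link bl B4 J P (traj_pt k) (traj_pt k.+1)) ->
  `|slow_energy bl P (traj_pt m) - slow_energy bl P (traj_pt 0)| <= A1 * er.
Definition fast_ctl := forall m, T m -> (forall k, (k <= m)%N -> pt_ok bl B4 J P (traj_pt k)) ->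
  (forall k, (k < m)%N -> link bl B4 J P (traj_pt k) (traj_pt k.+1)) ->
  `|fast_energy bl P (traj_pt m) - fast_energy bl P (traj_pt 0)| <= A2 * er.
Hypotheses (ctl1 : slow_ctl) (her : h <= er).

Lemma energy_pt_const_ge0 P1 : 0 <= P1 -> 0 <= energy_pt_const P1.
Proof. by move=> P10; rewrite /energy_pt_const !addr_ge0 ?mulrn_wge0 ?divr_ge0 ?mulr_ge0 ?addr_ge0 ?(ltW c00) ?(ltW cs1'). Qed.
Let B20 : 0 <= B2.
Proof. by apply: energy_pt_const_ge0; rewrite addr_ge0 // mulr_ge0 // addr_ge0. Qed.
Let B23 : B2 <= B3.
Proof.
have : 0 <= (2 + cs^-1) * Bm by rewrite mulr_ge0 // addr_ge0 // ltW.
by rewrite /B3 /next_pt_const; move: B20; lra.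
Qed.
Let B30 : 0 <= B3. Proof. exact: le_trans B23. Qed.

Let T_le m k : T m -> (k <= m)%N -> T k.
Proof.
elim: m => [|m IH] Tm; first by rewrite leqn0 => /eqP ->.
by rewrite leq_eqVlt => /orP [/eqP -> //|]; rewrite ltnS; apply: IH; exact: Tpred.
Qed.

Let links m : T m -> (forall k, (k <= m)%N -> traj_pt_ok B3 k) ->
  (forall k, (k <= m)%N -> pt_ok bl B4 J P (traj_pt k)) /\
  (forall k, (k < m)%N -> link bl B4 J P (traj_pt k) (traj_pt k.+1)).
Proof.
move=> Tm ok; split=> k km; first exact: pt_ok_mono (ok k km).
have [l1 l2] := link_point B30 hB (ok k (ltnW km)) (ok k.+1 km) (TK (T_le Tm (ltnW km))).
split=> // S hS; apply: le_trans (l2 S hS) _; apply: ler_wpM2r => //.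
by rewrite hP exprn_ge0.
Qed.

Definition slow_drift_const := n%:R * (Bm * (B3 + Bm)) *+ 2 + A1.
Definition fast_drift_const := n%:R * fast_approx_const B3 *+ 2 + A2.
Let triangle (a b a' b' e1 e2 : R) : `|a - a'| <= e1 -> `|b - b'| <= e1 -> `|a' - b'| <= e2 ->
  `|a - b| <= e1 *+ 2 + e2.
Proof.
move=> h1' h2 h3; have -> : a - b = (a - a') - (b - b') + (a' - b') by ring.
apply: le_trans (ler_normD _ _) _; apply: lerD h3.
by apply: le_trans (ler_normB _ _) _; rewrite mulr2n; exact: lerD.
Qed.

Lemma Hslow_ctl m : T m -> (forall k, (k <= m)%N -> traj_pt_ok B3 k) ->
  `|Hslow U (p m) (q m) - Hslow U (p 0) (q 0)| <= slow_drift_const * er.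
Proof.
move=> Tm ok; have [l1 l2] := links Tm ok.
have bb := addr_ge0 B30 Bm0; have c0' : 0 <= n%:R * (Bm * (B3 + Bm)) by rewrite !mulr_ge0.
have ap k : (k <= m)%N -> `|Hslow U (p k) (q k) - slow_energy bl P (traj_pt k)| <= n%:R * (Bm * (B3 + Bm)) * er.
  move=> km; apply: le_trans (slow_approx B30 (ok k km) _) _; last by apply: ler_wpM2l.
  exact/nbhd_half/TK/(T_le Tm).
rewrite /slow_drift_const mulrDl mulrnAl; exact: triangle (ap m (leqnn m)) (ap 0%N (leq0n m)) (ctl1 Tm l1 l2).
Qed.

Hypothesis ctl2 : fast_ctl.
Lemma Hmod_ctl m : T m -> (forall k, (k <= m)%N -> traj_pt_ok B3 k) ->
  `|Hmod alpha h omegat (p m) (q m) - Hmod alpha h omegat (p 0) (q 0)| <= fast_drift_const * er.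
Proof.
move=> Tm ok; have [l1 l2] := links Tm ok; have ci := ltW cs1'.
have c0' : 0 <= n%:R * fast_approx_const B3.
  by rewrite /fast_approx_const !mulr_ge0 ?addr_ge0 ?exprn_ge0 // mulr_ge0.
have ap k : (k <= m)%N -> `|Hmod alpha h omegat (p k) (q k) - fast_energy bl P (traj_pt k)| <= n%:R * fast_approx_const B3 * er.
  move=> km; apply: le_trans (fast_approx B30 (ok k km) _) _; last by apply: ler_wpM2l.
  exact/nbhd_half/TK/(T_le Tm).
rewrite /fast_drift_const mulrDl mulrnAl; exact: triangle (ap m (leqnn m)) (ap 0%N (leq0n m)) (ctl2 Tm l1 l2).
Qed.

Lemma energy_pt_ok k : T k -> Htotal omega U (p k) (q k) <= CC -> traj_pt_ok B3 k.
Proof. by move=> Tk HC; apply: pt_ok_mono B23 _; apply: pt_of_energy HC; exact/nbhd_half/TK. Qed.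

(* The modified energies control the energy at the next step, which is a priori
   only known to be bounded by a larger constant. *)
Lemma energy_bootstrap : Htotal omega U (p 0) (q 0) <= E ->
  Hosc_const * (Hmod_const * (`|E| + Bm) + 1) + `|E| + 1 <= CC -> slow_drift_const * er <= 1 -> fast_drift_const * er <= 1 ->
  forall m, T m -> forall k, (k <= m)%N -> Htotal omega U (p k) (q k) <= CC.
Proof.
move=> HE hCC s1 f1; have ci := ltW cs1'.
have om0' : 0 <= Hosc_const by rewrite /Hosc_const addr_ge0 // exprn_ge0.
have mo0 : 0 <= Hmod_const by rewrite /Hmod_const addr_ge0 ?mulr_ge0 ?invr_ge0 ?exprn_ge0 // ltW.
have z0 : 0 <= Hosc_const * (Hmod_const * (`|E| + Bm) + 1) by apply: mulr_ge0 => //; apply: addr_ge0 => //; apply: mulr_ge0 => //; exact: addr_ge0.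
have hE := ler_norm E.
elim=> [|m IH] Tm k; first by rewrite leqn0 => /eqP ->; lra.
have {}IH := IH (Tpred Tm).
rewrite leq_eqVlt ltnS => /orP [/eqP -> {k}|]; last exact: IH.
have T0 : T 0%N := T_le Tm (leq0n _).
have ok k : (k <= m.+1)%N -> traj_pt_ok B3 k.
  rewrite leq_eqVlt ltnS => /orP [/eqP -> {k}|km]; last first.
    by apply: energy_pt_ok (IH k km); exact: T_le Tm (leqW km).
  apply: pt_next => //; [|exact/nbhd_half/TK/Tpred|exact/nbhd_half/TK].
  by apply: pt_of_energy (IH m (leqnn m)); exact/nbhd_half/TK/Tpred.
have a1 := le_trans (Hslow_ctl Tm ok) s1; have a2 := le_trans (Hmod_ctl Tm ok) f1.
have o0 := Hosc_ge0 0; have sl0 := Hslow_ge (nbhd_half (TK T0)).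
rewrite /Htotal in HE *.
have b1 : Hosc omega (p 0%N) (q 0%N) <= `|E| + Bm by move: hE HE sl0; lra.
have b2 : Hmod alpha h omegat (p 0%N) (q 0%N) <= Hmod_const * (`|E| + Bm).
  by apply: le_trans (Hmod_le 0) _; apply: ler_wpM2l.
have b3 : Hmod alpha h omegat (p m.+1) (q m.+1) <= Hmod_const * (`|E| + Bm) + 1.
  by move: (ler_norm (Hmod alpha h omegat (p m.+1) (q m.+1) - Hmod alpha h omegat (p 0%N) (q 0%N))) a2 b2; lra.
have b4 : Hosc omega (p m.+1) (q m.+1) <= Hosc_const * (Hmod_const * (`|E| + Bm) + 1).
  by apply: le_trans (Hosc_le _) _; apply: ler_wpM2l.
by move: (ler_norm (Hslow U (p m.+1) (q m.+1) - Hslow U (p 0%N) (q 0%N))) a1 b4 hCC HE hE o0; lra.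
Qed.
End Drift.
End Trajectory.

(** As delta <= 1/2, the power h^(1 - delta) is at most sqrt h, which makes the threshold
    explicit. *)
Lemma pow_threshold (R : realType) (delta h D : R) : delta <= 2^-1 -> 0 < h -> h <= 1 -> 0 <= D ->
  h <= (D + 1)^-1 ^+ 2 -> D * h `^ (1 - delta) <= 1.
Proof.
move=> dl h0 h1 D0 hD; have D1 : 0 < D + 1 by rewrite ltr_wpDl.
have hs : h `^ (1 - delta) <= (D + 1)^-1.
  apply: (@le_trans _ _ (h `^ 2^-1)); first by apply: ger_powR; [rewrite h0|lra].
  have i0 : 0 <= (D + 1)^-1 by rewrite invr_ge0 ltW.
  by rewrite powR12_sqrt ?(ltW h0) // -(ger0_norm i0) -sqrtr_sqr; exact: ler_wsqrtr.
apply: (@le_trans _ _ (D * (D + 1)^-1)); first exact: ler_wpM2l.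
by rewrite ler_pdivrMr // mul1r lerDl.
Qed.

Local Open Scope classical_set_scope.
Local Open Scope ring_scope.

Theorem theorem3p2 (R : realType) (ell : nat) (d : 'I_ell.+1 -> nat)
    (alpha c1 theta : R) (N : nat) (delta : R)
    (E rho : R) (M : nat -> R) (c0 Const : R)
    (theta_lt1 : theta < 1) (N_ge1 : (1 <= N)%N)
    (delta_gt0 : 0 < delta) (delta_le : delta <= 4^-1)
    (rho_gt0 : 0 < rho) (c0_gt0 : 0 < c0) :
  exists h0 : R, 0 < h0 /\ exists C : R,
  forall (eps : R) (omega : 'I_ell.+1 -> R) (U : state R d -> R)
    (K : set 'rV[R]_(d ord0)) (h : R) (p q : nat -> state R d)
    (omegat : 'I_ell.+1 -> R),
    0 < eps ->
    omega ord0 = 0 ->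
    (forall j : 'I_ell, eps^-1 <= omega (lift ord0 j)) ->
    smooth U ->
    0 < h -> h <= h0 ->
    step_restriction alpha c1 theta h omega ->
    numerical_solution alpha h omega U p q ->
    numerical_frequencies alpha h omega omegat ->
    Htotal omega U (p 0%N) (q 0%N) <= E ->
    derivatives_bounded_on M (neighbourhood K rho) U ->
    (forall n : nat, n%:R * h <= h ^- N -> neighbourhood K (rho / 2) (q n)) ->
    c0 <= h / eps ->
    (forall n : nat, n%:R * h <= h ^- N ->
       (forall m : nat, (m <= n)%N -> Htotal omega U (p m) (q m) <= Const) ->
       `|Hslow U (p n) (q n) - Hslow U (p 0%N) (q 0%N)|
         <= C * h `^ (1 - delta))
    /\
    (nonresonant N h omegat ->
     forall kappa : R, Num.sqrt h <= kappa ->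
       (forall j : 'I_ell, kappa <= `|sin (h * omegat (lift ord0 j))|) ->
       forall n : nat, n%:R * h <= h ^- N ->
         `|Hmod alpha h omegat (p n) (q n)
           - Hmod alpha h omegat (p 0%N) (q 0%N)|
           <= C * (h `^ (1 - delta) / kappa)).
Proof.
have [cs cs0 hfreq] := frequency_bounds alpha c1 theta_lt1 c0_gt0.
have delta1 : delta <= 1 by lra.
have [J [NN [Kp [h1 [J1 NN3 dK [h10 hpar]]]]]] := params_ex ell N delta_gt0 delta1 cs0.
pose Bm := \sum_(m < J.+2) `|M m|.
have Bm0 : 0 <= Bm by exact: sumr_ge0.
have hBm m : (m <= J.+1)%N -> M m <= Bm.
  move=> mJ; apply: le_trans (ler_norm _) _.
  by rewrite /Bm (bigD1 (Ordinal (mJ : (m < J.+2)%N))) //= lerDl sumr_ge0.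
have ci : 0 <= cs^-1 by rewrite invr_ge0 ltW.
have om0' : 0 <= Hosc_const cs by rewrite /Hosc_const addr_ge0 // exprn_ge0.
have mo0 : 0 <= Hmod_const cs c0.
  by rewrite /Hmod_const addr_ge0 ?mulr_ge0 ?exprn_ge0 // invr_ge0 exprn_ge0 // ltW.
(* The bound returned by the bootstrap, increased by the modulus of [Const] so that the same
   constants serve for both claims. *)
pose CC := Hosc_const cs * (Hmod_const cs c0 * (`|E| + Bm) + 1) + `|E| + 1 + `|Const|.
pose B2 := energy_pt_const cs c0 Bm (1 + 2 * (`|CC| + Bm)).
pose B3 := next_pt_const cs Bm B2.
have B20 : 0 <= B2.
  by apply: energy_pt_const_ge0 => //; rewrite addr_ge0 // mulr_ge0 // addr_ge0.
have B30 : 0 <= B3.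
  by rewrite /B3 /next_pt_const; apply: addr_ge0; [rewrite mulr_ge0|rewrite mulr_ge0 // addr_ge0].
have lk0 : 0 <= link_const d Bm J B3.
  by rewrite /link_const mulr_ge0 // exprn_ge0 // addr_ge0 // !mulr_ge0.
(* The drift estimates use one constant for the pairs and for the links between them. *)
pose B4 := B3 + link_const d Bm J B3.
have B40 : 0 <= B4 by exact: addr_ge0.
have [A1 A10 hA1] := slow_drift (@fast_index ell d) cs0 J1 B40 NN3 dK.
have [A2 A20 hA2] := fast_drift (@fast_index ell d) cs0 J1 B40 NN3 dK N_ge1.
(* The factor 4 is that of the error bounds in [params_ex]. *)
pose Cs := slow_drift_const d cs c0 Bm CC (A1 * 4); pose Cf := fast_drift_const d cs c0 Bm CC (A2 * 4).
have Cs0 : 0 <= Cs.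
  by rewrite /Cs /slow_drift_const addr_ge0 ?mulrn_wge0 ?mulr_ge0 // addr_ge0.
have Cf0 : 0 <= Cf.
  have f0 : 0 <= fast_approx_const cs Bm B3.
    rewrite /fast_approx_const; apply: mulr_ge0; first by rewrite !mulr_ge0 ?exprn_ge0.
    by apply: addr_ge0; exact: mulr_ge0.
  have nf : 0 <= (\sum_i d i)%:R * fast_approx_const cs Bm B3 by exact: mulr_ge0.
  by apply: addr_ge0; [exact: mulrn_wge0|exact: mulr_ge0].
pose nB := (\sum_i d i)%:R * (2 * B3) : R.
have nB0 : 0 <= nB by rewrite !mulr_ge0.
(* Keeps the displacement in one step below rho / 2, as [link_point] requires. *)
pose h2 := rho / 2 / (nB + 1).
have h20 : 0 < h2 by rewrite !divr_gt0 // ltr_wpDl.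
(* Makes both drifts at most 1, by [pow_threshold], which closes the bootstrap. *)
pose h3 := (Cs + Cf + 1)^-1 ^+ 2.
have h30 : 0 < h3 by rewrite exprn_gt0 // invr_gt0 ltr_wpDl // addr_ge0.
exists (Num.min (Num.min 1 h1) (Num.min h2 h3)); split.
  by rewrite !lt_min ltr01 h10 h20 h30.
exists (Cs + Cf) => eps omega U K h p q omegat eps0 om0 om_eps smU h0.
rewrite !le_min => /andP [/andP [hle1 hh1] /andP [hh2 hh3]] [sr1 sr2] [[qm1 [pe0 me0]] ns] [omt0 hfr] HE dbd hK c0h.
(* The eliminated q_(-1) becomes the entry of index 0. *)
pose Qs k := if k is k'.+1 then q k' else qm1.
have qQ k : Qs k.+1 = q k by [].
have peq k : position_eq alpha h omega U (Qs k) (Qs k.+1) (Qs k.+2) by case: k => [|k]; [|have [] := ns k].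
have meq k : momentum_eq alpha h omega (Qs k) (Qs k.+2) (p k) by case: k => [|k]; [|have [] := ns k].
pose th (j : 'I_ell) := h * omegat (lift ord0 j).
have om_lo j : c0 <= h * omega (lift ord0 j).
  by apply: le_trans c0h _; apply: ler_wpM2l; [exact: ltW|exact: om_eps].
have fr j : [/\ cs <= chi alpha (th j) <= cs^-1, cs <= sin (th j), h * omega (lift ord0 j) <= cs^-1,
    chi alpha (th j) * (1 + alpha * (h * omega (lift ord0 j)) ^+ 2) = 1 &
    2 * cos (th j) = 2 - (h * omega (lift ord0 j)) ^+ 2 * chi alpha (th j)].
  have [t01 e] := hfr j; apply: hfreq => //.
  - by move=> /sr1.
  - by move=> /sr2.
  - by rewrite exprMn (mulrA alpha) /th !(mulrA 2^-1).
have th_pi j : 0 <= th j <= pi by have [] := hfr j.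
have [||P [okP hP thP chiP [er1 er2 nrP]]] := hpar h th (fun j => chi alpha (th j)) h0 hh1 th_pi.
- by move=> j; have [_ s _ _ _] := fr j; apply: le_trans s (ler_norm _).
- by move=> j; have [] := fr j.
have thP' j : th_ P j = h * omegat (lift ord0 j) by rewrite thP.
have chiP' j : chi_ P j = chi alpha (th_ P j) by rewrite chiP thP.
have frP j : [/\ cs <= chi_ P j <= cs^-1, cs <= sin (th_ P j), h * omega (lift ord0 j) <= cs^-1,
    chi_ P j * (1 + alpha * (h * omega (lift ord0 j)) ^+ 2) = 1 &
    2 * cos (th_ P j) = 2 - (h * omega (lift ord0 j)) ^+ 2 * chi_ P j] by rewrite chiP thP; exact: fr.
have th_rng j : 0 <= th_ P j <= 4.
  by rewrite thP; have /andP [-> t] := th_pi j; apply: le_trans t _; have := pihalf_lt2 R; lra.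
pose T (k : nat) : Prop := k%:R * h <= h ^- N.
have Tpred k : T k.+1 -> T k.
  by apply: le_trans; apply: ler_wpM2r; [exact: ltW|rewrite ler_nat].
pose er := h `^ (1 - delta).
have her : h <= er.
  have : h `^ 1 <= h `^ (1 - delta) by apply: ger_powR; [rewrite h0|lra].
  by rewrite powRr1 // ltW.
have er0 : 0 <= er by exact: powR_ge0.
have ctl1 : slow_ctl J U q Qs P (A1 * 4) er B4 T.
  move=> m Tm okm lkm; apply: le_trans (hA1 P _ m okP okm lkm) _.
  by rewrite -[leRHS]mulrA; apply: ler_wpM2l => //; have := er1 m Tm; rewrite hP.
have hBle : (\sum_i d i)%:R * (2 * B3) * h <= rho / 2.
  rewrite -/nB; move: hh2; rewrite /h2 ler_pdivlMr ?ltr_wpDl // mulrDr mulr1 (mulrC h).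
  by move: h0; lra.
have T_le m k : T m -> (k <= m)%N -> T k.
  by move=> Tm km; apply: le_trans Tm; apply: ler_wpM2r; [exact: ltW|rewrite ler_nat].
have B34 : B3 <= B4 by rewrite lerDl.
have Blk : link_const d Bm J B3 <= B4 by rewrite lerDr.
have z0 : 0 <= Hosc_const cs * (Hmod_const cs c0 * (`|E| + Bm) + 1).
  by apply: mulr_ge0 => //; apply: addr_ge0 => //; apply: mulr_ge0 => //; exact: addr_ge0.
have ConstCC : Const <= CC.
  by rewrite /CC; have := ler_norm Const; have := normr_ge0 E; move: z0; lra.
have D0 : 0 <= Cs + Cf by exact: addr_ge0.
have small : (Cs + Cf) * er <= 1 by apply: pow_threshold => //; lra.
have smalls : Cs * er <= 1 by apply: le_trans small; apply: ler_wpM2r; rewrite ?lerDl.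
have smallf : Cf * er <= 1 by apply: le_trans small; apply: ler_wpM2r; rewrite ?lerDr.
have pt_ok_of k : T k -> Htotal omega U (p k) (q k) <= CC -> traj_pt_ok J U q Qs P B3 k.
  exact: (energy_pt_ok h0 hle1 cs0 c0_gt0 Bm0 hP frP om_lo om0 smU dbd hBm qQ peq meq rho_gt0 (T := T) hK).
split=> [m Tm HC|nr kappa hk1 hk2 m Tm].
  have ok k : (k <= m)%N -> traj_pt_ok J U q Qs P B3 k.
    by move=> km; apply: pt_ok_of; [exact: T_le Tm km|exact: le_trans (HC k km) ConstCC].
  have := Hslow_ctl h0 hle1 cs0 c0_gt0 Bm0 hP frP om0 smU dbd hBm qQ peq meq rho_gt0 hBle B34 Blk hK Tpred ctl1 her Tm ok.
  by move=> H; apply: le_trans H _; apply: ler_wpM2r; rewrite ?lerDl.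
have ctl2 : fast_ctl J U q Qs P (A2 * 4) er B4 T.
  move=> m' Tm' okm lkm; apply: le_trans (hA2 P _ m' okP _ okm lkm) _; last first.
    by rewrite -[leRHS]mulrA; apply: ler_wpM2l => //; have := er2 m' Tm'; rewrite hP.
  apply: nrP => r k r0 kN; have := nr r k r0 kN; rewrite /phase mulr_sumr.
  by under eq_bigr do rewrite mulrCA.
have Hb := energy_bootstrap h0 hle1 cs0 c0_gt0 Bm0 hP thP' chiP' frP th_rng om_lo om0 smU dbd hBm qQ peq meq
  rho_gt0 hBle B34 Blk hK Tpred ctl1 her ctl2 HE _ smalls smallf Tm.
have ok k : (k <= m)%N -> traj_pt_ok J U q Qs P B3 k.
  move=> km; apply: pt_ok_of; [exact: T_le Tm km|].
  by apply: Hb => //; rewrite /CC lerDl.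
have H := Hmod_ctl h0 hle1 cs0 c0_gt0 Bm0 hP thP' chiP' frP th_rng om0 smU dbd hBm qQ peq meq rho_gt0 hBle B34 Blk
  hK Tpred her ctl2 Tm ok.
have k0 : 0 < kappa by apply: lt_le_trans hk1; rewrite sqrtr_gt0.
(* For ell = 0 nothing bounds kappa from above, but then H* is identically zero. *)
have [j _|no_j] := pickP (fun j : 'I_ell => true); last first.
  have H0 k : Hmod alpha h omegat (p k) (q k) = 0 by rewrite /Hmod big1 // => j; have := no_j j.
  by rewrite !H0 subrr normr0 mulr_ge0 // divr_ge0 // ltW.
have k1 : kappa <= 1 by apply: le_trans (hk2 j) _; rewrite ler_norml sin_geN1 sin_le1.
apply: le_trans H _; apply: ler_pM => //; first by rewrite lerDr.
by rewrite ler_pdivlMr // ler_piMr.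
Qed.
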